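(* Let $\mathbf v=(v_1,v_2)$ be the vector field on $\mathbf C^2$ given by $$v_1(x,y)=-\Bigl(\tfrac{\pi}{2}+i\log 2\Bigr)x^2+\Bigl(\tfrac{3\pi}{4}-\tfrac{i}{2}\log 2\Bigr)xy,\qquad v_2(x,y)=\Bigl(\tfrac{3\pi}{2}-i\log 2\Bigr)xy-\Bigl(\tfrac{5\pi}{4}+\tfrac{i}{2}\log 2\Bigr)y^2 .$$ The accumulation set of any regular trajectory of $\mathbf v$ contains the origin.
   Context: A trajectory of $\mathbf v$ is a maximal solution $\gamma$ of $\gamma'(t)=\mathbf v(\gamma(t))$ defined on a sub-interval of $\mathbf R$ (real time). It is regular if it is defined for infinite forward time (on some $[t_0,+\infty)$). The accumulation set of a regular trajectory $\gamma$ is the set of limits in $\mathbf C^2$ of sequences $\gamma(t_n)$ with $t_n\to+\infty$. *)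

(* Defs.v *)
From Stdlib Require Import Reals.
From Coquelicot Require Import Coquelicot.

(* C * C as a normed space over the reals, since time is real. *)
Definition C2 : NormedModule R_AbsRing :=
  prod_NormedModule R_AbsRing C_R_NormedModule C_R_NormedModule.

(* A nondegenerate interval, of any type (open, closed, half-open, unbounded). *)
Definition is_interval (I : R -> Prop) : Prop :=
  (exists a b : R, a < b /\ I a /\ I b)%R /\
  (forall a b t : R, I a -> I b -> (a <= t <= b)%R -> I t).

(* The derivative of gamma at t relative to I is l: two-sided at an interior
   point of I, one-sided at an endpoint; values of gamma outside I play no
   role.  For I = R this is [is_derive gamma t l]. *)
Definition is_derive_within (I : R -> Prop) (gamma : R -> C * C) (t : R)
    (l : C * C) : Prop :=
  @filterdiff R_AbsRing R_NormedModule C2 gamma (within I (locally t))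
    (fun h : R => @scal R_AbsRing C2 h l).

(* The solution is the restriction of the total function gamma to I. *)
Definition is_solution (v : C * C -> C * C) (I : R -> Prop)
    (gamma : R -> C * C) : Prop :=
  is_interval I /\
  forall t : R, I t -> is_derive_within I gamma t (v (gamma t)).

Definition is_trajectory (v : C * C -> C * C) (I : R -> Prop)
    (gamma : R -> C * C) : Prop :=
  is_solution v I gamma /\
  forall (J : R -> Prop) (delta : R -> C * C),
    is_solution v J delta ->
    (forall t : R, I t -> J t) ->
    (forall t : R, I t -> delta t = gamma t) ->
    forall t : R, J t -> I t.

(* Regularity only depends on the domain I of the trajectory. *)
Definition is_regular (I : R -> Prop) : Prop :=
  exists t0 : R, forall t : R, (t0 <= t)%R -> I t.

Definition accumulation_set (I : R -> Prop) (gamma : R -> C * C)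
    (p : C * C) : Prop :=
  exists tn : nat -> R,
    (forall n : nat, I (tn n)) /\
    is_lim_seq tn p_infty /\
    filterlim (fun n : nat => gamma (tn n)) eventually (@locally C2 p).

Local Open Scope C_scope.

Definition v1 (x y : C) : C :=
  - (PI / 2 + Ci * ln 2) * x ^ 2 + (3 * PI / 4 - Ci / 2 * ln 2) * (x * y).

Definition v2 (x y : C) : C :=
  (3 * PI / 2 - Ci * ln 2) * (x * y) - (5 * PI / 4 + Ci / 2 * ln 2) * y ^ 2.

Definition v (p : C * C) : C * C := (v1 (fst p) (snd p), v2 (fst p) (snd p)).

(* Main.v *)
(* With z = y / x the field becomes z' = 2 pi x z (1 - z), x' = - 2 pi x^2 (al - sg z), and
   x z^al (1 - z)^be is constant along trajectories. So, up to a constant factor, time is the integral of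
   z^(al - 1) (1 - z)^(be - 1) dz. This multivalued integral develops the sphere minus 0, 1, infinity
   in such a way that trajectories become straight lines run at constant speed. A fundamental domain is
   the triangle 0, 2, - 2 i, whose sides [0, 1] and [0, - 2 i] are glued by w -> - 2 i w, and [1, 2] and
   [- 2 i, 2] by w -> 2 + (2 + 2 i) (w - 2). Bringing the line back to the triangle with these similarities
   multiplies the scale S (the velocity being 2 pi / S) by - 2 i, by 2 + 2 i, or by an inverse of these, according
   to the side that is crossed, which the direction of the line dictates. As soon as Im S > 0, only the crossings that
   enlarge |S| are possible and they keep Im S > 0; then K |S| + Re (w S) grows at speed 2 pi at least, so |S| tends
   to infinity, while S x is bounded as long as z is in a compact part of the punctured sphere. If Im S <= 0 forever,
   then K |S| - Re (w S) >= 0 decreases at speed 2 pi at least, which is absurd. If z finally stays near one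
   puncture, then h(z) / x = 2 pi t + constant with h bounded, so (x, y) tends to 0. The trajectories
   inside the invariant lines x = 0, y = 0, x = y solve f' = a f^2. The functions h, with which the developing map
   is h(z) / (S x) up to a constant, are hypergeometric series at 0 and 1 and a similar series at infinity; that their
   branches fit together as stated is certified by evaluating them in integer disc arithmetic. *)

Require Import Defs.
From Stdlib Require Import Reals Lra Lia Psatz ZArith List Classical ClassicalEpsilon.
From Stdlib Require Machin Ratan.
From Coquelicot Require Import Coquelicot.
Import ListNotations.
Open Scope R_scope.

(** The obstacle is to continue a multivalued function along an orbit that may wind arbitrarily. Two
    devices remove it. First, the circle |z - 1/2| = 2/3 and its vertical diameter cut the sphere
    into three closed zones, one per puncture; since 1/2, 2/3, 5/6 is a right triangle, the series
    at 0 and 1 are evaluated only up to modulus 5/6, and the series at infinity, in q = 1 / (1 - 2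
    z), up to 3/4. Charts have to be compared only on the diameter and on two half circles, which
    are one-parameter families that a bisection can handle. Second, the sheet is recorded by an
    angle: a continuous angle that avoids two directions stays in its sector, so finitely many
    certified strict inequalities fix every branch. The vertices 0, 1, 2, - 2 i themselves are
    exact: they follow by linear algebra from the multipliers i / 2 and 2 + 2 i of z^al and (1 -
    z)^be. Derivatives are taken only along curves of a real variable, so no theory of holomorphic
    functions enters. *)

Definition cder (f : R -> C) (t : R) (l : C) : Prop :=
  is_derive (fun s => fst (f s)) t (fst l) /\
  is_derive (fun s => snd (f s)) t (snd l).

Lemma C_eq (a b : C) : fst a = fst b -> snd a = snd b -> a = b.
Proof. destruct a, b; simpl; intros -> ->; reflexivity. Qed.

Ltac neq0 := let E := fresh in intros E; apply (f_equal fst) in E; simpl in E; lra.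

Lemma cder_eq (f : R -> C) t l l' : cder f t l -> l = l' -> cder f t l'.
Proof. intros H <-; exact H. Qed.

Lemma cder_ext_loc (f g : R -> C) t l :
  locally t (fun s => f s = g s) -> cder f t l -> cder g t l.
Proof.
  intros H [H1 H2]; split.
  - eapply is_derive_ext_loc; [|exact H1].
    revert H; apply filter_imp; intros s ->; reflexivity.
  - eapply is_derive_ext_loc; [|exact H2].
    revert H; apply filter_imp; intros s ->; reflexivity.
Qed.

Lemma cder_ext (f g : R -> C) t l :
  (forall s, f s = g s) -> cder f t l -> cder g t l.
Proof. intros H; apply cder_ext_loc; apply filter_forall; exact H. Qed.

Lemma cder_const (c : C) t : cder (fun _ => c) t 0%C.
Proof. split; simpl; apply (is_derive_const (V := R_NormedModule)). Qed.

Lemma cder_plus f g t l m : cder f t l -> cder g t m ->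
  cder (fun s => f s + g s)%C t (l + m)%C.
Proof.
  intros [H1 H2] [H3 H4]; split; simpl;
    apply (is_derive_plus (V := R_NormedModule)); assumption.
Qed.

Lemma cder_opp f t l : cder f t l -> cder (fun s => - f s)%C t (- l)%C.
Proof.
  intros [H1 H2]; split; simpl;
    apply (is_derive_opp (V := R_NormedModule)); assumption.
Qed.

Lemma cder_minus f g t l m : cder f t l -> cder g t m ->
  cder (fun s => f s - g s)%C t (l - m)%C.
Proof. intros H1 H2; apply cder_plus; [|apply cder_opp]; assumption. Qed.

Lemma is_derive_eq (f : R -> R) t l l' : is_derive f t l -> l = l' -> is_derive f t l'.
Proof. intros H <-; exact H. Qed.

Lemma is_derive_mul (f g : R -> R) t l m : is_derive f t l -> is_derive g t m ->
  is_derive (fun s => f s * g s) t (l * g t + f t * m).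
Proof. intros H1 H2. apply (is_derive_mult f g t l m); auto. intros; apply Rmult_comm. Qed.

Lemma cder_mult f g t l m : cder f t l -> cder g t m ->
  cder (fun s => f s * g s)%C t (l * g t + f t * m)%C.
Proof.
  intros [H1 H2] [H3 H4]; split; simpl.
  - replace (fst l * fst (g t) - snd l * snd (g t) + (fst (f t) * fst m - snd (f t) * snd m))
      with ((fst l * fst (g t) + fst (f t) * fst m) - (snd l * snd (g t) + snd (f t) * snd m))
      by ring.
    apply (is_derive_minus (V := R_NormedModule)
             (fun s => fst (f s) * fst (g s)) (fun s => snd (f s) * snd (g s)));
      apply is_derive_mul; assumption.
  - replace (fst l * snd (g t) + snd l * fst (g t) + (fst (f t) * snd m + snd (f t) * fst m))
      with ((fst l * snd (g t) + fst (f t) * snd m) + (snd l * fst (g t) + snd (f t) * fst m))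
      by ring.
    apply (is_derive_plus (V := R_NormedModule)
             (fun s => fst (f s) * snd (g s)) (fun s => snd (f s) * fst (g s)));
      apply is_derive_mul; assumption.
Qed.

Lemma cder_scal (c : C) f t l : cder f t l -> cder (fun s => c * f s)%C t (c * l)%C.
Proof.
  intros H. eapply cder_eq; [apply cder_mult; [apply cder_const|exact H]|cbv beta; ring].
Qed.

Definition normsq (z : C) : R := fst z * fst z + snd z * snd z.

Lemma normsq_pos (z : C) : z <> 0%C -> 0 < normsq z.
Proof.
  intros H; unfold normsq; destruct z as [a b]; simpl.
  destruct (Req_dec a 0) as [->|Ha]; [destruct (Req_dec b 0) as [->|Hb]|];
    [exfalso; apply H; reflexivity| |]; nra.
Qed.

Lemma Cmod_normsq (z : C) : Cmod z = sqrt (normsq z).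
Proof. unfold Cmod, normsq; f_equal; simpl; ring. Qed.

Lemma Cmod_sqr (z : C) : Cmod z * Cmod z = normsq z.
Proof.
  rewrite Cmod_normsq; apply sqrt_sqrt; unfold normsq; nra.
Qed.

Lemma is_derive_divr (f g : R -> R) t l m : is_derive f t l -> is_derive g t m -> g t <> 0 ->
  is_derive (fun s => f s / g s) t ((l * g t - f t * m) / (g t * g t)).
Proof.
  intros H1 H2 H3.
  replace ((l * g t - f t * m) / (g t * g t)) with (l * / g t + f t * (- m / (g t)^2))
    by (field; exact H3).
  apply (is_derive_mul f (fun s => / g s) t l (- m / (g t)^2)); [exact H1|].
  apply is_derive_inv; assumption.
Qed.

Lemma cder_normsq f t l : cder f t l ->
  is_derive (fun s => normsq (f s)) t (2 * (fst (f t) * fst l + snd (f t) * snd l)).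
Proof.
  intros [H1 H2]. unfold normsq.
  replace (2 * (fst (f t) * fst l + snd (f t) * snd l))
    with ((fst l * fst (f t) + fst (f t) * fst l) + (snd l * snd (f t) + snd (f t) * snd l)) by ring.
  apply (is_derive_plus (V := R_NormedModule)
    (fun s => fst (f s) * fst (f s)) (fun s => snd (f s) * snd (f s)));
    apply is_derive_mul; assumption.
Qed.

Lemma cder_inv f t l : cder f t l -> f t <> 0%C ->
  cder (fun s => / f s)%C t (- l / (f t * f t))%C.
Proof.
  intros H Hn. pose proof (normsq_pos _ Hn) as Hp.
  pose proof (cder_normsq _ _ _ H) as HN. destruct H as [H1 H2].
  assert (Hnn : normsq (f t) <> 0) by lra.
  split.
  - apply (is_derive_ext (fun s => fst (f s) / normsq (f s))).
    { intros s; unfold normsq; simpl; unfold Rdiv; f_equal; f_equal; ring. }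
    eapply is_derive_eq.
    + apply is_derive_divr; [exact H1|exact HN|exact Hnn].
    + unfold normsq in *; simpl; field. split; nra.
  - apply (is_derive_ext (fun s => - snd (f s) / normsq (f s))).
    { intros s; unfold normsq; simpl; unfold Rdiv; f_equal; f_equal; ring. }
    eapply is_derive_eq.
    + apply is_derive_divr; [|exact HN|exact Hnn].
      apply (is_derive_opp (V := R_NormedModule)); exact H2.
    + unfold normsq, opp in *; simpl; field. split; nra.
Qed.

Lemma cder_div f g t l m : cder f t l -> cder g t m -> g t <> 0%C ->
  cder (fun s => f s / g s)%C t ((l * g t - f t * m) / (g t * g t))%C.
Proof.
  intros H1 H2 H3. eapply cder_eq.
  - apply cder_mult; [exact H1|apply cder_inv; [exact H2|exact H3]].
  - cbv beta; field; exact H3.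
Qed.

(** * Complex exponential and principal logarithm along curves *)

Definition cexp (z : C) : C := (exp (fst z) * cos (snd z), exp (fst z) * sin (snd z)).

Lemma cexp_plus (a b : C) : cexp (a + b)%C = (cexp a * cexp b)%C.
Proof.
  unfold cexp; apply C_eq; simpl; rewrite exp_plus.
  - rewrite cos_plus; ring.
  - rewrite sin_plus; ring.
Qed.

Lemma cexp_0 : cexp 0%C = 1%C.
Proof. unfold cexp; apply C_eq; simpl; rewrite exp_0, ?cos_0, ?sin_0; ring. Qed.

Lemma cexp_opp (a : C) : (cexp (- a) * cexp a = 1)%C.
Proof.
  rewrite <- cexp_plus, <- cexp_0. f_equal. ring.
Qed.

Lemma cexp_neq0 (a : C) : cexp a <> 0%C.
Proof.
  intros H. pose proof (cexp_opp a) as E. rewrite H in E.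
  assert (E' : (cexp (- a) * 0 = 0)%C) by ring. rewrite E' in E.
  injection E; lra.
Qed.

Lemma cexp_opp_inv (a : C) : cexp (- a) = (/ cexp a)%C.
Proof.
  pose proof (cexp_opp a). pose proof (cexp_neq0 a).
  rewrite <- (Cmult_1_l (/ cexp a)), <- H. field. assumption.
Qed.

Lemma cexp_minus (a b : C) : cexp (a - b)%C = (cexp a / cexp b)%C.
Proof. unfold Cminus; rewrite cexp_plus, cexp_opp_inv; reflexivity. Qed.

Lemma Cmod_cexp (z : C) : Cmod (cexp z) = exp (fst z).
Proof.
  rewrite Cmod_normsq. unfold normsq, cexp; simpl.
  replace (exp (fst z) * cos (snd z) * (exp (fst z) * cos (snd z)) +
    exp (fst z) * sin (snd z) * (exp (fst z) * sin (snd z)))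
    with (exp (fst z) * exp (fst z) * ((sin (snd z))² + (cos (snd z))²)) by (unfold Rsqr; ring).
  rewrite sin2_cos2, Rmult_1_r. apply sqrt_square. left; apply exp_pos.
Qed.

Lemma cder_cexp f t l : cder f t l -> cder (fun s => cexp (f s)) t (l * cexp (f t))%C.
Proof.
  intros [H1 H2].
  assert (He : is_derive (fun s => exp (fst (f s))) t (fst l * exp (fst (f t)))).
  { apply (is_derive_comp exp (fun s => fst (f s))); [apply is_derive_exp|exact H1]. }
  assert (Hc : is_derive (fun s => cos (snd (f s))) t (snd l * - sin (snd (f t)))).
  { apply (is_derive_comp cos (fun s => snd (f s))); [apply is_derive_cos|exact H2]. }
  assert (Hs : is_derive (fun s => sin (snd (f s))) t (snd l * cos (snd (f t)))).
  { apply (is_derive_comp sin (fun s => snd (f s))); [apply is_derive_sin|exact H2]. }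
  split; simpl.
  - eapply is_derive_eq.
    + apply is_derive_mul; [exact He|exact Hc].
    + simpl; ring.
  - eapply is_derive_eq.
    + apply is_derive_mul; [exact He|exact Hs].
    + simpl; ring.
Qed.

(* Principal logarithm, meaningful on the half-plane [0 < Re z] only. *)
Definition clog (z : C) : C := (ln (normsq z) / 2, atan (snd z / fst z)).

Lemma clog_bound (z : C) : - (PI / 2) < snd (clog z) < PI / 2.
Proof. simpl. pose proof (atan_bound (snd z / fst z)). lra. Qed.

Lemma cexp_clog (z : C) : 0 < fst z -> cexp (clog z) = z.
Proof.
  intros Hz. destruct z as [a b]; simpl in *.
  assert (Hn : 0 < normsq (a, b)) by (unfold normsq; simpl; nra).
  assert (E : exp (ln (normsq (a, b)) / 2) = sqrt (normsq (a, b))).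
  { rewrite <- (sqrt_square (exp (ln (normsq (a, b)) / 2))) by (left; apply exp_pos).
    f_equal. rewrite <- exp_plus.
    replace (ln (normsq (a, b)) / 2 + ln (normsq (a, b)) / 2) with (ln (normsq (a, b))) by field.
    apply exp_ln, Hn. }
  assert (F : sqrt (normsq (a, b)) = a * sqrt (1 + (b / a)²)).
  { rewrite <- (sqrt_square a) at 2 by lra. rewrite <- sqrt_mult.
    - f_equal. unfold normsq, Rsqr; simpl. field; lra.
    - nra.
    - pose proof (Rle_0_sqr (b/a)); lra. }
  assert (G : sqrt (1 + (b / a)²) <> 0).
  { pose proof (Rle_0_sqr (b/a)). apply Rgt_not_eq, sqrt_lt_R0; lra. }
  unfold cexp, clog; apply C_eq; simpl; rewrite E, F.
  - rewrite cos_atan. field. exact G.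
  - rewrite sin_atan. field. split; [lra|exact G].
Qed.

Lemma cder_clog f t l : cder f t l -> 0 < fst (f t) ->
  cder (fun s => clog (f s)) t (l / f t)%C.
Proof.
  intros H Hp. pose proof (cder_normsq _ _ _ H) as HN. destruct H as [H1 H2].
  assert (Hn : 0 < normsq (f t)) by (unfold normsq; nra).
  split; unfold clog; simpl fst; simpl snd.
  - eapply is_derive_eq.
    + apply is_derive_divr with (g := fun _ => 2).
      * apply (is_derive_comp ln (fun s => normsq (f s))); [|exact HN].
        apply is_derive_Reals. apply derivable_pt_lim_ln; exact Hn.
      * apply (is_derive_const (V := R_NormedModule)).
      * lra.
    + unfold normsq, scal, zero in *; simpl; unfold mult; simpl. field. nra.
  - eapply is_derive_eq.
    + apply (is_derive_comp atan (fun s => snd (f s) / fst (f s))).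
      * apply is_derive_atan.
      * apply is_derive_divr; [exact H2|exact H1|lra].
    + unfold normsq, Rsqr, scal in *; simpl; unfold mult; simpl. field. repeat split; nra.
Qed.

(** The one integration tool: two primitives of the same expression along a curve differ by a
    constant. The connection constants and the conservation laws along orbits are all obtained this
    way. *)
Lemma cder_const_eq (f : R -> C) (a b : R) :
  (forall t, a <= t <= b -> cder f t 0%C) -> a <= b -> f a = f b.
Proof.
  intros H [Hab| ->]; [|reflexivity].
  apply C_eq.
  - apply (eq_is_derive (fun s => fst (f s))); [|exact Hab]. intros t Ht; apply H, Ht.
  - apply (eq_is_derive (fun s => snd (f s))); [|exact Hab]. intros t Ht; apply H, Ht.
Qed.

Lemma cder_affine (f : R -> C) (c : C) (a b : R) :
  (forall t, a <= t <= b -> cder f t c) -> a <= b -> (f b = f a + c * (b - a)%R)%C.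
Proof.
  intros H Hab.
  assert (E : (f a - c * a)%C = (f b - c * b)%C).
  { apply (cder_const_eq (fun t => f t - c * t)%C); [|exact Hab]. intros t Ht.
    eapply cder_eq.
    - apply cder_minus; [apply H, Ht|].
      apply cder_scal with (l := RtoC 1). split; simpl.
      + apply (is_derive_id (K := R_AbsRing)).
      + apply (is_derive_const (V := R_NormedModule)).
    - ring. }
  rewrite RtoC_minus.
  replace (f b) with (f b - c * b + c * b)%C by ring. rewrite <- E. ring.
Qed.

(** * Power series *)

Definition clim (s : nat -> C) (l : C) : Prop :=
  is_lim_seq (fun n => fst (s n)) (fst l) /\ is_lim_seq (fun n => snd (s n)) (snd l).

Lemma clim_ext (s s' : nat -> C) l : (forall n, s n = s' n) -> clim s l -> clim s' l.
Proof.
  intros E [H1 H2]; split; eapply is_lim_seq_ext; try eassumption;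
    intros n; cbv beta; rewrite E; reflexivity.
Qed.

Lemma clim_const (l : C) : clim (fun _ => l) l.
Proof. split; apply is_lim_seq_const. Qed.

Lemma clim_plus s s' l l' : clim s l -> clim s' l' -> clim (fun n => s n + s' n)%C (l + l')%C.
Proof. intros [H1 H2] [H3 H4]; split; simpl; apply is_lim_seq_plus'; assumption. Qed.

Lemma clim_minus s s' l l' : clim s l -> clim s' l' -> clim (fun n => s n - s' n)%C (l - l')%C.
Proof.
  intros [H1 H2] [H3 H4]; split.
  - apply (is_lim_seq_minus' (fun n => fst (s n)) (fun n => fst (s' n))); assumption.
  - apply (is_lim_seq_minus' (fun n => snd (s n)) (fun n => snd (s' n))); assumption.
Qed.

Lemma clim_mult s s' l l' : clim s l -> clim s' l' -> clim (fun n => s n * s' n)%C (l * l')%C.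
Proof.
  intros [H1 H2] [H3 H4]; split; simpl.
  - apply is_lim_seq_minus'; apply is_lim_seq_mult'; assumption.
  - apply is_lim_seq_plus'; apply is_lim_seq_mult'; assumption.
Qed.

Lemma clim_incr s l : clim s l -> clim (fun n => s (S n)) l.
Proof. intros [H1 H2]; split; [apply -> is_lim_seq_incr_1 in H1|apply -> is_lim_seq_incr_1 in H2]; assumption. Qed.

Lemma clim_unique s l l' : clim s l -> clim s l' -> l = l'.
Proof.
  intros [H1 H2] [H3 H4]; apply C_eq.
  - apply is_lim_seq_unique in H1, H3. congruence.
  - apply is_lim_seq_unique in H2, H4. congruence.
Qed.

Lemma normsq_le (z : C) B : 0 <= B -> normsq z <= B * B <-> Cmod z <= B.
Proof.
  intros HB. rewrite <- Cmod_sqr. pose proof (Cmod_ge_0 z). split; intros; nra.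
Qed.

Lemma clim_bound s l B : clim s l -> (forall n, Cmod (s n) <= B) -> Cmod l <= B.
Proof.
  intros [H1 H2] H.
  assert (HB : 0 <= B) by (pose proof (Cmod_ge_0 (s 0%nat)); specialize (H 0%nat); lra).
  apply normsq_le; [exact HB|].
  assert (L : is_lim_seq (fun n => normsq (s n)) (normsq l)).
  { unfold normsq. apply is_lim_seq_plus'; apply is_lim_seq_mult'; assumption. }
  apply (is_lim_seq_le _ (fun _ => B * B) (normsq l) (B * B)) in L.
  - exact L.
  - intros n. apply normsq_le; auto.
  - apply is_lim_seq_const.
Qed.

Lemma abs_fst_le_Cmod (z : C) : Rabs (fst z) <= Cmod z.
Proof. eapply Rle_trans; [apply Rmax_l|apply Rmax_Cmod]. Qed.

Lemma abs_snd_le_Cmod (z : C) : Rabs (snd z) <= Cmod z.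
Proof. eapply Rle_trans; [apply Rmax_r|apply Rmax_Cmod]. Qed.

Lemma clim_squeeze (s : nat -> C) (b : nat -> R) :
  (forall n, Cmod (s n) <= b n) -> is_lim_seq b 0 -> clim s 0%C.
Proof.
  intros H Hb. split; simpl.
  - apply (is_lim_seq_le_le (fun n => - b n) _ b).
    + intros n. specialize (H n). pose proof (abs_fst_le_Cmod (s n)).
      apply Rabs_le_between. lra.
    + replace (Finite 0) with (Rbar_opp 0) by (simpl; f_equal; ring).
      apply is_lim_seq_opp in Hb. exact Hb.
    + exact Hb.
  - apply (is_lim_seq_le_le (fun n => - b n) _ b).
    + intros n. specialize (H n). pose proof (abs_snd_le_Cmod (s n)).
      apply Rabs_le_between. lra.
    + replace (Finite 0) with (Rbar_opp 0) by (simpl; f_equal; ring).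
      apply is_lim_seq_opp in Hb. exact Hb.
    + exact Hb.
Qed.

Fixpoint psum (c : nat -> C) (u : C) (n : nat) : C :=
  match n with
  | O => 0%C
  | S k => (psum c u k + c k * u ^ k)%C
  end.

Definition pser (c : nat -> C) (u : C) : C :=
  (Series (fun n => fst (c n * u ^ n)%C), Series (fun n => snd (c n * u ^ n)%C)).

Definition dcoef (c : nat -> C) (n : nat) : C := (INR (S n) * c (S n))%C.

Definition growth (c : nat -> C) (M : R) (w : nat -> R) : Prop :=
  forall n, Cmod (c n) <= M * w n.

(** The weights 1, n + 1 and (n + 1)(n + 2) dominate respectively the coefficients of a series,
    those of its derivative, and its second-order Taylor remainders. *)
Definition wt1 (n : nat) : R := 1.
Definition wt2 (n : nat) : R := INR (S n).
Definition wt3 (n : nat) : R := INR (S n) * INR (S (S n)).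

Lemma CV_radius_one : Rbar_le 1 (CV_radius (fun _ => 1)).
Proof.
  destruct (CV_radius_bounded (fun _ => 1)) as [H _]. apply H.
  exists 1. intros n. rewrite pow1, Rmult_1_r, Rabs_R1. lra.
Qed.

Lemma wt1_summable r : 0 <= r < 1 -> ex_series (fun n => wt1 n * r ^ n).
Proof.
  intros Hr. apply (ex_series_ext (fun n => r ^ n)).
  { intros n; unfold wt1. rewrite Rmult_1_l. reflexivity. }
  apply ex_series_geom. rewrite Rabs_pos_eq; lra.
Qed.

Lemma wt_gen_summable (a : nat -> R) r : Rbar_le 1 (CV_radius a) ->
  0 <= r < 1 -> (forall n, 0 <= a n) -> ex_series (fun n => a n * r ^ n).
Proof.
  intros H Hr Ha.
  apply (ex_series_ext (fun n => Rabs (a n * r ^ n))).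
  { intros n. apply Rabs_pos_eq, Rmult_le_pos; [auto|apply pow_le; lra]. }
  apply CV_disk_inside. eapply Rbar_lt_le_trans; [|exact H].
  simpl. rewrite Rabs_pos_eq; lra.
Qed.

(** The weights are the coefficients of the derivative of the geometric series, and differentiation
    keeps the radius of convergence; [wt3_summable] differentiates twice. *)
Lemma wt2_summable r : 0 <= r < 1 -> ex_series (fun n => wt2 n * r ^ n).
Proof.
  intros Hr. apply wt_gen_summable; [|exact Hr|intros; apply pos_INR].
  pose proof CV_radius_one as H. rewrite <- CV_radius_derive in H.
  rewrite (CV_radius_ext _ (PS_derive (fun _ => 1))); [exact H|].
  intros n. unfold PS_derive, wt2. rewrite Rmult_1_r. reflexivity.
Qed.

Lemma wt3_summable r : 0 <= r < 1 -> ex_series (fun n => wt3 n * r ^ n).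
Proof.
  intros Hr. apply wt_gen_summable; [|exact Hr|intros; apply Rmult_le_pos; apply pos_INR].
  pose proof CV_radius_one as H.
  rewrite <- CV_radius_derive, <- CV_radius_derive in H.
  rewrite (CV_radius_ext _ (PS_derive (PS_derive (fun _ => 1)))); [exact H|].
  intros n. unfold PS_derive, wt3. rewrite Rmult_1_r. reflexivity.
Qed.

Lemma Cmod_pow (u : C) n : Cmod (u ^ n) = Cmod u ^ n.
Proof. induction n; simpl; [apply Cmod_1|rewrite Cmod_mult, IHn; reflexivity]. Qed.

Lemma psum_fst c u n : fst (psum c u (S n)) = sum_n (fun n => fst (c n * u ^ n)%C) n.
Proof.
  induction n.
  - rewrite sum_O. simpl. ring.
  - rewrite sum_Sn, <- IHn. reflexivity.
Qed.

Lemma psum_snd c u n : snd (psum c u (S n)) = sum_n (fun n => snd (c n * u ^ n)%C) n.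
Proof.
  induction n.
  - rewrite sum_O. simpl. ring.
  - rewrite sum_Sn, <- IHn. reflexivity.
Qed.

Lemma pser_clim c u M w : growth c M w -> ex_series (fun n => w n * Cmod u ^ n) ->
  clim (psum c u) (pser c u).
Proof.
  intros Hc Hw.
  assert (Hb : forall n, Cmod (c n * u ^ n) <= M * (w n * Cmod u ^ n)).
  { intros n. rewrite Cmod_mult, Cmod_pow, <- Rmult_assoc.
    apply Rmult_le_compat_r; [apply pow_le, Cmod_ge_0|apply Hc]. }
  assert (HM : ex_series (fun n => M * (w n * Cmod u ^ n))).
  { apply (ex_series_scal_l M (fun n => w n * Cmod u ^ n)), Hw. }
  split.
  - apply is_lim_seq_incr_1. apply (is_lim_seq_ext (sum_n (fun n => fst (c n * u ^ n)%C))).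
    { intros n; rewrite psum_fst; reflexivity. }
    apply Series_correct. apply (ex_series_le (V := R_CompleteNormedModule) _ (fun n => M * (w n * Cmod u ^ n))); [|exact HM].
    intros n. eapply Rle_trans; [apply abs_fst_le_Cmod|apply Hb].
  - apply is_lim_seq_incr_1. apply (is_lim_seq_ext (sum_n (fun n => snd (c n * u ^ n)%C))).
    { intros n; rewrite psum_snd; reflexivity. }
    apply Series_correct. apply (ex_series_le (V := R_CompleteNormedModule) _ (fun n => M * (w n * Cmod u ^ n))); [|exact HM].
    intros n. eapply Rle_trans; [apply abs_snd_le_Cmod|apply Hb].
Qed.

Lemma pser_clim1 c u M : growth c M wt1 -> Cmod u < 1 -> clim (psum c u) (pser c u).
Proof.
  intros H Hu. eapply pser_clim; [exact H|]. apply wt1_summable. pose proof (Cmod_ge_0 u); lra.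
Qed.

Lemma dcoef_growth c M : growth c M wt1 -> growth (dcoef c) M wt2.
Proof.
  intros H n. unfold dcoef, wt2. rewrite Cmod_mult, Cmod_R, Rabs_pos_eq by apply pos_INR.
  specialize (H (S n)). unfold wt1 in H. pose proof (pos_INR (S n)). nra.
Qed.

Lemma pser_dclim c u M : growth c M wt1 -> Cmod u < 1 ->
  clim (psum (dcoef c) u) (pser (dcoef c) u).
Proof.
  intros H Hu. eapply pser_clim; [apply dcoef_growth, H|].
  apply wt2_summable. pose proof (Cmod_ge_0 u); lra.
Qed.

Definition Erem (u v : C) (n : nat) : C := (v ^ (S n) - u ^ (S n) - INR (S n) * u ^ n * (v - u))%C.

Lemma Erem_S u v n : Erem u v (S n) = (v * Erem u v n + INR (S n) * u ^ n * ((v - u) * (v - u)))%C.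
Proof.
  unfold Erem. rewrite (S_INR (S n)), RtoC_plus. simpl Cpow. ring.
Qed.

Lemma Erem_bound u v r n : Cmod u <= r -> Cmod v <= r -> 0 <= r ->
  Cmod (Erem u v (S n)) <= wt3 n * r ^ n * normsq (v - u).
Proof.
  intros Hu Hv Hr. rewrite <- Cmod_sqr.
  assert (Hd : 0 <= Cmod (v - u) * Cmod (v - u)) by nra.
  assert (Hp : forall k, Cmod (u ^ k) <= r ^ k).
  { intros k. rewrite Cmod_pow. apply pow_incr. split; [apply Cmod_ge_0|exact Hu]. }
  assert (Hstep : forall k, Cmod (Erem u v (S k)) <= r * Cmod (Erem u v k) +
     INR (S k) * r ^ k * (Cmod (v - u) * Cmod (v - u))).
  { intros k. rewrite Erem_S. eapply Rle_trans; [apply Cmod_triangle|].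
    rewrite !Cmod_mult, Cmod_R, Rabs_pos_eq by apply pos_INR.
    apply Rplus_le_compat.
    - apply Rmult_le_compat_r; [apply Cmod_ge_0|exact Hv].
    - apply Rmult_le_compat_r; [exact Hd|].
      apply Rmult_le_compat_l; [apply pos_INR|apply Hp]. }
  unfold wt3. induction n.
  - eapply Rle_trans; [apply Hstep|].
    assert (E0 : Erem u v 0 = 0%C) by (unfold Erem; simpl; ring).
    rewrite E0, Cmod_0. simpl. nra.
  - eapply Rle_trans; [apply Hstep|].
    apply Rle_trans with (r * (INR (S n) * INR (S (S n)) * r ^ n * (Cmod (v - u) * Cmod (v - u))) +
      INR (S (S n)) * r ^ S n * (Cmod (v - u) * Cmod (v - u))).
    + apply Rplus_le_compat_r. apply Rmult_le_compat_l; [exact Hr|exact IHn].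
    + pose proof (pow_le r n Hr). pose proof (pos_INR n).
      rewrite !S_INR. simpl (r ^ S n).
      assert (0 <= r * r ^ n) by nra.
      assert (0 <= (r * r ^ n) * (Cmod (v - u) * Cmod (v - u))) by nra.
      nra.
Qed.

Lemma psum_taylor c u v N :
  (psum c v (S (S N)) - psum c u (S (S N)) - psum (dcoef c) u (S N) * (v - u) =
   psum c v (S N) - psum c u (S N) - psum (dcoef c) u N * (v - u) + c (S N) * Erem u v N)%C.
Proof.
  change (psum c v (S (S N))) with (psum c v (S N) + c (S N) * v ^ S N)%C.
  change (psum c u (S (S N))) with (psum c u (S N) + c (S N) * u ^ S N)%C.
  change (psum (dcoef c) u (S N)) with (psum (dcoef c) u N + dcoef c N * u ^ N)%C.
  unfold dcoef, Erem. ring.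
Qed.

(** The remainders [Erem] of the monomials are bounded through the recurrence [Erem_S] and summed
    against the weight [wt3]. The quadratic bound, uniform on the disc, replaces complex
    differentiability: composed with a curve it gives the chain rule [cder_pser]. *)
Lemma pser_taylor c M r : growth c M wt1 -> 0 <= r < 1 ->
  exists K, 0 <= K /\ forall u v, Cmod u <= r -> Cmod v <= r ->
   Cmod (pser c v - pser c u - pser (dcoef c) u * (v - u)) <= K * normsq (v - u).
Proof.
  intros Hc Hr.
  assert (HM : 0 <= M).
  { specialize (Hc 0%nat). pose proof (Cmod_ge_0 (c 0%nat)). unfold wt1 in Hc. lra. }
  pose proof (wt3_summable r Hr) as Hs.
  assert (Hpos : forall n, 0 <= wt3 n * r ^ n).
  { intros n. apply Rmult_le_pos; [apply Rmult_le_pos; apply pos_INR|apply pow_le; lra]. }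
  set (K := Series (fun n => wt3 n * r ^ n)).
  assert (HK : forall N, sum_n (fun n => wt3 n * r ^ n) N <= K).
  { intros N. apply (is_lim_seq_incr_compare (sum_n (fun n => wt3 n * r ^ n))).
    - apply Series_correct, Hs.
    - intros n. rewrite sum_Sn. apply Rle_trans with (sum_n (fun n => wt3 n * r ^ n) n + 0); [lra|].
      apply Rplus_le_compat_l, Hpos. }
  assert (HK0 : 0 <= K).
  { eapply Rle_trans; [|apply (HK 0%nat)]. rewrite sum_O. apply Hpos. }
  exists (M * K). split; [nra|]. intros u v Hu Hv.
  assert (Hn : 0 <= normsq (v - u)) by (unfold normsq; nra).
  assert (L : clim (fun N => psum c v (S (S (S N))) - psum c u (S (S (S N))) - psum (dcoef c) u (S (S N)) * (v - u))%C
     (pser c v - pser c u - pser (dcoef c) u * (v - u))%C).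
  { apply clim_minus; [apply clim_minus|apply clim_mult].
    - apply (clim_incr (fun N => psum c v (S (S N)))), (clim_incr (fun N => psum c v (S N))), clim_incr.
      eapply pser_clim1; [exact Hc|lra].
    - apply (clim_incr (fun N => psum c u (S (S N)))), (clim_incr (fun N => psum c u (S N))), clim_incr.
      eapply pser_clim1; [exact Hc|lra].
    - apply (clim_incr (fun N => psum (dcoef c) u (S N))), clim_incr.
      eapply pser_dclim; [exact Hc|lra].
    - apply clim_const. }
  eapply clim_bound; [exact L|]. intros N. cbv beta.
  apply Rle_trans with (M * sum_n (fun n => wt3 n * r ^ n) N * normsq (v - u)).
  2:{ apply Rmult_le_compat_r; [exact Hn|]. apply Rmult_le_compat_l; [exact HM|apply HK]. }
  assert (Hterm : forall N, Cmod (c (S (S N)) * Erem u v (S N)) <= M * (wt3 N * r ^ N) * normsq (v - u)).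
  { intros k. rewrite Cmod_mult.
    apply Rle_trans with (M * (wt3 k * r ^ k * normsq (v - u))); [|right; ring].
    apply Rmult_le_compat; try apply Cmod_ge_0.
    - specialize (Hc (S (S k))). unfold wt1 in Hc. lra.
    - apply Erem_bound; lra. }
  induction N.
  (* Monomials of degree 0 and 1 have no second-order remainder, so the induction starts with the
     coefficient of index 2; this is the origin of the shift by two between [psum] and [wt3]. *)
  - rewrite psum_taylor, psum_taylor. rewrite sum_O.
    replace (psum c v 1 - psum c u 1 - psum (dcoef c) u 0 * (v - u) + c 1%nat * Erem u v 0 + c 2%nat * Erem u v 1)%C
      with (c 2%nat * Erem u v 1)%C by (unfold Erem; simpl; ring).
    apply (Hterm 0%nat).
  - rewrite psum_taylor. eapply Rle_trans; [apply Cmod_triangle|].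
    rewrite sum_Sn. change (plus (sum_n (fun n => wt3 n * r ^ n) N) (wt3 (S N) * r ^ S N))
      with (sum_n (fun n => wt3 n * r ^ n) N + wt3 (S N) * r ^ S N).
    pose proof (Hterm (S N)) as HT. rewrite Rmult_plus_distr_l, Rmult_plus_distr_r.
    apply Rplus_le_compat; [exact IHN|exact HT].
Qed.

Lemma is_derive_squeeze (g q : R -> R) t :
  locally t (fun s => Rabs (g s) <= q s) -> q t = 0 -> is_derive q t 0 -> is_derive g t 0.
Proof.
  intros Hloc Hq Hd. apply is_derive_Reals. apply is_derive_Reals in Hd.
  intros eps Heps. destruct (Hd eps Heps) as [d1 H1]. destruct Hloc as [d2 H2].
  assert (Hg : g t = 0).
  { pose proof (H2 t (ball_center t d2)) as H. rewrite Hq in H.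
    apply Rabs_le_between in H. lra. }
  assert (Hm : 0 < Rmin d1 d2) by (apply Rmin_pos; apply cond_pos).
  exists (mkposreal _ Hm). intros h Hh0 Hh. simpl in Hh.
  assert (Hh1 : Rabs h < d1) by (eapply Rlt_le_trans; [exact Hh|apply Rmin_l]).
  assert (Hh2 : Rabs h < d2) by (eapply Rlt_le_trans; [exact Hh|apply Rmin_r]).
  specialize (H1 h Hh0 Hh1). rewrite Hq in H1. rewrite Hg.
  assert (HB : Rabs (g (t + h)) <= q (t + h)).
  { apply H2. unfold ball; simpl; unfold AbsRing_ball, abs, minus, plus, opp; simpl.
    replace (t + h + - t) with h by ring. exact Hh2. }
  eapply Rle_lt_trans; [|exact H1]. rewrite !Rminus_0_r.
  unfold Rdiv. rewrite !Rabs_mult. apply Rmult_le_compat_r; [apply Rabs_pos|].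
  eapply Rle_trans; [exact HB|apply Rle_abs].
Qed.

Lemma cder_squeeze (g : R -> C) (q : R -> R) t :
  locally t (fun s => Cmod (g s) <= q s) -> q t = 0 -> is_derive q t 0 -> cder g t 0%C.
Proof.
  intros H Hq Hd; split; simpl; apply (is_derive_squeeze _ q); try assumption;
    revert H; apply filter_imp; intros s Hs.
  - eapply Rle_trans; [apply abs_fst_le_Cmod|exact Hs].
  - eapply Rle_trans; [apply abs_snd_le_Cmod|exact Hs].
Qed.

Lemma is_derive_locally_lt (f : R -> R) t l b : is_derive f t l -> f t < b ->
  locally t (fun s => f s < b).
Proof.
  intros H Hb.
  assert (Hc : continuous f t).
  { apply (ex_derive_continuous (K := R_AbsRing) (V := R_NormedModule)). exists l; exact H. }
  apply (Hc (fun y => y < b)). apply (open_lt b). exact Hb.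
Qed.

Lemma cder_locally_mod_lt f t l b : cder f t l -> Cmod (f t) < b ->
  locally t (fun s => Cmod (f s) < b).
Proof.
  intros H Hb. pose proof (cder_normsq _ _ _ H) as HN.
  pose proof (Cmod_ge_0 (f t)) as H0.
  eapply (is_derive_locally_lt _ t _ (b * b)) in HN.
  2:{ rewrite <- Cmod_sqr. nra. }
  revert HN; apply filter_imp; intros s Hs. rewrite <- Cmod_sqr in Hs.
  pose proof (Cmod_ge_0 (f s)). nra.
Qed.

Lemma cder_id t : cder (fun s => RtoC s) t 1%C.
Proof.
  split; simpl.
  - apply (is_derive_id (K := R_AbsRing)).
  - apply (is_derive_const (V := R_NormedModule)).
Qed.

Lemma cder_pser c M f t l : growth c M wt1 -> cder f t l -> Cmod (f t) < 1 ->
  cder (fun s => pser c (f s)) t (pser (dcoef c) (f t) * l)%C.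
Proof.
  intros Hc Hf Hlt. pose proof (Cmod_ge_0 (f t)) as H0.
  (* A radius strictly between |f t| and 1 leaves room for the values of [f] near [t], so one
     remainder constant serves a whole neighbourhood. *)
  set (r := (1 + Cmod (f t)) / 2).
  assert (Hr : 0 <= r < 1) by (unfold r; lra).
  destruct (pser_taylor c M r Hc Hr) as (K & HK & HT).
  set (D := pser (dcoef c) (f t)).
  set (g := fun s => (pser c (f s) - pser c (f t) - D * (f s - f t))%C).
  assert (Hsub : cder (fun s => f s - f t)%C t l).
  { eapply cder_eq; [apply cder_minus; [exact Hf|apply cder_const]|]. ring. }
  assert (Hg : cder g t 0%C).
  { apply (cder_squeeze g (fun s => K * normsq (f s - f t)%C)).
    - assert (Hl : locally t (fun s => Cmod (f s) < r)).
      { eapply cder_locally_mod_lt; [exact Hf|]. unfold r; lra. }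
      revert Hl; apply filter_imp; intros s Hs. unfold g, D. apply HT; unfold r in *; lra.
    - unfold normsq; simpl. ring.
    - pose proof (cder_normsq _ _ _ Hsub) as HN.
      apply (is_derive_scal _ _ K) in HN.
      eapply (fun a b => eq_ind _ (is_derive _ _) a _ b); [exact HN|]. simpl. ring. }
  apply (cder_ext (fun s => pser c (f t) + D * (f s - f t) + g s)%C).
  { intros s. unfold g. ring. }
  eapply cder_eq.
  - apply cder_plus; [apply cder_plus; [apply cder_const|apply cder_scal; exact Hsub]|exact Hg].
  - fold D. ring.
Qed.

Lemma wt2_lim r : 0 <= r < 1 -> is_lim_seq (fun n => wt2 n * r ^ n) 0.
Proof. intros H. apply ex_series_lim_0, wt2_summable, H. Qed.

(** * Series solutions at the three punctures *)

(* Coefficients of [(1/nu) 2F1(1, sigma; nu + 1; u)]. *)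
Fixpoint hcoef (nu sg : C) (n : nat) : C :=
  match n with
  | O => / nu
  | S k => (hcoef nu sg k * (INR k + sg) / (INR (S k) + nu))%C
  end.

(** The first clause makes the recurrence meaningful. The second says that the ratios of consecutive
    coefficients have modulus at most 1, which gives both convergence in the unit disc and explicit
    tails. *)
Definition hreg (nu sg : C) : Prop :=
  forall n : nat, (INR n + nu <> 0)%C /\ Cmod (INR n + sg) <= Cmod (INR (S n) + nu).

Lemma hreg_neq0 nu sg : hreg nu sg -> nu <> 0%C.
Proof. intros H E. apply (proj1 (H 0%nat)). simpl. rewrite E. ring. Qed.

Lemma hcoef_decr nu sg n : hreg nu sg -> Cmod (hcoef nu sg (S n)) <= Cmod (hcoef nu sg n).
Proof.
  intros H. destruct (H (S n)) as [H1 _]. destruct (H n) as [_ H2].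
  change (hcoef nu sg (S n)) with (hcoef nu sg n * (INR n + sg) / (INR (S n) + nu))%C.
  rewrite Cmod_div by exact H1. rewrite Cmod_mult.
  assert (Hp : 0 < Cmod (INR (S n) + nu)) by (apply Cmod_gt_0; exact H1).
  apply Rle_div_l; [exact Hp|]. apply Rmult_le_compat_l; [apply Cmod_ge_0|exact H2].
Qed.

Lemma hcoef_growth nu sg : hreg nu sg -> growth (hcoef nu sg) (Cmod (hcoef nu sg 0)) wt1.
Proof.
  intros H n. unfold wt1. rewrite Rmult_1_r. induction n; [lra|].
  eapply Rle_trans; [apply hcoef_decr, H|exact IHn].
Qed.

Definition hyp (nu sg u : C) : C := pser (hcoef nu sg) u.
Definition dhyp (nu sg u : C) : C := pser (dcoef (hcoef nu sg)) u.

Lemma cder_hyp nu sg f t l : hreg nu sg -> cder f t l -> Cmod (f t) < 1 ->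
  cder (fun s => hyp nu sg (f s)) t (dhyp nu sg (f t) * l)%C.
Proof. intros H; apply cder_pser with (M := Cmod (hcoef nu sg 0)), hcoef_growth, H. Qed.

(** The recurrence cancels every degree between 1 and [N]. Truncating the three sums at the unequal
    orders [N], [S N], [N] leaves a single boundary term, of degree [S N], which tends to 0 inside
    the disc. *)
Lemma hyp_ode_partial nu sg u N : hreg nu sg ->
  (u * (1 - u) * psum (dcoef (hcoef nu sg)) u N + nu * psum (hcoef nu sg) u (S N)
     - sg * u * psum (hcoef nu sg) u N
   = 1 - INR N * hcoef nu sg N * u ^ S N)%C.
Proof.
  intros H. pose proof (hreg_neq0 _ _ H) as Hnu. induction N.
  - simpl. field. exact Hnu.
  - change (psum (hcoef nu sg) u (S (S N))) with (psum (hcoef nu sg) u (S N) + hcoef nu sg (S N) * u ^ S N)%C.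
    change (psum (hcoef nu sg) u (S N)) with (psum (hcoef nu sg) u N + hcoef nu sg N * u ^ N)%C at 2.
    change (psum (dcoef (hcoef nu sg)) u (S N)) with
      (psum (dcoef (hcoef nu sg)) u N + dcoef (hcoef nu sg) N * u ^ N)%C.
    assert (E : (u * (1 - u) * psum (dcoef (hcoef nu sg)) u N + nu * psum (hcoef nu sg) u (S N)
     - sg * u * psum (hcoef nu sg) u N
   = 1 - INR N * hcoef nu sg N * u ^ S N)%C) by exact IHN.
    unfold dcoef at 2.
    transitivity ((u * (1 - u) * psum (dcoef (hcoef nu sg)) u N + nu * psum (hcoef nu sg) u (S N)
     - sg * u * psum (hcoef nu sg) u N) + u * (1 - u) * (INR (S N) * hcoef nu sg (S N) * u ^ N)
      + nu * hcoef nu sg (S N) * u ^ S N - sg * u * (hcoef nu sg N * u ^ N))%C; [ring|].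
    rewrite E.
    assert (R : (hcoef nu sg (S N) * (INR (S N) + nu) = hcoef nu sg N * (INR N + sg))%C).
    { change (hcoef nu sg (S N)) with (hcoef nu sg N * (INR N + sg) / (INR (S N) + nu))%C.
      destruct (H (S N)) as [H1 _]. field. exact H1. }
    change (u ^ S (S N))%C with (u * (u * u ^ N))%C. change (u ^ S N)%C with (u * u ^ N)%C.
    transitivity (1 + (hcoef nu sg (S N) * (INR (S N) + nu)) * (u * u ^ N) - hcoef nu sg N * (INR N + sg) * (u * u ^ N)
       - INR (S N) * hcoef nu sg (S N) * (u * (u * u ^ N)))%C; [ring|].
    rewrite R. ring.
Qed.

(** Equivalently, u^nu (1 - u)^(sg - nu) times the series is a primitive of u^(nu - 1) (1 - u)^(sg -
    nu - 1): this is how a branch of the developing map is obtained at 0 and at 1. *)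
Lemma hyp_ode nu sg u : hreg nu sg -> Cmod u < 1 ->
  (u * (1 - u) * dhyp nu sg u + (nu - sg * u) * hyp nu sg u = 1)%C.
Proof.
  intros H Hu. pose proof (hcoef_growth _ _ H) as HG.
  set (M := Cmod (hcoef nu sg 0)) in *.
  pose proof (pser_clim1 _ _ _ HG Hu) as L1. pose proof (pser_dclim _ _ _ HG Hu) as L2.
  fold (hyp nu sg u) in L1. fold (dhyp nu sg u) in L2.
  assert (HM : 0 <= M) by apply Cmod_ge_0.
  assert (La : clim (fun N => 1 - INR N * hcoef nu sg N * u ^ S N)%C (1 - 0)%C).
  { apply clim_minus; [apply clim_const|].
    apply (clim_squeeze _ (fun N => M * (wt2 N * Cmod u ^ N))).
    - intros n. rewrite !Cmod_mult, Cmod_R, Cmod_pow, Rabs_pos_eq by apply pos_INR.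
      specialize (HG n). unfold wt1 in HG. rewrite Rmult_1_r in HG.
      pose proof (pos_INR n). pose proof (Cmod_ge_0 (hcoef nu sg n)). pose proof (Cmod_ge_0 u).
      assert (0 <= Cmod u ^ n) by (apply pow_le; assumption).
      simpl (Cmod u ^ S n). unfold wt2. rewrite S_INR.
      assert (Cmod u * Cmod u ^ n <= Cmod u ^ n) by nra.
      assert (INR n * Cmod (hcoef nu sg n) <= M * (INR n + 1)) by nra.
      assert (0 <= INR n * Cmod (hcoef nu sg n)) by nra.
      apply Rle_trans with (INR n * Cmod (hcoef nu sg n) * Cmod u ^ n).
      + apply Rmult_le_compat_l; lra.
      + rewrite <- Rmult_assoc. apply Rmult_le_compat_r; lra.
    - replace (Finite 0) with (Rbar_mult M 0) by (simpl; f_equal; ring).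
      apply (is_lim_seq_scal_l _ M 0). apply wt2_lim. pose proof (Cmod_ge_0 u); lra. }
  assert (Lb : clim (fun N => u * (1 - u) * psum (dcoef (hcoef nu sg)) u N + nu * psum (hcoef nu sg) u (S N)
     - sg * u * psum (hcoef nu sg) u N)%C (u * (1 - u) * dhyp nu sg u + nu * hyp nu sg u - sg * u * hyp nu sg u)%C).
  { apply clim_minus; [apply clim_plus|]; apply clim_mult; try apply clim_const; try assumption.
    apply clim_incr, L1. }
  pose proof (clim_unique _ _ _ (clim_ext _ _ _ (fun N => hyp_ode_partial nu sg u N H) Lb) La) as E.
  transitivity (u * (1 - u) * dhyp nu sg u + nu * hyp nu sg u - sg * u * hyp nu sg u)%C; [ring|].
  rewrite E. ring.
Qed.

(* Pairs of consecutive coefficients [(g_n, g_(n+1))] of the solution at infinity. *)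
Fixpoint gpair (ga de : C) (n : nat) : C * C :=
  match n with
  | O => (- (2 / ga), de * (- (2 / ga)) / (1 + ga))%C
  | S k => let p := gpair ga de k in
           (snd p, ((de * snd p + INR (S k) * fst p) / (INR (S (S k)) + ga))%C)
  end.

Definition gcoef (ga de : C) (n : nat) : C := fst (gpair ga de n).

(** The inequality makes each coefficient at most the larger of the two before it, so a bound on two
    consecutive coefficients propagates forever. *)
Definition greg (ga de : C) : Prop :=
  forall n : nat, (INR n + ga <> 0)%C /\ Cmod de + INR n <= Cmod (INR (S n) + ga).

Lemma greg_neq0 ga de : greg ga de -> ga <> 0%C.
Proof. intros H E. apply (proj1 (H 0%nat)). simpl. rewrite E. ring. Qed.

Lemma gcoef_SS ga de n :
  gcoef ga de (S (S n)) = ((de * gcoef ga de (S n) + INR (S n) * gcoef ga de n) / (INR (S (S n)) + ga))%C.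
Proof. reflexivity. Qed.

Lemma gcoef_rec ga de n : greg ga de ->
  ((INR (S (S n)) + ga) * gcoef ga de (S (S n)) = de * gcoef ga de (S n) + INR (S n) * gcoef ga de n)%C.
Proof.
  intros H. rewrite gcoef_SS. destruct (H (S (S n))) as [H1 _]. field. exact H1.
Qed.

Lemma gcoef_step ga de n B : greg ga de -> Cmod (gcoef ga de n) <= B -> Cmod (gcoef ga de (S n)) <= B ->
  Cmod (gcoef ga de (S (S n))) <= B.
Proof.
  intros H H1 H2. rewrite gcoef_SS. destruct (H (S (S n))) as [Hn _]. destruct (H (S n)) as [_ Hb].
  assert (Hp : 0 < Cmod (INR (S (S n)) + ga)) by (apply Cmod_gt_0; exact Hn).
  rewrite Cmod_div by exact Hn. apply Rle_div_l; [exact Hp|].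
  eapply Rle_trans; [apply Cmod_triangle|]. rewrite !Cmod_mult, Cmod_R, Rabs_pos_eq by apply pos_INR.
  pose proof (Cmod_ge_0 (gcoef ga de n)). pose proof (Cmod_ge_0 (gcoef ga de (S n))).
  pose proof (Cmod_ge_0 de). pose proof (pos_INR (S n)).
  apply Rle_trans with (B * (Cmod de + INR (S n))); [nra|].
  apply Rmult_le_compat_l; [lra|exact Hb].
Qed.

Lemma gcoef_bound ga de n0 B : greg ga de -> Cmod (gcoef ga de n0) <= B -> Cmod (gcoef ga de (S n0)) <= B ->
  forall n, (n0 <= n)%nat -> Cmod (gcoef ga de n) <= B.
Proof.
  intros H H1 H2 n Hn.
  assert (forall k, Cmod (gcoef ga de (n0 + k)) <= B /\ Cmod (gcoef ga de (S (n0 + k))) <= B) as HH.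
  { induction k; [rewrite Nat.add_0_r; auto|]. destruct IHk as [Ha Hb].
    rewrite Nat.add_succ_r. split; [exact Hb|]. apply gcoef_step; assumption. }
  replace n with (n0 + (n - n0))%nat by lia. apply HH.
Qed.

Lemma gcoef_growth ga de : greg ga de -> growth (gcoef ga de) (Cmod (gcoef ga de 0)) wt1.
Proof.
  intros H n. unfold wt1. rewrite Rmult_1_r. apply (gcoef_bound ga de 0); [exact H|lra| |lia].
  unfold gcoef. simpl gpair. destruct (H 1%nat) as [H1 _]. destruct (H 0%nat) as [H0 Hb].
  simpl INR in *. simpl fst. 
  rewrite Cmod_div by exact H1.
  assert (Hp : 0 < Cmod (1 + ga)) by (apply Cmod_gt_0; exact H1).
  apply Rle_div_l; [exact Hp|]. rewrite Cmod_mult, Rmult_comm.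
  apply Rmult_le_compat_l; [apply Cmod_ge_0|lra].
Qed.

Definition gsol (ga de q : C) : C := pser (gcoef ga de) q.
Definition dgsol (ga de q : C) : C := pser (dcoef (gcoef ga de)) q.

Lemma cder_gsol ga de f t l : greg ga de -> cder f t l -> Cmod (f t) < 1 ->
  cder (fun s => gsol ga de (f s)) t (dgsol ga de (f t) * l)%C.
Proof. intros H; apply cder_pser with (M := Cmod (gcoef ga de 0)), gcoef_growth, H. Qed.

Lemma gsol_ode_partial ga de q N : greg ga de ->
  (q * psum (dcoef (gcoef ga de)) q N - q * q * q * psum (dcoef (gcoef ga de)) q N
   + ga * psum (gcoef ga de) q (S N) - (de * q + q * q) * psum (gcoef ga de) q (S N)
   = - (2) - (INR (S N) + ga) * gcoef ga de (S N) * q ^ S N - gcoef ga de N * q ^ S (S N)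
     - INR N * gcoef ga de N * q ^ S (S N))%C.
Proof.
  intros H. pose proof (greg_neq0 _ _ H) as Hga. induction N.
  - destruct (H 1%nat) as [H1 _]. simpl in H1. unfold gcoef; simpl. field. split; assumption.
  - change (psum (gcoef ga de) q (S (S N))) with (psum (gcoef ga de) q (S N) + gcoef ga de (S N) * q ^ S N)%C.
    change (psum (dcoef (gcoef ga de)) q (S N)) with
      (psum (dcoef (gcoef ga de)) q N + dcoef (gcoef ga de) N * q ^ N)%C.
    unfold dcoef at 2 4.
    transitivity ((q * psum (dcoef (gcoef ga de)) q N - q * q * q * psum (dcoef (gcoef ga de)) q N
   + ga * psum (gcoef ga de) q (S N) - (de * q + q * q) * psum (gcoef ga de) q (S N))
   + (q - q * q * q) * (INR (S N) * gcoef ga de (S N) * q ^ N)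
   + (ga - (de * q + q * q)) * (gcoef ga de (S N) * q ^ S N))%C; [ring|].
    rewrite IHN. rewrite (gcoef_rec ga de N H).
    change (q ^ S (S (S N)))%C with (q * (q * (q * q ^ N)))%C.
    change (q ^ S (S N))%C with (q * (q * q ^ N))%C. change (q ^ S N)%C with (q * q ^ N)%C.
    rewrite !(S_INR N), !RtoC_plus. ring.
Qed.

(** The coordinate q = 1 / (1 - 2 z) sends the punctures 0, 1, infinity to 1, - 1, 0, so that 0 and
    1 are treated symmetrically and the series converges for |q| < 1. The solution of the original
    problem near infinity is q times this series. *)
Lemma gsol_ode ga de q : greg ga de -> Cmod q < 1 ->
  ((1 - q * q) * q * dgsol ga de q + (ga - de * q - q * q) * gsol ga de q = - (2))%C.
Proof.
  intros H Hu. pose proof (gcoef_growth _ _ H) as HG.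
  set (M := Cmod (gcoef ga de 0)) in *.
  pose proof (pser_clim1 _ _ _ HG Hu) as L1. pose proof (pser_dclim _ _ _ HG Hu) as L2.
  fold (gsol ga de q) in L1. fold (dgsol ga de q) in L2.
  assert (HM : 0 <= M) by apply Cmod_ge_0.
  assert (H0q : 0 <= Cmod q < 1) by (pose proof (Cmod_ge_0 q); lra).
  assert (LM : forall (A : R) (s : nat -> C), (forall n, Cmod (s n) <= A * (wt2 n * Cmod q ^ n)) -> clim s 0%C).
  { intros A s Hs. apply (clim_squeeze _ (fun N => A * (wt2 N * Cmod q ^ N))); [exact Hs|].
    replace (Finite 0) with (Rbar_mult A 0) by (simpl; f_equal; ring).
    apply (is_lim_seq_scal_l _ A 0). apply wt2_lim, H0q. }
  assert (Hp : forall n, 0 <= Cmod q ^ n) by (intros; apply pow_le; lra).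
  assert (La : clim (fun N => - (2) - (INR (S N) + ga) * gcoef ga de (S N) * q ^ S N - gcoef ga de N * q ^ S (S N)
     - INR N * gcoef ga de N * q ^ S (S N))%C (- (2) - 0 - 0 - 0)%C).
  { apply clim_minus; [apply clim_minus; [apply clim_minus; [apply clim_const|]|]|].
    - apply (LM (M * (1 + Cmod ga))). intros n. rewrite !Cmod_mult, Cmod_pow.
      assert (Ha : Cmod (INR (S n) + ga) <= (1 + Cmod ga) * wt2 n).
      { eapply Rle_trans; [apply Cmod_triangle|]. rewrite Cmod_R, Rabs_pos_eq by apply pos_INR.
        unfold wt2. pose proof (Cmod_ge_0 ga). rewrite S_INR. pose proof (pos_INR n). nra. }
      pose proof (HG (S n)) as Hb. unfold wt1 in Hb. rewrite Rmult_1_r in Hb.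
      assert (Hc : Cmod q ^ S n <= Cmod q ^ n) by (simpl; specialize (Hp n); nra).
      replace (M * (1 + Cmod ga) * (wt2 n * Cmod q ^ n)) with (((1 + Cmod ga) * wt2 n) * M * Cmod q ^ n) by ring.
      apply Rmult_le_compat; try apply Hp; try exact Hc.
      + apply Rmult_le_pos; apply Cmod_ge_0.
      + apply Rmult_le_compat; try apply Cmod_ge_0; assumption.
    - apply (LM M). intros n. rewrite Cmod_mult, Cmod_pow.
      pose proof (HG n) as Hb. unfold wt1 in Hb. rewrite Rmult_1_r in Hb.
      assert (Hc : Cmod q ^ S (S n) <= wt2 n * Cmod q ^ n).
      { unfold wt2. rewrite S_INR. simpl. pose proof (pos_INR n). specialize (Hp n).
        assert (Cmod q * Cmod q ^ n <= Cmod q ^ n) by nra.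
        assert (0 <= Cmod q * Cmod q ^ n) by nra.
        assert (0 <= INR n * Cmod q ^ n) by nra. nra. }
      apply Rmult_le_compat; try apply Cmod_ge_0; [apply Hp|assumption|assumption].
    - apply (LM M). intros n. rewrite !Cmod_mult, Cmod_pow, Cmod_R, Rabs_pos_eq by apply pos_INR.
      pose proof (HG n) as Hb. unfold wt1 in Hb. rewrite Rmult_1_r in Hb.
      pose proof (pos_INR n) as Hn. pose proof (Cmod_ge_0 (gcoef ga de n)).
      assert (Hc : Cmod q ^ S (S n) <= Cmod q ^ n).
      { simpl. specialize (Hp n). assert (Cmod q * Cmod q ^ n <= Cmod q ^ n) by nra.
        assert (0 <= Cmod q * Cmod q ^ n) by nra. nra. }
      apply Rle_trans with ((INR n * M) * Cmod q ^ n).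
      + apply Rmult_le_compat; try apply Hp; [apply Rmult_le_pos; assumption| |exact Hc].
        apply Rmult_le_compat_l; assumption.
      + unfold wt2. rewrite S_INR. specialize (Hp n).
        assert (0 <= M * Cmod q ^ n) by nra. nra. }
  assert (Lb : clim (fun N => q * psum (dcoef (gcoef ga de)) q N - q * q * q * psum (dcoef (gcoef ga de)) q N
   + ga * psum (gcoef ga de) q (S N) - (de * q + q * q) * psum (gcoef ga de) q (S N))%C
     (q * dgsol ga de q - q * q * q * dgsol ga de q + ga * gsol ga de q - (de * q + q * q) * gsol ga de q)%C).
  { apply clim_minus; [apply clim_plus; [apply clim_minus|]|]; apply clim_mult; try apply clim_const; try assumption;
    apply (clim_incr _ _ L1). }
  pose proof (clim_unique _ _ _ (clim_ext _ _ _ (fun N => gsol_ode_partial ga de q N H) Lb) La) as E.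
  transitivity (q * dgsol ga de q - q * q * q * dgsol ga de q + ga * gsol ga de q - (de * q + q * q) * gsol ga de q)%C; [ring|].
  rewrite E. ring.
Qed.

(* The coefficients of the field are [- 2 pi al] for x^2 and [2 pi sg] for xy in [v1], and
   [2 pi (1 - al)] for xy and [- 2 pi (1 - sg)] for y^2 in [v2]; [be = sg - al]. *)
Definition lam : R := ln 2 / (2 * PI).
Definition al : C := (1/4, lam).
Definition be : C := (1/8, - (3/2 * lam)).
Definition sg : C := (3/8, - (lam / 2)).
Definition ga : C := (5/8, lam / 2).
Definition de : C := (1/8, 5/2 * lam).

Lemma sg_eq : (al + be)%C = sg.
Proof. apply C_eq; simpl; field. Qed.
Lemma ga_eq : (1 - (al + be))%C = ga.
Proof. apply C_eq; simpl; field. Qed.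
Lemma de_eq : (al - be)%C = de.
Proof. apply C_eq; simpl; field. Qed.

(** * Numerical bounds for log 2 and pi *)

(** exp x is the 2^n-th power of exp (x / 2^n), reached by n squarings, and exp y >= 1 + y. *)
Lemma exp_lower (x : R) n : 0 <= 1 + x / 2 ^ n -> Nat.iter n (fun y => y * y) (1 + x / 2 ^ n) <= exp x.
Proof.
  intros H.
  assert (G : forall m y, 0 <= y -> y <= exp (x / 2 ^ n) ->
    Nat.iter m (fun y => y * y) y <= exp (2 ^ m * (x / 2 ^ n)) /\ 0 <= Nat.iter m (fun y => y * y) y).
  { induction m; intros y Hy Hle; simpl.
    - rewrite Rmult_1_l. auto.
    - destruct (IHm y Hy Hle) as [I1 I2]. split; [|nra].
      replace (2 * 2 ^ m * (x / 2 ^ n)) with (2 ^ m * (x / 2 ^ n) + 2 ^ m * (x / 2 ^ n)) by ring.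
      rewrite exp_plus. apply Rmult_le_compat; assumption. }
  destruct (G n _ H (exp_ineq1_le _)) as [G1 _].
  replace (2 ^ n * (x / 2 ^ n)) with x in G1; [exact G1|].
  field. apply pow_nonzero; lra.
Qed.

(** One squaring in which the result is rounded down to [c], so that the decimals stay short through
    twelve squarings. *)
Lemma iter_sqr_lower (b k c : R) n y : b <= y -> 0 <= b -> c <= b * b ->
  (forall y, c <= y -> k <= Nat.iter n (fun y => y * y) y) ->
  k <= Nat.iter (S n) (fun y => y * y) y.
Proof. intros H1 H2 H3 H. rewrite Nat.iter_succ_r. apply H. nra. Qed.

Lemma pow2_12 : 2 ^ 12 = 4096.
Proof. ring. Qed.

Lemma ln2_bounds : 0.69305 < ln 2 < 0.69325.
Proof.
  split.
  - assert (H0 : exp 0.69305 < 2).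
    (* An upper bound of exp 0.69305 is a lower bound of exp at the opposite point, so both halves
       of the lemma rest on [exp_lower]. *)
    { assert (H : 1 / 2 < exp (- (0.69305))).
      { eapply Rlt_le_trans with 0.500017384; [lra|].
        eapply Rle_trans; [|apply (exp_lower (- (0.69305)) 12); rewrite pow2_12; lra].
        assert (H : 0.999830798 <= 1 + - (0.69305) / 2 ^ 12) by (rewrite pow2_12; lra).
        revert H. generalize (1 + - (0.69305) / 2 ^ 12). intros y H.
        apply (iter_sqr_lower 0.999830798 _ 0.999661624); [lra|lra|lra|]; clear y H; intros y H.
        apply (iter_sqr_lower 0.999661624 _ 0.999323362); [lra|lra|lra|]; clear y H; intros y H.
        apply (iter_sqr_lower 0.999323362 _ 0.998647181); [lra|lra|lra|]; clear y H; intros y H.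
        apply (iter_sqr_lower 0.998647181 _ 0.997296192); [lra|lra|lra|]; clear y H; intros y H.
        apply (iter_sqr_lower 0.997296192 _ 0.994599694); [lra|lra|lra|]; clear y H; intros y H.
        apply (iter_sqr_lower 0.994599694 _ 0.989228551); [lra|lra|lra|]; clear y H; intros y H.
        apply (iter_sqr_lower 0.989228551 _ 0.978573126); [lra|lra|lra|]; clear y H; intros y H.
        apply (iter_sqr_lower 0.978573126 _ 0.957605362); [lra|lra|lra|]; clear y H; intros y H.
        apply (iter_sqr_lower 0.957605362 _ 0.917008029); [lra|lra|lra|]; clear y H; intros y H.
        apply (iter_sqr_lower 0.917008029 _ 0.840903725); [lra|lra|lra|]; clear y H; intros y H.
        apply (iter_sqr_lower 0.840903725 _ 0.707119074); [lra|lra|lra|]; clear y H; intros y H.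
        apply (iter_sqr_lower 0.707119074 _ 0.500017384); [lra|lra|lra|]; clear y H; intros y H.
        exact H. }
      rewrite exp_Ropp in H. pose proof (exp_pos 0.69305).
      apply (Rmult_lt_compat_r (exp 0.69305)) in H; [|lra]. rewrite Rinv_l in H; lra. }
    rewrite <- (ln_exp 0.69305). apply ln_increasing; [apply exp_pos|exact H0].
  - assert (H0 : 2 < exp 0.69325).
    { eapply Rlt_le_trans with 2.000079345; [lra|].
      eapply Rle_trans; [|apply (exp_lower 0.69325 12); rewrite pow2_12; lra].
      assert (H : 1.000169250 <= 1 + 0.69325 / 2 ^ 12) by (rewrite pow2_12; lra).
      revert H. generalize (1 + 0.69325 / 2 ^ 12). intros y H.
      apply (iter_sqr_lower 1.000169250 _ 1.000338528); [lra|lra|lra|]; clear y H; intros y H.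
      apply (iter_sqr_lower 1.000338528 _ 1.000677170); [lra|lra|lra|]; clear y H; intros y H.
      apply (iter_sqr_lower 1.000677170 _ 1.001354798); [lra|lra|lra|]; clear y H; intros y H.
      apply (iter_sqr_lower 1.001354798 _ 1.002711431); [lra|lra|lra|]; clear y H; intros y H.
      apply (iter_sqr_lower 1.002711431 _ 1.005430213); [lra|lra|lra|]; clear y H; intros y H.
      apply (iter_sqr_lower 1.005430213 _ 1.010889913); [lra|lra|lra|]; clear y H; intros y H.
      apply (iter_sqr_lower 1.010889913 _ 1.021898416); [lra|lra|lra|]; clear y H; intros y H.
      apply (iter_sqr_lower 1.021898416 _ 1.044276372); [lra|lra|lra|]; clear y H; intros y H.
      apply (iter_sqr_lower 1.044276372 _ 1.090513141); [lra|lra|lra|]; clear y H; intros y H.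
      apply (iter_sqr_lower 1.090513141 _ 1.189218910); [lra|lra|lra|]; clear y H; intros y H.
      apply (iter_sqr_lower 1.189218910 _ 1.414241615); [lra|lra|lra|]; clear y H; intros y H.
      apply (iter_sqr_lower 1.414241615 _ 2.000079345); [lra|lra|lra|]; clear y H; intros y H.
      exact H. }
    rewrite <- (ln_exp 0.69325). apply ln_increasing; lra.
Qed.

Lemma PI_bounds : 3.1415 < PI < 3.1421.
Proof.
  pose proof (Machin.PI_2_3_7_ineq 1) as H.
  unfold tg_alt, Machin.PI_2_3_7_tg, Ratan.Ratan_seq in H. simpl in H. split; lra.
Qed.

Lemma lam_bounds : 0.11028 < lam < 0.11036.
Proof.
  pose proof ln2_bounds. pose proof PI_bounds. unfold lam.
  split; apply Rmult_lt_reg_r with (2 * PI); try lra;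
    replace (ln 2 / (2 * PI) * (2 * PI)) with (ln 2) by (field; lra); lra.
Qed.

Lemma hreg_al : hreg al sg.
Proof.
  pose proof lam_bounds. intros n. pose proof (pos_INR n). split.
  - neq0.
  - rewrite S_INR, !Cmod_normsq. apply sqrt_le_1_alt. unfold normsq; simpl. nra.
Qed.

Lemma hreg_be : hreg be sg.
Proof.
  pose proof lam_bounds. intros n. pose proof (pos_INR n). split.
  - neq0.
  - rewrite S_INR, !Cmod_normsq. apply sqrt_le_1_alt. unfold normsq; simpl. nra.
Qed.

Lemma greg_ga : greg ga de.
Proof.
  pose proof lam_bounds. intros n. pose proof (pos_INR n). split.
  - neq0.
  - assert (H1 : Cmod de <= 1/2).
    { apply normsq_le; [lra|]. unfold normsq; simpl. nra. }
    pose proof (abs_fst_le_Cmod (INR (S n) + ga)) as H2.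
    rewrite S_INR in *. simpl in H2. rewrite Rabs_pos_eq in H2; lra.
Qed.

(** * Local branches of the developing map and their multipliers *)

Definition hA (z : C) : C := hyp al sg z.
Definition hB (z : C) : C := (- hyp be sg (1 - z))%C.
Definition qM (z : C) : C := (/ (1 - 2 * z))%C.
Definition hM (z : C) : C := (qM z * gsol ga de (qM z))%C.

(** [dP] is the differential of log (z^al (1 - z)^be) in the direction [dz]; for a branch [P] of
    that logarithm, [dD] is the differential of the developing map. Branches enter only through the
    curve [P]. *)
Definition dP (z dz : C) : C := ((al / z - be / (1 - z)) * dz)%C.
Definition dD (z dz P : C) : C := (cexp P * dz / (z * (1 - z)))%C.

Lemma cder_eq' f t l l' : l = l' -> cder f t l -> cder f t l'.
Proof. intros <-; auto. Qed.

Lemma one_minus_neq0 (z : C) : z <> 1%C -> (1 - z <> 0)%C.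
Proof. intros H E. apply H. replace z with (1 - (1 - z))%C by ring. rewrite E. ring. Qed.

(** The product rule and [hyp_ode]. As [cder_DB] and [cder_DM] reach the same derivative [dD], the
    three local primitives differ by constants wherever two of the series converge along the same
    [P]. *)
Lemma cder_DA (z P : R -> C) t dz : z t <> 0%C -> z t <> 1%C -> Cmod (z t) < 1 ->
  cder z t dz -> cder P t (dP (z t) dz) ->
  cder (fun s => hA (z s) * cexp (P s))%C t (dD (z t) dz (P t)).
Proof.
  intros H0 H1 Hlt Hz HP. apply one_minus_neq0 in H1.
  pose proof (hyp_ode al sg (z t) hreg_al Hlt) as E. rewrite <- sg_eq in E.
  apply (cder_eq' _ _ (dhyp al sg (z t) * dz * cexp (P t) + hA (z t) * (dP (z t) dz * cexp (P t)))%C).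
  2:{ apply cder_mult; [apply cder_hyp; [exact hreg_al|assumption..]|apply cder_cexp; exact HP]. }
  rewrite sg_eq in E.
  unfold dD, dP. transitivity (cexp (P t) * dz * (z t * (1 - z t) * dhyp al sg (z t) + (al - (al + be) * z t) * hA (z t)) / (z t * (1 - z t)))%C.
  { field. split; assumption. }
  rewrite sg_eq. unfold hA. rewrite E. field. split; assumption.
Qed.

Lemma cder_DB (z P : R -> C) t dz : z t <> 0%C -> z t <> 1%C -> Cmod (1 - z t) < 1 ->
  cder z t dz -> cder P t (dP (z t) dz) ->
  cder (fun s => hB (z s) * cexp (P s))%C t (dD (z t) dz (P t)).
Proof.
  intros H0 H1 Hlt Hz HP. apply one_minus_neq0 in H1.
  pose proof (hyp_ode be sg (1 - z t)%C hreg_be Hlt) as E.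
  apply (cder_eq' _ _ (- (dhyp be sg (1 - z t) * (0 - dz)) * cexp (P t) + hB (z t) * (dP (z t) dz * cexp (P t)))%C).
  2:{ apply cder_mult; [|apply cder_cexp; exact HP].
      apply cder_opp. apply (cder_hyp be sg (fun s => 1 - z s)%C); [exact hreg_be| |exact Hlt].
      apply cder_minus; [apply cder_const|exact Hz]. }
  unfold dD, dP, hB. rewrite <- sg_eq in *.
  transitivity (cexp (P t) * dz * ((1 - z t) * (1 - (1 - z t)) * dhyp be (al + be) (1 - z t) + (be - (al + be) * (1 - z t)) * hyp be (al + be) (1 - z t)) / (z t * (1 - z t)))%C.
  { field. split; assumption. }
  rewrite E. field. split; assumption.
Qed.

Lemma cder_DM (z P : R -> C) t dz : z t <> 0%C -> z t <> 1%C -> (1 - 2 * z t <> 0)%C -> Cmod (qM (z t)) < 1 ->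
  cder z t dz -> cder P t (dP (z t) dz) ->
  cder (fun s => hM (z s) * cexp (P s))%C t (dD (z t) dz (P t)).
Proof.
  intros H0 H1 H2 Hlt Hz HP. apply one_minus_neq0 in H1.
  pose proof (gsol_ode ga de (qM (z t)) greg_ga Hlt) as E.
  set (q := qM (z t)) in *.
  assert (Hq : cder (fun s => qM (z s)) t (2 * dz * q * q)%C).
  { unfold qM. eapply cder_eq'; [|apply cder_inv; [|exact H2]].
    2:{ apply cder_minus; [apply cder_const|apply cder_scal; exact Hz]. }
    unfold q, qM. cbv beta. field. exact H2. }
  assert (Hg : cder (fun s => gsol ga de (qM (z s))) t (dgsol ga de q * (2 * dz * q * q))%C).
  { apply (cder_gsol ga de (fun s => qM (z s))); [exact greg_ga|exact Hq|exact Hlt]. }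
  apply (cder_eq' _ _ (((2 * dz * q * q) * gsol ga de q + q * (dgsol ga de q * (2 * dz * q * q))) * cexp (P t)
     + hM (z t) * (dP (z t) dz * cexp (P t)))%C).
  2:{ apply cder_mult; [|apply cder_cexp; exact HP].
      apply (cder_mult (fun s => qM (z s)) (fun s => gsol ga de (qM (z s)))); assumption. }
  unfold dD, dP, hM. fold q.
  assert (Hq1 : (q * (1 - 2 * z t) = 1)%C) by (unfold q, qM; field; exact H2).
  assert (Hz' : (z t = (1 - / q) / 2)%C).
  { unfold q, qM. field. exact H2. }
  assert (Hq0 : q <> 0%C).
  { intros Eq. rewrite Eq in Hq1. apply (f_equal fst) in Hq1. simpl in Hq1. lra. }
  assert (Hqm : (q - 1 <> 0)%C).
  { intros Eq. apply H0. rewrite Hz'. replace q with (q - 1 + 1)%C by ring. rewrite Eq.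
    apply C_eq; simpl; field. }
  assert (Hqp : (q + 1 <> 0)%C).
  { intros Eq. apply H1. rewrite Hz'. replace q with (q + 1 - 1)%C by ring. rewrite Eq.
    apply C_eq; simpl; field. }
  assert (Hqq : (q * q - 1 <> 0)%C).
  { replace (q * q - 1)%C with ((q - 1) * (q + 1))%C by ring. apply Cmult_neq_0; assumption. }
  assert (Hq2 : (q * 2 - (q - 1) <> 0)%C).
  { replace (q * 2 - (q - 1))%C with (q + 1)%C by ring. assumption. }
  (* Once z is replaced by (1 - 1 / q) / 2, the last factor is the left-hand side of [gsol_ode] up
     to sign. *)
  transitivity (2 * q * q / (q * q - 1) * dz * cexp (P t) *
     - ((1 - q * q) * q * dgsol ga de q + (ga - de * q - q * q) * gsol ga de q))%C.
  { rewrite <- ga_eq, <- de_eq. rewrite Hz'. generalize (dgsol (1 - (al + be)) (al - be) q) (gsol (1 - (al + be)) (al - be) q).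
    intros d g. field. repeat split; assumption. }
  rewrite E, Hz'. field. repeat split; assumption.
Qed.

Lemma exp_ln2_half : exp (- ln 2) = 1 / 2.
Proof. rewrite exp_Ropp, exp_ln by lra. field. Qed.

(** The multiplier of z^al for one turn around 0: the real part 1/4 of [al] gives a quarter turn and
    the imaginary part, a multiple of log 2, the modulus 1/2. It is the inverse of the gluing factor
    - 2 i. *)
Lemma cexp_rot_A : cexp (2 * PI * Ci * al)%C = (Ci / 2)%C.
Proof.
  pose proof PI_bounds. unfold cexp.
  replace (fst (2 * PI * Ci * al)%C) with (- ln 2) by (simpl; unfold lam; field; lra).
  replace (snd (2 * PI * Ci * al)%C) with (PI / 2) by (simpl; field).
  rewrite exp_ln2_half, cos_PI2, sin_PI2. apply C_eq; simpl; field.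
Qed.

Lemma cexp_rot_B : cexp (2 * PI * Ci * be)%C = (2 + 2 * Ci)%C.
Proof.
  pose proof PI_bounds. unfold cexp.
  replace (fst (2 * PI * Ci * be)%C) with (ln 2 + / 2 * ln 2) by (simpl; unfold lam; field; lra).
  replace (snd (2 * PI * Ci * be)%C) with (PI / 4) by (simpl; field).
  rewrite exp_plus, exp_ln by lra. rewrite cos_PI4, sin_PI4.
  assert (E : exp (/ 2 * ln 2) = sqrt 2).
  { rewrite <- Rpower_sqrt by lra. reflexivity. }
  rewrite E. pose proof (sqrt_sqrt 2). assert (sqrt 2 <> 0) by (apply Rgt_not_eq, sqrt_lt_R0; lra).
  apply C_eq; simpl; field; assumption.
Qed.

(** * Integer disc arithmetic *)

Definition SC : Z := 1048576%Z.
Definition S2 : R := 1048576.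

(* A zdisc [(x, y, r)] stands for the numbers [u] with [|2^20 u - (x + i y)| <= r]. *)
Definition zdisc : Type := (Z * Z * Z)%type.
Definition dc (d : zdisc) : C := (IZR (fst (fst d)), IZR (snd (fst d))).
Definition dr (d : zdisc) : R := IZR (snd d).
Definition indisc (d : zdisc) (u : C) : Prop := Cmod (S2 * u - dc d) <= dr d.

Definition l1n (d : zdisc) : Z := (Z.abs (fst (fst d)) + Z.abs (snd (fst d)))%Z.
Definition dadd (a b : zdisc) : zdisc :=
  (fst (fst a) + fst (fst b), snd (fst a) + snd (fst b), snd a + snd b)%Z.
Definition dsub (a b : zdisc) : zdisc :=
  (fst (fst a) - fst (fst b), snd (fst a) - snd (fst b), snd a + snd b)%Z.
Definition dconj (a : zdisc) : zdisc := (fst (fst a), - snd (fst a), snd a)%Z.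
(** [U] bounds the modulus of the first factor, so that in a Horner scheme the radius is multiplied
    by the modulus known in advance rather than by |x| + |y|. The final 3 pays two units for
    rounding the centre and one for the floor in the radius. *)
Definition dmulU (U : Z) (a b : zdisc) : zdisc :=
  let '(x, y, r) := a in let '(x', y', r') := b in
  ((x * x' - y * y') / SC, (x * y' + y * x') / SC,
   (U * r' + (Z.abs x' + Z.abs y') * r) / SC + 3)%Z.
Definition dmul (a b : zdisc) : zdisc := dmulU (l1n a + snd a) a b.
(** For centre c the error of 1 / c is |u - c| / (|u| |c|). The larger coordinate [m] is a lower
    bound of |c| that needs no square root. *)
Definition dinv (a : zdisc) : zdisc :=
  let '(x, y, r) := a in
  let n := (x * x + y * y)%Z in
  let m := Z.max (Z.abs x) (Z.abs y) in
  (x * SC * SC / n, - y * SC * SC / n, r * SC * SC / (m * (m - r)) + 3)%Z.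
Definition dinv_ok (a : zdisc) : bool :=
  (snd a <? Z.max (Z.abs (fst (fst a))) (Z.abs (snd (fst a))))%Z.
Definition dnat (k : Z) : zdisc := (k * SC, 0, 0)%Z.
Definition dfat (a : zdisc) (e : Z) : zdisc := (fst (fst a), snd (fst a), snd a + e)%Z.

Lemma S2_pos : 0 < S2. Proof. unfold S2; lra. Qed.
Lemma S2_SC : S2 = IZR SC. Proof. reflexivity. Qed.

Lemma dadd_ok a b u v : indisc a u -> indisc b v -> indisc (dadd a b) (u + v)%C.
Proof.
  unfold indisc. intros H1 H2.
  replace (S2 * (u + v) - dc (dadd a b))%C with ((S2 * u - dc a) + (S2 * v - dc b))%C.
  - eapply Rle_trans; [apply Cmod_triangle|]. unfold dadd, dr; simpl. rewrite plus_IZR.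
    unfold dr in *. lra.
  - unfold dadd, dc; simpl. rewrite !plus_IZR. apply C_eq; simpl; ring.
Qed.

Lemma dsub_ok a b u v : indisc a u -> indisc b v -> indisc (dsub a b) (u - v)%C.
Proof.
  unfold indisc. intros H1 H2.
  replace (S2 * (u - v) - dc (dsub a b))%C with ((S2 * u - dc a) + - (S2 * v - dc b))%C.
  - eapply Rle_trans; [apply Cmod_triangle|]. rewrite Cmod_opp. unfold dsub, dr; simpl. rewrite plus_IZR.
    unfold dr in *. lra.
  - unfold dsub, dc; simpl. rewrite !minus_IZR. apply C_eq; simpl; ring.
Qed.

Lemma dconj_ok a u : indisc a u -> indisc (dconj a) (Cconj u).
Proof.
  unfold indisc. intros H1.
  replace (S2 * Cconj u - dc (dconj a))%C with (Cconj (S2 * u - dc a)).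
  - rewrite Cmod_conj. exact H1.
  - unfold dconj, dc; simpl. rewrite opp_IZR. apply C_eq; simpl; ring.
Qed.

Lemma Cmod_l1 (u : C) : Cmod u <= Rabs (fst u) + Rabs (snd u).
Proof.
  rewrite Cmod_normsq. rewrite <- (sqrt_square (Rabs (fst u) + Rabs (snd u))).
  - apply sqrt_le_1_alt. unfold normsq.
    pose proof (Rabs_pos (fst u)). pose proof (Rabs_pos (snd u)).
    pose proof (Rsqr_abs (fst u)) as E1. pose proof (Rsqr_abs (snd u)) as E2. unfold Rsqr in *. nra.
  - pose proof (Rabs_pos (fst u)). pose proof (Rabs_pos (snd u)). lra.
Qed.

Lemma l1n_ok (d : zdisc) : Cmod (dc d) <= IZR (l1n d).
Proof.
  unfold l1n. rewrite plus_IZR, !abs_IZR. apply (Cmod_l1 (dc d)).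
Qed.

Lemma div_floor (a b : Z) : (0 < b)%Z -> IZR a / IZR b - 1 <= IZR (a / b) <= IZR a / IZR b.
Proof.
  intros Hb. pose proof (Z_div_mod_eq_full a b) as E. pose proof (Z.mod_pos_bound a b Hb) as M.
  assert (Hb' : 0 < IZR b) by (apply IZR_lt; exact Hb).
  set (q := (a / b)%Z) in *. set (m := (a mod b)%Z) in *.
  assert (E' : IZR a = IZR b * IZR q + IZR m) by (rewrite E, plus_IZR, mult_IZR; reflexivity).
  assert (0 <= IZR m) by (apply IZR_le; lia). assert (IZR m <= IZR b) by (apply IZR_le; lia).
  split.
  - apply Rmult_le_reg_r with (IZR b); [exact Hb'|]. replace ((IZR a / IZR b - 1) * IZR b) with (IZR a - IZR b) by (field; lra). nra.
  - apply Rmult_le_reg_r with (IZR b); [exact Hb'|]. replace (IZR a / IZR b * IZR b) with (IZR a) by (field; lra). nra.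
Qed.

Lemma round_pair (a b c : Z) : (0 < c)%Z ->
  Cmod ((IZR a / IZR c, IZR b / IZR c)%R - (IZR (a / c), IZR (b / c)))%C <= 2.
Proof.
  intros Hc. eapply Rle_trans; [apply Cmod_l1|]. simpl.
  pose proof (div_floor a c Hc). pose proof (div_floor b c Hc).
  rewrite (Rabs_pos_eq (IZR a / IZR c + _)) by lra. rewrite (Rabs_pos_eq (IZR b / IZR c + _)) by lra. lra.
Qed.

Lemma dmulU_ok U a b u v : indisc a u -> indisc b v -> Cmod (S2 * u) <= IZR U ->
  indisc (dmulU U a b) (u * v)%C.
Proof.
  destruct a as [[x y] r], b as [[x' y'] r']. unfold indisc. intros H1 H2 HU.
  pose proof S2_pos as Hs.
  set (e1 := (S2 * u - dc (x, y, r))%C) in *. set (e2 := (S2 * v - dc (x', y', r'))%C) in *.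
  unfold dmulU. unfold dc at 1; simpl fst; simpl snd.
  set (P := (x * x' - y * y')%Z). set (Q := (x * y' + y * x')%Z).
  assert (E : (S2 * (u * v) - (IZR (P / SC), IZR (Q / SC)) =
    (/ S2) * (S2 * u * e2 + e1 * dc (x', y', r')) + ((IZR P / IZR SC, IZR Q / IZR SC)%R - (IZR (P / SC), IZR (Q / SC))))%C).
  { unfold e1, e2, dc, P, Q; simpl fst; simpl snd.
    rewrite minus_IZR, plus_IZR, !mult_IZR, <- S2_SC.
    apply C_eq; simpl; field; lra. }
  rewrite E. eapply Rle_trans; [apply Cmod_triangle|].
  pose proof (round_pair P Q SC eq_refl) as HR.
  unfold dr. simpl snd. rewrite plus_IZR.
  set (N := (U * r' + (Z.abs x' + Z.abs y') * r)%Z).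
  pose proof (div_floor N SC eq_refl) as HN.
  assert (HM : Cmod (/ S2 * (S2 * u * e2 + e1 * dc (x', y', r'))) <= IZR N / IZR SC).
  { rewrite <- RtoC_inv by lra. rewrite Cmod_mult, Cmod_R, Rabs_pos_eq by (left; apply Rinv_0_lt_compat; exact Hs).
    rewrite <- S2_SC. unfold Rdiv. rewrite (Rmult_comm (IZR N)). apply Rmult_le_compat_l; [left; apply Rinv_0_lt_compat; exact Hs|].
    eapply Rle_trans; [apply Cmod_triangle|].
    rewrite (Cmod_mult (S2 * u) e2), (Cmod_mult e1). unfold N. rewrite plus_IZR, !mult_IZR.
    pose proof (l1n_ok (x', y', r')) as HL. unfold l1n in HL. simpl fst in HL; simpl snd in HL.
    unfold dr in *; simpl snd in *.
    pose proof (Cmod_ge_0 e1). pose proof (Cmod_ge_0 e2). pose proof (Cmod_ge_0 (S2 * u)).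
    pose proof (Cmod_ge_0 (dc (x', y', r'))).
    apply Rplus_le_compat.
    - apply Rmult_le_compat; assumption.
    - rewrite Rmult_comm. apply Rmult_le_compat; assumption. }
  lra.
Qed.

Lemma indisc_bound a u : indisc a u -> Cmod (S2 * u) <= IZR (l1n a + snd a).
Proof.
  unfold indisc. intros H. rewrite plus_IZR. pose proof (l1n_ok a).
  replace (S2 * u)%C with ((S2 * u - dc a) + dc a)%C by ring.
  eapply Rle_trans; [apply Cmod_triangle|]. unfold dr in H. lra.
Qed.

Lemma dmul_ok a b u v : indisc a u -> indisc b v -> indisc (dmul a b) (u * v)%C.
Proof. intros H1 H2. apply dmulU_ok; [exact H1|exact H2|apply indisc_bound, H1]. Qed.

Lemma indisc_radius a u : indisc a u -> (0 <= snd a)%Z.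
Proof. intros H. apply le_IZR. eapply Rle_trans; [apply Cmod_ge_0|exact H]. Qed.

Lemma dinv_sound a u : indisc a u -> dinv_ok a = true -> u <> 0%C /\ indisc (dinv a) (/ u)%C.
Proof.
  intros H Hok. pose proof (indisc_radius _ _ H) as Hr0.
  destruct a as [[x y] r]. unfold dinv_ok in Hok; simpl in Hok, Hr0. apply Z.ltb_lt in Hok.
  unfold indisc in *. unfold dr in H; simpl snd in H. pose proof S2_pos as Hs.
  set (c := dc (x, y, r)) in *. set (m := Z.max (Z.abs x) (Z.abs y)) in *.
  assert (Hr : 0 <= IZR r) by (apply IZR_le; exact Hr0).
  assert (Hm : IZR m <= Cmod c).
  { unfold m. destruct (Z.max_spec (Z.abs x) (Z.abs y)) as [[_ ->]|[_ ->]]; rewrite abs_IZR.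
    - apply (abs_snd_le_Cmod c).
    - apply (abs_fst_le_Cmod c). }
  assert (Hmr : IZR r < IZR m) by (apply IZR_lt; exact Hok).
  assert (Hu : IZR m - IZR r <= Cmod (S2 * u)).
  { assert (Cmod c <= Cmod (S2 * u) + Cmod (S2 * u - c)); [|lra].
    assert (Ec : (S2 * u + - (S2 * u - c))%C = c) by ring.
    pose proof (Cmod_triangle (S2 * u) (- (S2 * u - c))) as HT. rewrite Ec, Cmod_opp in HT. exact HT. }
  assert (Hu0 : u <> 0%C).
  { intros E. rewrite E in Hu. replace (S2 * 0)%C with (RtoC 0) in Hu by ring. rewrite Cmod_0 in Hu. lra. }
  split; [exact Hu0|].
  assert (Hc0 : c <> 0%C).
  { intros E. rewrite E, Cmod_0 in Hm. lra. }
  set (n := (x * x + y * y)%Z).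
  assert (Hn : IZR n = normsq c).
  { unfold n, normsq, c, dc; simpl. rewrite plus_IZR, !mult_IZR. reflexivity. }
  assert (Hnp : (0 < n)%Z).
  { apply lt_IZR. rewrite Hn. apply normsq_pos, Hc0. }
  unfold dinv. fold n. fold m. unfold dc; simpl fst; simpl snd.
  assert (E : (S2 * / u - (IZR (x * SC * SC / n), IZR (- y * SC * SC / n)) =
    (S2 * S2) * (- (S2 * u - c)) / (S2 * u * c) +
    ((IZR (x * SC * SC) / IZR n, IZR (- y * SC * SC) / IZR n)%R - (IZR (x * SC * SC / n), IZR (- y * SC * SC / n))))%C).
  { assert (E1 : (IZR (x * SC * SC) / IZR n, IZR (- y * SC * SC) / IZR n)%R = (S2 * S2 / c)%C).
    { rewrite Hn, !mult_IZR, opp_IZR, <- S2_SC.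
      pose proof (normsq_pos c Hc0) as Hp. unfold normsq, c, dc in *; simpl in *.
      apply C_eq; simpl; field; lra. }
    rewrite E1. transitivity (S2 * S2 * - (S2 * u - c) / (S2 * u * c) + S2 * S2 / c - (IZR (x * SC * SC / n), IZR (- y * SC * SC / n)))%C; [|ring].
    f_equal. field. repeat split; try assumption. intros E2. injection E2; lra. }
  rewrite E. eapply Rle_trans; [apply Cmod_triangle|].
  pose proof (round_pair (x * SC * SC) (- y * SC * SC) n Hnp) as HR.
  unfold dr. simpl snd. rewrite plus_IZR.
  assert (Hd : (0 < m * (m - r))%Z) by (apply Z.mul_pos_pos; lia).
  pose proof (div_floor (r * SC * SC) (m * (m - r)) Hd) as HN.
  assert (Hb : Cmod (S2 * S2 * - (S2 * u - c) / (S2 * u * c)) <= IZR (r * SC * SC) / IZR (m * (m - r))).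
  { assert (HSu : (S2 * u * c <> 0)%C).
    { apply Cmult_neq_0; [apply Cmult_neq_0|]; try assumption. intros E2; injection E2; lra. }
    rewrite Cmod_div by exact HSu. rewrite !mult_IZR, minus_IZR, <- S2_SC.
    rewrite (Cmod_mult (S2 * u) c), (Cmod_mult (S2 * S2)), Cmod_opp, (Cmod_mult S2 S2), Cmod_R, Rabs_pos_eq by lra.
    apply Rmult_le_compat.
    - apply Rmult_le_pos; [nra|apply Cmod_ge_0].
    - left. apply Rinv_0_lt_compat. nra.
    - nra.
    - apply Rinv_le_contravar; [nra|]. rewrite Rmult_comm. apply Rmult_le_compat; lra. }
  lra.
Qed.

Lemma dnat_ok k : indisc (dnat (Z.of_nat k)) (INR k).
Proof.
  unfold indisc, dnat, dc, dr; simpl. rewrite mult_IZR, <- S2_SC, INR_IZR_INZ.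
  replace (S2 * IZR (Z.of_nat k) - (IZR (Z.of_nat k) * S2, 0)%R)%C with (RtoC 0).
  - rewrite Cmod_0; lra.
  - apply C_eq; simpl; ring.
Qed.

Lemma dfat_ok a e u v : indisc a u -> S2 * Cmod (v - u) <= IZR e -> indisc (dfat a e) v.
Proof.
  unfold indisc. intros H He. unfold dfat, dr; simpl. rewrite plus_IZR.
  change (dc (fst (fst a), snd (fst a), (snd a + e)%Z)) with (dc a).
  replace (S2 * v - dc a)%C with ((S2 * u - dc a) + S2 * (v - u))%C by ring.
  eapply Rle_trans; [apply Cmod_triangle|]. pose proof S2_pos.
  rewrite (Cmod_mult S2), Cmod_R, Rabs_pos_eq by lra. unfold dr in H. lra.
Qed.

(** * Evaluation of the three series on discs *)

Fixpoint lok (c : nat -> C) (k : nat) (l : list zdisc) : Prop :=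
  match l with
  | [] => True
  | d :: l' => indisc d (c k) /\ lok c (S k) l'
  end.

Fixpoint horC (c : nat -> C) (k n : nat) (u : C) : C :=
  match n with
  | O => 0%C
  | S m => (c k + u * horC c (S k) m u)%C
  end.

Lemma psum_hor c u n : forall k, psum c u (k + n) = (psum c u k + u ^ k * horC c k n u)%C.
Proof.
  induction n; intros k.
  - rewrite Nat.add_0_r. simpl. ring.
  - replace (k + S n)%nat with (S k + n)%nat by lia. rewrite IHn.
    change (psum c u (S k)) with (psum c u k + c k * u ^ k)%C.
    change (horC c k (S n) u) with (c k + u * horC c (S k) n u)%C.
    change (u ^ S k)%C with (u * u ^ k)%C. ring.
Qed.

Fixpoint hor (U : Z) (u : zdisc) (l : list zdisc) : zdisc :=
  match l with
  | [] => (0, 0, 0)%Z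
  | d :: l' => dadd d (dmulU U u (hor U u l'))
  end.

Lemma hor_ok U du u c : indisc du u -> Cmod (S2 * u) <= IZR U ->
  forall l k, lok c k l -> indisc (hor U du l) (horC c k (length l) u).
Proof.
  intros H HU l. induction l as [|d l IH]; intros k Hl; simpl.
  - unfold indisc, dc, dr; simpl. replace (S2 * 0 - (0, 0)%R)%C with (RtoC 0) by (apply C_eq; simpl; ring).
    rewrite Cmod_0; lra.
  - destruct Hl as [Hd Hl]. apply dadd_ok; [exact Hd|]. apply dmulU_ok; auto.
Qed.

Lemma psum_diff_bound c u B r N : (forall n, (N <= n)%nat -> Cmod (c n) <= B) -> Cmod u <= r -> 0 <= r < 1 ->
  forall m, Cmod (psum c u (N + m) - psum c u N) <= B * r ^ N * (1 - r ^ m) / (1 - r).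
Proof.
  intros Hc Hu Hr m.
  assert (HB : 0 <= B) by (eapply Rle_trans; [apply Cmod_ge_0|apply (Hc N); lia]).
  induction m.
  - rewrite Nat.add_0_r. replace (psum c u N - psum c u N)%C with (RtoC 0) by ring. rewrite Cmod_0. simpl. right. field. lra.
  - rewrite Nat.add_succ_r. change (psum c u (S (N + m))) with (psum c u (N + m) + c (N + m)%nat * u ^ (N + m))%C.
    replace (psum c u (N + m) + c (N + m)%nat * u ^ (N + m) - psum c u N)%C
      with ((psum c u (N + m) - psum c u N) + c (N + m)%nat * u ^ (N + m))%C by ring.
    eapply Rle_trans; [apply Cmod_triangle|].
    apply Rle_trans with (B * r ^ N * (1 - r ^ m) / (1 - r) + B * r ^ (N + m)).
    + apply Rplus_le_compat; [exact IHm|]. rewrite Cmod_mult, Cmod_pow.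
      apply Rmult_le_compat; [apply Cmod_ge_0|apply pow_le, Cmod_ge_0|apply Hc; lia|].
      apply pow_incr; split; [apply Cmod_ge_0|exact Hu].
    + right. rewrite pow_add. simpl. field. lra.
Qed.

Lemma pser_tail c u M B r N : growth c M wt1 -> (forall n, (N <= n)%nat -> Cmod (c n) <= B) ->
  Cmod u <= r -> 0 <= r < 1 -> Cmod (pser c u - psum c u N) <= B * r ^ N / (1 - r).
Proof.
  intros Hg Hc Hu Hr.
  assert (HB : 0 <= B) by (eapply Rle_trans; [apply Cmod_ge_0|apply (Hc N); lia]).
  assert (L : clim (fun m => psum c u (N + m) - psum c u N)%C (pser c u - psum c u N)%C).
  { apply clim_minus; [|apply clim_const].
    pose proof (pser_clim1 c u M Hg ltac:(lra)) as [L1 L2].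
    split.
    - apply (is_lim_seq_ext (fun m => fst (psum c u (m + N)))); [intros m; rewrite Nat.add_comm; reflexivity|].
      apply (is_lim_seq_incr_n (fun m => fst (psum c u m)) N). exact L1.
    - apply (is_lim_seq_ext (fun m => snd (psum c u (m + N)))); [intros m; rewrite Nat.add_comm; reflexivity|].
      apply (is_lim_seq_incr_n (fun m => snd (psum c u m)) N). exact L2. }
  eapply clim_bound; [exact L|]. intros m. eapply Rle_trans; [apply (psum_diff_bound c u B r N Hc Hu Hr)|].
  apply Rmult_le_compat_r; [left; apply Rinv_0_lt_compat; lra|].
  assert (0 <= r ^ m) by (apply pow_le; lra). assert (0 <= r ^ N) by (apply pow_le; lra).
  assert (0 <= B * r ^ N) by (apply Rmult_le_pos; assumption). nra.
Qed.

(** Values of 2^20 times the exponents; the imaginary parts are multiples of [lam], and the radii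
    absorb the uncertainty left by [lam_bounds]. *)
Definition dal : zdisc := (262144, 115679, 45)%Z.
Definition dbe : zdisc := (131072, -173518, 67)%Z.
Definition dsg : zdisc := (393216, -57839, 25)%Z.
Definition dga : zdisc := (655360, 57840, 25)%Z.
Definition dde : zdisc := (131072, 289198, 110)%Z.

Lemma indisc_re (x y r : Z) (u : C) : S2 * fst u = IZR x -> Rabs (S2 * snd u - IZR y) <= IZR r ->
  indisc (x, y, r) u.
Proof.
  intros H1 H2. unfold indisc, dr. simpl snd. eapply Rle_trans; [apply Cmod_l1|]. simpl.
  replace (S2 * fst u - 0 * snd u + - IZR x) with 0 by lra. rewrite Rabs_R0, Rplus_0_l.
  replace (S2 * snd u + 0 * fst u + - IZR y) with (S2 * snd u - IZR y) by ring. exact H2.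
Qed.

Lemma dal_ok : indisc dal al.
Proof. pose proof lam_bounds. apply indisc_re; unfold S2; simpl; [lra|apply Rabs_le; lra]. Qed.
Lemma dbe_ok : indisc dbe be.
Proof. pose proof lam_bounds. apply indisc_re; unfold S2; simpl; [lra|apply Rabs_le; lra]. Qed.
Lemma dsg_ok : indisc dsg sg.
Proof. pose proof lam_bounds. apply indisc_re; unfold S2; simpl; [lra|apply Rabs_le; lra]. Qed.
Lemma dga_ok : indisc dga ga.
Proof. pose proof lam_bounds. apply indisc_re; unfold S2; simpl; [lra|apply Rabs_le; lra]. Qed.
Lemma dde_ok : indisc dde de.
Proof. pose proof lam_bounds. apply indisc_re; unfold S2; simpl; [lra|apply Rabs_le; lra]. Qed.

Definition hnext (nu s c : zdisc) (k : nat) : zdisc :=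
  dmul (dmul c (dadd (dnat (Z.of_nat k)) s)) (dinv (dadd (dnat (Z.of_nat (S k))) nu)).

Fixpoint hlist (nu s c : zdisc) (k n : nat) : list zdisc :=
  c :: match n with O => [] | S m => hlist nu s (hnext nu s c k) (S k) m end.

Fixpoint hlist_ok (nu : zdisc) (k n : nat) : bool :=
  match n with
  | O => true
  | S m => dinv_ok (dadd (dnat (Z.of_nat (S k))) nu) && hlist_ok nu (S k) m
  end.

Lemma hlist_sound dn ds nu s : indisc dn nu -> indisc ds s ->
  forall n k c, indisc c (hcoef nu s k) -> hlist_ok dn k n = true ->
  lok (hcoef nu s) k (hlist dn ds c k n).
Proof.
  intros Hn Hs. induction n; intros k c Hc Hok; simpl in *.
  - auto.
  - apply andb_prop in Hok. destruct Hok as [H1 H2]. split; [exact Hc|].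
    apply IHn; [|exact H2]. unfold hnext.
    assert (Hi : indisc (dadd (dnat (Z.of_nat (S k))) dn) (INR (S k) + nu)%C) by (apply dadd_ok; [apply dnat_ok|exact Hn]).
    destruct (dinv_sound _ _ Hi H1) as [_ Hinv].
    apply (dmul_ok _ _ (hcoef nu s k * (INR k + s))%C (/ (INR (S k) + nu))%C); [|exact Hinv].
    apply dmul_ok; [exact Hc|]. apply dadd_ok; [apply dnat_ok|exact Hs].
Qed.

Definition gnext (g d c0 c1 : zdisc) (k : nat) : zdisc :=
  dmul (dadd (dmul d c1) (dmul (dnat (Z.of_nat (S k))) c0)) (dinv (dadd (dnat (Z.of_nat (S (S k)))) g)).

Fixpoint glist (g d c0 c1 : zdisc) (k n : nat) : list zdisc :=
  c0 :: match n with O => [] | S m => glist g d c1 (gnext g d c0 c1 k) (S k) m end.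

Lemma glist_sound dg dd g s : indisc dg g -> indisc dd s ->
  forall n k c0 c1, indisc c0 (gcoef g s k) -> indisc c1 (gcoef g s (S k)) ->
  hlist_ok dg (S k) n = true -> lok (gcoef g s) k (glist dg dd c0 c1 k n).
Proof.
  intros Hg Hd. induction n; intros k c0 c1 H0 H1 Hok; [simpl; auto|].
  change (glist dg dd c0 c1 k (S n)) with (c0 :: glist dg dd c1 (gnext dg dd c0 c1 k) (S k) n).
  change (hlist_ok dg (S k) (S n)) with
    (dinv_ok (dadd (dnat (Z.of_nat (S (S k)))) dg) && hlist_ok dg (S (S k)) n)%bool in Hok.
  apply andb_prop in Hok. destruct Hok as [Ha Hb]. split; [exact H0|].
  apply IHn; [exact H1| |exact Hb]. rewrite gcoef_SS. unfold gnext.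
  assert (Hi : indisc (dadd (dnat (Z.of_nat (S (S k)))) dg) (INR (S (S k)) + g)%C) by (apply dadd_ok; [apply dnat_ok|exact Hg]).
  destruct (dinv_sound _ _ Hi Ha) as [_ Hinv].
  apply (dmul_ok _ _ (s * gcoef g s (S k) + INR (S k) * gcoef g s k)%C (/ (INR (S (S k)) + g))%C); [|exact Hinv].
  apply dadd_ok; apply dmul_ok; try assumption. apply dnat_ok.
Qed.

(** [LA] and [LB] hold the coefficients 0 to 24. [LG] holds 0 to 25: its first 24 are summed, and
    the last two bound the tail, since a three-term recurrence propagates bounds from two
    consecutive coefficients. *)
Definition LA : list zdisc := Eval vm_compute in hlist dal dsg (dinv dal) 0 24.
Definition LB : list zdisc := Eval vm_compute in hlist dbe dsg (dinv dbe) 0 24.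
Definition g0 : zdisc := Eval vm_compute in dmul (-2 * SC, 0, 0)%Z (dinv dga).
Definition g1 : zdisc := Eval vm_compute in dmul (dmul dde g0) (dinv (dadd (dnat 1) dga)).
Definition LG : list zdisc := Eval vm_compute in glist dga dde g0 g1 0 25.

Lemma LA_ok : lok (hcoef al sg) 0 LA.
Proof.
  replace LA with (hlist dal dsg (dinv dal) 0 24) by (vm_compute; reflexivity).
  apply hlist_sound; [exact dal_ok|exact dsg_ok| |vm_compute; reflexivity].
  apply dinv_sound; [exact dal_ok|vm_compute; reflexivity].
Qed.

Lemma LB_ok : lok (hcoef be sg) 0 LB.
Proof.
  replace LB with (hlist dbe dsg (dinv dbe) 0 24) by (vm_compute; reflexivity).
  apply hlist_sound; [exact dbe_ok|exact dsg_ok| |vm_compute; reflexivity].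
  apply dinv_sound; [exact dbe_ok|vm_compute; reflexivity].
Qed.

Lemma g0_ok : indisc g0 (gcoef ga de 0).
Proof.
  replace g0 with (dmul (-2 * SC, 0, 0)%Z (dinv dga)) by (vm_compute; reflexivity).
  replace (gcoef ga de 0) with (- (2) * / ga)%C.
  2:{ change (gcoef ga de 0) with (- (2 / ga))%C. unfold Cdiv. ring. }
  apply dmul_ok.
  - apply indisc_re; simpl; unfold S2; [lra|]. rewrite Ropp_0, Rmult_0_r, Rminus_0_r, Rabs_R0; lra.
  - apply dinv_sound; [exact dga_ok|vm_compute; reflexivity].
Qed.

Lemma g1_ok : indisc g1 (gcoef ga de 1).
Proof.
  replace g1 with (dmul (dmul dde g0) (dinv (dadd (dnat 1) dga))) by (vm_compute; reflexivity).
  change (gcoef ga de 1) with (de * gcoef ga de 0 * / (1 + ga))%C.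
  apply dmul_ok; [apply dmul_ok; [exact dde_ok|exact g0_ok]|].
  apply dinv_sound; [|vm_compute; reflexivity].
  apply dadd_ok; [apply (dnat_ok 1)|exact dga_ok].
Qed.

Lemma LG_ok : lok (gcoef ga de) 0 LG.
Proof.
  replace LG with (glist dga dde g0 g1 0 25) by (vm_compute; reflexivity).
  apply glist_sound; [exact dga_ok|exact dde_ok|exact g0_ok|exact g1_ok|vm_compute; reflexivity].
Qed.

Lemma lok_nth c l : forall k i d, lok c k l -> nth_error l i = Some d -> indisc d (c (k + i)%nat).
Proof.
  induction l as [|a l IH]; intros k [|i] d Hl Hi; simpl in *; try discriminate.
  - injection Hi as <-. rewrite Nat.add_0_r. apply Hl.
  - rewrite Nat.add_succ_r. apply (IH (S k)); [apply Hl|exact Hi].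
Qed.

Definition lastnrm (l : list zdisc) (i : nat) : Z :=
  match nth_error l i with Some d => (l1n d + snd d)%Z | None => 0%Z end.

Lemma lastnrm_ok c l i : lok c 0 l -> (i < length l)%nat -> S2 * Cmod (c i) <= IZR (lastnrm l i).
Proof.
  intros Hl Hi. unfold lastnrm. destruct (nth_error l i) as [d|] eqn:E.
  - pose proof (lok_nth _ _ _ _ _ Hl E) as H. apply indisc_bound in H. simpl in H.
    rewrite Cmod_mult, Cmod_R, Rabs_pos_eq in H; [exact H|pose proof S2_pos; lra].
  - apply nth_error_None in E. lia.
Qed.

(** [U1] is 2^20 times 5/6 rounded up and [U2] is 2^20 times 3/4: the largest moduli at which the
    series are evaluated. *)
Definition U1 : Z := 873814%Z.
Definition U2 : Z := 786432%Z.

Lemma hyp_tail nu s N u (L : Z) : hreg nu s -> S2 * Cmod (hcoef nu s N) <= IZR L -> Cmod u <= 5/6 ->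
  S2 * Cmod (hyp nu s u - psum (hcoef nu s) u (S N)) <= IZR L * (5/6) ^ S N * 6.
Proof.
  intros H HL Hu. pose proof S2_pos.
  assert (HB : forall n, (S N <= n)%nat -> Cmod (hcoef nu s n) <= Cmod (hcoef nu s N)).
  { intros n Hn. induction Hn; [apply hcoef_decr, H|].
    eapply Rle_trans; [apply hcoef_decr, H|exact IHHn]. }
  pose proof (pser_tail _ u _ _ (5/6) (S N) (hcoef_growth nu s H) HB Hu ltac:(lra)) as T.
  fold (hyp nu s u) in T.
  assert (Hp : 0 <= (5/6) ^ S N) by (apply pow_le; lra).
  apply Rle_trans with (S2 * (Cmod (hcoef nu s N) * (5/6) ^ S N / (1 - 5/6))).
  - apply Rmult_le_compat_l; lra.
  - replace (S2 * (Cmod (hcoef nu s N) * (5/6) ^ S N / (1 - 5/6))) with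
      ((S2 * Cmod (hcoef nu s N)) * (5/6) ^ S N * 6) by field.
    apply Rmult_le_compat_r; [lra|]. apply Rmult_le_compat_r; assumption.
Qed.

Lemma gsol_tail N q (L : Z) : S2 * Cmod (gcoef ga de N) <= IZR L -> S2 * Cmod (gcoef ga de (S N)) <= IZR L ->
  Cmod q <= 3/4 ->
  S2 * Cmod (gsol ga de q - psum (gcoef ga de) q N) <= IZR L * (3/4) ^ N * 4.
Proof.
  intros HL HL' Hu. pose proof S2_pos as Hs.
  assert (HB : forall n, (N <= n)%nat -> Cmod (gcoef ga de n) <= IZR L / S2).
  { apply gcoef_bound; [exact greg_ga| |];
      apply Rmult_le_reg_l with S2; try lra; replace (S2 * (IZR L / S2)) with (IZR L) by (field; lra); assumption. }
  pose proof (pser_tail _ q _ _ (3/4) N (gcoef_growth ga de greg_ga) HB Hu ltac:(lra)) as T.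
  fold (gsol ga de q) in T.
  replace (IZR L * (3/4) ^ N * 4) with (S2 * (IZR L / S2 * (3/4) ^ N / (1 - 3/4))) by (field; lra).
  apply Rmult_le_compat_l; lra.
Qed.

Definition tailZ (L a b m k e : Z) : bool := (L * a ^ k * m <=? e * b ^ k)%Z.

Lemma tailZ_ok L a b m n e : (0 < b)%Z -> tailZ L a b m (Z.of_nat n) e = true ->
  IZR L * (IZR a / IZR b) ^ n * IZR m <= IZR e.
Proof.
  intros Hb H. apply Z.leb_le in H. apply IZR_le in H. rewrite !mult_IZR, <- !pow_IZR in H.
  assert (Hb' : 0 < IZR b) by (apply IZR_lt; exact Hb).
  assert (Hp : 0 < IZR b ^ n) by (apply pow_lt; exact Hb').
  unfold Rdiv. rewrite Rpow_mult_distr, pow_inv.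
  apply Rmult_le_reg_r with (IZR b ^ n); [exact Hp|].
  replace (IZR L * (IZR a ^ n * / IZR b ^ n) * IZR m * IZR b ^ n) with (IZR L * IZR a ^ n * IZR m) by (field; lra).
  exact H.
Qed.

Definition tailbound (L a b m k : Z) : Z := (L * a ^ k * m / b ^ k + 1)%Z.

Definition eA : Z := Eval vm_compute in tailbound (lastnrm LA 24) 5 6 6 25.
Definition eB : Z := Eval vm_compute in tailbound (lastnrm LB 24) 5 6 6 25.
Definition eG : Z := Eval vm_compute in tailbound (Z.max (lastnrm LG 24) (lastnrm LG 25)) 3 4 4 24.

Definition evA (u : zdisc) : zdisc := dfat (hor U1 u LA) eA.
Definition evB (u : zdisc) : zdisc := dfat (hor U1 u LB) eB.
Definition LG' : list zdisc := Eval vm_compute in firstn 24 LG.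
Definition evG (q : zdisc) : zdisc := dfat (hor U2 q LG') eG.

Lemma scaled_bound (u : C) (U : Z) b : Cmod u <= b -> S2 * b <= IZR U -> Cmod (S2 * u) <= IZR U.
Proof.
  intros H1 H2. pose proof S2_pos. rewrite Cmod_mult, Cmod_R, Rabs_pos_eq by lra. nra.
Qed.

Lemma evA_ok d u : indisc d u -> Cmod u <= 5/6 -> indisc (evA d) (hyp al sg u).
Proof.
  intros Hd Hu. unfold evA. apply (dfat_ok _ _ (psum (hcoef al sg) u 25)).
  - pose proof (hor_ok U1 d u (hcoef al sg) Hd (scaled_bound u U1 _ Hu ltac:(unfold S2, U1; lra)) LA 0 LA_ok) as H.
    replace (psum (hcoef al sg) u 25) with (horC (hcoef al sg) 0 25 u); [exact H|].
    symmetry. etransitivity; [exact (psum_hor (hcoef al sg) u 25 0)|]. simpl psum; simpl Cpow. ring.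
  - eapply Rle_trans; [apply (hyp_tail al sg 24 u (lastnrm LA 24)); [exact hreg_al| |exact Hu]|].
    + apply lastnrm_ok; [exact LA_ok|vm_compute; lia].
    + apply (tailZ_ok _ 5 6 6 25 eA); [lia|vm_compute; reflexivity].
Qed.

Lemma evB_ok d u : indisc d u -> Cmod u <= 5/6 -> indisc (evB d) (hyp be sg u).
Proof.
  intros Hd Hu. unfold evB. apply (dfat_ok _ _ (psum (hcoef be sg) u 25)).
  - pose proof (hor_ok U1 d u (hcoef be sg) Hd (scaled_bound u U1 _ Hu ltac:(unfold S2, U1; lra)) LB 0 LB_ok) as H.
    replace (psum (hcoef be sg) u 25) with (horC (hcoef be sg) 0 25 u); [exact H|].
    symmetry. etransitivity; [exact (psum_hor (hcoef be sg) u 25 0)|]. simpl psum; simpl Cpow. ring.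
  - eapply Rle_trans; [apply (hyp_tail be sg 24 u (lastnrm LB 24)); [exact hreg_be| |exact Hu]|].
    + apply lastnrm_ok; [exact LB_ok|vm_compute; lia].
    + apply (tailZ_ok _ 5 6 6 25 eB); [lia|vm_compute; reflexivity].
Qed.

Lemma lok_firstn c l : forall k n, lok c k l -> lok c k (firstn n l).
Proof.
  induction l as [|a l IH]; intros k [|n] H; simpl in *; auto. destruct H; split; auto.
Qed.

Lemma evG_ok d q : indisc d q -> Cmod q <= 3/4 -> indisc (evG d) (gsol ga de q).
Proof.
  intros Hd Hu. unfold evG. apply (dfat_ok _ _ (psum (gcoef ga de) q 24)).
  - assert (HL : lok (gcoef ga de) 0 LG').
    { replace LG' with (firstn 24 LG) by (vm_compute; reflexivity). apply lok_firstn, LG_ok. }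
    pose proof (hor_ok U2 d q (gcoef ga de) Hd (scaled_bound q U2 _ Hu ltac:(unfold S2, U2; lra)) LG' 0 HL) as H.
    replace (psum (gcoef ga de) q 24) with (horC (gcoef ga de) 0 24 q); [exact H|].
    symmetry. etransitivity; [exact (psum_hor (gcoef ga de) q 24 0)|]. simpl psum; simpl Cpow. ring.
  - eapply Rle_trans; [apply (gsol_tail 24 q (Z.max (lastnrm LG 24) (lastnrm LG 25))); [| |exact Hu]|].
    + eapply Rle_trans; [apply (lastnrm_ok _ LG); [exact LG_ok|vm_compute; lia]|]. apply IZR_le. lia.
    + eapply Rle_trans; [apply (lastnrm_ok _ LG); [exact LG_ok|vm_compute; lia]|]. apply IZR_le. lia.
    + apply (tailZ_ok _ 3 4 4 24 eG); [lia|vm_compute; reflexivity].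
Qed.

(* Otherwise conversion unfolds disc arithmetic on symbolic arguments. *)
Strategy opaque [dmul dadd dsub dconj evA evB evG].

(** * Certified inequalities on the diameter and on the two half circles *)

(** [t] is a centre and [w] a half-width, in units of 2^(-20). Half-widths are rounded up, so that
    the two halves still cover the interval. *)
Fixpoint bisect (test : Z -> Z -> bool) (fuel : nat) (t w : Z) : bool :=
  if test t w then true else
  match fuel with
  | O => false
  | S f => let h := ((w + 1) / 2)%Z in (bisect test f (t - h) h && bisect test f (t + h) h)%bool
  end.

Lemma bisect_ok test (Q : R -> Prop) :
  (forall t w s, test t w = true -> Rabs (S2 * s - IZR t) <= IZR w -> Q s) ->
  forall fuel t w, bisect test fuel t w = true -> forall s, Rabs (S2 * s - IZR t) <= IZR w -> Q s.
Proof.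
  intros HT. induction fuel; intros t w H s Hs; simpl in H; destruct (test t w) eqn:E; try discriminate;
    try (exact (HT t w s E Hs)).
  apply andb_prop in H. destruct H as [H1 H2]. set (h := ((w + 1) / 2)%Z) in *.
  assert (Hh : (w <= 2 * h)%Z) by (unfold h; pose proof (Z_div_mod_eq_full (w + 1) 2); pose proof (Z.mod_pos_bound (w + 1) 2 eq_refl); lia).
  apply IZR_le in Hh. rewrite mult_IZR in Hh. apply Rabs_le_between in Hs.
  destruct (Rle_dec (S2 * s) (IZR t)) as [L|L].
  - apply (IHfuel _ _ H1). rewrite minus_IZR. apply Rabs_le. lra.
  - apply (IHfuel _ _ H2). rewrite plus_IZR. apply Rabs_le. lra.
Qed.

Lemma indisc_fst d u : indisc d u -> IZR (fst (fst d)) - IZR (snd d) <= S2 * fst u <= IZR (fst (fst d)) + IZR (snd d).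
Proof.
  unfold indisc, dr. intros H. pose proof (abs_fst_le_Cmod (S2 * u - dc d)) as A. simpl in A.
  replace (S2 * fst u - 0 * snd u + - IZR (fst (fst d))) with (S2 * fst u - IZR (fst (fst d))) in A by ring.
  assert (A' := Rle_trans _ _ _ A H). apply Rabs_le_between in A'. lra.
Qed.

Lemma indisc_snd d u : indisc d u -> IZR (snd (fst d)) - IZR (snd d) <= S2 * snd u <= IZR (snd (fst d)) + IZR (snd d).
Proof.
  unfold indisc, dr. intros H. pose proof (abs_snd_le_Cmod (S2 * u - dc d)) as A. simpl in A.
  replace (S2 * snd u + 0 * fst u + - IZR (snd (fst d))) with (S2 * snd u - IZR (snd (fst d))) in A by ring.
  assert (A' := Rle_trans _ _ _ A H). apply Rabs_le_between in A'. lra.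
Qed.

Lemma normsq_conj (u : C) : fst (u * Cconj u)%C = normsq u.
Proof. unfold normsq; simpl; ring. Qed.

Definition seg_u (t w : Z) : zdisc := (524288, 2 * t / 3, 2 * w / 3 + 3)%Z.

(** For m = a conj(D) and n = |D|^2 these signs put 2 a / D strictly inside the triangle 0, 2, - 2
    i. *)
Definition seg_signs (m n : zdisc) : bool :=
  let '(x, y, r) := m in
  let '(nx, ny, nr) := n in
  ((r <? x) && (y + r <? 0) && (x - y + 2 * r <? nx - nr))%Z%bool.

(** Here p = m / n is the position relative to the vertex 1. The signs put p below the antidiagonal
    and 1 + p in the right half-plane. Membership in the triangle cannot be asked: the lift along
    the left half circle ends above the real axis. Two half-planes still confine the angles at 1 and
    at 0. *)
Definition left_signs (m n : zdisc) : bool :=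
  let '(x, y, r) := m in
  let '(nx, ny, nr) := n in
  ((x + y + 2 * r <? 0) && (0 <? x - r + nx - nr) && (0 <? nx - nr))%Z%bool.

(** Again p = m / n is the position relative to 1: it lies below the diagonal, while p - 1, the
    position relative to 2, lies in the quarter plane |Im| < - Re. *)
Definition right_signs (m n : zdisc) : bool :=
  let '(x, y, r) := m in
  let '(nx, ny, nr) := n in
  ((y - x + 2 * r <? 0) && (x + y + 2 * r <? nx - nr) && (x - y + 2 * r <? nx - nr) && (0 <? nx - nr))%Z%bool.

Strategy opaque [seg_signs left_signs right_signs].

(** The quotient a / D is located from a conj(D) and |D|^2, so no disc has to be inverted. *)
Definition quotient_test (signs : zdisc -> zdisc -> bool) (a D : zdisc) : bool :=
  signs (dmul a (dconj D)) (dmul D (dconj D)).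

Definition seg_test (t w : Z) : bool :=
  let u := seg_u t w in
  let a := evA u in
  quotient_test seg_signs a (dadd a (evB (dconj u))).

Lemma seg_signs_ok m n um un : seg_signs m n = true -> indisc m um -> indisc n un ->
  0 < fst um /\ snd um < 0 /\ fst um - snd um < fst un.
Proof.
  intros Ht Hm Hn. pose proof S2_pos as Hp.
  apply indisc_fst in Hn. pose proof (indisc_fst _ _ Hm) as H1. pose proof (indisc_snd _ _ Hm) as H2.
  destruct m as [[x y] r], n as [[nx ny] nr]. cbn [seg_signs fst snd] in *.
  apply andb_prop in Ht; destruct Ht as [Ht T3]. apply andb_prop in Ht; destruct Ht as [T1 T2].
  apply Z.ltb_lt, IZR_lt in T1, T2, T3.
  repeat rewrite ?plus_IZR, ?minus_IZR, ?mult_IZR in *.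
  repeat split; apply Rmult_lt_reg_l with S2; try exact Hp; lra.
Qed.

Lemma left_signs_ok m n um un : left_signs m n = true -> indisc m um -> indisc n un ->
  fst um + snd um < 0 /\ 0 < fst um + fst un /\ 0 < fst un.
Proof.
  intros Ht Hm Hn. pose proof S2_pos as Hp.
  apply indisc_fst in Hn. pose proof (indisc_fst _ _ Hm) as H1. pose proof (indisc_snd _ _ Hm) as H2.
  destruct m as [[x y] r], n as [[nx ny] nr]. cbn [left_signs fst snd] in *.
  apply andb_prop in Ht; destruct Ht as [Ht T3]. apply andb_prop in Ht; destruct Ht as [T1 T2].
  apply Z.ltb_lt, IZR_lt in T1, T2, T3.
  repeat rewrite ?plus_IZR, ?minus_IZR, ?mult_IZR in *.
  repeat split; apply Rmult_lt_reg_l with S2; try exact Hp; lra.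
Qed.

Lemma right_signs_ok m n um un : right_signs m n = true -> indisc m um -> indisc n un ->
  snd um - fst um < 0 /\ fst um + snd um < fst un /\ fst um - snd um < fst un /\ 0 < fst un.
Proof.
  intros Ht Hm Hn. pose proof S2_pos as Hp.
  apply indisc_fst in Hn. pose proof (indisc_fst _ _ Hm) as H1. pose proof (indisc_snd _ _ Hm) as H2.
  destruct m as [[x y] r], n as [[nx ny] nr]. cbn [right_signs fst snd] in *.
  apply andb_prop in Ht; destruct Ht as [Ht T4]. apply andb_prop in Ht; destruct Ht as [Ht T3]. apply andb_prop in Ht; destruct Ht as [T1 T2].
  apply Z.ltb_lt, IZR_lt in T1, T2, T3, T4.
  repeat rewrite ?plus_IZR, ?minus_IZR, ?mult_IZR in *.
  repeat split; apply Rmult_lt_reg_l with S2; try exact Hp; lra.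
Qed.

(** For |s| <= 1, the vertical diameter of the circle |z - 1/2| = 2/3; its two ends have modulus
    exactly 5/6. *)
Definition seg_pt (s : R) : C := (1/2, 2/3 * s).

Lemma seg_pt_mod s : Rabs s <= 1 -> Cmod (seg_pt s) <= 5/6.
Proof.
  intros H. apply Rabs_le_between in H. apply normsq_le; [lra|]. unfold normsq, seg_pt; simpl. nra.
Qed.

Lemma seg_u_ok t w s : Rabs (S2 * s - IZR t) <= IZR w -> indisc (seg_u t w) (seg_pt s).
Proof.
  intros H. unfold seg_u. apply indisc_re; unfold seg_pt; cbn [fst snd]; [unfold S2; lra|].
  rewrite plus_IZR. pose proof (div_floor (2 * t) 3 eq_refl) as Ha. pose proof (div_floor (2 * w) 3 eq_refl) as Hb.
  rewrite mult_IZR in Ha, Hb. apply Rabs_le_between in H. apply Rabs_le. split; lra.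
Qed.

Definition seg_cond (s : R) : Prop :=
  let a := hyp al sg (seg_pt s) in
  let D := (a + hyp be sg (Cconj (seg_pt s)))%C in
  let m := (a * Cconj D)%C in
  0 < fst m /\ snd m < 0 /\ fst m - snd m < normsq D.

Lemma seg_test_ok t w s : seg_test t w = true -> Rabs (S2 * s - IZR t) <= IZR w ->
  Rabs s <= 1 -> seg_cond s.
Proof.
  intros Ht Hw Hs. pose proof (seg_u_ok t w s Hw) as Hu. pose proof (seg_pt_mod s Hs) as Hm.
  pose proof S2_pos as Hp. unfold seg_cond.
  pose proof (evA_ok _ _ Hu Hm) as HA.
  pose proof (evB_ok _ _ (dconj_ok _ _ Hu) ltac:(rewrite Cmod_conj; exact Hm)) as HB.
  pose proof (dadd_ok _ _ _ _ HA HB) as HD.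
  rewrite <- normsq_conj.
  exact (seg_signs_ok _ _ _ _ Ht (dmul_ok _ _ _ _ HA (dconj_ok _ _ HD)) (dmul_ok _ _ _ _ HD (dconj_ok _ _ HD))).
Qed.

Lemma seg_fact s : Rabs s <= 1 -> seg_cond s.
Proof.
  intros Hs. refine (bisect_ok seg_test (fun s => Rabs s <= 1 -> seg_cond s) _ 12 0 1048576 _ s _ Hs).
  - intros t w s0 H1 H2 H3. exact (seg_test_ok t w s0 H1 H2 H3).
  - vm_compute. reflexivity.
  - rewrite Rminus_0_r, Rabs_mult, (Rabs_pos_eq S2) by (unfold S2; lra). unfold S2. lra.
Qed.

Definition arc_e (t w : Z) : zdisc :=
  let d := (SC * SC + t * t)%Z in
  ((SC * SC - t * t) * SC / d, 2 * t * SC * SC / d, 2 * w + 3)%Z.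

(** A rational parametrisation of the unit circle, with |s| <= 1 giving its right half. It is
    2-Lipschitz because |1 - i s| >= 1, whence the radius [2 * w] in [arc_e]. *)
Definition arc_pt (s : R) : C := ((1 + Ci * s) / (1 - Ci * s))%C.

Lemma arc_den (s : R) : (1 - Ci * s <> 0)%C.
Proof.
  intros E. apply (f_equal fst) in E. simpl in E.
  replace (1 + - (0 * s - 1 * 0)) with 1 in E by ring. lra.
Qed.

Lemma Cmod_arc_den (s : R) : 1 <= Cmod (1 - Ci * s).
Proof.
  eapply Rle_trans; [|apply abs_fst_le_Cmod]. simpl.
  replace (1 + - (0 * s - 1 * 0)) with 1 by ring. rewrite Rabs_R1; lra.
Qed.

Lemma arc_e_ok t w s : Rabs (S2 * s - IZR t) <= IZR w -> indisc (arc_e t w) (arc_pt s).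
Proof.
  intros H. pose proof S2_pos as Hp. set (t0 := IZR t / S2).
  assert (E0 : (S2 * arc_pt t0 = (IZR ((SC * SC - t * t) * SC) / IZR (SC * SC + t * t), IZR (2 * t * SC * SC) / IZR (SC * SC + t * t))%R)%C).
  { unfold arc_pt, t0. rewrite !mult_IZR, minus_IZR, plus_IZR, !mult_IZR, <- S2_SC.
    assert (0 < S2 * S2 + IZR t * IZR t) by nra.
    replace ((1 + Ci * (IZR t / S2)) / (1 - Ci * (IZR t / S2)))%C with
      ((S2 * S2 - IZR t * IZR t) / (S2 * S2 + IZR t * IZR t), 2 * IZR t * S2 / (S2 * S2 + IZR t * IZR t))%R.
    - apply C_eq; simpl; field; lra.
    - symmetry. rewrite <- RtoC_div by lra. apply C_eq; simpl; field; split; nra. }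
  assert (Hd : (0 < SC * SC + t * t)%Z) by (unfold SC; nia).
  pose proof (round_pair ((SC * SC - t * t) * SC) (2 * t * SC * SC) _ Hd) as HR.
  unfold indisc, arc_e, dr, dc. cbv zeta. cbn [fst snd].
  rewrite <- E0 in HR.
  match goal with |- Cmod (_ - ?p) <= _ => set (c := p) in * end.
  replace (S2 * arc_pt s - c)%C with ((S2 * arc_pt t0 - c) + S2 * (arc_pt s - arc_pt t0))%C by ring.
  eapply Rle_trans; [apply Cmod_triangle|].
  assert (E1 : (arc_pt s - arc_pt t0 = 2 * Ci * (s - t0)%R / ((1 - Ci * s) * (1 - Ci * t0)))%C).
  { unfold arc_pt. rewrite RtoC_minus. field. split; apply arc_den. }
  assert (H1 : Cmod (arc_pt s - arc_pt t0) <= 2 * Rabs (s - t0)).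
  { rewrite E1. pose proof (Cmod_arc_den s). pose proof (Cmod_arc_den t0).
    rewrite Cmod_div by (apply Cmult_neq_0; apply arc_den).
    rewrite !Cmod_mult, !Cmod_R, Rabs_pos_eq by lra.
    assert (Ei : Cmod Ci = 1) by (rewrite Cmod_normsq; unfold normsq; simpl; replace (0*0+1*1) with 1 by ring; apply sqrt_1).
    rewrite Ei. pose proof (Rabs_pos (s - t0)).
    apply Rle_div_l; [nra|]. assert (1 <= Cmod (1 - Ci * s) * Cmod (1 - Ci * t0)) by nra. nra. }
  rewrite plus_IZR, mult_IZR, (Cmod_mult S2), Cmod_R, Rabs_pos_eq by lra.
  assert (H2 : S2 * Rabs (s - t0) <= IZR w).
  { rewrite <- (Rabs_pos_eq S2) by lra. rewrite <- Rabs_mult.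
    replace (S2 * (s - t0)) with (S2 * s - IZR t) by (unfold t0; field; lra). exact H. }
  nra.
Qed.

Definition dscale (p q : Z) (d : zdisc) : zdisc :=
  (p * fst (fst d) / q, p * snd (fst d) / q, Z.abs p * snd d / q + 3)%Z.

Lemma dscale_ok p q d u : (0 < q)%Z -> indisc d u -> indisc (dscale p q d) ((IZR p / IZR q)%R * u)%C.
Proof.
  intros Hq H. unfold indisc, dscale, dr. cbn [snd]. rewrite plus_IZR.
  assert (Hq' : 0 < IZR q) by (apply IZR_lt; exact Hq).
  pose proof (round_pair (p * fst (fst d)) (p * snd (fst d)) q Hq) as HR.
  unfold dc at 1; cbn [fst snd].
  match type of HR with Cmod (?a - ?b) <= _ => set (A := a) in *; set (B := b) in * end.
  replace (S2 * ((IZR p / IZR q)%R * u) - B)%C with ((IZR p / IZR q)%R * (S2 * u - dc d) + (A - B))%C.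
  - eapply Rle_trans; [apply Cmod_triangle|]. rewrite Cmod_mult, Cmod_R.
    pose proof (div_floor (Z.abs p * snd d) q Hq) as Hf. rewrite mult_IZR, abs_IZR in Hf.
    unfold Rdiv in *. rewrite Rabs_mult, (Rabs_pos_eq (/ IZR q)) by (left; apply Rinv_0_lt_compat; exact Hq').
    unfold indisc, dr in H. pose proof (Rabs_pos (IZR p)).
    assert (Rabs (IZR p) * / IZR q * Cmod (S2 * u - dc d) <= Rabs (IZR p) * IZR (snd d) * / IZR q).
    { rewrite (Rmult_assoc _ (/ IZR q)), (Rmult_comm (/ IZR q)), <- Rmult_assoc.
      apply Rmult_le_compat_r; [left; apply Rinv_0_lt_compat; exact Hq'|]. apply Rmult_le_compat_l; assumption. }
    lra.
  - assert (EA : A = ((IZR p / IZR q)%R * dc d)%C).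
    { unfold A, dc. rewrite !mult_IZR. apply C_eq; simpl; field; lra. }
    rewrite EA. ring.
Qed.

Strategy opaque [dscale].

Definition dhalf : zdisc := (524288, 0, 0)%Z.
Lemma dhalf_ok : indisc dhalf (1/2)%R.
Proof.
  apply indisc_re; simpl; unfold S2; [lra|]. rewrite Rmult_0_r, Rminus_0_r, Rabs_R0. lra.
Qed.

(* Both arcs are parametrised by a unit vector [e] in the right half-plane;
   [1/2 - 2/3 e] is [z] on the left arc and [1 - z] on the right one. *)
Definition arc_z (e : C) : C := ((1/2)%R - (2/3)%R * e)%C.

Definition left_test (t w : Z) : bool :=
  let e := arc_e t w in
  let q := dscale 3 4 (dconj e) in
  let a := evA (dsub dhalf (dscale 2 3 e)) in
  let M := dmul q (evG q) in
  quotient_test left_signs M (dsub a M).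

Definition right_test (t w : Z) : bool :=
  let e := arc_e t w in
  let q := dscale (-3) 4 (dconj e) in
  let b := evB (dsub dhalf (dscale 2 3 e)) in
  let M := dmul q (evG q) in
  quotient_test right_signs M (dadd M b).

Definition left_cond (e : C) : Prop :=
  let q := ((3/4)%R * Cconj e)%C in
  let M := (q * gsol ga de q)%C in
  let D := (hyp al sg (arc_z e) - M)%C in
  let m := (M * Cconj D)%C in
  fst m + snd m < 0 /\ 0 < fst m + normsq D /\ 0 < normsq D.

Definition right_cond (e : C) : Prop :=
  let q := ((-3/4)%R * Cconj e)%C in
  let M := (q * gsol ga de q)%C in
  let D := (M + hyp be sg (arc_z e))%C in
  let m := (M * Cconj D)%C in
  snd m - fst m < 0 /\ fst m + snd m < normsq D /\ fst m - snd m < normsq D /\ 0 < normsq D.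

Lemma arc_z_mod e : Cmod e = 1 -> 0 <= fst e -> Cmod (arc_z e) <= 5/6.
Proof.
  intros He Hf. apply normsq_le; [lra|].
  assert (normsq e = 1) by (rewrite <- Cmod_sqr, He; ring).
  unfold normsq, arc_z in *; simpl. nra.
Qed.

Lemma arc_q_mod (c : R) e : Cmod e = 1 -> Rabs c = 3/4 -> Cmod (c * Cconj e) <= 3/4.
Proof. intros He Hc. rewrite Cmod_mult, Cmod_R, Cmod_conj, He, Hc. lra. Qed.

Lemma left_test_ok t w e : left_test t w = true -> indisc (arc_e t w) e -> Cmod e = 1 -> 0 <= fst e -> left_cond e.
Proof.
  intros Ht He Hm Hf. pose proof S2_pos as Hp.
  pose proof (dscale_ok 3 4 _ _ eq_refl (dconj_ok _ _ He)) as Hq.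
  pose proof (evA_ok _ _ (dsub_ok _ _ _ _ dhalf_ok (dscale_ok 2 3 _ _ eq_refl He)) (arc_z_mod e Hm Hf)) as HA.
  pose proof (evG_ok _ _ Hq (arc_q_mod (3/4) e Hm ltac:(apply Rabs_pos_eq; lra))) as HG.
  pose proof (dmul_ok _ _ _ _ Hq HG) as HM.
  pose proof (dsub_ok _ _ _ _ HA HM) as HD.
  unfold left_cond. cbv zeta. rewrite <- normsq_conj.
  exact (left_signs_ok _ _ _ _ Ht (dmul_ok _ _ _ _ HM (dconj_ok _ _ HD)) (dmul_ok _ _ _ _ HD (dconj_ok _ _ HD))).
Qed.

Lemma right_test_ok t w e : right_test t w = true -> indisc (arc_e t w) e -> Cmod e = 1 -> 0 <= fst e -> right_cond e.
Proof.
  intros Ht He Hm Hf. pose proof S2_pos as Hp.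
  pose proof (dscale_ok (-3) 4 _ _ eq_refl (dconj_ok _ _ He)) as Hq.
  pose proof (evB_ok _ _ (dsub_ok _ _ _ _ dhalf_ok (dscale_ok 2 3 _ _ eq_refl He)) (arc_z_mod e Hm Hf)) as HA.
  pose proof (evG_ok _ _ Hq (arc_q_mod (-3/4) e Hm ltac:(rewrite Rabs_left; lra))) as HG.
  pose proof (dmul_ok _ _ _ _ Hq HG) as HM.
  pose proof (dadd_ok _ _ _ _ HM HA) as HD.
  unfold right_cond. cbv zeta. rewrite <- normsq_conj.
  exact (right_signs_ok _ _ _ _ Ht (dmul_ok _ _ _ _ HM (dconj_ok _ _ HD)) (dmul_ok _ _ _ _ HD (dconj_ok _ _ HD))).
Qed.

Lemma arc_pt_param e : Cmod e = 1 -> 0 <= fst e -> exists s, Rabs s <= 1 /\ e = arc_pt s.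
Proof.
  intros He Hf. assert (Hn : normsq e = 1) by (rewrite <- Cmod_sqr, He; ring).
  destruct e as [c s]; unfold normsq in Hn; simpl in *.
  (* The tangent of half the argument; c >= 0 makes its modulus at most 1. *)
  exists (s / (1 + c)). split.
  - unfold Rdiv. rewrite Rabs_mult, (Rabs_pos_eq (/ (1 + c))) by (left; apply Rinv_0_lt_compat; lra).
    apply Rle_div_l; [lra|]. apply Rabs_le. nra.
  - assert (H1 : 1 + c <> 0) by lra. assert (H2 : s * s = 1 - c * c) by lra.
    assert (E : (arc_pt (s / (1 + c)) * ((1 + c) - Ci * s) = (1 + c) + Ci * s)%C).
    { unfold arc_pt. rewrite RtoC_div by exact H1. rewrite RtoC_plus. field.
      split.
      - neq0.
      - neq0. }
    assert (E2 : ((c, s) * ((1 + c) - Ci * s) = (1 + c) + Ci * s)%C).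
    { apply C_eq; simpl; nra. }
    assert (Hd : ((1 + c) - Ci * s <> 0)%C).
    { neq0. }
    rewrite <- E2 in E.
    assert (E3 : ((arc_pt (s / (1 + c)) - (c, s)) * ((1 + c) - Ci * s) = 0)%C).
    { transitivity (arc_pt (s / (1 + c)) * ((1 + c) - Ci * s) - (c, s) * ((1 + c) - Ci * s))%C; [ring|]. rewrite E. ring. }
    destruct (Ceq_dec (arc_pt (s / (1 + c)) - (c, s)) 0) as [E4|E4].
    + replace (arc_pt (s / (1 + c))) with ((arc_pt (s / (1 + c)) - (c, s)) + (c, s))%C by ring.
      rewrite E4. apply C_eq; simpl; ring.
    + exfalso. exact (Cmult_neq_0 _ _ E4 Hd E3).
Qed.

Lemma left_fact e : Cmod e = 1 -> 0 <= fst e -> left_cond e.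
Proof.
  intros He Hf. destruct (arc_pt_param e He Hf) as (s & Hs & ->).
  refine (bisect_ok left_test (fun s => Cmod (arc_pt s) = 1 -> 0 <= fst (arc_pt s) -> left_cond (arc_pt s)) _ 12 0 1048576 _ s _ He Hf).
  - intros t w s0 H1 H2 H3 H4. exact (left_test_ok t w _ H1 (arc_e_ok t w s0 H2) H3 H4).
  - vm_compute. reflexivity.
  - rewrite Rminus_0_r, Rabs_mult, (Rabs_pos_eq S2) by (unfold S2; lra). unfold S2. lra.
Qed.

Lemma right_fact e : Cmod e = 1 -> 0 <= fst e -> right_cond e.
Proof.
  intros He Hf. destruct (arc_pt_param e He Hf) as (s & Hs & ->).
  refine (bisect_ok right_test (fun s => Cmod (arc_pt s) = 1 -> 0 <= fst (arc_pt s) -> right_cond (arc_pt s)) _ 12 0 1048576 _ s _ He Hf).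
  - intros t w s0 H1 H2 H3 H4. exact (right_test_ok t w _ H1 (arc_e_ok t w s0 H2) H3 H4).
  - vm_compute. reflexivity.
  - rewrite Rminus_0_r, Rabs_mult, (Rabs_pos_eq S2) by (unfold S2; lra). unfold S2. lra.
Qed.

(** * The normalised series stay within distance 1 of 1 *)

(** A Horner scheme on moduli: it bounds the sum for all |u| <= p / q at once, so no subdivision of
    the disc is needed. *)
Fixpoint habs (p q : Z) (l : list zdisc) : Z :=
  match l with
  | [] => 0%Z
  | d :: l' => (l1n d + snd d + (p * habs p q l' / q + 1))%Z
  end.

Lemma habs_nonneg p q c k l : (0 <= p)%Z -> (0 < q)%Z -> lok c k l -> (0 <= habs p q l)%Z.
Proof.
  intros Hp Hq. revert k. induction l as [|d l IH]; intros k Hl; simpl; [lia|].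
  destruct Hl as [Hd Hl]. specialize (IH _ Hl). pose proof (indisc_radius _ _ Hd).
  assert (0 <= p * habs p q l / q)%Z by (apply Z.div_pos; nia).
  unfold l1n. lia.
Qed.

Lemma habs_ok p q c u : (0 <= p)%Z -> (0 < q)%Z -> Cmod u <= IZR p / IZR q ->
  forall l k, lok c k l -> S2 * Cmod (horC c k (length l) u) <= IZR (habs p q l).
Proof.
  intros Hp Hq Hu. assert (Hq' : 0 < IZR q) by (apply IZR_lt; exact Hq). pose proof S2_pos as Hs.
  induction l as [|d l IH]; intros k Hl; simpl.
  - rewrite Cmod_0. lra.
  - destruct Hl as [Hd Hl]. pose proof (habs_nonneg p q _ _ _ Hp Hq Hl) as Hn. specialize (IH _ Hl).
    rewrite !plus_IZR. apply indisc_bound in Hd. rewrite Cmod_mult, Cmod_R, Rabs_pos_eq, plus_IZR in Hd by lra.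
    pose proof (div_floor (p * habs p q l) q Hq) as Hf. rewrite mult_IZR in Hf.
    apply Rle_trans with (S2 * (Cmod (c k) + Cmod (u * horC c (S k) (length l) u))).
    + apply Rmult_le_compat_l; [lra|apply Cmod_triangle].
    + rewrite Cmod_mult. pose proof (Cmod_ge_0 u). pose proof (Cmod_ge_0 (horC c (S k) (length l) u)).
      assert (Cmod u * (S2 * Cmod (horC c (S k) (length l) u)) <= IZR p / IZR q * IZR (habs p q l)).
      { apply Rmult_le_compat; try assumption. nra. }
      replace (IZR p / IZR q * IZR (habs p q l)) with (IZR p * IZR (habs p q l) / IZR q) in * by (field; lra). lra.
Qed.

Lemma lok_scale a da c l : indisc da a -> forall k, lok c k l -> lok (fun n => a * c n)%C k (map (dmul da) l).
Proof.
  intros Ha. induction l as [|d l IH]; intros k Hl; simpl; [exact Logic.I|].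
  destruct Hl; split; [apply dmul_ok; assumption|auto].
Qed.

Lemma horC_scale a c u n : forall k, horC (fun i => a * c i)%C k n u = (a * horC c k n u)%C.
Proof. induction n; intros k; simpl; [ring|rewrite IHn; ring]. Qed.

(* The constant term dominates: [|a c(u) - 1| < 1] when the remaining terms are small. *)
Lemma series_near_one (a : C) da (c : nat -> C) (l : list zdisc) p q N (H : C) (e : Z) u :
  indisc da a -> (a * c 0%nat = 1)%C -> lok c 0 l -> length l = S N -> (0 <= p)%Z -> (0 < q)%Z ->
  Cmod u <= IZR p / IZR q -> S2 * Cmod (H - psum c u (S N)) <= IZR e ->
  ((l1n da + snd da) * e / SC + 1 + (p * habs p q (map (dmul da) (tl l)) / q + 1) <? SC)%Z = true ->
  Cmod (a * H - 1) < 1.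
Proof.
  intros Ha Hc Hl HN Hp Hq Hu He Hb. pose proof S2_pos as Hs.
  destruct l as [|d0 l]; [discriminate|]. simpl in HN. injection HN as HN. destruct Hl as [Hd0 Hl]. simpl tl in Hb.
  apply Z.ltb_lt, IZR_lt in Hb. rewrite !plus_IZR in Hb.
  assert (Hq' : 0 < IZR q) by (apply IZR_lt; exact Hq).
  pose proof (lok_scale a da c l Ha 1 Hl) as Hl'.
  pose proof (habs_ok p q _ u Hp Hq Hu _ _ Hl') as Hh. rewrite length_map, HN, horC_scale in Hh.
  pose proof (habs_nonneg p q _ _ _ Hp Hq Hl') as Hn.
  set (X := habs p q (map (dmul da) l)) in *.
  pose proof (div_floor (p * X) q Hq) as Hf1. rewrite mult_IZR in Hf1.
  pose proof (div_floor ((l1n da + snd da) * e) SC eq_refl) as Hf2. rewrite mult_IZR in Hf2.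
  assert (E : psum c u (S N) = (c 0%nat + u * horC c 1 N u)%C).
  { pose proof (psum_hor c u (S N) 0) as E. simpl in E |- *. rewrite E. ring. }
  assert (E2 : (a * H - 1 = a * (H - psum c u (S N)) + u * (a * horC c 1 N u))%C).
  { rewrite E. transitivity (a * (H - (c 0%nat + u * horC c 1 N u)) + u * (a * horC c 1 N u) + (a * c 0%nat - 1))%C; [ring|].
    rewrite Hc. ring. }
  apply Rmult_lt_reg_l with S2; [exact Hs|]. rewrite Rmult_1_r. rewrite <- S2_SC in *.
  rewrite E2. eapply Rle_lt_trans; [apply Rmult_le_compat_l; [lra|apply Cmod_triangle]|].
  apply indisc_bound in Ha. rewrite Cmod_mult, Cmod_R, Rabs_pos_eq in Ha by lra.
  rewrite (Cmod_mult a (H - _)), (Cmod_mult u).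
  set (T1 := Cmod (H - psum c u (S N))) in *. set (T2 := Cmod (a * horC c 1 N u)) in *.
  assert (0 <= T1) by apply Cmod_ge_0. assert (0 <= T2) by apply Cmod_ge_0.
  pose proof (Cmod_ge_0 u). pose proof (Cmod_ge_0 a).
  assert (B1 : S2 * (Cmod a * T1) <= IZR (l1n da + snd da) * IZR e / S2).
  { apply Rmult_le_reg_r with S2; [exact Hs|]. replace (IZR (l1n da + snd da) * IZR e / S2 * S2) with (IZR (l1n da + snd da) * IZR e) by (field; lra).
    replace (S2 * (Cmod a * T1) * S2) with ((S2 * Cmod a) * (S2 * T1)) by ring.
    apply Rmult_le_compat; try assumption; nra. }
  assert (B2 : S2 * (Cmod u * T2) <= IZR p * IZR X / IZR q).
  { replace (IZR p * IZR X / IZR q) with (IZR p / IZR q * IZR X) by (field; lra).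
    replace (S2 * (Cmod u * T2)) with (Cmod u * (S2 * T2)) by ring.
    apply Rmult_le_compat; try assumption; nra. }
  lra.
Qed.

Lemma Cmod_lt1_fst (w : C) : Cmod (w - 1) < 1 -> 0 < fst w.
Proof.
  intros H. pose proof (abs_fst_le_Cmod (w - 1)) as A. simpl in A.
  assert (B := Rle_lt_trans _ _ _ A H). apply Rabs_lt_between in B. lra.
Qed.

Lemma hA_near u : Cmod u <= 5/6 -> Cmod (al * hyp al sg u - 1) < 1.
Proof.
  intros Hu.
  apply (series_near_one al dal (hcoef al sg) LA 5 6 24 (hyp al sg u) eA u); try lia; try exact Hu.
  - exact dal_ok.
  - simpl. field. exact (hreg_neq0 _ _ hreg_al).
  - exact LA_ok.
  - reflexivity.
  - eapply Rle_trans; [apply (hyp_tail al sg 24 u (lastnrm LA 24)); [exact hreg_al| |exact Hu]|].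
    + apply lastnrm_ok; [exact LA_ok|vm_compute; lia].
    + apply (tailZ_ok _ 5 6 6 25 eA); [lia|vm_compute; reflexivity].
  - vm_compute. reflexivity.
Qed.

Lemma hB_near u : Cmod u <= 5/6 -> Cmod (be * hyp be sg u - 1) < 1.
Proof.
  intros Hu.
  apply (series_near_one be dbe (hcoef be sg) LB 5 6 24 (hyp be sg u) eB u); try lia; try exact Hu.
  - exact dbe_ok.
  - simpl. field. exact (hreg_neq0 _ _ hreg_be).
  - exact LB_ok.
  - reflexivity.
  - eapply Rle_trans; [apply (hyp_tail be sg 24 u (lastnrm LB 24)); [exact hreg_be| |exact Hu]|].
    + apply lastnrm_ok; [exact LB_ok|vm_compute; lia].
    + apply (tailZ_ok _ 5 6 6 25 eB); [lia|vm_compute; reflexivity].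
  - vm_compute. reflexivity.
Qed.

Definition dmg : zdisc := (-327680, -28920, 14)%Z.

Lemma dmg_ok : indisc dmg (- (ga / 2))%C.
Proof. pose proof lam_bounds. apply indisc_re; unfold S2; simpl; [lra|apply Rabs_le; lra]. Qed.

Lemma hM_near q : Cmod q <= 3/4 -> Cmod (- (ga / 2) * gsol ga de q - 1) < 1.
Proof.
  intros Hu.
  apply (series_near_one (- (ga / 2))%C dmg (gcoef ga de) LG' 3 4 23 (gsol ga de q) eG q); try lia; try exact Hu.
  - exact dmg_ok.
  - change (gcoef ga de 0) with (- (2 / ga))%C. field. exact (greg_neq0 _ _ greg_ga).
  - replace LG' with (firstn 24 LG) by (vm_compute; reflexivity). apply lok_firstn, LG_ok.
  - reflexivity.
  - eapply Rle_trans; [apply (gsol_tail 24 q (Z.max (lastnrm LG 24) (lastnrm LG 25))); [| |exact Hu]|].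
    + eapply Rle_trans; [apply (lastnrm_ok _ LG); [exact LG_ok|vm_compute; lia]|]. apply IZR_le. lia.
    + eapply Rle_trans; [apply (lastnrm_ok _ LG); [exact LG_ok|vm_compute; lia]|]. apply IZR_le. lia.
    + apply (tailZ_ok _ 3 4 4 24 eG); [lia|vm_compute; reflexivity].
  - vm_compute. reflexivity.
Qed.

Lemma hA_pos u : Cmod u <= 5/6 -> 0 < fst (al * hyp al sg u)%C.
Proof. intros Hu. apply Cmod_lt1_fst, hA_near, Hu. Qed.
Lemma hB_pos u : Cmod u <= 5/6 -> 0 < fst (be * hyp be sg u)%C.
Proof. intros Hu. apply Cmod_lt1_fst, hB_near, Hu. Qed.
Lemma hM_pos q : Cmod q <= 3/4 -> 0 < fst (- (ga / 2) * gsol ga de q)%C.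
Proof. intros Hu. apply Cmod_lt1_fst, hM_near, Hu. Qed.

(** * Connection constants *)

(** Branches of al log z + be log (1 - z) in which the logarithm of the local coordinate is free and
    the rest is principal. At infinity the free one is [xi], a logarithm of 1 - 2 z, and the
    formulas come from z = - (1 - 2 z)(1 - q) / 2 and 1 - z = (1 - 2 z)(1 + q) / 2. *)
Definition PA (l z : C) : C := (al * l + be * clog (1 - z))%C.
Definition PB (l z : C) : C := (al * clog z + be * l)%C.
Definition lM0 (xi z : C) : C := (xi + Ci * PI - ln 2 + clog (1 - qM z))%C.
Definition lM1 (xi z : C) : C := (xi - ln 2 + clog (1 + qM z))%C.
Definition PM (xi z : C) : C := (al * lM0 xi z + be * lM1 xi z)%C.

(* Branches of [log (1 - 2 z)] on the two arcs of [|1 - 2 z| = 4/3]. *)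
Definition xiL (z : C) : C := (clog (1 - z) - clog (1 + qM z) + ln 2)%C.
Definition xiR (z : C) : C := (clog z - clog (1 - qM z) + ln 2 - Ci * PI)%C.

Lemma lM1_xiL z : lM1 (xiL z) z = clog (1 - z).
Proof. unfold lM1, xiL. ring. Qed.
Lemma lM0_xiR z : lM0 (xiR z) z = clog z.
Proof. unfold lM0, xiR. ring. Qed.

Lemma fst_pos_neq0 (u : C) : 0 < fst u -> u <> 0%C.
Proof. intros H E. rewrite E in H. simpl in H. lra. Qed.

Lemma lt1_pos (q : C) : Cmod q < 1 -> 0 < fst (1 - q)%C /\ 0 < fst (1 + q)%C.
Proof.
  intros H. pose proof (abs_fst_le_Cmod q) as A. assert (B := Rle_lt_trans _ _ _ A H).
  apply Rabs_lt_between in B. simpl. lra.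
Qed.

Lemma cexp_ln (x : R) : 0 < x -> cexp (ln x) = x.
Proof.
  intros H. unfold cexp; apply C_eq; simpl; rewrite ?cos_0, ?sin_0, exp_ln by exact H; ring.
Qed.

Lemma cexp_iPI : cexp (Ci * PI)%C = (- (1))%C.
Proof.
  unfold cexp; apply C_eq; simpl.
  - replace (0 * PI - 1 * 0) with 0 by ring. replace (0 * 0 + 1 * PI) with PI by ring.
    rewrite cos_PI, exp_0. ring.
  - replace (0 * PI - 1 * 0) with 0 by ring. replace (0 * 0 + 1 * PI) with PI by ring.
    rewrite sin_PI, exp_0. ring.
Qed.

Lemma cexp_lM0 xi z : cexp xi = (1 - 2 * z)%C -> Cmod (qM z) < 1 -> (1 - 2 * z <> 0)%C -> cexp (lM0 xi z) = z.
Proof.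
  intros H Hq Hn. unfold lM0. destruct (lt1_pos _ Hq) as [H1 _].
  unfold Cminus at 1. rewrite !cexp_plus, cexp_opp_inv, cexp_iPI, H, cexp_ln, cexp_clog by (exact H1 || lra).
  unfold qM. field. exact Hn.
Qed.

Lemma cexp_lM1 xi z : cexp xi = (1 - 2 * z)%C -> Cmod (qM z) < 1 -> (1 - 2 * z <> 0)%C -> cexp (lM1 xi z) = (1 - z)%C.
Proof.
  intros H Hq Hn. unfold lM1. destruct (lt1_pos _ Hq) as [_ H1].
  unfold Cminus at 1. rewrite !cexp_plus, cexp_opp_inv, H, cexp_ln, cexp_clog by (exact H1 || lra).
  unfold qM. field. exact Hn.
Qed.

Lemma cexp_xiL z : 0 < fst (1 - z)%C -> Cmod (qM z) < 1 -> (1 - 2 * z <> 0)%C -> cexp (xiL z) = (1 - 2 * z)%C.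
Proof.
  intros H Hq Hn. unfold xiL. destruct (lt1_pos _ Hq) as [_ H1].
  pose proof (fst_pos_neq0 _ H1) as Hn1.
  unfold Cminus at 1. rewrite !cexp_plus, cexp_opp_inv, cexp_ln, !cexp_clog by (exact H || exact H1 || lra).
  assert (E : (1 + qM z = 2 * (1 - z) / (1 - 2 * z))%C) by (unfold qM; field; exact Hn).
  pose proof (fst_pos_neq0 _ H).
  rewrite E. field. split; assumption.
Qed.

Lemma cexp_xiR z : 0 < fst z -> Cmod (qM z) < 1 -> (1 - 2 * z <> 0)%C -> cexp (xiR z) = (1 - 2 * z)%C.
Proof.
  intros H Hq Hn. unfold xiR. destruct (lt1_pos _ Hq) as [H1 _].
  pose proof (fst_pos_neq0 _ H1) as Hn1. pose proof (fst_pos_neq0 _ H) as Hz.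
  unfold Cminus at 1. rewrite !cexp_plus, cexp_opp_inv, cexp_iPI. unfold Cminus at 1.
  rewrite !cexp_plus, cexp_opp_inv, cexp_ln, !cexp_clog by (exact H || exact H1 || lra).
  assert (E : (1 - qM z = - (2) * z / (1 - 2 * z))%C) by (unfold qM; field; exact Hn).
  rewrite E. field. repeat split; assumption.
Qed.

Lemma cder_qM (z : R -> C) t dz : cder z t dz -> (1 - 2 * z t <> 0)%C ->
  cder (fun s => qM (z s)) t (2 * dz * qM (z t) * qM (z t))%C.
Proof.
  intros Hz H2. unfold qM. eapply cder_eq'; [|apply cder_inv; [|exact H2]].
  2:{ apply cder_minus; [apply cder_const|apply cder_scal; exact Hz]. }
  cbv beta. field. exact H2.
Qed.

Lemma cder_PA (l z : R -> C) t dz : z t <> 0%C -> 0 < fst (1 - z t)%C -> cder z t dz -> cder l t (dz / z t)%C ->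
  cder (fun s => PA (l s) (z s)) t (dP (z t) dz).
Proof.
  intros H0 H1 Hz Hl. unfold PA, dP. pose proof (fst_pos_neq0 _ H1).
  eapply cder_eq'.
  2:{ apply cder_plus; [apply cder_scal; exact Hl|apply cder_scal].
      apply cder_clog; [|exact H1]. apply cder_minus; [apply cder_const|exact Hz]. }
  cbv beta. field. split; assumption.
Qed.

Lemma cder_PB (l z : R -> C) t dz : (1 - z t <> 0)%C -> 0 < fst (z t) -> cder z t dz -> cder l t (- dz / (1 - z t))%C ->
  cder (fun s => PB (l s) (z s)) t (dP (z t) dz).
Proof.
  intros H0 H1 Hz Hl. unfold PB, dP. pose proof (fst_pos_neq0 _ H1).
  eapply cder_eq'.
  2:{ apply cder_plus; apply cder_scal; [|exact Hl]. apply cder_clog; [exact Hz|exact H1]. }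
  cbv beta. field. split; assumption.
Qed.

Lemma qM_rel z : (1 - 2 * z <> 0)%C -> z <> 0%C -> (1 - z <> 0)%C ->
  let q := qM z in q <> 0%C /\ (1 - q <> 0)%C /\ (1 + q <> 0)%C /\ z = ((q - 1) / (2 * q))%C.
Proof.
  intros Hn H0 H1 q.
  assert (E2 : RtoC 2 <> 0%C) by (intros E'; injection E'; lra).
  assert (Hq : q <> 0%C).
  { intros E. assert (E1 : (q * (1 - 2 * z) = 1)%C) by (unfold q, qM; field; exact Hn).
    rewrite E in E1. apply (f_equal fst) in E1. simpl in E1. lra. }
  assert (A : (1 - q = - (2) * z * q)%C) by (unfold q, qM; field; exact Hn).
  assert (B : (1 + q = 2 * (1 - z) * q)%C) by (unfold q, qM; field; exact Hn).
  repeat split.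
  - exact Hq.
  - rewrite A. repeat apply Cmult_neq_0; try assumption. intros E'. apply (f_equal fst) in E'; simpl in E'; lra.
  - rewrite B. repeat apply Cmult_neq_0; assumption.
  - unfold q, qM. field. first [assumption | split; assumption].
Qed.

Lemma cder_lM0 (xi z : R -> C) t dz : (1 - 2 * z t <> 0)%C -> z t <> 0%C -> (1 - z t <> 0)%C -> Cmod (qM (z t)) < 1 ->
  cder z t dz -> cder xi t (- (2) * dz * qM (z t))%C ->
  cder (fun s => lM0 (xi s) (z s)) t (dz / z t)%C.
Proof.
  intros Hn H0 H1 Hq Hz Hxi. destruct (lt1_pos _ Hq) as [Ha Hb].
  pose proof (cder_qM z t dz Hz Hn) as Hdq.
  assert (Hc1 : cder (fun s => clog (1 - qM (z s))%C) t ((0 - 2 * dz * qM (z t) * qM (z t)) / (1 - qM (z t)))%C).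
  { apply (cder_clog (fun s => 1 - qM (z s))%C); [|exact Ha]. apply cder_minus; [apply cder_const|exact Hdq]. }
  unfold lM0. eapply cder_eq'.
  2:{ apply cder_plus; [|exact Hc1]. apply cder_minus; [apply cder_plus; [exact Hxi|apply cder_const]|apply cder_const]. }
  destruct (qM_rel (z t) Hn H0 H1) as (Q0 & Q1 & Q2 & Qz). set (q := qM (z t)) in *.
  cbv beta. rewrite Qz. field.
  assert (Q1' : (q - 1 <> 0)%C).
  { intros E. apply Q1. replace (1 - q)%C with (- (q - 1))%C by ring. rewrite E. ring. }
  repeat split; try assumption.
Qed.

Lemma cder_lM1 (xi z : R -> C) t dz : (1 - 2 * z t <> 0)%C -> z t <> 0%C -> (1 - z t <> 0)%C -> Cmod (qM (z t)) < 1 ->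
  cder z t dz -> cder xi t (- (2) * dz * qM (z t))%C ->
  cder (fun s => lM1 (xi s) (z s)) t (- dz / (1 - z t))%C.
Proof.
  intros Hn H0 H1 Hq Hz Hxi. destruct (lt1_pos _ Hq) as [Ha Hb].
  pose proof (cder_qM z t dz Hz Hn) as Hdq.
  assert (Hc1 : cder (fun s => clog (1 + qM (z s))%C) t ((0 + 2 * dz * qM (z t) * qM (z t)) / (1 + qM (z t)))%C).
  { apply (cder_clog (fun s => 1 + qM (z s))%C); [|exact Hb]. apply cder_plus; [apply cder_const|exact Hdq]. }
  unfold lM1. eapply cder_eq'.
  2:{ apply cder_plus; [|exact Hc1]. apply cder_minus; [exact Hxi|apply cder_const]. }
  destruct (qM_rel (z t) Hn H0 H1) as (Q0 & Q1 & Q2 & Qz). set (q := qM (z t)) in *.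
  cbv beta. rewrite Qz. field.
  assert (Q2' : (q + 1 <> 0)%C).
  { intros E. apply Q2. replace (1 + q)%C with (q + 1)%C by ring. exact E. }
  assert (Q3 : (2 * q - (q - 1) <> 0)%C).
  { intros E. apply Q2'. replace (q + 1)%C with (2 * q - (q - 1))%C by ring. exact E. }
  repeat split; try assumption.
Qed.

Lemma cder_PM (xi z : R -> C) t dz : (1 - 2 * z t <> 0)%C -> z t <> 0%C -> (1 - z t <> 0)%C -> Cmod (qM (z t)) < 1 ->
  cder z t dz -> cder xi t (- (2) * dz * qM (z t))%C ->
  cder (fun s => PM (xi s) (z s)) t (dP (z t) dz).
Proof.
  intros Hn H0 H1 Hq Hz Hxi. unfold PM, dP. eapply cder_eq'.
  2:{ apply cder_plus; apply cder_scal; [apply cder_lM0|apply cder_lM1]; eassumption. }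
  field. split; assumption.
Qed.

Lemma cder_xiL (z : R -> C) t dz : (1 - 2 * z t <> 0)%C -> z t <> 0%C -> 0 < fst (1 - z t)%C -> Cmod (qM (z t)) < 1 ->
  cder z t dz -> cder (fun s => xiL (z s)) t (- (2) * dz * qM (z t))%C.
Proof.
  intros Hn H0 H1 Hq Hz. destruct (lt1_pos _ Hq) as [Ha Hb]. pose proof (fst_pos_neq0 _ H1) as H1'.
  pose proof (cder_qM z t dz Hz Hn) as Hdq. unfold xiL.
  eapply cder_eq'.
  2:{ apply cder_plus; [apply cder_minus|apply cder_const].
      - apply cder_clog; [|exact H1]. apply cder_minus; [apply cder_const|exact Hz].
      - apply (cder_clog (fun s => 1 + qM (z s))%C); [|exact Hb]. apply cder_plus; [apply cder_const|exact Hdq]. }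
  destruct (qM_rel (z t) Hn H0 H1') as (Q0 & Q1 & Q2 & Qz). set (q := qM (z t)) in *.
  cbv beta. rewrite Qz. field.
  assert (Q2' : (q + 1 <> 0)%C).
  { intros E. apply Q2. replace (1 + q)%C with (q + 1)%C by ring. exact E. }
  assert (Q3 : (2 * q - (q - 1) <> 0)%C).
  { intros E. apply Q2'. replace (q + 1)%C with (2 * q - (q - 1))%C by ring. exact E. }
  repeat split; try assumption.
Qed.

Lemma cder_xiR (z : R -> C) t dz : (1 - 2 * z t <> 0)%C -> (1 - z t <> 0)%C -> 0 < fst (z t) -> Cmod (qM (z t)) < 1 ->
  cder z t dz -> cder (fun s => xiR (z s)) t (- (2) * dz * qM (z t))%C.
Proof.
  intros Hn H1' H0 Hq Hz. destruct (lt1_pos _ Hq) as [Ha Hb]. pose proof (fst_pos_neq0 _ H0) as H0'.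
  pose proof (cder_qM z t dz Hz Hn) as Hdq. unfold xiR.
  eapply cder_eq'.
  2:{ apply cder_minus; [apply cder_plus; [apply cder_minus|apply cder_const]|apply cder_const].
      - apply cder_clog; [exact Hz|exact H0].
      - apply (cder_clog (fun s => 1 - qM (z s))%C); [|exact Ha]. apply cder_minus; [apply cder_const|exact Hdq]. }
  destruct (qM_rel (z t) Hn H0' H1') as (Q0 & Q1 & Q2 & Qz). set (q := qM (z t)) in *.
  cbv beta. rewrite Qz. field.
  assert (Q1' : (q - 1 <> 0)%C).
  { intros E. apply Q1. replace (1 - q)%C with (- (q - 1))%C by ring. rewrite E. ring. }
  repeat split; try assumption.
Qed.

Definition P0 (z : C) : C := (al * clog z + be * clog (1 - z))%C.

Definition seg_const (s : R) : C := ((hA (seg_pt s) - hB (seg_pt s)) * cexp (P0 (seg_pt s)))%C.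
Definition zL (e : C) : C := arc_z e.
Definition zR (e : C) : C := (1 - arc_z e)%C.
Definition left_const (e : C) : C := ((hA (zL e) - hM (zL e)) * cexp (PM (xiL (zL e)) (zL e)))%C.
Definition right_const (e : C) : C := ((hB (zR e) - hM (zR e)) * cexp (PM (xiR (zR e)) (zR e)))%C.

Lemma Cmult_cancel_l (a x y : C) : a <> 0%C -> (a * x = a * y)%C -> x = y.
Proof. intros H E. replace x with (/ a * (a * x))%C by (field; exact H). rewrite E. field. exact H. Qed.

Lemma one_minus_seg s : (1 - seg_pt s)%C = Cconj (seg_pt s).
Proof. unfold seg_pt. apply C_eq; simpl; lra. Qed.

Lemma cder_seg s : cder seg_pt s (Ci * (2/3)%R)%C.
Proof.
  split; simpl.
  - replace (0 * (2/3) - 1 * 0) with 0 by ring. apply (is_derive_const (V := R_NormedModule)).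
  - replace (0 * 0 + 1 * (2/3)) with (2/3 * 1) by ring.
    apply (is_derive_scal (fun x => x) s (2/3) 1). apply (is_derive_id (K := R_AbsRing)).
Qed.

Lemma cder_arc_pt s : cder arc_pt s (2 * Ci / ((1 - Ci * s) * (1 - Ci * s)))%C.
Proof.
  unfold arc_pt. eapply cder_eq'.
  2:{ apply (cder_div (fun s => 1 + Ci * s)%C (fun s => 1 - Ci * s)%C s); [| |apply arc_den].
      - apply cder_plus; [apply cder_const|apply cder_scal, cder_id].
      - apply cder_minus; [apply cder_const|apply cder_scal, cder_id]. }
  field. apply arc_den.
Qed.

Lemma arc_pt_unit s : Cmod (arc_pt s) = 1.
Proof.
  unfold arc_pt. rewrite Cmod_div by apply arc_den.
  assert (E : Cmod (1 + Ci * s) = Cmod (1 - Ci * s)) by (rewrite !Cmod_normsq; f_equal; unfold normsq; simpl; ring).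
  rewrite E. field. pose proof (Cmod_arc_den s). lra.
Qed.

Lemma arc_pt_right s : Rabs s <= 1 -> 0 <= fst (arc_pt s).
Proof.
  intros H. apply Rabs_le_between in H.
  assert (E : arc_pt s = ((1 - s * s) / (1 + s * s), 2 * s / (1 + s * s))%R).
  { unfold arc_pt. apply C_eq; simpl; field; nra. }
  rewrite E; simpl. apply Rdiv_le_0_compat; nra.
Qed.

Lemma unit_inv (e : C) : Cmod e = 1 -> (e * Cconj e = 1)%C.
Proof.
  intros H. assert (Hn : normsq e = 1) by (rewrite <- Cmod_sqr, H; ring).
  unfold normsq in Hn. apply C_eq; simpl; lra.
Qed.

Lemma unit_neq0 (e : C) : Cmod e = 1 -> e <> 0%C.
Proof. intros H E. rewrite E, Cmod_0 in H. lra. Qed.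

Lemma left_geom e : Cmod e = 1 -> 0 <= fst e -> let z := zL e in
  (1 - 2 * z = (4/3)%R * e)%C /\ (1 - 2 * z <> 0)%C /\ qM z = ((3/4)%R * Cconj e)%C /\ Cmod (qM z) <= 3/4 /\ 
  Cmod z <= 5/6 /\ fst z <= 1/2 /\ z <> 0%C.
Proof.
  intros He Hf z.
  assert (E1 : (1 - 2 * z = (4/3)%R * e)%C) by (unfold z, zL, arc_z; apply C_eq; simpl; field).
  assert (N : (1 - 2 * z <> 0)%C).
  { rewrite E1. apply Cmult_neq_0; [|apply unit_neq0, He]. intros E. injection E; lra. }
  assert (E2 : qM z = ((3/4)%R * Cconj e)%C).
  { unfold qM. apply (Cmult_cancel_l (1 - 2 * z)%C); [exact N|].
    transitivity (RtoC 1); [field; exact N|]. rewrite E1.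
    transitivity ((4/3)%R * (3/4)%R * (e * Cconj e))%C; [|ring]. rewrite unit_inv by exact He.
    apply C_eq; simpl; field. }
  repeat split; try assumption.
  - rewrite E2. apply arc_q_mod; [exact He|apply Rabs_pos_eq; lra].
  - apply arc_z_mod; assumption.
  - unfold z, zL, arc_z; simpl. lra.
  - intros E. rewrite E in E1. apply (f_equal Cmod) in E1. rewrite Cmod_mult, He, Cmod_R, Rabs_pos_eq in E1 by lra.
    replace (1 - 2 * 0)%C with (RtoC 1) in E1 by ring. rewrite Cmod_1 in E1. lra.
Qed.

Lemma right_geom e : Cmod e = 1 -> 0 <= fst e -> let z := zR e in
  (1 - 2 * z = (-4/3)%R * e)%C /\ (1 - 2 * z <> 0)%C /\ qM z = ((-3/4)%R * Cconj e)%C /\ Cmod (qM z) <= 3/4 /\ 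
  Cmod (1 - z) <= 5/6 /\ 1/2 <= fst z /\ (1 - z <> 0)%C.
Proof.
  intros He Hf z.
  assert (E1 : (1 - 2 * z = (-4/3)%R * e)%C) by (unfold z, zR, arc_z; apply C_eq; simpl; field).
  assert (N : (1 - 2 * z <> 0)%C).
  { rewrite E1. apply Cmult_neq_0; [|apply unit_neq0, He]. intros E. injection E; lra. }
  assert (E2 : qM z = ((-3/4)%R * Cconj e)%C).
  { unfold qM. apply (Cmult_cancel_l (1 - 2 * z)%C); [exact N|].
    transitivity (RtoC 1); [field; exact N|]. rewrite E1.
    transitivity ((-4/3)%R * (-3/4)%R * (e * Cconj e))%C; [|ring]. rewrite unit_inv by exact He.
    apply C_eq; simpl; field. }
  assert (E3 : (1 - z = arc_z e)%C) by (unfold z, zR; ring).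
  repeat split; try assumption.
  - rewrite E2. apply arc_q_mod; [exact He|rewrite Rabs_left; lra].
  - rewrite E3. apply arc_z_mod; assumption.
  - unfold z, zR, arc_z; simpl. lra.
  - intros E. assert (Ez : z = 1%C) by (replace z with (1 - (1 - z))%C by ring; rewrite E; ring).
    rewrite Ez in E1. apply (f_equal Cmod) in E1. rewrite Cmod_mult, He, Cmod_R, Rabs_left in E1 by lra.
    replace (1 - 2 * 1)%C with (- RtoC 1)%C in E1 by ring. rewrite Cmod_opp, Cmod_1 in E1. lra.
Qed.

Lemma one_minus_neq (z : C) : (1 - z <> 0)%C -> z <> 1%C.
Proof. intros H E. apply H. rewrite E. ring. Qed.

Lemma fst_one_minus (z : C) : fst (1 - z)%C = 1 - fst z.
Proof. reflexivity. Qed.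

Lemma cder_zL s : exists dz, cder (fun s => zL (arc_pt s)) s dz.
Proof.
  eexists. unfold zL, arc_z. apply cder_minus; [apply cder_const|apply cder_scal, cder_arc_pt].
Qed.

Lemma cder_zR s : exists dz, cder (fun s => zR (arc_pt s)) s dz.
Proof.
  destruct (cder_zL s) as [dz H]. eexists. unfold zR. unfold zL in H. apply cder_minus; [apply cder_const|exact H].
Qed.

Lemma seg_half s : Rabs s <= 1 -> 0 < fst (seg_pt s) /\ 0 < fst (1 - seg_pt s)%C /\
  Cmod (seg_pt s) < 1 /\ Cmod (1 - seg_pt s) < 1.
Proof.
  intros H. pose proof (seg_pt_mod s H). rewrite one_minus_seg, Cmod_conj. unfold seg_pt at 1 2; simpl. lra.
Qed.

Lemma cder_P0_seg s : exists dz, cder seg_pt s dz /\ cder (fun s => P0 (seg_pt s)) s (dP (seg_pt s) dz).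
Proof.
  exists (Ci * (2/3)%R)%C. pose proof (cder_seg s) as Hz. split; [exact Hz|].
  assert (0 < fst (seg_pt s)) by (unfold seg_pt; simpl; lra).
  assert (0 < fst (1 - seg_pt s)%C) by (unfold seg_pt; simpl; lra).
  apply (cder_PA (fun s => clog (seg_pt s)) seg_pt); try assumption.
  - apply fst_pos_neq0; assumption.
  - apply cder_clog; assumption.
Qed.

(** Both products are primitives of [dD] along the segment for the same branch [P0]; the two arcs
    are treated in the same way. *)
Lemma seg_const_eq s : Rabs s <= 1 -> seg_const s = seg_const 1.
Proof.
  intros Hs. apply Rabs_le_between in Hs. apply (cder_const_eq seg_const s 1); [|lra]. intros t Ht.
  assert (Ht' : Rabs t <= 1) by (apply Rabs_le; lra). destruct (seg_half t Ht') as (Ha & Hb & Hc & Hd).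
  destruct (cder_P0_seg t) as (dz & Hz & HP).
  pose proof (fst_pos_neq0 _ Ha). pose proof (one_minus_neq _ (fst_pos_neq0 _ Hb)).
  apply (cder_ext (fun s => hA (seg_pt s) * cexp (P0 (seg_pt s)) - hB (seg_pt s) * cexp (P0 (seg_pt s)))%C).
  { intros u. unfold seg_const. ring. }
  eapply cder_eq'.
  2:{ apply cder_minus; [apply (cder_DA seg_pt (fun s => P0 (seg_pt s)))|apply (cder_DB seg_pt (fun s => P0 (seg_pt s)))]; eassumption. }
  ring.
Qed.

Lemma left_const_eq s : Rabs s <= 1 -> left_const (arc_pt s) = left_const (arc_pt 1).
Proof.
  intros Hs. apply Rabs_le_between in Hs. apply (cder_const_eq (fun s => left_const (arc_pt s)) s 1); [|lra]. intros t Ht.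
  assert (Ht' : Rabs t <= 1) by (apply Rabs_le; lra).
  pose proof (left_geom (arc_pt t) (arc_pt_unit t) (arc_pt_right t Ht')) as HG. cbv zeta in HG. destruct HG as (E1 & N1 & Eq & Hq & Hz & Hf & H0).
  destruct (cder_zL t) as [dz Hd].
  assert (H1 : 0 < fst (1 - zL (arc_pt t))%C) by (rewrite fst_one_minus; lra).
  pose proof (fst_pos_neq0 _ H1) as H1'. pose proof (one_minus_neq _ H1').
  assert (HP : cder (fun s => PM (xiL (zL (arc_pt s))) (zL (arc_pt s))) t (dP (zL (arc_pt t)) dz)).
  { apply (cder_PM (fun s => xiL (zL (arc_pt s))) (fun s => zL (arc_pt s))); try assumption; [lra|].
    apply (cder_xiL (fun s => zL (arc_pt s))); try assumption; lra. }
  unfold left_const.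
  apply (cder_ext (fun s => hA (zL (arc_pt s)) * cexp (PM (xiL (zL (arc_pt s))) (zL (arc_pt s))) -
     hM (zL (arc_pt s)) * cexp (PM (xiL (zL (arc_pt s))) (zL (arc_pt s))))%C); [intros u; ring|].
  eapply cder_eq'.
  2:{ apply cder_minus; [apply (cder_DA (fun s => zL (arc_pt s)))|apply (cder_DM (fun s => zL (arc_pt s)))]; try eassumption; lra. }
  ring.
Qed.

Lemma right_const_eq s : Rabs s <= 1 -> right_const (arc_pt s) = right_const (arc_pt 1).
Proof.
  intros Hs. apply Rabs_le_between in Hs. apply (cder_const_eq (fun s => right_const (arc_pt s)) s 1); [|lra]. intros t Ht.
  assert (Ht' : Rabs t <= 1) by (apply Rabs_le; lra).
  pose proof (right_geom (arc_pt t) (arc_pt_unit t) (arc_pt_right t Ht')) as HG. cbv zeta in HG.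
  destruct HG as (E1 & N1 & Eq & Hq & Hz & Hf & H1).
  destruct (cder_zR t) as [dz Hd].
  assert (H0 : 0 < fst (zR (arc_pt t))) by lra.
  pose proof (fst_pos_neq0 _ H0) as H0'. pose proof (one_minus_neq _ H1).
  assert (HP : cder (fun s => PM (xiR (zR (arc_pt s))) (zR (arc_pt s))) t (dP (zR (arc_pt t)) dz)).
  { apply (cder_PM (fun s => xiR (zR (arc_pt s))) (fun s => zR (arc_pt s))); try assumption; [lra|].
    apply (cder_xiR (fun s => zR (arc_pt s))); try assumption; lra. }
  unfold right_const.
  apply (cder_ext (fun s => hB (zR (arc_pt s)) * cexp (PM (xiR (zR (arc_pt s))) (zR (arc_pt s))) -
     hM (zR (arc_pt s)) * cexp (PM (xiR (zR (arc_pt s))) (zR (arc_pt s))))%C); [intros u; ring|].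
  eapply cder_eq'.
  2:{ apply cder_minus; [apply (cder_DB (fun s => zR (arc_pt s)))|apply (cder_DM (fun s => zR (arc_pt s)))]; try eassumption; lra. }
  ring.
Qed.

Lemma arc_pt_1 : arc_pt 1 = Ci.
Proof. unfold arc_pt. apply C_eq; simpl; field. Qed.

Lemma arc_pt_m1 : arc_pt (-1) = (- Ci)%C.
Proof. unfold arc_pt. apply C_eq; simpl; field. Qed.

Lemma zL_m1 : zL (- Ci) = seg_pt 1.
Proof. unfold zL, arc_z, seg_pt. apply C_eq; simpl; field. Qed.
Lemma zL_1 : zL Ci = seg_pt (-1).
Proof. unfold zL, arc_z, seg_pt. apply C_eq; simpl; field. Qed.
Lemma zR_m1 : zR (- Ci) = seg_pt (-1).
Proof. unfold zR, arc_z, seg_pt. apply C_eq; simpl; field. Qed.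
Lemma zR_1 : zR Ci = seg_pt 1.
Proof. unfold zR, arc_z, seg_pt. apply C_eq; simpl; field. Qed.

Lemma qM_seg (s : R) : s = 1 \/ s = -1 -> qM (seg_pt s) = (0, 3/4 * s)%R.
Proof. intros [-> | ->]; unfold qM, seg_pt; apply C_eq; simpl; field. Qed.

(** At the upper corner 1/2 + 2 i / 3 the argument of z is atan (4/3) and that of 1 + q is atan
    (3/4). As these are complementary, the branches at the corners differ by exact multiples of 2
    pi. *)
Lemma atan_sum : 2 * atan (4/3) + 2 * atan (3/4) = PI.
Proof. replace (3/4) with (/ (4/3)) by field. rewrite atan_inv by lra. field. Qed.

Lemma atan_sgn s x y : s = 1 \/ s = -1 -> x = s * y -> atan x = s * atan y.
Proof.
  intros [-> | ->] ->; [rewrite !Rmult_1_l; reflexivity|].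
  replace (-1 * y) with (- y) by ring. rewrite atan_opp. ring.
Qed.

Lemma clog_seg (s : R) : s = 1 \/ s = -1 -> let z := seg_pt s in
  clog z = (ln (25/36) / 2, s * atan (4/3))%R /\ clog (1 - z) = (ln (25/36) / 2, - s * atan (4/3))%R /\
  clog (1 + qM z) = (ln (25/16) / 2, s * atan (3/4))%R /\ clog (1 - qM z) = (ln (25/16) / 2, - s * atan (3/4))%R.
Proof.
  intros H z. unfold z. rewrite (qM_seg s H). unfold clog, normsq, seg_pt.
  destruct H as [-> | ->]; repeat split; apply C_eq; simpl;
    try (f_equal; f_equal; field); apply atan_sgn; try lra; field.
Qed.

Definition zp : C := seg_pt 1.
Definition zm : C := seg_pt (-1).

Lemma lM0_zp : lM0 (xiL zp) zp = clog zp.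
Proof.
  pose proof atan_sum. destruct (clog_seg 1 (or_introl eq_refl)) as (E1 & E2 & E3 & E4). fold zp in *.
  unfold lM0, xiL. rewrite E1, E2, E3, E4. apply C_eq; simpl; lra.
Qed.

(** The left arc from [zp] to [zm], closed up by the segment, turns once around 0, which costs 2 pi
    i. The right arc does the same around 1, in the other direction, in [lM1_zm]. *)
Lemma lM0_zm : lM0 (xiL zm) zm = (clog zm + 2 * PI * Ci)%C.
Proof.
  pose proof atan_sum. destruct (clog_seg (-1) (or_intror eq_refl)) as (E1 & E2 & E3 & E4). fold zm in *.
  unfold lM0, xiL. rewrite E1, E2, E3, E4. apply C_eq; simpl; lra.
Qed.

Lemma lM1_zp : lM1 (xiR zp) zp = clog (1 - zp).
Proof.
  pose proof atan_sum. destruct (clog_seg 1 (or_introl eq_refl)) as (E1 & E2 & E3 & E4). fold zp in *.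
  unfold lM1, xiR. rewrite E1, E2, E3, E4. apply C_eq; simpl; lra.
Qed.

Lemma lM1_zm : lM1 (xiR zm) zm = (clog (1 - zm) - 2 * PI * Ci)%C.
Proof.
  pose proof atan_sum. destruct (clog_seg (-1) (or_intror eq_refl)) as (E1 & E2 & E3 & E4). fold zm in *.
  unfold lM1, xiR. rewrite E1, E2, E3, E4. apply C_eq; simpl; lra.
Qed.

Lemma xiLR_zp : xiL zp = xiR zp.
Proof.
  pose proof atan_sum. destruct (clog_seg 1 (or_introl eq_refl)) as (E1 & E2 & E3 & E4). fold zp in *.
  unfold xiL, xiR. rewrite E1, E2, E3, E4. apply C_eq; simpl; lra.
Qed.

Lemma PM_xiL z : PM (xiL z) z = PA (lM0 (xiL z) z) z.
Proof. unfold PM, PA. rewrite lM1_xiL. reflexivity. Qed.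
Lemma PM_xiR z : PM (xiR z) z = PB (lM1 (xiR z) z) z.
Proof. unfold PM, PB. rewrite lM0_xiR. reflexivity. Qed.
Lemma P0_PA z : P0 z = PA (clog z) z.
Proof. reflexivity. Qed.
Lemma P0_PB z : P0 z = PB (clog (1 - z)) z.
Proof. reflexivity. Qed.

(** The unit of length: after division by [mm] the developing map puts the image of infinity at 1
    when that of 0 is at 0. *)
Definition mm : C := left_const (arc_pt 1).

Lemma arc_m1_le : Rabs (-1) <= 1.
Proof. apply Rabs_le; lra. Qed.
Lemma arc_1_le : Rabs 1 <= 1.
Proof. apply Rabs_le; lra. Qed.

Lemma cexp_P0_rotA z : cexp (PA (clog z + 2 * PI * Ci)%C z) = (Ci / 2 * cexp (P0 z))%C.
Proof.
  rewrite <- cexp_rot_A, <- cexp_plus. f_equal. unfold P0, PA. ring.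
Qed.
Lemma cexp_P0_rotB z : cexp (PB (clog (1 - z) - 2 * PI * Ci)%C z) = (cexp (P0 z) / (2 + 2 * Ci))%C.
Proof.
  rewrite <- cexp_rot_B, <- cexp_minus. f_equal. unfold P0, PB. ring.
Qed.

Lemma two_two_i_neq0 : (2 + 2 * Ci <> 0)%C.
Proof. neq0. Qed.

(* At the two points where the circle meets the line the three constants are linked;
   this is a linear system with a one-dimensional space of solutions. *)
Lemma connection_constants : seg_const 1 = (2 * mm)%C /\ right_const (arc_pt 1) = (- mm)%C.
Proof.
  pose proof (seg_const_eq (-1) arc_m1_le) as HS.
  pose proof (left_const_eq (-1) arc_m1_le) as HL.
  pose proof (right_const_eq (-1) arc_m1_le) as HR. fold mm in HL.
  assert (M2 : mm = ((hA zm - hM zm) * (Ci / 2 * cexp (P0 zm)))%C).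
  { unfold mm, left_const. rewrite arc_pt_1, zL_1. fold zm. rewrite PM_xiL, lM0_zm, cexp_P0_rotA. reflexivity. }
  rewrite <- HL in M2 at 1. unfold left_const in M2. rewrite arc_pt_m1, zL_m1 in M2. fold zp in M2.
  rewrite PM_xiL, lM0_zp, <- P0_PA in M2.
  assert (M1 : mm = ((hA zp - hM zp) * cexp (P0 zp))%C).
  { rewrite <- HL. unfold left_const. rewrite arc_pt_m1, zL_m1. fold zp.
    rewrite PM_xiL, lM0_zp, <- P0_PA. reflexivity. }
  assert (N1 : right_const (arc_pt 1) = ((hB zp - hM zp) * cexp (P0 zp))%C).
  { unfold right_const. rewrite arc_pt_1, zR_1. fold zp. rewrite PM_xiR, lM1_zp, <- P0_PB. reflexivity. }
  assert (N2 : right_const (arc_pt 1) = ((hB zm - hM zm) * (cexp (P0 zm) / (2 + 2 * Ci)))%C).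
  { rewrite <- HR. unfold right_const. rewrite arc_pt_m1, zR_m1. fold zm. rewrite PM_xiR, lM1_zm, cexp_P0_rotB. reflexivity. }
  unfold seg_const in HS. fold zm zp in HS. unfold seg_const. fold zp.
  set (K := right_const (arc_pt 1)) in *. clearbody K. rewrite <- M1 in M2.
  pose proof two_two_i_neq0 as Hn.
  assert (Q1 : ((hA zp - hB zp) * cexp (P0 zp) = mm - K)%C) by (rewrite M1, N1; ring).
  assert (I2 : (Ci * Ci = - (1))%C) by (apply C_eq; simpl; ring).
  assert (Q2 : ((hA zm - hB zm) * cexp (P0 zm) = - (2) * Ci * mm - (2 + 2 * Ci) * K)%C).
  { rewrite M2, N2. replace (- (2) * Ci * ((hA zm - hM zm) * (Ci / 2 * cexp (P0 zm))))%C with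
     (- (Ci * Ci) * ((hA zm - hM zm) * cexp (P0 zm)))%C by (field; neq0).
    rewrite I2. field. exact Hn. }
  rewrite HS, Q1 in Q2.
  (* The constant on the segment, written once at [zp] and once at [zm]. The factor 1 + 2 i is
     nonzero, which makes infinity develop to the midpoint of the images of 0 and 1. *)
  assert (Q3 : ((1 + 2 * Ci) * (mm + K) = 0)%C).
  { transitivity (mm - K - (- (2) * Ci * mm - (2 + 2 * Ci) * K))%C; [ring|]. rewrite <- Q2. ring. }
  assert (Q4 : (mm + K = 0)%C).
  { apply (Cmult_cancel_l (1 + 2 * Ci)%C); [neq0|].
    rewrite Q3. ring. }
  assert (Q5 : K = (- mm)%C) by (replace K with (mm + K - mm)%C by ring; rewrite Q4; ring).
  split; [|exact Q5]. rewrite Q1, Q5. ring.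
Qed.

Lemma seg_rel s : Rabs s <= 1 -> ((hA (seg_pt s) - hB (seg_pt s)) * cexp (P0 (seg_pt s)) = 2 * mm)%C.
Proof. intros H. rewrite <- (proj1 connection_constants). exact (seg_const_eq s H). Qed.

Lemma left_rel e : Cmod e = 1 -> 0 <= fst e -> ((hA (zL e) - hM (zL e)) * cexp (PM (xiL (zL e)) (zL e)) = mm)%C.
Proof. intros H H'. destruct (arc_pt_param e H H') as (s & Hs & ->). exact (left_const_eq s Hs). Qed.

Lemma right_rel e : Cmod e = 1 -> 0 <= fst e -> ((hB (zR e) - hM (zR e)) * cexp (PM (xiR (zR e)) (zR e)) = - mm)%C.
Proof. intros H H'. destruct (arc_pt_param e H H') as (s & Hs & ->). rewrite <- (proj2 connection_constants). exact (right_const_eq s Hs). Qed.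

Lemma mm_neq0 : mm <> 0%C.
Proof.
  unfold mm, left_const. apply Cmult_neq_0; [|apply cexp_neq0].
  pose proof (arc_pt_unit 1) as H1. pose proof (arc_pt_right 1 arc_1_le) as H2.
  pose proof (left_geom _ H1 H2) as HG. cbv zeta in HG. destruct HG as (_ & _ & Eq & _).
  pose proof (left_fact _ H1 H2) as (_ & _ & HD).
  intros E. unfold hM in E. rewrite Eq in E. unfold hA, zL in E. rewrite E in HD.
  unfold normsq in HD. simpl in HD. lra.
Qed.

(** * Charts and branches of the developing map *)

Inductive zone := ZA | ZB | ZM.

Definition zeta (Z : zone) (z : C) : C :=
  match Z with ZA => z | ZB => (1 - z)%C | ZM => (1 - 2 * z)%C end.
Definition dzeta (Z : zone) (dz : C) : C :=
  match Z with ZA => dz | ZB => (- dz)%C | ZM => (- (2) * dz)%C end.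
Definition PZ (Z : zone) (l z : C) : C :=
  match Z with ZA => PA l z | ZB => PB l z | ZM => PM l z end.
Definition hZ (Z : zone) (z : C) : C :=
  match Z with ZA => hA z | ZB => hB z | ZM => hM z end.
(* [hZ] normalised to be close to 1, so that its principal logarithm makes sense. *)
Definition uZ (Z : zone) (z : C) : C :=
  match Z with
  | ZA => (al * hyp al sg z)%C
  | ZB => (be * hyp be sg (1 - z))%C
  | ZM => (- (ga / 2) * gsol ga de (qM z))%C
  end.
(** An open condition, under which the chart and the logarithm of [uZ] are differentiable, as
    opposed to the closed zones [inZ] that tile the sphere. Thus a chart remains usable on both
    sides of the border of its zone. *)
Definition okZ (Z : zone) (z : C) : Prop :=
  z <> 0%C /\ (1 - z)%C <> 0%C /\ 0 < fst (uZ Z z) /\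
  match Z with
  | ZA => Cmod z < 1
  | ZB => Cmod (1 - z) < 1
  | ZM => (1 - 2 * z)%C <> 0%C /\ Cmod (qM z) < 1
  end.
Definition inZ (Z : zone) (z : C) : Prop :=
  match Z with
  | ZA => fst z <= 1/2 /\ Cmod (1 - 2 * z) <= 4/3
  | ZB => 1/2 <= fst z /\ Cmod (1 - 2 * z) <= 4/3
  | ZM => 4/3 <= Cmod (1 - 2 * z)
  end.

Lemma inZA_mod z : inZ ZA z -> Cmod z <= 5/6.
Proof.
  intros [H1 H2]. apply normsq_le in H2; [|lra]. apply normsq_le; [lra|].
  unfold normsq in *; simpl in *. nra.
Qed.
Lemma inZB_mod z : inZ ZB z -> Cmod (1 - z) <= 5/6.
Proof.
  intros [H1 H2]. apply normsq_le in H2; [|lra]. apply normsq_le; [lra|].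
  unfold normsq in *; simpl in *. nra.
Qed.
Lemma inZM_mod z : inZ ZM z -> (1 - 2 * z)%C <> 0%C /\ Cmod (qM z) <= 3/4.
Proof.
  intros H. simpl in H. assert (N : (1 - 2 * z)%C <> 0%C).
  { intros E. rewrite E, Cmod_0 in H. lra. }
  split; [exact N|]. unfold qM. rewrite Cmod_inv by exact N.
  replace (3/4) with (/ (4/3)) by field. apply Rinv_le_contravar; lra.
Qed.

Lemma inZ_ok Z z : inZ Z z -> z <> 0%C -> (1 - z)%C <> 0%C -> okZ Z z.
Proof.
  intros H H0 H1. split; [exact H0|split; [exact H1|]]. destruct Z.
  - apply inZA_mod in H. split; [apply hA_pos; exact H|lra].
  - apply inZB_mod in H. split; [apply hB_pos; exact H|lra].
  - apply inZM_mod in H. destruct H. split; [apply hM_pos; assumption|split; [assumption|lra]].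
Qed.

Lemma Cmod_lt1_one_minus (z : C) : Cmod z < 1 -> 0 < fst (1 - z)%C.
Proof. intros H. apply (proj1 (lt1_pos z H)). Qed.

Lemma Cmod_one_minus_lt1 (z : C) : Cmod (1 - z) < 1 -> 0 < fst z.
Proof. intros H. apply Cmod_lt1_one_minus in H. simpl in H. lra. Qed.

Lemma cder_PZ Z (l z : R -> C) t dz : okZ Z (z t) -> cder z t dz -> cder l t (dzeta Z dz / zeta Z (z t))%C ->
  cder (fun s => PZ Z (l s) (z s)) t (dP (z t) dz).
Proof.
  intros (H0 & H1 & Hu & Hz) Hd Hl. destruct Z; simpl in *.
  - apply cder_PA; try assumption. apply Cmod_lt1_one_minus, Hz.
  - apply cder_PB; try assumption. apply Cmod_one_minus_lt1, Hz.
  - destruct Hz. apply cder_PM; assumption.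
Qed.

Lemma cder_DZ Z (z P : R -> C) t dz : okZ Z (z t) -> cder z t dz -> cder P t (dP (z t) dz) ->
  cder (fun s => hZ Z (z s) * cexp (P s))%C t (dD (z t) dz (P t)).
Proof.
  intros (H0 & H1 & Hu & Hz) Hd HP. apply one_minus_neq in H1. destruct Z; simpl in *.
  - apply cder_DA; assumption.
  - apply cder_DB; assumption.
  - destruct Hz. apply cder_DM; assumption.
Qed.

Lemma cder_uZ Z (z : R -> C) t dz : okZ Z (z t) -> cder z t dz -> exists d, cder (fun s => uZ Z (z s)) t d.
Proof.
  intros (H0 & H1 & Hu & Hz) Hd. destruct Z; simpl in *; eexists.
  - apply cder_scal, cder_hyp; [exact hreg_al|exact Hd|exact Hz].
  - apply cder_scal, (cder_hyp be sg (fun s => 1 - z s)%C); [exact hreg_be| |exact Hz].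
    apply cder_minus; [apply cder_const|exact Hd].
  - destruct Hz. apply cder_scal, (cder_gsol ga de (fun s => qM (z s))); [exact greg_ga| |assumption].
    apply cder_qM; eassumption.
Qed.

Lemma cder_locally_neq0 f t l : cder f t l -> f t <> 0%C -> locally t (fun s => f s <> 0%C).
Proof.
  intros H H0. pose proof (cder_normsq _ _ _ H) as HN.
  assert (Hp : - normsq (f t) < 0).
  { assert (0 < normsq (f t)) by (apply normsq_pos; exact H0). lra. }
  assert (HN' : is_derive (fun s => - normsq (f s)) t (- (2 * (fst (f t) * fst l + snd (f t) * snd l)))).
  { apply (is_derive_opp (V := R_NormedModule)). exact HN. }
  pose proof (is_derive_locally_lt _ _ _ _ HN' Hp) as HL. revert HL. apply filter_imp. intros s Hs E.
  rewrite E in Hs. unfold normsq in Hs; simpl in Hs. lra.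
Qed.

Lemma cder_locally_fst_pos f t l : cder f t l -> 0 < fst (f t) -> locally t (fun s => 0 < fst (f s)).
Proof.
  intros [H _] H0. assert (H' : is_derive (fun s => - fst (f s)) t (- fst l)) by (apply (is_derive_opp (V := R_NormedModule)); exact H).
  assert (Hp : - fst (f t) < 0) by lra.
  pose proof (is_derive_locally_lt _ _ _ _ H' Hp) as HL. revert HL. apply filter_imp. intros s Hs. lra.
Qed.

Lemma okZ_open Z (z : R -> C) t dz : okZ Z (z t) -> cder z t dz -> locally t (fun s => okZ Z (z s)).
Proof.
  intros H Hd. destruct (cder_uZ Z z t dz H Hd) as [d Hu]. destruct H as (H0 & H1 & Hp & Hz).
  assert (Hd1 : cder (fun s => 1 - z s)%C t (0 - dz)%C) by (apply cder_minus; [apply cder_const|exact Hd]).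
  apply filter_and; [exact (cder_locally_neq0 z t dz Hd H0)|].
  apply filter_and; [exact (cder_locally_neq0 (fun s => 1 - z s)%C t _ Hd1 H1)|].
  apply filter_and; [exact (cder_locally_fst_pos _ t _ Hu Hp)|].
  destruct Z.
  - exact (cder_locally_mod_lt z t dz 1 Hd Hz).
  - exact (cder_locally_mod_lt _ t _ 1 Hd1 Hz).
  - destruct Hz as [Hn Hq]. apply filter_and.
    + eapply (cder_locally_neq0 (fun s => 1 - 2 * z s)%C); [|exact Hn].
      apply cder_minus; [apply cder_const|apply cder_scal; exact Hd].
    + eapply (cder_locally_mod_lt (fun s => qM (z s))); [|exact Hq]. apply cder_qM; eassumption.
Qed.

Definition wp : C := (hA zp * cexp (P0 zp) / mm)%C.
(** Chosen so that at [zp] the three [WZ] are logarithms of [wp], [wp - 2] and [wp - 1] whose angles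
    are those seen in the triangle. The corrections by i pi and i pi / 2 bring the argument of
    [clog] into the right half-plane. *)
Definition lZ (Z : zone) : C :=
  match Z with
  | ZA => (P0 zp + clog (uZ ZA zp) - clog wp)%C
  | ZB => (P0 zp + clog (uZ ZB zp) - clog (2 - wp) - Ci * PI)%C
  | ZM => (PM (xiL zp) zp + clog (uZ ZM zp) - xiL zp - clog (Ci * (wp - 1)) + Ci * (PI / 2)%R)%C
  end.
(** [hM] has the extra factor [qM], whose logarithm is minus that of 1 - 2 z. *)
Definition epsZ (Z : zone) : C := match Z with ZM => RtoC 1 | _ => RtoC 0 end.
Definition kapZ (Z : zone) : C := match Z with ZA => al | ZB => be | ZM => (al + be)%C end.

(* A logarithm of [hZ Z z * exp (PZ Z l z) / mm]. *)
Definition WZ (Z : zone) (l z : C) : C := (PZ Z l z + clog (uZ Z z) - epsZ Z * l - lZ Z)%C.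

Lemma PZ_shift Z l z c : PZ Z (l + c)%C z = (PZ Z l z + kapZ Z * c)%C.
Proof. destruct Z; simpl; unfold PA, PB, PM, lM0, lM1; ring. Qed.

Lemma WZ_shift Z l z c : WZ Z (l + c)%C z = (WZ Z l z + (kapZ Z - epsZ Z) * c)%C.
Proof. unfold WZ. rewrite PZ_shift. ring. Qed.

Lemma cder_WZ Z (l z : R -> C) t dz dl : okZ Z (z t) -> cder z t dz -> cder l t dl -> dl = (dzeta Z dz / zeta Z (z t))%C ->
  exists d, cder (fun s => WZ Z (l s) (z s)) t d.
Proof.
  intros H Hd Hl ->. destruct (cder_uZ Z z t dz H Hd) as [d Hu]. pose proof (cder_PZ Z l z t dz H Hd Hl) as HP.
  destruct H as (_ & _ & Hp & _). eexists. unfold WZ.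
  apply cder_minus; [apply cder_minus; [apply cder_plus; [exact HP|]|]|apply cder_const].
  - apply (cder_clog (fun s => uZ Z (z s))); eassumption.
  - apply cder_scal; exact Hl.
Qed.

Lemma Cdiv_conj (a D : C) : D <> 0%C -> (a / D = (/ normsq D)%R * (a * Cconj D))%C.
Proof.
  intros H. apply normsq_pos in H. destruct a as [a1 a2], D as [d1 d2]. unfold normsq in *. simpl in H.
  apply C_eq; simpl; field; lra.
Qed.

(* The position [w = 2 hA / (hA - hB)] on the segment. *)
Lemma pos_seg s : Rabs s <= 1 -> let z := seg_pt s in
  let w := (hA z * cexp (P0 z) / mm)%C in
  (hB z * cexp (P0 z) / mm = w - 2)%C /\ 0 < fst w /\ snd w < 0 /\ fst w - snd w < 2.
Proof.
  intros Hs z w. pose proof (seg_rel s Hs) as HR. fold z in HR. pose proof mm_neq0 as Hm.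
  pose proof (seg_fact s Hs) as HF. unfold seg_cond in HF. cbv zeta in HF.
  rewrite <- one_minus_seg in HF. fold z in HF.
  replace (hyp al sg z + hyp be sg (1 - z))%C with (hA z - hB z)%C in HF by (unfold hA, hB; ring).
  change (hyp al sg z) with (hA z) in HF. set (D := (hA z - hB z)%C) in *.
  destruct HF as (F1 & F2 & F3).
  assert (HD : D <> 0%C).
  { intros E. rewrite E in F1. replace (hA z * Cconj 0)%C with (RtoC 0) in F1 by (apply C_eq; cbn [fst snd Cmult Cconj RtoC]; ring).
    simpl in F1. lra. }
  assert (Ew : w = (2 * hA z / D)%C).
  { unfold w. replace mm with (D * cexp (P0 z) / 2)%C by (rewrite HR; field; neq0).
    field. repeat split; try assumption; try apply cexp_neq0; neq0. }
  split.
  - unfold w. replace (2 : C) with (2 * mm / mm)%C by (field; exact Hm). rewrite <- HR. unfold D. field. exact Hm.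
  - assert (Hn : 0 < normsq D) by (apply normsq_pos; exact HD).
    assert (Ew' : w = ((2 / normsq D)%R * (hA z * Cconj D))%C).
    { rewrite Ew, Cdiv_conj by exact HD. unfold Rdiv. rewrite RtoC_mult. ring. }
    assert (Hq : 0 < 2 / normsq D) by (apply Rdiv_lt_0_compat; lra).
    rewrite Ew'. set (m := (hA z * Cconj D)%C) in *. set (k := 2 / normsq D) in *.
    assert (Ek : k * normsq D = 2) by (unfold k; field; lra).
    replace (fst (k * m)%C) with (k * fst m) by (simpl; ring).
    replace (snd (k * m)%C) with (k * snd m) by (simpl; ring). split; [nra|]. split; [nra|]. nra.
Qed.

Lemma pos_left e : Cmod e = 1 -> 0 <= fst e -> let z := zL e in
  let E := cexp (PM (xiL z) z) in let p := (hM z * E / mm)%C in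
  (hA z * E / mm = 1 + p)%C /\ fst p + snd p < 0 /\ -1 < fst p.
Proof.
  intros He Hf z E p. pose proof (left_rel e He Hf) as HR. fold z in HR. fold E in HR. pose proof mm_neq0 as Hm.
  assert (HE : E <> 0%C) by apply cexp_neq0.
  pose proof (left_geom e He Hf) as HG. cbv zeta in HG. destruct HG as (_ & _ & Eq & _). fold z in Eq.
  pose proof (left_fact e He Hf) as HF. unfold left_cond in HF. cbv zeta in HF. rewrite <- Eq in HF.
  change (qM z * gsol ga de (qM z))%C with (hM z) in HF. change (hyp al sg (arc_z e)) with (hA z) in HF.
  set (D := (hA z - hM z)%C) in *. destruct HF as (F1 & F2 & F3).
  assert (HD : D <> 0%C) by (intros E'; rewrite E' in F3; unfold normsq in F3; simpl in F3; lra).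
  assert (Ep : p = ((/ normsq D)%R * (hM z * Cconj D))%C).
  { rewrite <- Cdiv_conj by exact HD. unfold p. rewrite <- HR. field. split; assumption. }
  split.
  - unfold p. replace (RtoC 1) with (mm / mm)%C by (field; exact Hm). rewrite <- HR at 2. unfold D. field. exact Hm.
  - assert (Hq : 0 < / normsq D) by (apply Rinv_0_lt_compat; lra).
    rewrite Ep. set (m := (hM z * Cconj D)%C) in *. set (k := / normsq D) in *.
    assert (Ek : k * normsq D = 1) by (unfold k; field; lra).
    replace (fst (k * m)%C) with (k * fst m) by (simpl; ring).
    replace (snd (k * m)%C) with (k * snd m) by (simpl; ring). split; nra.
Qed.

Lemma pos_right e : Cmod e = 1 -> 0 <= fst e -> let z := zR e in
  let E := cexp (PM (xiR z) z) in let p := (hM z * E / mm)%C in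
  (hB z * E / mm = p - 1)%C /\ snd p < fst p /\ fst p + snd p < 1 /\ fst p - snd p < 1.
Proof.
  intros He Hf z E p. pose proof (right_rel e He Hf) as HR. fold z in HR. fold E in HR. pose proof mm_neq0 as Hm.
  assert (HE : E <> 0%C) by apply cexp_neq0.
  pose proof (right_geom e He Hf) as HG. cbv zeta in HG. destruct HG as (_ & _ & Eq & _). fold z in Eq.
  pose proof (right_fact e He Hf) as HF. unfold right_cond in HF. cbv zeta in HF. rewrite <- Eq in HF.
  change (qM z * gsol ga de (qM z))%C with (hM z) in HF.
  replace (arc_z e) with (1 - z)%C in HF by (unfold z, zR; ring).
  replace (hM z + hyp be sg (1 - z))%C with (hM z - hB z)%C in HF by (unfold hB; ring).
  set (D := (hM z - hB z)%C) in *. destruct HF as (F1 & F2 & F3 & F4).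
  assert (HD : D <> 0%C) by (intros E'; rewrite E' in F4; unfold normsq in F4; simpl in F4; lra).
  assert (HR' : (mm = D * E)%C) by (transitivity (- - mm)%C; [ring|rewrite <- HR; unfold D; ring]).
  assert (Ep : p = ((/ normsq D)%R * (hM z * Cconj D))%C).
  { rewrite <- Cdiv_conj by exact HD. unfold p. rewrite HR'. field. split; assumption. }
  split.
  - unfold p. replace (RtoC 1) with (mm / mm)%C by (field; exact Hm). rewrite HR' at 3. unfold D. field. exact Hm.
  - assert (Hq : 0 < / normsq D) by (apply Rinv_0_lt_compat; lra).
    rewrite Ep. set (m := (hM z * Cconj D)%C) in *. set (k := / normsq D) in *.
    assert (Ek : k * normsq D = 1) by (unfold k; field; lra).
    replace (fst (k * m)%C) with (k * fst m) by (simpl; ring).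
    replace (snd (k * m)%C) with (k * snd m) by (simpl; ring). split; [nra|]. split; nra.
Qed.

Lemma fst_Ci_mult (u : C) : fst (Ci * u)%C = - snd u.
Proof. simpl. ring. Qed.

Lemma wp_pos : (hB zp * cexp (P0 zp) / mm = wp - 2)%C /\ 0 < fst wp /\ snd wp < 0 /\ fst wp - snd wp < 2.
Proof. exact (pos_seg 1 arc_1_le). Qed.

Lemma arc_unit_i : Cmod Ci = 1.
Proof. rewrite Cmod_normsq. replace (normsq Ci) with 1 by (unfold normsq; simpl; ring). exact sqrt_1. Qed.

Lemma arc_unit_mi : Cmod (- Ci) = 1.
Proof. rewrite Cmod_opp. exact arc_unit_i. Qed.

Lemma PM_xiL_zp : PM (xiL zp) zp = P0 zp.
Proof. rewrite PM_xiL, lM0_zp, <- P0_PA. reflexivity. Qed.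

(** The corner [zp] belongs to both arcs, so the left and the right inequalities hold there together
    and confine [wp - 1] to the lower quarter plane |Re| < - Im. *)
Lemma wp_pM : (hM zp * cexp (P0 zp) / mm = wp - 1)%C /\ fst wp - 1 + snd wp < 0 /\ snd wp < fst wp - 1.
Proof.
  assert (Hf : 0 <= fst (- Ci)%C) by (simpl; lra). assert (Hf' : 0 <= fst Ci) by (simpl; lra).
  pose proof (pos_left (- Ci)%C arc_unit_mi Hf) as HL. pose proof (pos_right Ci arc_unit_i Hf') as HR.
  cbv zeta in HL, HR. rewrite zL_m1 in HL. rewrite zR_1 in HR. fold zp in HL, HR.
  rewrite <- xiLR_zp in HR. rewrite PM_xiL_zp in *. fold wp in HL.
  set (p := (hM zp * cexp (P0 zp) / mm)%C) in *. destruct HL as (E & F1 & F2). destruct HR as (_ & F3 & _).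
  clearbody p. rewrite E. split; [ring|]. change (1 + fst p - 1 + (0 + snd p) < 0 /\ 0 + snd p < 1 + fst p - 1). lra.
Qed.

Lemma hZ_uZ Z z : hZ Z z = match Z with ZA => (uZ ZA z / al)%C | ZB => (- uZ ZB z / be)%C | ZM => (- (2) * qM z * uZ ZM z / ga)%C end.
Proof.
  pose proof (hreg_neq0 _ _ hreg_al). pose proof (hreg_neq0 _ _ hreg_be). pose proof (greg_neq0 _ _ greg_ga).
  destruct Z; simpl; unfold hA, hB, hM; field; try assumption.
Qed.

Lemma okZ_zp Z : okZ Z zp.
Proof.
  apply inZ_ok.
  - unfold zp, seg_pt. assert (Cmod (1 - 2 * (1/2, 2/3 * 1)%R) = 4/3).
    { rewrite Cmod_normsq. replace (4/3) with (sqrt (16/9)). f_equal; unfold normsq; simpl; field.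
      replace (16/9) with (4/3 * (4/3)) by field. apply sqrt_square; lra. }
    destruct Z; simpl fst; simpl inZ; simpl in H |- *; rewrite H; lra.
  - apply fst_pos_neq0. unfold zp, seg_pt; simpl; lra.
  - apply fst_pos_neq0. unfold zp, seg_pt; simpl; lra.
Qed.

Lemma cexp_lZ Z : cexp (lZ Z) = match Z with ZA => (al * mm)%C | ZB => (- (be * mm))%C | ZM => (- (ga / 2 * mm))%C end.
Proof.
  destruct wp_pos as (EB & W1 & W2 & W3). destruct wp_pM as (EM & W4 & W5).
  pose proof (okZ_zp Z) as (_ & _ & Hu & Hz). pose proof mm_neq0 as Hm. pose proof (cexp_neq0 (P0 zp)) as HE.
  pose proof (hreg_neq0 _ _ hreg_al) as Hal. pose proof (hreg_neq0 _ _ hreg_be) as Hbe. pose proof (greg_neq0 _ _ greg_ga) as Hga.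
  pose proof (fst_pos_neq0 _ Hu) as Hu'.
  destruct Z; unfold lZ.
  - rewrite cexp_minus, cexp_plus, !cexp_clog by assumption.
    assert (Hw : wp <> 0%C) by (apply fst_pos_neq0; exact W1).
    apply (Cmult_cancel_l wp); [exact Hw|]. unfold wp at 2. change (hA zp) with (hZ ZA zp). rewrite (hZ_uZ ZA). field. repeat split; assumption.
  - assert (W : 0 < fst (2 - wp)%C) by (change (0 < 2 - fst wp); lra).
    rewrite !cexp_minus, cexp_plus, cexp_iPI, !cexp_clog by assumption.
    pose proof (fst_pos_neq0 _ W) as Hw.
    apply (Cmult_cancel_l (2 - wp)%C); [exact Hw|].
    replace ((2 - wp) * - (be * mm))%C with ((wp - 2) * (be * mm))%C by ring. rewrite <- EB.
    change (hB zp) with (hZ ZB zp). rewrite (hZ_uZ ZB). field. repeat split; assumption.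
  - assert (W : 0 < fst (Ci * (wp - 1))%C) by (rewrite fst_Ci_mult; change (0 < - (snd wp + - 0)); lra).
    pose proof (fst_pos_neq0 _ W) as Hw.
    rewrite PM_xiL_zp, cexp_plus, !cexp_minus, cexp_plus, !cexp_clog by assumption.
    destruct Hz as [Hz1 Hz2]. rewrite cexp_xiL by first [assumption | unfold zp, seg_pt; simpl; lra].
    assert (EI : cexp (Ci * (PI / 2)%R) = Ci).
    { unfold cexp. apply C_eq; simpl.
      - replace (0 * (PI / 2) - 1 * 0) with 0 by ring. replace (0 * 0 + 1 * (PI / 2)) with (PI / 2) by ring. rewrite cos_PI2; ring.
      - replace (0 * (PI / 2) - 1 * 0) with 0 by ring. replace (0 * 0 + 1 * (PI / 2)) with (PI / 2) by ring. rewrite sin_PI2, exp_0; ring. }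
    rewrite EI. apply (Cmult_cancel_l (Ci * (wp - 1))%C); [exact Hw|].
    transitivity (cexp (P0 zp) * uZ ZM zp * qM zp * Ci)%C.
    { unfold qM. field. repeat split; try assumption.
      - intros E. apply Hw. rewrite E. ring.
      - intros E. apply Hw. rewrite E. ring. }
    rewrite <- EM. change (hM zp) with (hZ ZM zp). rewrite (hZ_uZ ZM). field. repeat split; assumption.
Qed.

Lemma cexp_WZ Z l z : okZ Z z -> cexp l = zeta Z z -> cexp (WZ Z l z) = (hZ Z z * cexp (PZ Z l z) / mm)%C.
Proof.
  intros (H0 & H1 & Hu & Hz) Hl. pose proof mm_neq0 as Hm.
  pose proof (hreg_neq0 _ _ hreg_al) as Hal. pose proof (hreg_neq0 _ _ hreg_be) as Hbe. pose proof (greg_neq0 _ _ greg_ga) as Hga.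
  assert (H2 : RtoC 2 <> 0%C) by (neq0).
  unfold WZ. rewrite (hZ_uZ Z), !cexp_minus, cexp_lZ, cexp_plus, cexp_clog by exact Hu.
  destruct Z; unfold epsZ.
  - replace (0 * l)%C with (RtoC 0) by ring. rewrite cexp_0. field. repeat split; assumption.
  - replace (0 * l)%C with (RtoC 0) by ring. rewrite cexp_0. field. repeat split; try assumption.
  - rewrite Cmult_1_l, Hl. unfold qM. simpl zeta. field. repeat split; try assumption. apply Hz.
Qed.

(** * Angles of the developing map along the borders of the zones *)

Lemma is_derive_continuity_pt f t l : is_derive f t l -> continuity_pt f t.
Proof.
  intros H. apply derivable_continuous_pt. exists l. apply is_derive_Reals. exact H.
Qed.

Lemma ivt_avoid (f : R -> R) a b c : a <= b -> (forall s, a <= s <= b -> continuity_pt f s) ->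
  (forall s, a <= s <= b -> f s <> c) -> f a < c -> f b < c.
Proof.
  intros Hab Hc Hn Ha. destruct (Rlt_or_le (f b) c) as [H|H]; [exact H|].
  destruct (Req_dec (f b) c) as [E|E]; [exfalso; apply (Hn b); [lra|exact E]|].
  destruct Hab as [Hab|Hab]; [|subst b; lra].
  destruct (Ranalysis5.IVT_interv (fun s => f s - c) a b) as (s & Hs & Es); try lra.
  - intros s Hs. apply continuity_pt_minus; [apply Hc, Hs|apply continuity_pt_const; intros x y; reflexivity].
  - exfalso. apply (Hn s Hs). lra.
Qed.

Lemma continuity_pt_reflect f a s : continuity_pt f (a - s) -> continuity_pt (fun s => f (a - s)) s.
Proof.
  intros H. apply (continuity_pt_comp (fun s => a - s) f); [|exact H].
  apply continuity_pt_minus; [apply continuity_pt_const; intros x y; reflexivity|apply derivable_continuous_pt, derivable_pt_id].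
Qed.

Lemma ivt_avoid' (f : R -> R) a b c : a <= b -> (forall s, a <= s <= b -> continuity_pt f s) ->
  (forall s, a <= s <= b -> f s <> c) -> f b < c -> f a < c.
Proof.
  intros Hab Hc Hn Hb. replace a with (a + b - b) by ring.
  apply (ivt_avoid (fun s => f (a + b - s)) a b c Hab).
  - intros s Hs. apply continuity_pt_reflect, Hc. lra.
  - intros s Hs. apply Hn. lra.
  - replace (a + b - a) with b by ring. exact Hb.
Qed.

(** The device that fixes the sheets: certified inequalities exclude the two bounding directions,
    and the angle at a single point, always [zp], then decides the sector on the whole border. *)
Lemma angle_stays (th : R -> R) a b s0 lo hi : a <= s0 <= b ->
  (forall s, a <= s <= b -> continuity_pt th s) ->
  (forall s, a <= s <= b -> th s <> lo /\ th s <> hi) -> lo < th s0 < hi ->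
  forall s, a <= s <= b -> lo < th s < hi.
Proof.
  intros H0 Hc Hn [Hlo Hhi] s Hs.
  assert (Hc' : forall s, a <= s <= b -> continuity_pt (fun s => - th s) s) by (intros; apply continuity_pt_opp, Hc; assumption).
  split.
  - apply Ropp_lt_cancel. destruct (Rle_lt_dec s s0) as [L|L].
    + apply (ivt_avoid' (fun s => - th s) s s0); [exact L| | |lra].
      * intros u Hu. apply Hc'; lra.
      * intros u Hu E. apply (proj1 (Hn u ltac:(lra))). lra.
    + apply (ivt_avoid (fun s => - th s) s0 s); [lra| | |lra].
      * intros u Hu. apply Hc'; lra.
      * intros u Hu E. apply (proj1 (Hn u ltac:(lra))). lra.
  - destruct (Rle_lt_dec s s0) as [L|L].
    + apply (ivt_avoid' th s s0); [exact L| | |exact Hhi].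
      * intros u Hu. apply Hc; lra.
      * intros u Hu. apply Hn; lra.
    + apply (ivt_avoid th s0 s); [lra| | |exact Hhi].
      * intros u Hu. apply Hc; lra.
      * intros u Hu. apply Hn; lra.
Qed.

Lemma sin_5PI4 : sin (5 * (PI / 4)) = sin (- (3 * (PI / 4))).
Proof. replace (5 * (PI/4)) with (- (3 * (PI/4)) + 2 * PI) by field. rewrite sin_2PI_neg || rewrite sin_plus, sin_2PI, cos_2PI; ring. Qed.
Lemma cos_5PI4 : cos (5 * (PI / 4)) = cos (- (3 * (PI / 4))).
Proof. replace (5 * (PI/4)) with (- (3 * (PI/4)) + 2 * PI) by field. rewrite cos_plus, sin_2PI, cos_2PI; ring. Qed.

Lemma diag_angle (t : R) :
  (t = PI / 4 -> cos t = sin t) /\ (t = 5 * (PI / 4) -> cos t = sin t) /\ (t = - (3 * (PI / 4)) -> cos t = sin t) /\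
  (t = - (PI / 4) -> cos t = - sin t) /\ (t = 3 * (PI / 4) -> cos t = - sin t) /\ (t = - (5 * (PI / 4)) -> cos t = - sin t).
Proof.
  pose proof sin_cos_PI4 as H.
  assert (A : cos (3 * (PI/4)) = - sin (3 * (PI/4))).
  { replace (3 * (PI/4)) with (PI / 2 + PI / 4) by field. rewrite cos_plus, sin_plus, cos_PI2, sin_PI2, H. ring. }
  assert (B : cos (- (3 * (PI/4))) = sin (- (3 * (PI/4)))).
  { rewrite cos_neg, sin_neg. exact A. }
  repeat split; intros ->.
  - symmetry; exact H.
  - rewrite cos_5PI4, sin_5PI4. exact B.
  - exact B.
  - rewrite cos_neg, sin_neg, H. ring.
  - exact A.
  - rewrite cos_neg, sin_neg, cos_5PI4, sin_5PI4, B. ring.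
Qed.

Lemma cexp_snd_pos w : 0 < snd w < PI -> 0 < snd (cexp w).
Proof. intros H. simpl. apply Rmult_lt_0_compat; [apply exp_pos|apply sin_gt_0; lra]. Qed.
Lemma cexp_snd_neg w : - PI < snd w < 0 -> snd (cexp w) < 0.
Proof. intros H. simpl. pose proof (exp_pos (fst w)). assert (sin (snd w) < 0) by (apply sin_lt_0_var; lra). nra. Qed.
Lemma cexp_snd_neg' w : PI < snd w < 2 * PI -> snd (cexp w) < 0.
Proof. intros H. simpl. pose proof (exp_pos (fst w)). assert (sin (snd w) < 0) by (apply sin_lt_0; lra). nra. Qed.
Lemma cexp_snd_pos' w : - (2 * PI) < snd w < - PI -> 0 < snd (cexp w).
Proof.
  intros H. simpl. apply Rmult_lt_0_compat; [apply exp_pos|].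
  replace (snd w) with (- (- snd w)) by ring. rewrite sin_neg.
  assert (sin (- snd w) < 0) by (apply sin_lt_0; lra). lra.
Qed.
Lemma cexp_fst_pos w : - (PI / 2) < snd w < PI / 2 -> 0 < fst (cexp w).
Proof. intros H. simpl. apply Rmult_lt_0_compat; [apply exp_pos|apply cos_gt_0; lra]. Qed.
Lemma cexp_fst_neg w : - (3 * (PI / 2)) < snd w < - (PI / 2) -> fst (cexp w) < 0.
Proof.
  intros H. simpl. pose proof (exp_pos (fst w)). rewrite <- cos_neg.
  assert (cos (- snd w) < 0) by (apply cos_lt_0; lra). nra.
Qed.
Lemma cexp_fst0 w : snd w = - (PI / 2) \/ snd w = PI / 2 -> fst (cexp w) = 0.
Proof. intros [H|H]; simpl; rewrite H, ?cos_neg, cos_PI2; ring. Qed.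
Lemma cexp_snd0 w : snd w = 0 \/ snd w = PI \/ snd w = - PI -> snd (cexp w) = 0.
Proof. intros [H|[H|H]]; simpl; rewrite H, ?sin_neg, ?sin_PI, ?sin_0; ring. Qed.
Lemma cexp_diag w : snd w = PI / 4 \/ snd w = 5 * (PI / 4) \/ snd w = - (3 * (PI / 4)) -> fst (cexp w) = snd (cexp w).
Proof. pose proof (diag_angle (snd w)) as (A & B & D & _). intros [H|[H|H]]; simpl; f_equal; auto. Qed.
Lemma cexp_antidiag w : snd w = - (PI / 4) \/ snd w = 3 * (PI / 4) \/ snd w = - (5 * (PI / 4)) -> fst (cexp w) + snd (cexp w) = 0.
Proof. pose proof (diag_angle (snd w)) as (_ & _ & _ & A & B & D). intros [H|[H|H]]; simpl; [rewrite A|rewrite B|rewrite D]; auto; ring. Qed.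

Lemma atan_lt1 x : x < 1 -> atan x < PI / 4.
Proof. intros H. rewrite <- atan_1. apply atan_increasing, H. Qed.
Lemma atan_gtm1 x : -1 < x -> - (PI / 4) < atan x.
Proof. intros H. rewrite <- atan_1, <- atan_opp. apply atan_increasing, H. Qed.

Lemma div_lt1 y x : 0 < x -> y < x -> y / x < 1.
Proof. intros H H'. apply Rmult_lt_reg_r with x; [exact H|]. replace (y / x * x) with y by (field; lra). lra. Qed.
Lemma div_gtm1 y x : 0 < x -> - x < y -> -1 < y / x.
Proof. intros H H'. apply Rmult_lt_reg_r with x; [exact H|]. replace (y / x * x) with y by (field; lra). lra. Qed.

Lemma WA_zp : WZ ZA (clog zp) zp = clog wp.
Proof. unfold WZ, epsZ, lZ. change (PZ ZA (clog zp) zp) with (P0 zp). ring. Qed.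
Lemma WB_zp : WZ ZB (clog (1 - zp)) zp = (clog (2 - wp) + Ci * PI)%C.
Proof. unfold WZ, epsZ, lZ. change (PZ ZB (clog (1 - zp)) zp) with (P0 zp). ring. Qed.
Lemma WM_zp : WZ ZM (xiL zp) zp = (clog (Ci * (wp - 1)) - Ci * (PI / 2)%R)%C.
Proof. unfold WZ, epsZ, lZ. change (PZ ZM (xiL zp) zp) with (PM (xiL zp) zp). ring. Qed.

Lemma angA_zp : - (PI / 2) < snd (WZ ZA (clog zp) zp) < 0.
Proof.
  rewrite WA_zp. destruct wp_pos as (_ & W1 & W2 & W3). pose proof (clog_bound wp). split; [lra|].
  unfold clog; cbn [snd]. rewrite <- atan_0. apply atan_increasing.
  unfold Rdiv. pose proof (Rinv_0_lt_compat _ W1). nra.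
Qed.

Lemma angB_zp : PI < snd (WZ ZB (clog (1 - zp)) zp) < 5 * (PI / 4).
Proof.
  rewrite WB_zp. destruct wp_pos as (_ & W1 & W2 & W3).
  assert (E : snd (clog (2 - wp) + Ci * PI)%C = atan (- snd wp / (2 - fst wp)) + PI).
  { unfold clog. cbn -[atan wp Rdiv]. f_equal; [|ring]. f_equal. unfold Rdiv, Rminus. f_equal; ring. }
  rewrite E. pose proof (atan_lt1 _ (div_lt1 (- snd wp) (2 - fst wp) ltac:(lra) ltac:(lra))).
  assert (atan 0 < atan (- snd wp / (2 - fst wp))).
  { apply atan_increasing. unfold Rdiv. assert (0 < 2 - fst wp) as Hx by lra. pose proof (Rinv_0_lt_compat _ Hx). nra. }
  rewrite atan_0 in *. lra.
Qed.

Lemma angM_zp : - (3 * (PI / 4)) < snd (WZ ZM (xiL zp) zp) < - (PI / 4).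
Proof.
  rewrite WM_zp. destruct wp_pM as (_ & W4 & W5).
  assert (E : snd (clog (Ci * (wp - 1)) - Ci * (PI / 2)%R)%C = atan ((fst wp - 1) / (- snd wp)) - PI / 2).
  { unfold clog. cbn -[atan wp Rdiv]. unfold Rminus. f_equal; [|ring]. f_equal. unfold Rdiv. f_equal; [ring|f_equal; ring]. }
  rewrite E. pose proof (atan_lt1 _ (div_lt1 (fst wp - 1) (- snd wp) ltac:(lra) ltac:(lra))).
  pose proof (atan_gtm1 _ (div_gtm1 (fst wp - 1) (- snd wp) ltac:(lra) ltac:(lra))). lra.
Qed.

Lemma seg_pt_in s : Rabs s <= 1 -> inZ ZA (seg_pt s) /\ inZ ZB (seg_pt s).
Proof.
  intros H. apply Rabs_le_between in H.
  assert (A : Cmod (1 - 2 * seg_pt s) <= 4/3) by (apply normsq_le; [lra|unfold normsq, seg_pt; simpl; nra]).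
  unfold inZ, seg_pt in *; simpl fst. repeat split; try lra; exact A.
Qed.

Lemma ang_continuous Z (l z : R -> C) t dz dl : okZ Z (z t) -> cder z t dz -> cder l t dl -> dl = (dzeta Z dz / zeta Z (z t))%C ->
  continuity_pt (fun s => snd (WZ Z (l s) (z s))) t.
Proof.
  intros H1 H2 H3 H4. destruct (cder_WZ Z l z t dz dl H1 H2 H3 H4) as [d [_ Hd]].
  exact (is_derive_continuity_pt _ _ _ Hd).
Qed.

Lemma seg_angles s : Rabs s <= 1 -> let z := seg_pt s in
  - (PI / 2) < snd (WZ ZA (clog z) z) < 0 /\ PI < snd (WZ ZB (clog (1 - z)) z) < 5 * (PI / 4).
Proof.
  intros Hs z. unfold z; clear z. apply Rabs_le_between in Hs. split.
  - apply (angle_stays (fun s => snd (WZ ZA (clog (seg_pt s)) (seg_pt s))) (-1) 1 1); [lra| | |exact angA_zp|exact Hs];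
    intros t Ht; apply Rabs_le in Ht; destruct (seg_half t Ht) as (S1 & S2 & S3 & S4); pose proof (seg_pt_in t Ht) as [I1 I2];
    pose proof (inZ_ok _ _ I1 (fst_pos_neq0 _ S1) (fst_pos_neq0 _ S2)) as Hok.
    + eapply (ang_continuous ZA (fun s => clog (seg_pt s)) seg_pt); [exact Hok|apply cder_seg| |].
      * apply cder_clog; [apply cder_seg|exact S1].
      * reflexivity.
    + pose proof (cexp_WZ ZA (clog (seg_pt t)) (seg_pt t) Hok (cexp_clog _ S1)) as E.
      pose proof (pos_seg t Ht) as (_ & P1 & P2 & P3). cbv zeta in P1, P2, P3.
      unfold hZ, PZ in E. rewrite <- P0_PA in E. rewrite <- E in P1, P2, P3.
      split; intros F.
      * rewrite cexp_fst0 in P1 by (left; exact F). lra.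
      * rewrite cexp_snd0 in P2 by (left; exact F). lra.
  - apply (angle_stays (fun s => snd (WZ ZB (clog (1 - seg_pt s)) (seg_pt s))) (-1) 1 1); [lra| | |exact angB_zp|exact Hs];
    intros t Ht; apply Rabs_le in Ht; destruct (seg_half t Ht) as (S1 & S2 & S3 & S4); pose proof (seg_pt_in t Ht) as [I1 I2];
    pose proof (inZ_ok _ _ I2 (fst_pos_neq0 _ S1) (fst_pos_neq0 _ S2)) as Hok.
    + eapply (ang_continuous ZB (fun s => clog (1 - seg_pt s)) seg_pt); [exact Hok|apply cder_seg| |].
      * apply (cder_clog (fun s => 1 - seg_pt s)%C); [|exact S2]. apply cder_minus; [apply cder_const|apply cder_seg].
      * simpl dzeta. simpl zeta. f_equal. ring.
    + pose proof (cexp_WZ ZB (clog (1 - seg_pt t)) (seg_pt t) Hok (cexp_clog _ S2)) as E.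
      pose proof (pos_seg t Ht) as (P0' & P1 & P2 & P3). cbv zeta in P0', P1, P2, P3.
      unfold hZ, PZ in E. rewrite <- P0_PB in E. rewrite P0' in E.
      split; intros F.
      * pose proof (cexp_snd0 (WZ ZB (clog (1 - seg_pt t)) (seg_pt t)) ltac:(right; left; exact F)) as G. rewrite E in G.
        set (w := (hA (seg_pt t) * cexp (P0 (seg_pt t)) / mm)%C) in *. clearbody w. simpl in G. lra.
      * pose proof (cexp_diag (WZ ZB (clog (1 - seg_pt t)) (seg_pt t)) ltac:(right; left; exact F)) as G. rewrite E in G.
        set (w := (hA (seg_pt t) * cexp (P0 (seg_pt t)) / mm)%C) in *. clearbody w. simpl in G. lra.
Qed.

Lemma left_in e : Cmod e = 1 -> 0 <= fst e -> inZ ZA (zL e) /\ inZ ZM (zL e) /\ okZ ZA (zL e) /\ okZ ZM (zL e) /\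
  cexp (xiL (zL e)) = (1 - 2 * zL e)%C /\ cexp (lM0 (xiL (zL e)) (zL e)) = zL e.
Proof.
  intros He Hf. pose proof (left_geom e He Hf) as HG. cbv zeta in HG. destruct HG as (E1 & N1 & Eq & Hq & Hz & Hfz & H0).
  assert (H1 : 0 < fst (1 - zL e)%C) by (rewrite fst_one_minus; lra). pose proof (fst_pos_neq0 _ H1) as H1'.
  assert (EM : Cmod (1 - 2 * zL e) = 4/3).
  { rewrite E1, Cmod_mult, He, Cmod_R, Rabs_pos_eq; lra. }
  assert (IA : inZ ZA (zL e)) by (simpl; simpl in EM; rewrite EM; lra).
  assert (IM : inZ ZM (zL e)) by (simpl; simpl in EM; rewrite EM; lra).
  assert (Hq' : Cmod (qM (zL e)) < 1) by lra.
  assert (EX : cexp (xiL (zL e)) = (1 - 2 * zL e)%C) by (apply cexp_xiL; assumption).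
  refine (conj IA (conj IM (conj (inZ_ok _ _ IA H0 H1') (conj (inZ_ok _ _ IM H0 H1') (conj EX _))))).
  apply cexp_lM0; assumption.
Qed.

Lemma right_in e : Cmod e = 1 -> 0 <= fst e -> inZ ZB (zR e) /\ inZ ZM (zR e) /\ okZ ZB (zR e) /\ okZ ZM (zR e) /\
  cexp (xiR (zR e)) = (1 - 2 * zR e)%C /\ cexp (lM1 (xiR (zR e)) (zR e)) = (1 - zR e)%C.
Proof.
  intros He Hf. pose proof (right_geom e He Hf) as HG. cbv zeta in HG. destruct HG as (E1 & N1 & Eq & Hq & Hz & Hfz & H1).
  assert (H0 : 0 < fst (zR e)) by lra. pose proof (fst_pos_neq0 _ H0) as H0'.
  assert (EM : Cmod (1 - 2 * zR e) = 4/3).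
  { rewrite E1, Cmod_mult, He, Cmod_R, Rabs_left; lra. }
  assert (IB : inZ ZB (zR e)) by (simpl; simpl in EM; rewrite EM; lra).
  assert (IM : inZ ZM (zR e)) by (simpl; simpl in EM; rewrite EM; lra).
  assert (Hq' : Cmod (qM (zR e)) < 1) by lra.
  assert (EX : cexp (xiR (zR e)) = (1 - 2 * zR e)%C) by (apply cexp_xiR; assumption).
  refine (conj IB (conj IM (conj (inZ_ok _ _ IB H0' H1) (conj (inZ_ok _ _ IM H0' H1) (conj EX _))))).
  apply cexp_lM1; assumption.
Qed.

Lemma left_W e : Cmod e = 1 -> 0 <= fst e -> let z := zL e in let p := cexp (WZ ZM (xiL z) z) in
  cexp (WZ ZA (lM0 (xiL z) z) z) = (1 + p)%C /\ fst p + snd p < 0 /\ -1 < fst p.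
Proof.
  intros He Hf z p. destruct (left_in e He Hf) as (I1 & I2 & O1 & O2 & EX & EL).
  unfold p. rewrite cexp_WZ, cexp_WZ by assumption. simpl PZ. rewrite <- PM_xiL. exact (pos_left e He Hf).
Qed.

Lemma right_W e : Cmod e = 1 -> 0 <= fst e -> let z := zR e in let p := cexp (WZ ZM (xiR z) z) in
  cexp (WZ ZB (lM1 (xiR z) z) z) = (p - 1)%C /\ snd p < fst p /\ fst p + snd p < 1 /\ fst p - snd p < 1.
Proof.
  intros He Hf z p. destruct (right_in e He Hf) as (I1 & I2 & O1 & O2 & EX & EL).
  unfold p. rewrite cexp_WZ, cexp_WZ by assumption. simpl PZ. rewrite <- PM_xiR. exact (pos_right e He Hf).
Qed.

Lemma seg_W s : Rabs s <= 1 -> let z := seg_pt s in let w := cexp (WZ ZA (clog z) z) in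
  cexp (WZ ZB (clog (1 - z)) z) = (w - 2)%C /\ 0 < fst w /\ snd w < 0 /\ fst w - snd w < 2.
Proof.
  intros Hs z w. destruct (seg_half s Hs) as (S1 & S2 & _). pose proof (seg_pt_in s Hs) as [I1 I2].
  pose proof (inZ_ok _ _ I1 (fst_pos_neq0 _ S1) (fst_pos_neq0 _ S2)). pose proof (inZ_ok _ _ I2 (fst_pos_neq0 _ S1) (fst_pos_neq0 _ S2)).
  unfold w. rewrite !cexp_WZ by (assumption || apply cexp_clog; assumption). simpl PZ. rewrite <- P0_PA, <- P0_PB. exact (pos_seg s Hs).
Qed.

Lemma arc_deriv_left t : Rabs t <= 1 -> exists dz, cder (fun s => zL (arc_pt s)) t dz /\
  cder (fun s => xiL (zL (arc_pt s))) t (- (2) * dz * qM (zL (arc_pt t)))%C /\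
  cder (fun s => lM0 (xiL (zL (arc_pt s))) (zL (arc_pt s))) t (dz / zL (arc_pt t))%C.
Proof.
  intros Ht. pose proof (left_geom (arc_pt t) (arc_pt_unit t) (arc_pt_right t Ht)) as HG. cbv zeta in HG.
  destruct HG as (E1 & N1 & Eq & Hq & Hz & Hf & H0).
  destruct (cder_zL t) as [dz Hd]. assert (H1 : 0 < fst (1 - zL (arc_pt t))%C) by (rewrite fst_one_minus; lra).
  pose proof (fst_pos_neq0 _ H1) as H1'. assert (Hq' : Cmod (qM (zL (arc_pt t))) < 1) by lra.
  pose proof (cder_xiL (fun s => zL (arc_pt s)) t dz N1 H0 H1 Hq' Hd) as Hx.
  exists dz. split; [exact Hd|]. split; [exact Hx|].
  exact (cder_lM0 (fun s => xiL (zL (arc_pt s))) (fun s => zL (arc_pt s)) t dz N1 H0 H1' Hq' Hd Hx).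
Qed.

Lemma arc_deriv_right t : Rabs t <= 1 -> exists dz, cder (fun s => zR (arc_pt s)) t dz /\
  cder (fun s => xiR (zR (arc_pt s))) t (- (2) * dz * qM (zR (arc_pt t)))%C /\
  cder (fun s => lM1 (xiR (zR (arc_pt s))) (zR (arc_pt s))) t (- dz / (1 - zR (arc_pt t)))%C.
Proof.
  intros Ht. pose proof (right_geom (arc_pt t) (arc_pt_unit t) (arc_pt_right t Ht)) as HG. cbv zeta in HG.
  destruct HG as (E1 & N1 & Eq & Hq & Hz & Hf & H1).
  destruct (cder_zR t) as [dz Hd]. assert (H0 : 0 < fst (zR (arc_pt t))) by lra.
  pose proof (fst_pos_neq0 _ H0) as H0'. assert (Hq' : Cmod (qM (zR (arc_pt t))) < 1) by lra.
  pose proof (cder_xiR (fun s => zR (arc_pt s)) t dz N1 H1 H0 Hq' Hd) as Hx.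
  exists dz. split; [exact Hd|]. split; [exact Hx|].
  exact (cder_lM1 (fun s => xiR (zR (arc_pt s))) (fun s => zR (arc_pt s)) t dz N1 H0' H1 Hq' Hd Hx).
Qed.

Lemma qM_zetaM dz z : (1 - 2 * z <> 0)%C -> (- (2) * dz * qM z = dzeta ZM dz / zeta ZM z)%C.
Proof. intros H. simpl. unfold qM. field. exact H. Qed.

(** The sectors are wider than those of the triangle at 0 and at 1, because the lift along the arc
    passes above the real axis; [transfer_AM] sorts out the two sheets that result. *)
Lemma left_angles e : Cmod e = 1 -> 0 <= fst e -> let z := zL e in
  - (PI / 2) < snd (WZ ZA (lM0 (xiL z) z) z) < PI / 2 /\ - (5 * (PI / 4)) < snd (WZ ZM (xiL z) z) < - (PI / 4).
Proof.
  intros He Hf z. pose proof PI_bounds. unfold z; clear z. destruct (arc_pt_param e He Hf) as (s & Hs & ->). clear He Hf. apply Rabs_le_between in Hs. split.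
  - apply (angle_stays (fun s => snd (WZ ZA (lM0 (xiL (zL (arc_pt s))) (zL (arc_pt s))) (zL (arc_pt s)))) (-1) 1 (-1)); [lra| | | |exact Hs].
    3:{ rewrite arc_pt_m1, zL_m1. fold zp. rewrite lM0_zp. pose proof angA_zp. lra. }
    + intros t Ht. apply Rabs_le in Ht. destruct (arc_deriv_left t Ht) as (dz & D1 & D2 & D3).
      destruct (left_in _ (arc_pt_unit t) (arc_pt_right t Ht)) as (I1 & I2 & O1 & O2 & EX & EL).
      exact (ang_continuous ZA _ _ t dz _ O1 D1 D3 eq_refl).
    + intros t Ht. apply Rabs_le in Ht.
      pose proof (left_W _ (arc_pt_unit t) (arc_pt_right t Ht)) as (E & P1 & P2). cbv zeta in E, P1, P2.
      set (p := cexp (WZ ZM _ _)) in *. clearbody p.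
      split; intros F; [apply or_introl with (B := snd (WZ ZA (lM0 (xiL (zL (arc_pt t))) (zL (arc_pt t))) (zL (arc_pt t))) = PI / 2) in F
         |apply or_intror with (A := snd (WZ ZA (lM0 (xiL (zL (arc_pt t))) (zL (arc_pt t))) (zL (arc_pt t))) = - (PI / 2)) in F];
      apply cexp_fst0 in F; rewrite E in F; simpl in F; lra.
  - apply (angle_stays (fun s => snd (WZ ZM (xiL (zL (arc_pt s))) (zL (arc_pt s)))) (-1) 1 (-1)); [lra| | | |exact Hs].
    3:{ rewrite arc_pt_m1, zL_m1. fold zp. pose proof angM_zp. lra. }
    + intros t Ht. apply Rabs_le in Ht. destruct (arc_deriv_left t Ht) as (dz & D1 & D2 & D3).
      destruct (left_in _ (arc_pt_unit t) (arc_pt_right t Ht)) as (I1 & I2 & O1 & O2 & EX & EL).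
      refine (ang_continuous ZM _ _ t dz _ O2 D1 D2 (qM_zetaM _ _ _)). apply O2.
    + intros t Ht. apply Rabs_le in Ht.
      pose proof (left_W _ (arc_pt_unit t) (arc_pt_right t Ht)) as (E & P1 & P2). cbv zeta in E, P1, P2.
      split; intros F; pose proof (cexp_antidiag (WZ ZM (xiL (zL (arc_pt t))) (zL (arc_pt t))) ltac:(tauto)); lra.
Qed.

Lemma right_angles e : Cmod e = 1 -> 0 <= fst e -> let z := zR e in
  3 * (PI / 4) < snd (WZ ZB (lM1 (xiR z) z) z) < 5 * (PI / 4) /\ - (3 * (PI / 4)) < snd (WZ ZM (xiR z) z) < PI / 4.
Proof.
  intros He Hf z. pose proof PI_bounds. unfold z; clear z. destruct (arc_pt_param e He Hf) as (s & Hs & ->). clear He Hf. apply Rabs_le_between in Hs. split.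
  - apply (angle_stays (fun s => snd (WZ ZB (lM1 (xiR (zR (arc_pt s))) (zR (arc_pt s))) (zR (arc_pt s)))) (-1) 1 1); [lra| | | |exact Hs].
    3:{ rewrite arc_pt_1, zR_1. fold zp. rewrite lM1_zp. pose proof angB_zp. lra. }
    + intros t Ht. apply Rabs_le in Ht. destruct (arc_deriv_right t Ht) as (dz & D1 & D2 & D3).
      destruct (right_in _ (arc_pt_unit t) (arc_pt_right t Ht)) as (I1 & I2 & O1 & O2 & EX & EL).
      exact (ang_continuous ZB _ _ t dz _ O1 D1 D3 eq_refl).
    + intros t Ht. apply Rabs_le in Ht.
      pose proof (right_W _ (arc_pt_unit t) (arc_pt_right t Ht)) as (E & P1 & P2 & P3). cbv zeta in E, P1, P2, P3.
      set (p := cexp (WZ ZM _ _)) in *. clearbody p.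
      split; intros F; [pose proof (cexp_antidiag (WZ ZB (lM1 (xiR (zR (arc_pt t))) (zR (arc_pt t))) (zR (arc_pt t))) ltac:(tauto)) as G
         |pose proof (cexp_diag (WZ ZB (lM1 (xiR (zR (arc_pt t))) (zR (arc_pt t))) (zR (arc_pt t))) ltac:(tauto)) as G];
      rewrite E in G; simpl in G; lra.
  - apply (angle_stays (fun s => snd (WZ ZM (xiR (zR (arc_pt s))) (zR (arc_pt s)))) (-1) 1 1); [lra| | | |exact Hs].
    3:{ rewrite arc_pt_1, zR_1. fold zp. rewrite <- xiLR_zp. pose proof angM_zp. lra. }
    + intros t Ht. apply Rabs_le in Ht. destruct (arc_deriv_right t Ht) as (dz & D1 & D2 & D3).
      destruct (right_in _ (arc_pt_unit t) (arc_pt_right t Ht)) as (I1 & I2 & O1 & O2 & EX & EL).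
      refine (ang_continuous ZM _ _ t dz _ O2 D1 D2 (qM_zetaM _ _ _)). apply O2.
    + intros t Ht. apply Rabs_le in Ht.
      pose proof (right_W _ (arc_pt_unit t) (arc_pt_right t Ht)) as (E & P1 & P2 & P3). cbv zeta in E, P1, P2, P3.
      split; intros F; pose proof (cexp_diag (WZ ZM (xiR (zR (arc_pt t))) (zR (arc_pt t))) ltac:(tauto)); lra.
Qed.

(** * Monodromy of the charts *)

Definition tpi : C := (2 * PI * Ci)%C.

Lemma cexp_tpi : cexp tpi = 1%C.
Proof.
  unfold tpi, cexp. apply C_eq; simpl.
  - replace ((2 * PI - 0 * 0) * 0 - (2 * 0 + 0 * PI) * 1) with 0 by ring.
    replace ((2 * PI - 0 * 0) * 1 + (2 * 0 + 0 * PI) * 0) with (2 * PI) by ring. rewrite exp_0, cos_2PI; ring.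
  - replace ((2 * PI - 0 * 0) * 0 - (2 * 0 + 0 * PI) * 1) with 0 by ring.
    replace ((2 * PI - 0 * 0) * 1 + (2 * 0 + 0 * PI) * 0) with (2 * PI) by ring. rewrite exp_0, sin_2PI; ring.
Qed.

Lemma cexp_inj (a b : C) : cexp a = cexp b -> exists k : Z, a = (b + IZR k * tpi)%C.
Proof.
  intros H.
  assert (E : fst a = fst b).
  { apply exp_inv. rewrite <- !Cmod_cexp, H. reflexivity. }
  assert (Hc : cos (snd a) = cos (snd b)).
  { apply (f_equal fst) in H. simpl in H. rewrite E in H. apply Rmult_eq_reg_l in H; [exact H|]. apply Rgt_not_eq, exp_pos. }
  assert (Hs : sin (snd a) = sin (snd b)).
  { apply (f_equal snd) in H. simpl in H. rewrite E in H. apply Rmult_eq_reg_l in H; [exact H|]. apply Rgt_not_eq, exp_pos. }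
  assert (Hd : sin ((snd a - snd b) / 2) = 0).
  { assert (C1 : cos (snd a - snd b) = 1) by (rewrite cos_minus, Hc, Hs; pose proof (sin2_cos2 (snd b)); unfold Rsqr in *; lra).
    replace (snd a - snd b) with (2 * ((snd a - snd b) / 2)) in C1 by field. rewrite cos_2a_sin in C1. nra. }
  apply sin_eq_0_0 in Hd. destruct Hd as [k Hk]. exists k.
  apply C_eq; simpl; [rewrite E; ring|].
  replace (snd a) with (snd b + 2 * ((snd a - snd b) / 2)) by field. rewrite Hk. ring.
Qed.

Definition rhoZ (Z : zone) : C :=
  match Z with ZA => (Ci / 2)%C | ZB => (2 + 2 * Ci)%C | ZM => (Ci / 2 * (2 + 2 * Ci))%C end.

Lemma cexp_kap Z : cexp (kapZ Z * tpi) = rhoZ Z.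
Proof.
  unfold tpi. destruct Z; simpl.
  - rewrite <- cexp_rot_A. f_equal. ring.
  - rewrite <- cexp_rot_B. f_equal. ring.
  - rewrite <- cexp_rot_A, <- cexp_rot_B, <- cexp_plus. f_equal. ring.
Qed.

Lemma cexp_kap_eps Z : cexp ((kapZ Z - epsZ Z) * tpi) = rhoZ Z.
Proof.
  rewrite <- cexp_kap. destruct Z; simpl epsZ.
  - f_equal. ring.
  - f_equal. ring.
  - replace ((kapZ ZM - 1) * tpi)%C with (kapZ ZM * tpi - tpi)%C by ring. rewrite cexp_minus, cexp_tpi. field.
Qed.

Lemma rhoZ_neq0 Z : rhoZ Z <> 0%C.
Proof. rewrite <- cexp_kap. apply cexp_neq0. Qed.

Definition XZ (Z : zone) (l z : C) : C := (mm * cexp (- PZ Z l z))%C.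
Definition UZ (Z : zone) (l z : C) : C := cexp (WZ Z l z).
Arguments WZ : simpl never.
Arguments UZ : simpl never.
Arguments XZ : simpl never.
Arguments mm : simpl never.

(** The angle that [WZ] gains when the logarithm of the coordinate gains 2 pi i: 2 pi times the real
    part of al, be and al + be - 1. The absolute values are the cone angles of the flat sphere. *)
Definition rateZ (Z : zone) : R := match Z with ZA => PI / 2 | ZB => PI / 4 | ZM => - (5 * (PI / 4)) end.

Lemma XZ_up Z l z : XZ Z (l + tpi)%C z = (XZ Z l z / rhoZ Z)%C.
Proof.
  unfold XZ. rewrite PZ_shift, <- cexp_kap.
  replace (- (PZ Z l z + kapZ Z * tpi))%C with (- PZ Z l z - kapZ Z * tpi)%C by ring. rewrite cexp_minus.
  unfold Cdiv. ring.
Qed.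
Lemma XZ_dn Z l z : XZ Z (l - tpi)%C z = (XZ Z l z * rhoZ Z)%C.
Proof.
  replace l with (l - tpi + tpi)%C at 2 by ring. rewrite XZ_up. field. apply rhoZ_neq0.
Qed.
Lemma UZ_up Z l z : UZ Z (l + tpi)%C z = (UZ Z l z * rhoZ Z)%C.
Proof. unfold UZ. rewrite WZ_shift, cexp_plus, cexp_kap_eps. reflexivity. Qed.
Lemma UZ_dn Z l z : UZ Z (l - tpi)%C z = (UZ Z l z / rhoZ Z)%C.
Proof.
  replace l with (l - tpi + tpi)%C at 2 by ring. rewrite UZ_up. field. apply rhoZ_neq0.
Qed.
Lemma ang_shift Z l z (k : R) : snd (WZ Z (l + k * tpi)%C z) = snd (WZ Z l z) + k * rateZ Z.
Proof.
  rewrite WZ_shift. generalize (WZ Z l z). intros W. unfold tpi. destruct Z; simpl; field.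
Qed.
Lemma ang_up Z l z : snd (WZ Z (l + tpi)%C z) = snd (WZ Z l z) + rateZ Z.
Proof. replace (l + tpi)%C with (l + 1 * tpi)%C by ring. rewrite ang_shift. ring. Qed.
Lemma RtoC_m1 : RtoC (-1) = (- (1))%C.
Proof. apply C_eq; simpl; ring. Qed.
Lemma ang_dn Z l z : snd (WZ Z (l - tpi)%C z) = snd (WZ Z l z) - rateZ Z.
Proof. replace (l - tpi)%C with (l + (-1)%R * tpi)%C by (rewrite RtoC_m1; ring). rewrite ang_shift. ring. Qed.

(** * Frames *)

Inductive vertex := VA | VB | VM | VC.

Definition zoneof (V : vertex) : zone := match V with VA => ZA | VB => ZB | VM | VC => ZM end.
Definition vpos (V : vertex) : C :=
  match V with VA => RtoC 0 | VB => RtoC 2 | VM => RtoC 1 | VC => (- (2) * Ci)%C end.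
(** A point 1 + u read at [VM] is carried by the gluing of [1, 2] with [- 2 i, 2] to 2 + (2 + 2 i)(u
    - 1) = - 2 i + (2 + 2 i) u, which is the reading at [VC]. *)
Definition vscale (V : vertex) : C := match V with VC => (2 + 2 * Ci)%C | _ => RtoC 1 end.
(** The angular sectors of the triangle at 0, 2, the midpoint 1 and - 2 i, measured in the chart.
    Those of [VM] and [VC] are adjacent and add up to 5 pi / 4, the cone angle at infinity. *)
Definition vlo (V : vertex) : R := match V with VA => - (PI / 2) | VB => PI | VM => - PI | VC => 0 end.
Definition vhi (V : vertex) : R := match V with VA => 0 | VB => 5 * (PI / 4) | VM => 0 | VC => PI / 4 end.

(* [w] is the value of the developing map at the current point, in the frame where the
   fundamental domain is the triangle 0, 2, - 2 i; [X] is [S * x], where [2 pi / S] is the constant velocity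
   of [w] along the orbit. The points [VM] = 1 and [VC] = - 2 i both lie over infinity. The vertex [V]
   names the chart, and the bound on the angle picks the sheet. *)
Definition Val (V : vertex) (z X w : C) : Prop :=
  exists l, cexp l = zeta (zoneof V) z /\ X = (XZ (zoneof V) l z / vscale V)%C /\
    w = (vpos V + vscale V * UZ (zoneof V) l z)%C /\ vlo V <= snd (WZ (zoneof V) l z) <= vhi V.

Lemma Z_range (k a b : Z) (c : R) : 0 < c -> IZR a * c < IZR k * c < IZR b * c -> (a < k < b)%Z.
Proof.
  intros Hc [H1 H2]. apply Rmult_lt_reg_r in H1; [|exact Hc]. apply Rmult_lt_reg_r in H2; [|exact Hc].
  split; apply lt_IZR; assumption.
Qed.

Lemma RtoC2_neq0 : RtoC 2 <> 0%C.
Proof. neq0. Qed.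
Lemma RtoC1_neq0 : RtoC 1 <> 0%C.
Proof. neq0. Qed.
Lemma Ci_neq0 : Ci <> 0%C.
Proof. intros E'; apply (f_equal snd) in E'; simpl in E'; lra. Qed.
Lemma Ci_sqr : (Ci * Ci = - (1))%C.
Proof. apply C_eq; simpl; ring. Qed.
Lemma one_i_neq0 : (1 + Ci)%C <> 0%C.
Proof. neq0. Qed.

Lemma two_div_Ci : (2 / Ci = - (2) * Ci)%C.
Proof. apply C_eq; simpl; field. Qed.

Lemma add_0_tpi l : (l + 0 * tpi)%C = l.
Proof. ring. Qed.

Ltac vsimp := cbn [zoneof zeta vscale vpos vlo vhi rhoZ rateZ] in *.

(** The angle bounds leave a single sheet on either side, the one of the principal logarithms, and
    there both charts use the same branch of the exponent and the same position. *)
Lemma transfer_AB s X w : Rabs s <= 1 -> Val VA (seg_pt s) X w <-> Val VB (seg_pt s) X w.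
Proof.
  intros Hs. pose proof PI_bounds. destruct (seg_half s Hs) as (S1 & S2 & _).
  destruct (seg_angles s Hs) as [A1 A2]. destruct (seg_W s Hs) as (E & _). cbv zeta in *. set (z := seg_pt s) in *.
  assert (EX : XZ ZA (clog z) z = XZ ZB (clog (1 - z)) z) by (unfold XZ, PZ, PA, PB; reflexivity).
  split; intros (l & Hl & HX & Hw & Ha); vsimp.
  - rewrite <- (cexp_clog z S1) in Hl. apply cexp_inj in Hl. destruct Hl as [k ->].
    rewrite ang_shift in Ha. vsimp.
    assert (Hk : (-1 < k < 1)%Z) by (apply (Z_range k (-1) 1 (PI / 2)); lra).
    assert (k = 0%Z) by lia. subst k. rewrite add_0_tpi in *.
    exists (clog (1 - z)). vsimp. split; [apply cexp_clog; exact S2|]. split; [rewrite <- EX; exact HX|].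
    split; [|lra]. rewrite Hw. unfold UZ. rewrite E. ring.
  - rewrite <- (cexp_clog _ S2) in Hl. apply cexp_inj in Hl. destruct Hl as [k ->].
    rewrite ang_shift in Ha. vsimp.
    assert (Hk : (-1 < k < 1)%Z) by (apply (Z_range k (-1) 1 (PI / 4)); lra).
    assert (k = 0%Z) by lia. subst k. rewrite add_0_tpi in *.
    exists (clog z). vsimp. split; [apply cexp_clog; exact S1|]. split; [rewrite EX; exact HX|].
    split; [|lra]. rewrite Hw. unfold UZ. rewrite E. ring.
Qed.

(** Two sheets remain possible: the unshifted one, read at 1, and the one shifted by a turn around
    0, read at - 2 i. On the unshifted sheet the positions relative to 0 and to 1 differ by a real
    number, so they have the same imaginary part, and its sign makes the closed angle ranges
    correspond. *)
Lemma transfer_AM e X w : Cmod e = 1 -> 0 <= fst e ->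
  Val VA (zL e) X w <-> (Val VM (zL e) X w \/ Val VC (zL e) X w).
Proof.
  intros He Hf. pose proof PI_bounds. destruct (left_in e He Hf) as (I1 & I2 & O1 & O2 & EX & EL).
  destruct (left_angles e He Hf) as [A1 A2]. destruct (left_W e He Hf) as (E & _). cbv zeta in *. set (z := zL e) in *.
  set (l0 := lM0 (xiL z) z) in *.
  assert (EP : XZ ZA l0 z = XZ ZM (xiL z) z) by (unfold XZ; simpl PZ; rewrite PM_xiL; reflexivity).
  change (cexp (WZ ZA l0 z)) with (UZ ZA l0 z) in E. change (cexp (WZ ZM (xiL z) z)) with (UZ ZM (xiL z) z) in E.
  assert (ES : snd (UZ ZA l0 z) = snd (UZ ZM (xiL z) z)) by (rewrite E; generalize (UZ ZM (xiL z) z); intros u; simpl; ring).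
  pose proof RtoC2_neq0. pose proof Ci_neq0. pose proof two_two_i_neq0. pose proof RtoC1_neq0. pose proof one_i_neq0.
  split.
  - intros (l & Hl & HX & Hw & Ha). vsimp. rewrite <- EL in Hl. apply cexp_inj in Hl. destruct Hl as [k ->].
    rewrite ang_shift in Ha. vsimp.
    assert (Hk : (-2 < k < 1)%Z) by (apply (Z_range k (-2) 1 (PI / 2)); lra).
    assert (Hk' : k = 0%Z \/ k = (-1)%Z) by lia. destruct Hk' as [-> | ->].
    + rewrite add_0_tpi in *. left. exists (xiL z). vsimp.
      split; [exact EX|]. split; [rewrite <- EP; exact HX|]. split; [rewrite Hw, E; ring|].
      split; [|lra]. apply Rnot_lt_le. intros L.
      pose proof (cexp_snd_pos' (WZ ZM (xiL z) z) ltac:(lra)) as G1. fold (UZ ZM (xiL z) z) in G1.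
      assert (Ha' : - (PI / 2) <= snd (WZ ZA l0 z) <= 0) by lra.
      destruct (Req_dec (snd (WZ ZA l0 z)) 0) as [Z0|Z0].
      * pose proof (cexp_snd0 _ (or_introl Z0)) as G2. fold (UZ ZA l0 z) in G2. lra.
      * pose proof (cexp_snd_neg (WZ ZA l0 z) ltac:(lra)) as G2. fold (UZ ZA l0 z) in G2. lra.
    + replace (l0 + (-1)%R * tpi)%C with (l0 - tpi)%C in * by (rewrite RtoC_m1; ring).
      rewrite XZ_dn in HX. rewrite UZ_dn in Hw. right. exists (xiL z - tpi)%C. vsimp.
      split; [rewrite cexp_minus, cexp_tpi, EX; field; exact RtoC1_neq0|].
      rewrite XZ_dn, UZ_dn, ang_dn. vsimp. split; [rewrite HX, EP; field; assumption|].
      split.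
      * rewrite Hw, E. vsimp. rewrite <- two_div_Ci. field. repeat split; assumption.
      * split; [lra|]. assert (G : snd (WZ ZM (xiL z) z) <= - PI); [|lra]. apply Rnot_lt_le. intros L.
        pose proof (cexp_snd_neg (WZ ZM (xiL z) z) ltac:(lra)) as G1. fold (UZ ZM (xiL z) z) in G1.
        destruct (Req_dec (snd (WZ ZA l0 z)) 0) as [Z0|Z0].
        -- pose proof (cexp_snd0 _ (or_introl Z0)) as G2. fold (UZ ZA l0 z) in G2. lra.
        -- pose proof (cexp_snd_pos (WZ ZA l0 z) ltac:(lra)) as G2. fold (UZ ZA l0 z) in G2. lra.
  - intros [(l & Hl & HX & Hw & Ha)|(l & Hl & HX & Hw & Ha)]; vsimp; rewrite <- EX in Hl; apply cexp_inj in Hl; destruct Hl as [k ->];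
      rewrite ang_shift in Ha; vsimp.
    + assert (Hk : (-1 < k < 1)%Z) by (apply (Z_range k (-1) 1 (5 * (PI / 4))); lra).
      assert (k = 0%Z) by lia. subst k. rewrite add_0_tpi in *. exists l0. vsimp.
      split; [exact EL|]. split; [rewrite EP; exact HX|]. split; [rewrite Hw, E; ring|].
      split; [lra|]. apply Rnot_lt_le. intros L.
      pose proof (cexp_snd_pos (WZ ZA l0 z) ltac:(lra)) as G1. fold (UZ ZA l0 z) in G1.
      destruct (Req_dec (snd (WZ ZM (xiL z) z)) (- PI)) as [Z0|Z0].
      * pose proof (cexp_snd0 _ (or_intror (or_intror Z0))) as G2. fold (UZ ZM (xiL z) z) in G2. lra.
      * pose proof (cexp_snd_neg (WZ ZM (xiL z) z) ltac:(lra)) as G2. fold (UZ ZM (xiL z) z) in G2. lra.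
    + assert (Hk : (-2 < k < 0)%Z) by (apply (Z_range k (-2) 0 (5 * (PI / 4))); lra).
      assert (k = (-1)%Z) by lia. subst k.
      replace (xiL z + (-1)%R * tpi)%C with (xiL z - tpi)%C in * by (rewrite RtoC_m1; ring).
      rewrite XZ_dn in HX. rewrite UZ_dn in Hw. exists (l0 - tpi)%C. vsimp.
      split; [rewrite cexp_minus, cexp_tpi, EL; field; exact RtoC1_neq0|].
      rewrite XZ_dn, UZ_dn, ang_dn. vsimp. split; [rewrite HX, EP; field; assumption|].
      split.
      * rewrite Hw, E. vsimp. rewrite <- two_div_Ci. field. repeat split; assumption.
      * split; [|lra]. assert (G : 0 <= snd (WZ ZA l0 z)); [|lra]. apply Rnot_lt_le. intros L.
        pose proof (cexp_snd_neg (WZ ZA l0 z) ltac:(lra)) as G1. fold (UZ ZA l0 z) in G1.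
        destruct (Req_dec (snd (WZ ZM (xiL z) z)) (- PI)) as [Z0|Z0].
        -- pose proof (cexp_snd0 _ (or_intror (or_intror Z0))) as G2. fold (UZ ZM (xiL z) z) in G2. lra.
        -- pose proof (cexp_snd_pos' (WZ ZM (xiL z) z) ltac:(lra)) as G2. fold (UZ ZM (xiL z) z) in G2. lra.
Qed.

(** As on the left arc, with the shifted sheet now obtained by a turn around 1. *)
Lemma transfer_BM e X w : Cmod e = 1 -> 0 <= fst e ->
  Val VB (zR e) X w <-> (Val VM (zR e) X w \/ Val VC (zR e) X w).
Proof.
  intros He Hf. pose proof PI_bounds. destruct (right_in e He Hf) as (I1 & I2 & O1 & O2 & EX & EL).
  destruct (right_angles e He Hf) as [A1 A2]. destruct (right_W e He Hf) as (E & _). cbv zeta in *. set (z := zR e) in *.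
  set (l0 := lM1 (xiR z) z) in *.
  assert (EP : XZ ZB l0 z = XZ ZM (xiR z) z) by (unfold XZ; simpl PZ; rewrite PM_xiR; reflexivity).
  change (cexp (WZ ZB l0 z)) with (UZ ZB l0 z) in E. change (cexp (WZ ZM (xiR z) z)) with (UZ ZM (xiR z) z) in E.
  assert (ES : snd (UZ ZB l0 z) = snd (UZ ZM (xiR z) z)) by (rewrite E; generalize (UZ ZM (xiR z) z); intros u; simpl; ring).
  pose proof two_two_i_neq0. pose proof RtoC1_neq0.
  split.
  - intros (l & Hl & HX & Hw & Ha). vsimp. rewrite <- EL in Hl. apply cexp_inj in Hl. destruct Hl as [k ->].
    rewrite ang_shift in Ha. vsimp.
    assert (Hk : (-1 < k < 2)%Z) by (apply (Z_range k (-1) 2 (PI / 4)); lra).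
    assert (Hk' : k = 0%Z \/ k = 1%Z) by lia. destruct Hk' as [-> | ->].
    + rewrite add_0_tpi in *. left. exists (xiR z). vsimp.
      split; [exact EX|]. split; [rewrite <- EP; exact HX|]. split; [rewrite Hw, E; ring|].
      split; [lra|]. apply Rnot_lt_le. intros L.
      pose proof (cexp_snd_pos (WZ ZM (xiR z) z) ltac:(lra)) as G1. fold (UZ ZM (xiR z) z) in G1.
      destruct (Req_dec (snd (WZ ZB l0 z)) PI) as [Z0|Z0].
      * pose proof (cexp_snd0 _ (or_intror (or_introl Z0))) as G2. fold (UZ ZB l0 z) in G2. lra.
      * pose proof (cexp_snd_neg' (WZ ZB l0 z) ltac:(lra)) as G2. fold (UZ ZB l0 z) in G2. lra.
    + replace (l0 + 1 * tpi)%C with (l0 + tpi)%C in * by ring.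
      rewrite XZ_up in HX. rewrite UZ_up in Hw. right. exists (xiR z). vsimp.
      split; [exact EX|]. split; [rewrite HX, EP; field; assumption|].
      split; [rewrite Hw, E; ring|].
      split; [|lra]. apply Rnot_lt_le. intros L.
      pose proof (cexp_snd_neg (WZ ZM (xiR z) z) ltac:(lra)) as G1. fold (UZ ZM (xiR z) z) in G1.
      destruct (Req_dec (snd (WZ ZB l0 z)) PI) as [Z0|Z0].
      * pose proof (cexp_snd0 _ (or_intror (or_introl Z0))) as G2. fold (UZ ZB l0 z) in G2. lra.
      * pose proof (cexp_snd_pos (WZ ZB l0 z) ltac:(lra)) as G2. fold (UZ ZB l0 z) in G2. lra.
  - intros [(l & Hl & HX & Hw & Ha)|(l & Hl & HX & Hw & Ha)]; vsimp; rewrite <- EX in Hl; apply cexp_inj in Hl; destruct Hl as [k ->];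
      rewrite ang_shift in Ha; vsimp.
    + assert (Hk : (-1 < k < 1)%Z) by (apply (Z_range k (-1) 1 (5 * (PI / 4))); lra).
      assert (k = 0%Z) by lia. subst k. rewrite add_0_tpi in *. exists l0. vsimp.
      split; [exact EL|]. split; [rewrite EP; exact HX|]. split; [rewrite Hw, E; ring|].
      split; [|lra]. apply Rnot_lt_le. intros L.
      pose proof (cexp_snd_pos (WZ ZB l0 z) ltac:(lra)) as G1. fold (UZ ZB l0 z) in G1.
      destruct (Req_dec (snd (WZ ZM (xiR z) z)) 0) as [Z0|Z0].
      * pose proof (cexp_snd0 _ (or_introl Z0)) as G2. fold (UZ ZM (xiR z) z) in G2. lra.
      * pose proof (cexp_snd_neg (WZ ZM (xiR z) z) ltac:(lra)) as G2. fold (UZ ZM (xiR z) z) in G2. lra.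
    + assert (Hk : (-1 < k < 1)%Z) by (apply (Z_range k (-1) 1 (5 * (PI / 4))); lra).
      assert (k = 0%Z) by lia. subst k. rewrite add_0_tpi in *. exists (l0 + tpi)%C. vsimp.
      split; [rewrite cexp_plus, cexp_tpi, EL; ring|].
      rewrite XZ_up, UZ_up, ang_up. vsimp. split; [rewrite HX, EP; field; assumption|].
      split; [rewrite Hw, E; ring|].
      split; [lra|]. assert (G : snd (WZ ZB l0 z) <= PI); [|lra]. apply Rnot_lt_le. intros L.
      pose proof (cexp_snd_neg' (WZ ZB l0 z) ltac:(lra)) as G1. fold (UZ ZB l0 z) in G1.
      destruct (Req_dec (snd (WZ ZM (xiR z) z)) 0) as [Z0|Z0].
      * pose proof (cexp_snd0 _ (or_introl Z0)) as G2. fold (UZ ZM (xiR z) z) in G2. lra.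
      * pose proof (cexp_snd_pos (WZ ZM (xiR z) z) ltac:(lra)) as G2. fold (UZ ZM (xiR z) z) in G2. lra.
Qed.

Lemma AB_point z : inZ ZA z -> inZ ZB z -> exists s, Rabs s <= 1 /\ z = seg_pt s.
Proof.
  intros [H1 H2] [H3 _]. apply normsq_le in H2; [|lra]. exists (3/2 * snd z).
  assert (E : fst z = 1/2) by lra. split.
  - unfold normsq in H2; simpl in H2. rewrite E in H2. apply Rabs_le. split; nra.
  - apply C_eq; unfold seg_pt; simpl; lra.
Qed.

Lemma AM_point z : inZ ZA z -> inZ ZM z -> exists e, Cmod e = 1 /\ 0 <= fst e /\ z = zL e.
Proof.
  intros [H1 H2] H3. exists ((3/4)%R * (1 - 2 * z))%C. cbn [inZ] in H3. split; [|split].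
  - rewrite Cmod_mult, Cmod_R, Rabs_pos_eq by lra. replace (Cmod (1 - 2 * z)) with (4/3) by lra. field.
  - simpl. lra.
  - unfold zL, arc_z. apply C_eq; simpl; field.
Qed.

Lemma BM_point z : inZ ZB z -> inZ ZM z -> exists e, Cmod e = 1 /\ 0 <= fst e /\ z = zR e.
Proof.
  intros [H1 H2] H3. exists ((-3/4)%R * (1 - 2 * z))%C. cbn [inZ] in H3. split; [|split].
  - rewrite Cmod_mult, Cmod_R, Rabs_left by lra. replace (Cmod (1 - 2 * z)) with (4/3) by lra. field.
  - simpl. lra.
  - unfold zR, arc_z. apply C_eq; simpl; field.
Qed.

Lemma Val_transfer V Z' z X w : inZ (zoneof V) z -> inZ Z' z -> Val V z X w ->
  exists V', zoneof V' = Z' /\ Val V' z X w.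
Proof.
  intros H1 H2 HV. destruct V, Z'; cbn [zoneof] in H1;
    try (eexists; split; [|exact HV]; reflexivity).
  - destruct (AB_point z H1 H2) as (s & Hs & ->). exists VB. split; [reflexivity|]. apply transfer_AB; assumption.
  - destruct (AM_point z H1 H2) as (e & He & Hf & ->). apply transfer_AM in HV; [|assumption..].
    destruct HV as [HV|HV]; eexists; (split; [|exact HV]; reflexivity).
  - destruct (AB_point z H2 H1) as (s & Hs & ->). exists VA. split; [reflexivity|]. apply transfer_AB; assumption.
  - destruct (BM_point z H1 H2) as (e & He & Hf & ->). apply transfer_BM in HV; [|assumption..].
    destruct HV as [HV|HV]; eexists; (split; [|exact HV]; reflexivity).
  - destruct (AM_point z H2 H1) as (e & He & Hf & ->). exists VA. split; [reflexivity|]. apply transfer_AM; auto.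
  - destruct (BM_point z H2 H1) as (e & He & Hf & ->). exists VB. split; [reflexivity|]. apply transfer_BM; auto.
  - destruct (AM_point z H2 H1) as (e & He & Hf & ->). exists VA. split; [reflexivity|]. apply transfer_AM; auto.
  - destruct (BM_point z H2 H1) as (e & He & Hf & ->). exists VB. split; [reflexivity|]. apply transfer_BM; auto.
Qed.

Lemma cexp_surj (z : C) : z <> 0%C -> exists l, cexp l = z.
Proof.
  intros H.
  assert (E2 : cexp (Ci * (PI / 2)%R)%C = Ci).
  { unfold cexp. apply C_eq; simpl.
    - replace (0 * (PI / 2) - 1 * 0) with 0 by ring. replace (0 * 0 + 1 * (PI / 2)) with (PI / 2) by ring. rewrite cos_PI2; ring.
    - replace (0 * (PI / 2) - 1 * 0) with 0 by ring. replace (0 * 0 + 1 * (PI / 2)) with (PI / 2) by ring. rewrite sin_PI2, exp_0; ring. }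
  pose proof Ci_neq0 as HC.
  destruct (Rtotal_order (fst z) 0) as [F|[F|F]].
  - exists (clog (- z) + Ci * PI)%C. rewrite cexp_plus, cexp_iPI, cexp_clog by (simpl; lra). ring.
  - destruct (Rtotal_order (snd z) 0) as [G|[G|G]].
    + exists (clog (Ci * z) - Ci * (PI / 2)%R)%C. rewrite cexp_minus, E2, cexp_clog by (simpl; lra). field. exact HC.
    + exfalso. apply H. apply C_eq; assumption.
    + exists (clog (- (Ci * z)) + Ci * (PI / 2)%R)%C. rewrite cexp_plus, E2, cexp_clog by (simpl; lra).
      transitivity (- (Ci * Ci) * z)%C; [ring|]. rewrite Ci_sqr. ring.
  - exists (clog z). apply cexp_clog, F.
Qed.

Lemma mod_shift (a lo c : R) : 0 < c -> exists k : Z, lo <= a + IZR k * c < lo + c.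
Proof.
  intros Hc. pose proof (archimed ((lo - a) / c)) as [A1 A2]. set (n := up ((lo - a) / c)) in *.
  assert (B1 : lo - a < IZR n * c).
  { replace (lo - a) with ((lo - a) / c * c) by (field; lra). apply Rmult_lt_compat_r; lra. }
  assert (B2 : (IZR n - 1) * c <= lo - a).
  { replace (lo - a) with ((lo - a) / c * c) by (field; lra). apply Rmult_le_compat_r; lra. }
  destruct (Req_dec ((IZR n - 1) * c) (lo - a)) as [E|E].
  - exists (n - 1)%Z. rewrite minus_IZR. nra.
  - exists n. nra.
Qed.

Lemma cexp_shift l (k : Z) : cexp (l + IZR k * tpi) = cexp l.
Proof.
  rewrite cexp_plus.
  assert (S : sin (IZR k * PI) = 0) by (apply sin_eq_0_1; exists k; reflexivity).
  assert (E : (IZR k * tpi)%C = (0, 2 * (IZR k * PI))%R) by (unfold tpi; apply C_eq; simpl; ring).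
  rewrite E. replace (cexp (0, 2 * (IZR k * PI))%R) with (RtoC 1); [ring|].
  unfold cexp; apply C_eq; simpl fst; simpl snd; rewrite exp_0.
  - rewrite cos_2a_sin, S. ring.
  - rewrite sin_2a, S. ring.
Qed.

Lemma inZ_cases z : exists Z, inZ Z z.
Proof.
  destruct (Rle_dec (4/3) (Cmod (1 - 2 * z))) as [H|H]; [exists ZM; exact H|].
  destruct (Rle_dec (fst z) (1/2)) as [H'|H'].
  - exists ZA. split; lra.
  - exists ZB. split; lra.
Qed.

(** The sectors of the vertices lying over one puncture fill a whole period |[rateZ]|, so some
    branch of the logarithm falls into one of them. *)
Lemma Val_exists (z : C) : z <> 0%C -> (1 - z)%C <> 0%C -> exists V X w, inZ (zoneof V) z /\ Val V z X w.
Proof.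
  intros H0 H1. pose proof PI_bounds. destruct (inZ_cases z) as [Zo HZ].
  assert (Hz : zeta Zo z <> 0%C).
  { destruct Zo; cbn [zeta]; try assumption. apply (inZM_mod z HZ). }
  destruct (cexp_surj _ Hz) as [l Hl].
  assert (HV : forall (V : vertex) (k : Z), zoneof V = Zo ->
    vlo V <= snd (WZ Zo l z) + IZR k * rateZ Zo <= vhi V -> exists V X w, inZ (zoneof V) z /\ Val V z X w).
  { intros V k <- Hk. exists V. eexists. eexists. split; [exact HZ|].
    exists (l + IZR k * tpi)%C. split; [rewrite cexp_shift; exact Hl|]. split; [reflexivity|]. split; [reflexivity|].
    rewrite ang_shift. exact Hk. }
  destruct Zo.
  - destruct (mod_shift (snd (WZ ZA l z)) (- (PI / 2)) (PI / 2)) as [k Hk]; [lra|].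
    apply (HV VA k eq_refl). cbn [vlo vhi rateZ]. lra.
  - destruct (mod_shift (snd (WZ ZB l z)) PI (PI / 4)) as [k Hk]; [lra|].
    apply (HV VB k eq_refl). cbn [vlo vhi rateZ]. lra.
  - destruct (mod_shift (snd (WZ ZM l z)) (- PI) (5 * (PI / 4))) as [k Hk]; [lra|].
    destruct (Rle_dec (snd (WZ ZM l z) + IZR k * (5 * (PI / 4))) 0) as [D|D].
    (* [rateZ ZM] is negative, hence the opposite number of turns. *)
    + apply (HV VM (- k)%Z eq_refl). rewrite opp_IZR. cbn [vlo vhi rateZ]. lra.
    + apply (HV VC (- k)%Z eq_refl). rewrite opp_IZR. cbn [vlo vhi rateZ]. lra.
Qed.

Lemma XZ_neq0 Z l z : XZ Z l z <> 0%C.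
Proof. unfold XZ. apply Cmult_neq_0; [exact mm_neq0|apply cexp_neq0]. Qed.
Lemma vscale_neq0 V : vscale V <> 0%C.
Proof. destruct V; try exact RtoC1_neq0. exact two_two_i_neq0. Qed.

(** * Bounds on the position and on S x *)

Definition nuZ (Z : zone) : C := match Z with ZA => al | ZB => be | ZM => ga end.
Definition argZ (Z : zone) (l : C) : C := match Z with ZM => (- l)%C | _ => l end.
Definition bZ (Z : zone) (z : C) : C :=
  match Z with
  | ZA => (be * clog (1 - z))%C
  | ZB => (al * clog z)%C
  | ZM => (al * (Ci * PI - ln 2 + clog (1 - qM z)) + be * (clog (1 + qM z) - ln 2))%C
  end.

Lemma PZ_decomp Z l z : PZ Z l z = (kapZ Z * l + bZ Z z)%C.
Proof. destruct Z; unfold PZ, PA, PB, PM, lM0, lM1, kapZ, bZ; ring. Qed.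

(** Only the logarithm of the coordinate is unbounded in a zone. At infinity the exponent al + be -
    1 equals - ga, and [argZ] changes the sign of the logarithm, so that its real part is at most 0
    in all three zones. *)
Lemma WZ_decomp Z l z : WZ Z l z = (nuZ Z * argZ Z l + (bZ Z z + clog (uZ Z z) - lZ Z))%C.
Proof.
  unfold WZ. rewrite PZ_decomp. generalize (clog (uZ Z z)) (lZ Z) (bZ Z z). intros a b c.
  destruct Z; unfold kapZ, nuZ, argZ, epsZ; [ring|ring|]. rewrite <- ga_eq. ring.
Qed.

Lemma nuZ_pos Z : 0 < fst (nuZ Z).
Proof. destruct Z; simpl; lra. Qed.

Lemma ln4_le : ln 4 <= 2.
Proof. pose proof ln2_bounds. replace 4 with (2 * 2) by ring. rewrite ln_mult by lra. lra. Qed.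

Lemma clog_mod v : 1/16 <= normsq v <= 4 -> Cmod (clog v) <= 4.
Proof.
  intros [H1 H2]. pose proof PI_bounds. pose proof ln2_bounds. pose proof (clog_bound v) as Hb. pose proof ln4_le.
  assert (A : ln (normsq v) <= ln 4) by (destruct H2 as [H2| ->]; [left; apply ln_increasing; lra|right; reflexivity]).
  assert (B : ln (1/16) <= ln (normsq v)) by (destruct H1 as [H1| <-]; [left; apply ln_increasing; lra|right; reflexivity]).
  replace (1/16) with (/ (4 * 4)) in B by field. rewrite ln_Rinv, ln_mult in B by lra.
  eapply Rle_trans; [apply Cmod_l1|].
  assert (Rabs (snd (clog v)) <= 1.6) by (apply Rabs_le; lra).
  assert (Rabs (fst (clog v)) <= 2) by (unfold clog; cbn [fst]; apply Rabs_le; lra). lra.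
Qed.

Lemma normsq_near (v : C) : 1/4 <= fst v -> Cmod v <= 2 -> 1/16 <= normsq v <= 4.
Proof.
  intros H1 H2. apply normsq_le in H2; [|lra]. split; [|lra]. unfold normsq in *. nra.
Qed.

Lemma bZ_bound Z : exists B, forall z, inZ Z z -> Cmod (bZ Z z) <= B.
Proof.
  destruct Z.
  - exists (Cmod be * 4). intros z Hz. pose proof (inZA_mod z Hz) as Hm. cbn [bZ]. rewrite Cmod_mult.
    apply Rmult_le_compat_l; [apply Cmod_ge_0|]. apply clog_mod, normsq_near.
    + destruct Hz as [Hz _]. rewrite fst_one_minus. lra.
    + unfold Cminus. eapply Rle_trans; [apply Cmod_triangle|]. rewrite Cmod_opp, Cmod_1. lra.
  - exists (Cmod al * 4). intros z Hz. pose proof (inZB_mod z Hz) as Hm. cbn [bZ]. rewrite Cmod_mult.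
    apply Rmult_le_compat_l; [apply Cmod_ge_0|]. apply clog_mod, normsq_near.
    + destruct Hz as [Hz _]. lra.
    + replace z with (1 - (1 - z))%C by ring. unfold Cminus at 1. eapply Rle_trans; [apply Cmod_triangle|]. rewrite Cmod_opp, Cmod_1. lra.
  - exists (Cmod al * (Cmod (Ci * PI - ln 2) + 4) + Cmod be * (4 + Cmod (ln 2))). intros z Hz.
    pose proof (inZM_mod z Hz) as [_ Hm]. cbn [bZ]. pose proof (abs_fst_le_Cmod (qM z)) as Hf.
    assert (Hf' : Rabs (fst (qM z)) <= 3/4) by lra. apply Rabs_le_between in Hf'.
    assert (A : Cmod (clog (1 - qM z)) <= 4).
    { apply clog_mod, normsq_near.
      - rewrite fst_one_minus. lra.
      - unfold Cminus. eapply Rle_trans; [apply Cmod_triangle|]. rewrite Cmod_opp, Cmod_1. lra. }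
    assert (B : Cmod (clog (1 + qM z)) <= 4).
    { apply clog_mod, normsq_near.
      - change (1/4 <= 1 + fst (qM z)). lra.
      - eapply Rle_trans; [apply Cmod_triangle|]. rewrite Cmod_1. lra. }
    eapply Rle_trans; [apply Cmod_triangle|]. rewrite !Cmod_mult. apply Rplus_le_compat; apply Rmult_le_compat_l; try apply Cmod_ge_0.
    + eapply Rle_trans; [apply Cmod_triangle|]. lra.
    + unfold Cminus. eapply Rle_trans; [apply Cmod_triangle|]. rewrite Cmod_opp. lra.
Qed.

Lemma uZ_near Z z : inZ Z z -> Cmod (uZ Z z - 1) < 1.
Proof.
  intros H. destruct Z; cbn [uZ].
  - apply hA_near, inZA_mod, H.
  - apply hB_near, inZB_mod, H.
  - apply hM_near, inZM_mod, H.
Qed.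

Lemma uZ_Cmod Z z : inZ Z z -> Cmod (uZ Z z) <= 2.
Proof.
  intros H. apply uZ_near in H. replace (uZ Z z) with (1 + (uZ Z z - 1))%C by ring.
  eapply Rle_trans; [apply Cmod_triangle|]. rewrite Cmod_1. lra.
Qed.

Lemma clog_uZ Z z : inZ Z z -> fst (clog (uZ Z z)) <= 2 /\ Rabs (snd (clog (uZ Z z))) <= 2.
Proof.
  intros H. pose proof PI_bounds. pose proof (clog_bound (uZ Z z)). split; [|apply Rabs_le; lra].
  pose proof (uZ_Cmod Z z H) as H2. apply uZ_near, Cmod_lt1_fst in H.
  apply normsq_le in H2; [|lra]. unfold clog; cbn [fst]. pose proof ln4_le.
  assert (P : 0 < normsq (uZ Z z)) by (apply normsq_pos, fst_pos_neq0, H).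
  assert (A : ln (normsq (uZ Z z)) <= ln 4); [|lra].
  destruct (Rle_lt_or_eq_dec (normsq (uZ Z z)) 4) as [L|L]; [lra|left; apply ln_increasing; lra|rewrite L; lra].
Qed.

(* When [nu * u] rotates by a bounded angle, [snd u] is tied to [fst u], and then
   [fst (nu * u)] is [(|nu|^2 / fst nu) * fst u] up to a bounded error. *)
Lemma lin_bound (nu u b : C) c : 0 < fst nu -> Rabs (snd (nu * u + b)%C) <= c -> Rabs (snd b) <= c -> fst b <= c ->
  fst u <= 0 -> fst (nu * u + b)%C <= c + Rabs (snd nu) * (2 * c) / fst nu.
Proof.
  intros Hn H1 H2 H3 Hu. simpl in *. destruct nu as [n1 n2], u as [u1 u2], b as [b1 b2]; simpl in *.
  apply Rmult_le_reg_l with n1; [exact Hn|].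
  replace (n1 * (c + Rabs n2 * (2 * c) / n1)) with (n1 * c + Rabs n2 * (2 * c)) by (field; lra).
  set (S := n1 * u2 + n2 * u1 + b2) in *.
  replace (n1 * (n1 * u1 - n2 * u2 + b1)) with ((n1 * n1 + n2 * n2) * u1 + n1 * b1 - n2 * (S - b2)) by (unfold S; ring).
  assert (A : - (n2 * (S - b2)) <= Rabs n2 * (2 * c)).
  { eapply Rle_trans; [apply Rle_abs|]. rewrite Rabs_Ropp, Rabs_mult. apply Rmult_le_compat_l; [apply Rabs_pos|].
    apply Rabs_le. apply Rabs_le_between in H1. apply Rabs_le_between in H2. lra. }
  assert (B : (n1 * n1 + n2 * n2) * u1 <= 0) by nra.
  assert (n1 * b1 <= n1 * c) by nra. lra.
Qed.

(** The same balance solved for the imaginary part: as nu has positive real part, a bounded angle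
    and a bounded real part of the logarithm leave no room for winding. *)
Lemma lin_bound2 (nu u b : C) c c' : 0 < fst nu -> Rabs (snd (nu * u + b)%C) <= c -> Rabs (snd b) <= c ->
  Rabs (fst u) <= c' -> Rabs (snd u) <= (2 * c + Rabs (snd nu) * c') / fst nu.
Proof.
  intros Hn H1 H2 H3. simpl in *. destruct nu as [n1 n2], u as [u1 u2], b as [b1 b2]; simpl in *.
  apply Rmult_le_reg_r with n1; [exact Hn|].
  replace ((2 * c + Rabs n2 * c') / n1 * n1) with (2 * c + Rabs n2 * c') by (field; lra).
  rewrite <- (Rabs_pos_eq n1) at 1 by lra. rewrite <- Rabs_mult.
  replace (u2 * n1) with ((n1 * u2 + n2 * u1 + b2) - b2 - n2 * u1) by ring.
  assert (A : Rabs (n2 * u1) <= Rabs n2 * c') by (rewrite Rabs_mult; apply Rmult_le_compat_l; [apply Rabs_pos|exact H3]).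
  apply Rabs_le. apply Rabs_le_between in H1. apply Rabs_le_between in H2. apply Rabs_le_between in A. lra.
Qed.

Definition restb (Z : zone) (B : R) : R := B + 2 + Cmod (lZ Z) + 4.

Lemma rest_bound Z z B : inZ Z z -> Cmod (bZ Z z) <= B ->
  Rabs (snd (bZ Z z + clog (uZ Z z) - lZ Z)%C) <= restb Z B /\ fst (bZ Z z + clog (uZ Z z) - lZ Z)%C <= restb Z B.
Proof.
  intros Hz HB. destruct (clog_uZ Z z Hz) as [U1 U2]. unfold restb.
  pose proof (abs_fst_le_Cmod (bZ Z z)) as A1. pose proof (abs_snd_le_Cmod (bZ Z z)) as A2.
  pose proof (abs_fst_le_Cmod (lZ Z)) as A3. pose proof (abs_snd_le_Cmod (lZ Z)) as A4.
  set (m := Cmod (lZ Z)) in *. set (n := Cmod (bZ Z z)) in *. clearbody m n.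
  set (l := lZ Z) in *. set (b := bZ Z z) in *. set (u := clog (uZ Z z)) in *. clearbody l b u. simpl. apply Rabs_le_between in A1, A2, A3, A4, U2. split; [apply Rabs_le|]; lra.
Qed.

Lemma vang_bound V t : vlo V <= t <= vhi V -> Rabs t <= 4.
Proof. pose proof PI_bounds. destruct V; cbn [vlo vhi]; intros H'; apply Rabs_le; lra. Qed.

Lemma fst_log_le l (z : C) r : cexp l = z -> Cmod z <= r -> fst l <= r - 1.
Proof.
  intros <- H. rewrite Cmod_cexp in H. pose proof (exp_ineq1_le (fst l)). lra.
Qed.

Lemma fst_log_le0 l (z : C) : cexp l = z -> Cmod z <= 1 -> fst l <= 0.
Proof.
  intros <- H. rewrite Cmod_cexp in H. apply Rnot_lt_le. intros L. apply exp_increasing in L. rewrite exp_0 in L. lra.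
Qed.

Lemma fst_log_ge l (z : C) r : cexp l = z -> 0 < r -> / r <= Cmod z -> - (r - 1) <= fst l.
Proof.
  intros <- Hr H. rewrite Cmod_cexp in H. pose proof (exp_ineq1_le (- fst l)).
  rewrite exp_Ropp in *. apply Rinv_le_contravar in H; [|apply Rinv_0_lt_compat, Hr]. rewrite Rinv_inv in H. lra.
Qed.

Lemma argZ_le Z l z : cexp l = zeta Z z -> inZ Z z -> fst (argZ Z l) <= 0.
Proof.
  intros Hl Hz. destruct Z; cbn [zeta argZ] in *.
  - apply (fst_log_le0 l _ Hl). pose proof (inZA_mod z Hz). lra.
  - apply (fst_log_le0 l _ Hl). pose proof (inZB_mod z Hz). lra.
  - pose proof (fst_log_ge l _ (3/4) Hl ltac:(lra)) as H. cbn [inZ] in Hz. simpl. simpl in H, Hz. lra.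
Qed.

(** With a complex exponent, |exp (nu l)| is not controlled by |z| alone, since [l] may wind. The
    angle restriction in [Val] ties the winding to the real part of [l], and [lin_bound]
    concludes. *)
Lemma pos_bound_V V : exists D, forall z X w, inZ (zoneof V) z -> Val V z X w -> Cmod w <= D.
Proof.
  destruct (bZ_bound (zoneof V)) as [B HB].
  set (c := restb (zoneof V) B).
  exists (Cmod (vpos V) + Cmod (vscale V) * exp (c + Rabs (snd (nuZ (zoneof V))) * (2 * c) / fst (nuZ (zoneof V)))).
  intros z X w Hz (l & Hl & HX & Hw & Ha). specialize (HB z Hz). destruct (rest_bound (zoneof V) z B Hz HB) as [R1 R2].
  apply vang_bound in Ha. rewrite Hw. eapply Rle_trans; [apply Cmod_triangle|]. apply Rplus_le_compat_l. rewrite Cmod_mult.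
  apply Rmult_le_compat_l; [apply Cmod_ge_0|]. unfold UZ. rewrite Cmod_cexp.
  assert (Hc : 4 <= c).
  { unfold c, restb. pose proof (Cmod_ge_0 (lZ (zoneof V))). pose proof (Cmod_ge_0 (bZ (zoneof V) z)). lra. }
  apply Rnot_lt_le. intros L. apply exp_lt_inv in L. revert L. apply Rle_not_lt.
  rewrite WZ_decomp in *. apply lin_bound; [apply nuZ_pos|fold c; lra|exact R1|exact R2|].
  apply (argZ_le (zoneof V) l z Hl Hz).
Qed.

Lemma pos_bound : exists D, forall V z X w, inZ (zoneof V) z -> Val V z X w -> Cmod w <= D.
Proof.
  destruct (pos_bound_V VA) as [DA HA]. destruct (pos_bound_V VB) as [DB HB].
  destruct (pos_bound_V VM) as [DM HM]. destruct (pos_bound_V VC) as [DC HC].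
  exists (Rmax (Rmax DA DB) (Rmax DM DC)).
  pose proof (Rmax_l (Rmax DA DB) (Rmax DM DC)). pose proof (Rmax_r (Rmax DA DB) (Rmax DM DC)).
  pose proof (Rmax_l DA DB). pose proof (Rmax_r DA DB). pose proof (Rmax_l DM DC). pose proof (Rmax_r DM DC).
  intros [] z X w Hz HV; [specialize (HA z X w Hz HV)|specialize (HB z X w Hz HV)|specialize (HM z X w Hz HV)|specialize (HC z X w Hz HV)]; lra.
Qed.

(* A compact part of the quotient sphere that every orbit crossing from one
   puncture to another has to meet. *)
Definition Good (z : C) : Prop := 1/6 <= Cmod z /\ 1/6 <= Cmod (1 - z) /\ Cmod (1 - 2 * z) <= 4/3.

Lemma log_bound_Good Z l z : Good z -> inZ Z z -> cexp l = zeta Z z -> Rabs (fst l) <= 5.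
Proof.
  intros (G1 & G2 & G3) Hz Hl. apply Rabs_le. destruct Z; cbn [zeta] in *.
  - pose proof (inZA_mod z Hz). pose proof (fst_log_le0 l _ Hl). pose proof (fst_log_ge l _ 6 Hl). lra.
  - pose proof (inZB_mod z Hz). pose proof (fst_log_le0 l _ Hl). pose proof (fst_log_ge l _ 6 Hl). lra.
  - pose proof (fst_log_ge l _ (3/4) Hl ltac:(lra)) as H. pose proof (fst_log_le l _ _ Hl G3). cbn [inZ] in Hz.
    replace (/ (3/4)) with (4/3) in H by field. specialize (H Hz). lra.
Qed.

(** Up to bounded factors X is the exponential of - [kapZ] l. On [Good] the real part of [l] is
    bounded, and the angle restriction then bounds [l] itself. *)
Lemma X_bound_V V : exists D, forall z X w, Good z -> inZ (zoneof V) z -> Val V z X w -> Cmod X <= D.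
Proof.
  destruct (bZ_bound (zoneof V)) as [B HB].
  set (c := restb (zoneof V) B).
  set (lb := 5 + (2 * c + Rabs (snd (nuZ (zoneof V))) * 5) / fst (nuZ (zoneof V))).
  exists (Cmod mm * exp (Cmod (kapZ (zoneof V)) * lb + B) * / Cmod (vscale V)).
  intros z X w HG Hz (l & Hl & HX & Hw & Ha). specialize (HB z Hz). destruct (rest_bound (zoneof V) z B Hz HB) as [R1 R2].
  apply vang_bound in Ha. pose proof (log_bound_Good (zoneof V) l z HG Hz Hl) as Hf.
  assert (Hc : 4 <= c).
  { unfold c, restb. pose proof (Cmod_ge_0 (lZ (zoneof V))). pose proof (Cmod_ge_0 (bZ (zoneof V) z)). lra. }
  assert (Hlb : Cmod l <= lb).
  { eapply Rle_trans; [apply Cmod_l1|]. unfold lb. apply Rplus_le_compat; [exact Hf|].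
    assert (E1 : Rabs (snd l) = Rabs (snd (argZ (zoneof V) l))) by (destruct (zoneof V); cbn [argZ]; try reflexivity; simpl; rewrite Rabs_Ropp; reflexivity).
    assert (E2 : Rabs (fst (argZ (zoneof V) l)) <= 5) by (destruct (zoneof V); cbn [argZ]; try exact Hf; simpl; rewrite Rabs_Ropp; exact Hf).
    rewrite E1. rewrite WZ_decomp in Ha. eapply lin_bound2; [apply nuZ_pos| |exact R1|exact E2]. fold c. lra. }
  rewrite HX. unfold Cdiv. rewrite Cmod_mult, Cmod_inv by apply vscale_neq0.
  apply Rmult_le_compat_r; [left; apply Rinv_0_lt_compat, Cmod_gt_0, vscale_neq0|].
  unfold XZ. rewrite Cmod_mult. apply Rmult_le_compat_l; [apply Cmod_ge_0|]. rewrite Cmod_cexp.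
  apply Rnot_lt_le. intros L. apply exp_lt_inv in L. revert L. apply Rle_not_lt.
  eapply Rle_trans; [apply Rle_abs|]. eapply Rle_trans; [apply abs_fst_le_Cmod|]. rewrite Cmod_opp, PZ_decomp.
  eapply Rle_trans; [apply Cmod_triangle|]. rewrite Cmod_mult. apply Rplus_le_compat; [|exact HB].
  apply Rmult_le_compat_l; [apply Cmod_ge_0|exact Hlb].
Qed.

Lemma X_bound : exists D, forall V z X w, Good z -> inZ (zoneof V) z -> Val V z X w -> Cmod X <= D.
Proof.
  destruct (X_bound_V VA) as [DA HA]. destruct (X_bound_V VB) as [DB HB].
  destruct (X_bound_V VM) as [DM HM]. destruct (X_bound_V VC) as [DC HC].
  exists (Rmax (Rmax DA DB) (Rmax DM DC)).
  pose proof (Rmax_l (Rmax DA DB) (Rmax DM DC)). pose proof (Rmax_r (Rmax DA DB) (Rmax DM DC)).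
  pose proof (Rmax_l DA DB). pose proof (Rmax_r DA DB). pose proof (Rmax_l DM DC). pose proof (Rmax_r DM DC).
  intros [] z X w HG Hz HV; [specialize (HA z X w HG Hz HV)|specialize (HB z X w HG Hz HV)|specialize (HM z X w HG Hz HV)|specialize (HC z X w HG Hz HV)]; lra.
Qed.

Lemma cexp_diff_sign w : fst (cexp w) - snd (cexp w) = exp (fst w) * (cos (snd w + PI / 4) / cos (PI / 4)).
Proof.
  pose proof PI_bounds. assert (0 < cos (PI / 4)) by (apply cos_gt_0; lra).
  simpl. rewrite cos_plus, sin_cos_PI4. field. lra.
Qed.

Lemma cexp_diff_pos w : - (PI / 2) < snd w + PI / 4 < PI / 2 -> 0 < fst (cexp w) - snd (cexp w).
Proof.
  intros H. pose proof PI_bounds. rewrite cexp_diff_sign. apply Rmult_lt_0_compat; [apply exp_pos|].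
  apply Rdiv_lt_0_compat; apply cos_gt_0; lra.
Qed.
Lemma cexp_diff_neg w : PI / 2 < snd w + PI / 4 < 3 * (PI / 2) -> fst (cexp w) - snd (cexp w) < 0.
Proof.
  intros H. pose proof PI_bounds. rewrite cexp_diff_sign. assert (0 < cos (PI / 4)) by (apply cos_gt_0; lra).
  assert (A : cos (snd w + PI / 4) < 0) by (apply cos_lt_0; lra). pose proof (exp_pos (fst w)).
  assert (cos (snd w + PI / 4) / cos (PI / 4) < 0).
  { unfold Rdiv. pose proof (Rinv_0_lt_compat (cos (PI / 4)) ltac:(assumption)). nra. }
  nra.
Qed.
Lemma cexp_diff_pos' w : 3 * (PI / 2) < snd w + PI / 4 < 5 * (PI / 2) -> 0 < fst (cexp w) - snd (cexp w).
Proof.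
  intros H. pose proof PI_bounds. rewrite cexp_diff_sign. apply Rmult_lt_0_compat; [apply exp_pos|].
  apply Rdiv_lt_0_compat; [|apply cos_gt_0; lra].
  replace (snd w + PI / 4) with (snd w + PI / 4 - 2 * PI + 2 * PI) by ring.
  rewrite cos_plus, cos_2PI, sin_2PI. assert (0 < cos (snd w + PI / 4 - 2 * PI)) by (apply cos_gt_0; lra). lra.
Qed.

(* Crossings of the sides [0, - 2 i], [- 2 i, 2] and [0, 2] of the triangle; [w] and [w'] are
   the positions before and after in the old frame, and [Val] is stated in the new one. *)
Definition down1 (Z : zone) (z X w w' : C) : Prop :=
  0 <= fst w /\ fst w' < 0 /\ exists V, zoneof V = Z /\ Val V z (- (2) * Ci * X)%C (w' * (Ci / 2))%C.
Definition down2 (Z : zone) (z X w w' : C) : Prop :=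
  fst w - snd w <= 2 /\ 2 < fst w' - snd w' /\
  exists V, zoneof V = Z /\ Val V z ((2 + 2 * Ci) * X)%C (2 + (w' - 2) / (2 + 2 * Ci))%C.
Definition cross_up (Z : zone) (z X w w' : C) : Prop :=
  snd w <= 0 /\ 0 < snd w' /\ exists V, zoneof V = Z /\
  (Val V z (X * (Ci / 2))%C (- (2) * Ci * w')%C \/ Val V z (X / (2 + 2 * Ci))%C (2 + (2 + 2 * Ci) * (w' - 2))%C).
Definition stay (Z : zone) (z X w' : C) : Prop := exists V, zoneof V = Z /\ Val V z X w'.

Lemma le_from_cases (a : R) t t0 : (t = t0 -> a = 0) -> (t0 < t -> 0 < a) -> t0 <= t -> 0 <= a.
Proof. intros H1 H2 [H|H]; [left; auto|right; symmetry; auto]. Qed.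

(** A change of angle below pi / 8 is smaller than the narrowest sector, so at most one side is
    crossed, and the end of the sector that is overstepped tells which. At 0 and 2 the new reading
    is one turn away in the same chart; at 1 and - 2 i the roles of [VM] and [VC] are exchanged,
    with or without a turn. *)
Lemma step_cases V l z l' z' : cexp l' = zeta (zoneof V) z' ->
  let Z := zoneof V in let U := UZ Z l z in let U' := UZ Z l' z' in
  let w := (vpos V + vscale V * U)%C in let w' := (vpos V + vscale V * U')%C in
  let X' := (XZ Z l' z' / vscale V)%C in
  vlo V <= snd (WZ Z l z) <= vhi V -> Rabs (snd (WZ Z l' z') - snd (WZ Z l z)) < PI / 8 ->
  stay Z z' X' w' \/ down1 Z z' X' w w' \/ down2 Z z' X' w w' \/ cross_up Z z' X' w w'.
Proof.
  intros Hl' Z U U' w w' X' Ha Hd. pose proof PI_bounds. apply Rabs_lt_between in Hd.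
  pose proof RtoC2_neq0. pose proof Ci_neq0. pose proof two_two_i_neq0. pose proof RtoC1_neq0. pose proof one_i_neq0.
  assert (Hup : cexp (l' + tpi) = zeta (zoneof V) z') by (rewrite cexp_plus, cexp_tpi, Hl'; ring).
  assert (Hdn : cexp (l' - tpi) = zeta (zoneof V) z') by (rewrite cexp_minus, cexp_tpi, Hl'; field; assumption).
  subst Z U U' w w' X'.
  destruct (Rlt_le_dec (snd (WZ (zoneof V) l' z')) (vlo V)) as [L1|L1];
  [|destruct (Rle_lt_dec (snd (WZ (zoneof V) l' z')) (vhi V)) as [L2|L2]].
  2:{ left. exists V. split; [reflexivity|]. exists l'. repeat split; assumption. }
  - right. destruct V; cbn [vlo vhi zoneof zeta vpos vscale] in *.
    + left. split; [|split].
      * rewrite Cplus_0_l, Cmult_1_l. apply (le_from_cases _ (snd (WZ ZA l z)) (- (PI / 2))); [| |lra]; intros T; unfold UZ.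
        -- apply cexp_fst0. auto.
        -- apply cexp_fst_pos. lra.
      * rewrite Cplus_0_l, Cmult_1_l. apply cexp_fst_neg. lra.
      * exists VA. split; [reflexivity|]. exists (l' + tpi)%C. vsimp. split; [exact Hup|].
        rewrite XZ_up, UZ_up, ang_up. vsimp. split; [rewrite <- two_div_Ci; field; repeat split; assumption|]. split; [ring|lra].
    + right. right. split; [|split].
      * rewrite Cmult_1_l. change (0 + snd (UZ ZB l z) <= 0). rewrite Rplus_0_l.
        apply Ropp_le_cancel. rewrite Ropp_0. apply (le_from_cases _ (snd (WZ ZB l z)) PI); [| |lra]; intros T; unfold UZ.
        -- rewrite cexp_snd0 by auto. ring.
        -- assert (snd (cexp (WZ ZB l z)) < 0) by (apply cexp_snd_neg'; lra). lra.
      * rewrite Cmult_1_l. change (0 < 0 + snd (UZ ZB l' z')). rewrite Rplus_0_l. apply cexp_snd_pos. lra.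
      * exists VB. split; [reflexivity|]. right. exists (l' + tpi)%C. vsimp. split; [exact Hup|].
        rewrite XZ_up, UZ_up, ang_up. vsimp. split; [field; assumption|]. split; [cbn [vpos]; ring|lra].
    + right. right. split; [|split].
      * rewrite Cmult_1_l. change (0 + snd (UZ ZM l z) <= 0). rewrite Rplus_0_l.
        apply Ropp_le_cancel. rewrite Ropp_0. apply (le_from_cases _ (snd (WZ ZM l z)) (- PI)); [| |lra]; intros T; unfold UZ.
        -- rewrite cexp_snd0 by auto. ring.
        -- assert (snd (cexp (WZ ZM l z)) < 0) by (apply cexp_snd_neg; lra). lra.
      * rewrite Cmult_1_l. change (0 < 0 + snd (UZ ZM l' z')). rewrite Rplus_0_l. apply cexp_snd_pos'. lra.
      * exists VC. split; [reflexivity|]. left. exists (l' - tpi)%C. vsimp. split; [exact Hdn|].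
        rewrite XZ_dn, UZ_dn, ang_dn. vsimp. split; [field; assumption|]. split; [|lra].
        cbn [vpos]. rewrite <- two_div_Ci. field. repeat split; assumption.
    + right. left. split; [|split].
      * assert (A : 0 <= snd (UZ ZM l z)).
        { apply (le_from_cases _ (snd (WZ ZM l z)) 0); [| |lra]; intros T; unfold UZ.
          - apply cexp_snd0. auto.
          - apply cexp_snd_pos. lra. }
        revert A. generalize (UZ ZM l z). intros u A. simpl. lra.
      * assert (A : snd (UZ ZM l' z') < 0) by (apply cexp_snd_neg; lra).
        revert A. generalize (UZ ZM l' z'). intros u A. simpl. lra.
      * exists VM. split; [reflexivity|]. exists l'. vsimp. split; [exact Hl'|].
        split; [field; assumption|]. split; [cbn [vpos]; field; assumption|lra].
  - right. destruct V; cbn [vlo vhi zoneof zeta vpos vscale] in *.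
    + right. right. split; [|split].
      * rewrite Cplus_0_l, Cmult_1_l. apply Ropp_le_cancel. rewrite Ropp_0.
        apply (le_from_cases _ (- snd (WZ ZA l z)) 0); [| |lra]; intros T; unfold UZ.
        -- rewrite cexp_snd0 by lra. ring.
        -- assert (snd (cexp (WZ ZA l z)) < 0) by (apply cexp_snd_neg; lra). lra.
      * rewrite Cplus_0_l, Cmult_1_l. apply cexp_snd_pos. lra.
      * exists VA. split; [reflexivity|]. left. exists (l' - tpi)%C. vsimp. split; [exact Hdn|].
        rewrite XZ_dn, UZ_dn, ang_dn. vsimp. split; [field; assumption|]. split; [|lra].
        cbn [vpos]. rewrite <- two_div_Ci. field. repeat split; assumption.
    + right. left. split; [|split].
      * rewrite Cmult_1_l. assert (A : 0 <= - (fst (UZ ZB l z) - snd (UZ ZB l z))).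
        { apply (le_from_cases _ (- snd (WZ ZB l z)) (- (5 * (PI / 4)))); [| |lra]; intros T; unfold UZ.
          - rewrite cexp_diag by lra. ring.
          - assert (fst (cexp (WZ ZB l z)) - snd (cexp (WZ ZB l z)) < 0) by (apply cexp_diff_neg; lra). lra. }
        revert A. generalize (UZ ZB l z). intros u A. simpl. lra.
      * rewrite Cmult_1_l. assert (A : 0 < fst (UZ ZB l' z') - snd (UZ ZB l' z')) by (apply cexp_diff_pos'; lra).
        revert A. generalize (UZ ZB l' z'). intros u A. simpl. lra.
      * exists VB. split; [reflexivity|]. exists (l' - tpi)%C. vsimp. split; [exact Hdn|].
        rewrite XZ_dn, UZ_dn, ang_dn. vsimp. split; [field; assumption|]. split; [|lra].
        cbn [vpos]. field. assumption.
    + right. right. split; [|split].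
      * rewrite Cmult_1_l. change (0 + snd (UZ ZM l z) <= 0). rewrite Rplus_0_l.
        apply Ropp_le_cancel. rewrite Ropp_0. apply (le_from_cases _ (- snd (WZ ZM l z)) 0); [| |lra]; intros T; unfold UZ.
        -- rewrite cexp_snd0 by lra. ring.
        -- assert (snd (cexp (WZ ZM l z)) < 0) by (apply cexp_snd_neg; lra). lra.
      * rewrite Cmult_1_l. change (0 < 0 + snd (UZ ZM l' z')). rewrite Rplus_0_l. apply cexp_snd_pos. lra.
      * exists VC. split; [reflexivity|]. right. exists l'. vsimp. split; [exact Hl'|].
        split; [field; assumption|]. split; [cbn [vpos]; ring|lra].
    + left. split; [|split].
      * assert (A : 0 <= fst (UZ ZM l z) - snd (UZ ZM l z)).
        { apply (le_from_cases _ (- snd (WZ ZM l z)) (- (PI / 4))); [| |lra]; intros T; unfold UZ.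
          - rewrite cexp_diag by lra. ring.
          - apply cexp_diff_pos; lra. }
        revert A. generalize (UZ ZM l z). intros u A. simpl. lra.
      * assert (A : fst (UZ ZM l' z') - snd (UZ ZM l' z') < 0) by (apply cexp_diff_neg; lra).
        revert A. generalize (UZ ZM l' z'). intros u A. simpl. lra.
      * exists VM. split; [reflexivity|]. exists (l' + tpi)%C. vsimp. split; [exact Hup|].
        rewrite XZ_up, UZ_up, ang_up. vsimp. split; [rewrite <- two_div_Ci; field; repeat split; assumption|]. split; [|lra].
        cbn [vpos]. transitivity (- (Ci * Ci) + (2 + 2 * Ci) * UZ ZM l' z' * (Ci / 2))%C; [field; assumption|]. rewrite Ci_sqr. field.
Qed.

(** * Motion of a frame along an orbit *)

Definition orbit (x z : R -> C) (t0 : R) : Prop :=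
  forall t, t0 < t ->
    cder z t (2 * PI * x t * z t * (1 - z t))%C /\
    cder x t (- (2 * PI) * (x t * x t) * (al - sg * z t))%C /\
    x t <> 0%C /\ z t <> 0%C /\ (1 - z t)%C <> 0%C.

Lemma cder_zeta Z (z : R -> C) t dz : cder z t dz -> cder (fun s => zeta Z (z s)) t (dzeta Z dz).
Proof.
  intros H. destruct Z; cbn [zeta dzeta].
  - exact H.
  - eapply cder_eq; [apply cder_minus; [apply cder_const|exact H]|ring].
  - eapply cder_eq; [apply cder_minus; [apply cder_const|apply cder_scal; exact H]|ring].
Qed.

Lemma zeta_neq0 Z z : okZ Z z -> zeta Z z <> 0%C.
Proof. intros (H0 & H1 & _ & H). destruct Z; cbn [zeta]; try assumption. apply H. Qed.

Lemma locally_Rabs (t : R) (P : R -> Prop) : locally t P -> exists e, 0 < e /\ forall s, Rabs (s - t) < e -> P s.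
Proof. intros [e He]. exists e. split; [apply cond_pos|]. intros s Hs. apply He. exact Hs. Qed.

Lemma cder_const_ball (f : R -> C) t e : (forall s, Rabs (s - t) < e -> cder f s 0%C) ->
  forall s, Rabs (s - t) < e -> f s = f t.
Proof.
  intros H s Hs. apply Rabs_lt_between in Hs. destruct (Rle_lt_dec s t) as [L|L].
  - apply cder_const_eq; [|exact L]. intros u Hu. apply H, Rabs_lt_between. lra.
  - symmetry. apply cder_const_eq; [|lra]. intros u Hu. apply H, Rabs_lt_between. lra.
Qed.

(** Along a continuous branch, x exp P has derivative zero, so it is a constant [c]; then h exp P
    has the constant derivative 2 pi c, and dividing by [c] yields the last formula. Two angle
    deviations of pi / 16 make the pi / 8 of [step_cases]. *)
Lemma local_lift Z (x z : R -> C) t0 t1 : orbit x z t0 -> t0 < t1 -> inZ Z (z t1) ->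
  exists (e : R) (L : R -> C) (a c : C), 0 < e /\ c <> 0%C /\ forall s, Rabs (s - t1) < e ->
    t0 < s /\ okZ Z (z s) /\ cexp (L s) = zeta Z (z s) /\
    Rabs (snd (WZ Z (L s) (z s)) - snd (WZ Z (L t1) (z t1))) < PI / 16 /\
    (x s * cexp (PZ Z (L s) (z s)) = c)%C /\
    hZ Z (z s) = ((a + (2 * PI * s)%R) * x s)%C.
Proof.
  intros HO Ht1 HZ. pose proof PI_bounds. destruct (HO t1 Ht1) as (Dz1 & Dx1 & Hx1 & Hz1 & Hw1).
  pose proof (inZ_ok _ _ HZ Hz1 Hw1) as Hok1. pose proof (zeta_neq0 _ _ Hok1) as Hze1.
  destruct (cexp_surj _ Hze1) as [l1 Hl1].
  (* Dividing by the value at [t1] makes the argument of [clog] equal to 1 at [t1], hence in the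
     right half-plane nearby, whatever the position of the coordinate. *)
  set (L := fun s => (l1 + clog (zeta Z (z s) / zeta Z (z t1)))%C).
  assert (DR : forall s dz, cder z s dz -> cder (fun s => zeta Z (z s) / zeta Z (z t1))%C s (dzeta Z dz / zeta Z (z t1))%C).
  { intros s dz Hd. unfold Cdiv. eapply cder_eq'.
    2:{ apply cder_mult; [apply cder_zeta; exact Hd|apply cder_const]. }
    cbv beta. ring. }
  assert (E1 : (zeta Z (z t1) / zeta Z (z t1) = 1)%C) by (field; exact Hze1).
  assert (HRp : locally t1 (fun s => 0 < fst (zeta Z (z s) / zeta Z (z t1))%C)).
  { apply (cder_locally_fst_pos _ t1 _ (DR t1 _ Dz1)). rewrite E1. simpl. lra. }
  pose proof (okZ_open Z z t1 _ Hok1 Dz1) as Hop.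
  assert (Hgt : locally t1 (fun s => t0 < s)).
  { apply (open_gt t0 t1 Ht1). }
  destruct (locally_Rabs _ _ (filter_and _ _ Hgt (filter_and _ _ Hop HRp))) as (e1 & He1 & HB).
  assert (DL : forall s dz, Rabs (s - t1) < e1 -> cder z s dz -> cder L s (dzeta Z dz / zeta Z (z s))%C).
  { intros s dz Hs Hd. destruct (HB s Hs) as (_ & Ho & Hp). unfold L. eapply cder_eq'.
    2:{ apply cder_plus; [apply cder_const|]. apply cder_clog; [apply DR; exact Hd|exact Hp]. }
    cbv beta. field. repeat split; first [exact Hze1|apply zeta_neq0; exact Ho]. }
  assert (Hc1 : Rabs (t1 - t1) < e1) by (rewrite Rminus_diag, Rabs_R0; exact He1).
  assert (HC : continuity_pt (fun s => snd (WZ Z (L s) (z s))) t1).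
  { apply (ang_continuous Z L z t1 _ _ Hok1 Dz1 (DL t1 _ Hc1 Dz1) eq_refl). }
  destruct (HC (PI / 16)) as (e2 & He2 & HC2); [lra|].
  set (F := fun s => PZ Z (L s) (z s)).
  assert (DF : forall s, Rabs (s - t1) < e1 -> cder F s (2 * PI * x s * (al - sg * z s))%C).
  { intros s Hs. destruct (HB s Hs) as (Hts & Ho & Hp). destruct (HO s Hts) as (Dz & _ & _ & Hz0 & Hw0).
    eapply cder_eq; [apply (cder_PZ Z L z s _ Ho Dz (DL s _ Hs Dz))|]. unfold dP. rewrite <- sg_eq. cbv beta. field. split; assumption. }
  assert (Hconst : forall s, Rabs (s - t1) < e1 -> (x s * cexp (F s) = x t1 * cexp (F t1))%C).
  { apply cder_const_ball with (f := fun s => (x s * cexp (F s))%C). intros s Hs. destruct (HB s Hs) as (Hts & Ho & Hp).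
    destruct (HO s Hts) as (Dz & Dx & _ & Hz0 & Hw0).
    eapply cder_eq; [apply cder_mult; [exact Dx|apply cder_cexp, DF, Hs]|]. cbv beta. ring. }
  set (c := (x t1 * cexp (F t1))%C) in *.
  assert (Hc : c <> 0%C) by (apply Cmult_neq_0; [exact Hx1|apply cexp_neq0]).
  assert (Haff : forall s, Rabs (s - t1) < e1 ->
     (hZ Z (z s) * cexp (F s) - 2 * PI * c * s = hZ Z (z t1) * cexp (F t1) - 2 * PI * c * t1)%C).
  { apply cder_const_ball with (f := fun s => (hZ Z (z s) * cexp (F s) - 2 * PI * c * s)%C). intros s Hs. destruct (HB s Hs) as (Hts & Ho & Hp).
    destruct (HO s Hts) as (Dz & Dx & _ & Hz0 & Hw0).
    eapply cder_eq; [apply cder_minus; [apply (cder_DZ Z z F s _ Ho Dz)|apply cder_scal, cder_id]|].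
    - apply (cder_PZ Z L z s _ Ho Dz (DL s _ Hs Dz)).
    - unfold dD. rewrite <- (Hconst s Hs). cbv beta. field. split; assumption. }
  exists (Rmin e1 e2), L, ((hZ Z (z t1) * cexp (F t1) - 2 * PI * c * t1) / c)%C, c.
  split; [apply Rmin_glb_lt; assumption|]. split; [exact Hc|]. intros s Hs.
  assert (Hs1 : Rabs (s - t1) < e1) by (eapply Rlt_le_trans; [exact Hs|apply Rmin_l]).
  assert (Hs2 : Rabs (s - t1) < e2) by (eapply Rlt_le_trans; [exact Hs|apply Rmin_r]).
  destruct (HB s Hs1) as (Hts & Ho & Hp). refine (conj Hts (conj Ho (conj _ (conj _ (conj (Hconst s Hs1) _))))).
  - unfold L. rewrite cexp_plus, Hl1, cexp_clog by exact Hp. field. exact Hze1.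
  - destruct (Req_dec s t1) as [->|Hne]; [rewrite Rminus_diag, Rabs_R0; lra|].
    apply (HC2 s). split; [split; [exact I|auto]|exact Hs2].
  - specialize (Haff s Hs1). apply (Cmult_cancel_l (cexp (F s))); [apply cexp_neq0|].
    transitivity (c * ((hZ Z (z t1) * cexp (F t1) - 2 * PI * c * t1) / c + (2 * PI * s)%R))%C.
    + rewrite <- Haff, !RtoC_mult. field. exact Hc.
    + generalize ((hZ Z (z t1) * cexp (F t1) - 2 * PI * c * t1) / c + (2 * PI * s)%R)%C. intros Q.
      rewrite <- (Hconst s Hs1). ring.
Qed.

Lemma UZ_XZ Z l z : okZ Z z -> cexp l = zeta Z z -> UZ Z l z = (hZ Z z / XZ Z l z)%C.
Proof.
  intros H Hl. unfold UZ. rewrite (cexp_WZ Z l z H Hl). unfold XZ. rewrite cexp_opp_inv. field.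
  split; [apply cexp_neq0|exact mm_neq0].
Qed.

Lemma local_step V (x z : R -> C) t0 t1 : orbit x z t0 -> t0 < t1 -> inZ (zoneof V) (z t1) ->
  exists e, 0 < e /\ forall t t' S w, Rabs (t - t1) < e -> Rabs (t' - t1) < e ->
    Val V (z t) (S * x t)%C w ->
    let w' := (w + (2 * PI * (t' - t))%R / S)%C in
    stay (zoneof V) (z t') (S * x t')%C w' \/ down1 (zoneof V) (z t') (S * x t')%C w w' \/
    down2 (zoneof V) (z t') (S * x t')%C w w' \/ cross_up (zoneof V) (z t') (S * x t')%C w w'.
Proof.
  intros HO Ht1 HZ. pose proof PI_bounds. destruct (local_lift _ x z t0 t1 HO Ht1 HZ) as (e & L & a & c & He & Hc & HB).
  exists e. split; [exact He|]. intros t t' S w Ht Ht' (l & Hl & HX & Hw & Ha) w'.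
  destruct (HB t Ht) as (T0 & O & EL & AL & EC & EH). destruct (HB t' Ht') as (T0' & O' & EL' & AL' & EC' & EH').
  destruct (HO t T0) as (_ & _ & Hx & _). destruct (HO t' T0') as (_ & _ & Hx' & _).
  assert (EE : cexp l = cexp (L t)) by congruence. apply cexp_inj in EE. destruct EE as [k ->].
  set (l' := (L t' + IZR k * tpi)%C).
  assert (Hl' : cexp l' = zeta (zoneof V) (z t')) by (unfold l'; rewrite cexp_shift; exact EL').
  pose proof (XZ_neq0 (zoneof V) (L t + IZR k * tpi)%C (z t)) as HXn. pose proof (vscale_neq0 V) as Hv.
  assert (HXX : forall s, (x s * cexp (PZ (zoneof V) (L s) (z s)) = c)%C ->
     XZ (zoneof V) (L s + IZR k * tpi)%C (z s) = (mm / c * cexp (- (kapZ (zoneof V) * (IZR k * tpi))) * x s)%C).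
  { intros s Es. unfold XZ. rewrite PZ_shift.
    replace (- (PZ (zoneof V) (L s) (z s) + kapZ (zoneof V) * (IZR k * tpi)))%C with
      (- PZ (zoneof V) (L s) (z s) + - (kapZ (zoneof V) * (IZR k * tpi)))%C by ring.
    rewrite cexp_plus, (cexp_opp_inv (PZ _ _ _)). apply (Cmult_cancel_l c); [exact Hc|]. rewrite <- Es at 1. field.
    split; [exact Hc|apply cexp_neq0]. }
  (* On the sheet of index [k] the ratio of [XZ] to [x] is this constant, so [S] is the same at [t]
     and [t']. *)
  set (G := (mm / c * cexp (- (kapZ (zoneof V) * (IZR k * tpi))))%C) in *.
  assert (ES : S = (G / vscale V)%C).
  { apply (Cmult_cancel_l (x t)); [exact Hx|]. rewrite Cmult_comm, HX, (HXX t EC). field. exact Hv. }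
  assert (HG : G <> 0%C).
  { intros E. apply HXn. rewrite (HXX t EC), E. ring. }
  assert (EX' : (S * x t' = XZ (zoneof V) l' (z t') / vscale V)%C).
  { unfold l'. rewrite (HXX t' EC'), ES. field. exact Hv. }
  assert (EW' : w' = (vpos V + vscale V * UZ (zoneof V) l' (z t'))%C).
  { unfold w'. rewrite Hw, (UZ_XZ _ _ _ O Hl), (UZ_XZ _ _ _ O' Hl'), EH, EH'. unfold l'.
    rewrite (HXX t EC), (HXX t' EC'), ES. rewrite !RtoC_mult, RtoC_minus. field. repeat split; assumption. }
  rewrite EX', EW', Hw. apply step_cases; [exact Hl'|exact Ha|].
  unfold l'. rewrite !ang_shift.
  replace (snd (WZ (zoneof V) (L t') (z t')) + IZR k * rateZ (zoneof V) - (snd (WZ (zoneof V) (L t) (z t)) + IZR k * rateZ (zoneof V)))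
   with ((snd (WZ (zoneof V) (L t') (z t')) - snd (WZ (zoneof V) (L t1) (z t1))) - (snd (WZ (zoneof V) (L t) (z t)) - snd (WZ (zoneof V) (L t1) (z t1)))) by ring.
  apply Rabs_lt_between in AL, AL'. apply Rabs_lt_between. lra.
Qed.

(** A least upper bound argument. The step is demanded only between T and a nearby point: from the
    left to reach T, to the right to leave it. *)
Lemma real_induction (Q : R -> Prop) a : Q a ->
  (forall T, a <= T -> exists e, 0 < e /\ forall t t', a <= t <= t' -> Rabs (t - T) < e -> Rabs (t' - T) < e ->
     t = T \/ t' = T -> Q t -> Q t') ->
  forall b, a <= b -> Q b.
Proof.
  intros Ha Hs b Hb. destruct (classic (Q b)) as [H|H]; [exact H|exfalso].
  set (E := fun s => a <= s <= b /\ forall u, a <= u <= s -> Q u).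
  assert (HE : E a) by (split; [lra|intros u Hu; replace u with a by lra; exact Ha]).
  destruct (completeness E) as [T [HT1 HT2]].
  - exists b. intros s [Hs1 _]. lra.
  - exists a. exact HE.
  - assert (Ta : a <= T) by (apply HT1, HE). assert (Tb : T <= b) by (apply HT2; intros s [Hs1 _]; lra).
    assert (Hlt : forall u, a <= u < T -> Q u).
    { intros u Hu. destruct (classic (exists s, E s /\ u < s)) as [(s & [Hs1 Hs2] & Hus)|N]; [apply Hs2; lra|].
      exfalso. assert (T <= u); [|lra]. apply HT2. intros s Hes. apply Rnot_lt_le. intros L. apply N. exists s. auto. }
    destruct (Hs T Ta) as (e & He & Hst).
    assert (QT : Q T).
    { destruct (Req_dec a T) as [<-|Hne]; [exact Ha|].
      set (t := Rmax a (T - e / 2)). assert (Ht : a <= t < T /\ T - e < t) by (unfold t, Rmax; destruct (Rle_dec a (T - e / 2)); lra).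
      apply (Hst t T); [lra|apply Rabs_lt_between; lra|rewrite Rminus_diag, Rabs_R0; lra|auto|apply Hlt; lra]. }
    destruct (Req_dec T b) as [->|Hne]; [exact (H QT)|].
    set (s := Rmin b (T + e / 2)).
    assert (Hs' : T < s <= b /\ s < T + e) by (unfold s, Rmin; destruct (Rle_dec b (T + e / 2)); lra).
    assert (Es : E s).
    { split; [lra|]. intros u Hu. destruct (Rlt_le_dec u T) as [L|L]; [apply Hlt; lra|].
      apply (Hst T u); [lra|rewrite Rminus_diag, Rabs_R0; lra|apply Rabs_lt_between; lra|auto|exact QT]. }
    specialize (HT1 s Es). lra.
Qed.

Definition frame (x z : R -> C) (t : R) (S w : C) : Prop :=
  exists V, inZ (zoneof V) (z t) /\ Val V (z t) (S * x t)%C w.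

Lemma Cmod_gt_iff (u : C) r : 0 <= r -> r < Cmod u <-> r * r < normsq u.
Proof.
  intros Hr. split; intros H; apply Rnot_le_lt; intros L.
  - apply normsq_le in L; lra.
  - apply normsq_le in L; lra.
Qed.

Lemma cder_locally_mod_gt f t l b : 0 <= b -> cder f t l -> b < Cmod (f t) -> locally t (fun s => b < Cmod (f s)).
Proof.
  intros Hb H H0. pose proof (cder_normsq _ _ _ H) as HN. apply Cmod_gt_iff in H0; [|exact Hb].
  assert (HN' : is_derive (fun s => - normsq (f s)) t (- (2 * (fst (f t) * fst l + snd (f t) * snd l)))).
  { apply (is_derive_opp (V := R_NormedModule)). exact HN. }
  assert (Hp : - normsq (f t) < - (b * b)) by lra.
  pose proof (is_derive_locally_lt _ _ _ _ HN' Hp) as HL. revert HL. apply filter_imp. intros s Hs.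
  apply Cmod_gt_iff; lra.
Qed.

Lemma inZ_closed (z : R -> C) t dz Z : cder z t dz -> exists e, 0 < e /\ forall s, Rabs (s - t) < e -> inZ Z (z s) -> inZ Z (z t).
Proof.
  intros Hd. destruct (classic (inZ Z (z t))) as [H|H]; [exists 1; split; [lra|auto]|].
  assert (D2 : cder (fun s => 1 - 2 * z s)%C t (0 - 2 * dz)%C) by (apply cder_minus; [apply cder_const|apply cder_scal; exact Hd]).
  assert (HL : locally t (fun s => ~ inZ Z (z s))).
  { assert (H43 : 0 <= 4/3) by lra.
    destruct Z; cbn [inZ] in *.
    - destruct (Rlt_le_dec (1/2) (fst (z t))) as [L|L].
      + destruct Hd as [Hd _]. assert (Hd' : is_derive (fun s => - fst (z s)) t (- fst dz)) by (apply (is_derive_opp (V := R_NormedModule)); exact Hd).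
        assert (Hp : - fst (z t) < - (1/2)) by lra. pose proof (is_derive_locally_lt _ _ _ _ Hd' Hp) as HL.
        revert HL. apply filter_imp. intros s Hs. lra.
      + assert (L' : 4/3 < Cmod (1 - 2 * z t)) by (apply Rnot_le_lt; intros L'; apply H; split; assumption).
        pose proof (cder_locally_mod_gt _ _ _ _ H43 D2 L') as HL. revert HL. apply filter_imp. intros s Hs. lra.
    - destruct (Rlt_le_dec (fst (z t)) (1/2)) as [L|L].
      + destruct Hd as [Hd _]. pose proof (is_derive_locally_lt _ _ _ _ Hd L) as HL.
        revert HL. apply filter_imp. intros s Hs. lra.
      + assert (L' : 4/3 < Cmod (1 - 2 * z t)) by (apply Rnot_le_lt; intros L'; apply H; split; assumption).
        pose proof (cder_locally_mod_gt _ _ _ _ H43 D2 L') as HL. revert HL. apply filter_imp. intros s Hs. lra.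
    - apply Rnot_le_lt in H. pose proof (cder_locally_mod_lt _ _ _ _ D2 H) as HL. revert HL. apply filter_imp. intros s Hs. lra. }
  destruct (locally_Rabs _ _ HL) as (e & He & HB). exists e. split; [exact He|]. intros s Hs Hin. exfalso. exact (HB s Hs Hin).
Qed.

Definition fdown1 (x z : R -> C) t S (w w' : C) : Prop := 0 <= fst w /\ fst w' < 0 /\ frame x z t (- (2) * Ci * S)%C (w' * (Ci / 2))%C.
Definition fdown2 (x z : R -> C) t S (w w' : C) : Prop :=
  fst w - snd w <= 2 /\ 2 < fst w' - snd w' /\ frame x z t ((2 + 2 * Ci) * S)%C (2 + (w' - 2) / (2 + 2 * Ci))%C.
Definition fup (x z : R -> C) t S (w w' : C) : Prop :=
  snd w <= 0 /\ 0 < snd w' /\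
  (frame x z t (S * (Ci / 2))%C (- (2) * Ci * w')%C \/ frame x z t (S / (2 + 2 * Ci))%C (2 + (2 + 2 * Ci) * (w' - 2))%C).

Lemma outcome_frame (x z : R -> C) (t : R) (S w w' : C) (Z : zone) : inZ Z (z t) ->
  stay Z (z t) (S * x t)%C w' \/ down1 Z (z t) (S * x t)%C w w' \/
  down2 Z (z t) (S * x t)%C w w' \/ cross_up Z (z t) (S * x t)%C w w' ->
  frame x z t S w' \/ fdown1 x z t S w w' \/ fdown2 x z t S w w' \/ fup x z t S w w'.
Proof.
  intros HZ [(V & <- & HV)|[(A & B & V & <- & HV)|[(A & B & V & <- & HV)|(A & B & V & <- & HV)]]].
  - left. exists V. auto.
  - right; left. refine (conj A (conj B _)). exists V. split; [exact HZ|]. rewrite <- Cmult_assoc. exact HV.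
  - right; right; left. refine (conj A (conj B _)). exists V. split; [exact HZ|]. rewrite <- Cmult_assoc. exact HV.
  - right; right; right. refine (conj A (conj B _)). destruct HV as [HV|HV]; [left|right]; exists V; (split; [exact HZ|]).
    + replace (S * (Ci / 2) * x t)%C with (S * x t * (Ci / 2))%C by ring. exact HV.
    + replace (S / (2 + 2 * Ci) * x t)%C with (S * x t / (2 + 2 * Ci))%C by (unfold Cdiv; ring). exact HV.
Qed.

(** Zones are closed, so every zone met close to [t1] contains [z t1]. As one end of the step is
    [t1], a change of chart, when it is needed, is made exactly there, where [Val_transfer]
    applies. *)
Lemma frame_step (x z : R -> C) t0 t1 : orbit x z t0 -> t0 < t1 ->
  exists e, 0 < e /\ forall t t' S w, Rabs (t - t1) < e -> Rabs (t' - t1) < e -> t = t1 \/ t' = t1 ->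
    frame x z t S w ->
    let w' := (w + (2 * PI * (t' - t))%R / S)%C in
    frame x z t' S w' \/ fdown1 x z t' S w w' \/ fdown2 x z t' S w w' \/ fup x z t' S w w'.
Proof.
  intros HO Ht1.
  assert (A : forall V, exists e, 0 < e /\ forall t t' S w, Rabs (t - t1) < e -> Rabs (t' - t1) < e -> inZ (zoneof V) (z t1) ->
    Val V (z t) (S * x t)%C w ->
    let w' := (w + (2 * PI * (t' - t))%R / S)%C in
    stay (zoneof V) (z t') (S * x t')%C w' \/ down1 (zoneof V) (z t') (S * x t')%C w w' \/
    down2 (zoneof V) (z t') (S * x t')%C w w' \/ cross_up (zoneof V) (z t') (S * x t')%C w w').
  { intros V. destruct (classic (inZ (zoneof V) (z t1))) as [H|H].
    - destruct (local_step V x z t0 t1 HO Ht1 H) as (e & He & HB). exists e. split; [exact He|]. intros; apply HB; assumption.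
    - exists 1. split; [lra|]. intros; exfalso; auto. }
  destruct (HO t1 Ht1) as (Dz & _).
  destruct (inZ_closed z t1 _ ZA Dz) as (c1 & Hc1 & C1). destruct (inZ_closed z t1 _ ZB Dz) as (c2 & Hc2 & C2).
  destruct (inZ_closed z t1 _ ZM Dz) as (c3 & Hc3 & C3).
  destruct (A VA) as (d1 & Hd1 & D1). destruct (A VB) as (d2 & Hd2 & D2). destruct (A VM) as (d3 & Hd3 & D3). destruct (A VC) as (d4 & Hd4 & D4).
  exists (Rmin (Rmin (Rmin c1 c2) c3) (Rmin (Rmin d1 d2) (Rmin d3 d4))).
  assert (HM : forall r, r < Rmin (Rmin (Rmin c1 c2) c3) (Rmin (Rmin d1 d2) (Rmin d3 d4)) ->
     r < c1 /\ r < c2 /\ r < c3 /\ r < d1 /\ r < d2 /\ r < d3 /\ r < d4).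
  { intros r Hr. pose proof (Rmin_l (Rmin (Rmin c1 c2) c3) (Rmin (Rmin d1 d2) (Rmin d3 d4))). pose proof (Rmin_r (Rmin (Rmin c1 c2) c3) (Rmin (Rmin d1 d2) (Rmin d3 d4))).
    pose proof (Rmin_l (Rmin c1 c2) c3). pose proof (Rmin_r (Rmin c1 c2) c3). pose proof (Rmin_l c1 c2). pose proof (Rmin_r c1 c2).
    pose proof (Rmin_l (Rmin d1 d2) (Rmin d3 d4)). pose proof (Rmin_r (Rmin d1 d2) (Rmin d3 d4)).
    pose proof (Rmin_l d1 d2). pose proof (Rmin_r d1 d2). pose proof (Rmin_l d3 d4). pose proof (Rmin_r d3 d4). lra. }
  split; [repeat apply Rmin_glb_lt; assumption|]. intros t t' S w Ht Ht' Hor (V & HZ & HV) w'.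
  apply HM in Ht, Ht'.
  assert (HC : forall Z s, Rabs (s - t1) < c1 -> Rabs (s - t1) < c2 -> Rabs (s - t1) < c3 -> inZ Z (z s) -> inZ Z (z t1)).
  { intros [] s S1 S2 S3 Hin; [exact (C1 s S1 Hin)|exact (C2 s S2 Hin)|exact (C3 s S3 Hin)]. }
  assert (HD : forall V, inZ (zoneof V) (z t1) -> Val V (z t) (S * x t)%C w ->
    stay (zoneof V) (z t') (S * x t')%C w' \/ down1 (zoneof V) (z t') (S * x t')%C w w' \/
    down2 (zoneof V) (z t') (S * x t')%C w w' \/ cross_up (zoneof V) (z t') (S * x t')%C w w').
  { intros [] Hin HV'; [apply D1|apply D2|apply D3|apply D4]; tauto. }
  destruct Hor as [-> | ->].
  - destruct (inZ_cases (z t')) as [Z' HZ'].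
    assert (HZ1 : inZ Z' (z t1)) by (apply (HC Z' t'); tauto).
    destruct (Val_transfer V Z' (z t1) _ _ HZ HZ1 HV) as (V' & EV & HV'). subst Z'.
    apply (outcome_frame x z t' S w w' (zoneof V')); [exact HZ'|]. apply HD; assumption.
  - assert (HZ1 : inZ (zoneof V) (z t1)) by (apply (HC _ t); tauto).
    apply (outcome_frame x z t1 S w w' (zoneof V)); [exact HZ1|]. apply HD; assumption.
Qed.

Lemma frame_exists (x z : R -> C) t0 t : orbit x z t0 -> t0 < t -> exists S w, frame x z t S w.
Proof.
  intros HO Ht. destruct (HO t Ht) as (_ & _ & Hx & H0 & H1). destruct (Val_exists (z t) H0 H1) as (V & X & w & HZ & HV).
  exists (X / x t)%C, w, V. split; [exact HZ|]. replace (X / x t * x t)%C with X by (field; exact Hx). exact HV.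
Qed.

Lemma frame_neq0 (x z : R -> C) t S w : frame x z t S w -> S <> 0%C.
Proof.
  intros (V & _ & l & _ & HX & _) E. apply (Cmult_neq_0 (XZ (zoneof V) l (z t)) (/ vscale V)).
  - apply XZ_neq0.
  - intros E'. pose proof (vscale_neq0 V) as Hv. assert (vscale V * / vscale V = 1)%C by (field; exact Hv).
    rewrite E', Cmult_0_r in H. apply (f_equal fst) in H. simpl in H. lra.
  - unfold Cdiv in HX. rewrite <- HX, E. ring.
Qed.

(** * Monotone quantities of a moving frame *)

Lemma fst_ge_Cmod (u : C) : - Cmod u <= fst u.
Proof. pose proof (abs_fst_le_Cmod u) as H. apply Rabs_le_between in H. lra. Qed.
Lemma fst_le_Cmod (u : C) : fst u <= Cmod u.
Proof. pose proof (abs_fst_le_Cmod u) as H. apply Rabs_le_between in H. lra. Qed.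

Lemma Cmod_22i : 2.8 <= Cmod (2 + 2 * Ci).
Proof.
  apply Rnot_lt_le. intros H. assert (H' : Cmod (2 + 2 * Ci) <= 2.8) by lra.
  apply normsq_le in H'; [|lra]. unfold normsq in H'; simpl in H'. lra.
Qed.

Lemma move_coords (w S : C) d : S <> 0%C ->
  fst (w + RtoC d / S)%C = fst w + d * fst S / normsq S /\ snd (w + RtoC d / S)%C = snd w - d * snd S / normsq S.
Proof.
  intros H. apply normsq_pos in H. unfold normsq in *. destruct S as [s1 s2]; simpl in *. split; field; lra.
Qed.

Lemma div_neg_sign d s n : 0 < n -> 0 <= d -> d * s / n < 0 -> s < 0.
Proof.
  intros Hn Hd H. apply Rnot_le_lt. intros L. assert (0 <= d * s / n); [|lra].
  apply Rdiv_le_0_compat; [nra|exact Hn].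
Qed.

(** Since (w + d / S) S = w S + d, the number Re (w S) advances exactly like 2 pi times time between
    crossings. The term K |S| pays for the jumps of w S at the gluings. *)
Definition height (K : R) (S w : C) : R := K * Cmod S + fst (w * S)%C.

Lemma height_stay (w S : C) K d : S <> 0%C -> height K S (w + RtoC d / S)%C = height K S w + d.
Proof.
  intros H. unfold height. replace ((w + RtoC d / S) * S)%C with (w * S + RtoC d)%C by (field; exact H).
  simpl. ring.
Qed.

Lemma height_down1 (w S : C) K : 0 <= K -> height K S w <= height K (- (2) * Ci * S)%C (w * (Ci / 2))%C.
Proof.
  intros HK. unfold height. replace (w * (Ci / 2) * (- (2) * Ci * S))%C with (- (Ci * Ci) * (w * S))%C by (field; apply RtoC2_neq0).
  rewrite Ci_sqr, !Cmod_mult, Cmod_opp, Cmod_R, Rabs_pos_eq by lra.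
  replace (Cmod Ci) with 1 by (symmetry; apply arc_unit_i).
  replace (- - (1) * (w * S))%C with (w * S)%C by ring. pose proof (Cmod_ge_0 S). nra.
Qed.

(** This gluing fixes 2 and not 0, so it adds (2 + 4 i) S to w S. The loss is at most 4.5 |S|, while
    |S| is multiplied by at least 2.8; the bound on [K] covers it. *)
Lemma height_down2 (w S : C) K : 10 <= K -> height K S w <= height K ((2 + 2 * Ci) * S)%C (2 + (w - 2) / (2 + 2 * Ci))%C.
Proof.
  intros HK. unfold height. pose proof two_two_i_neq0 as Hn.
  replace ((2 + (w - 2) / (2 + 2 * Ci)) * ((2 + 2 * Ci) * S))%C with (w * S + (2 + 4 * Ci) * S)%C by (field; exact Hn).
  rewrite Cmod_mult. pose proof Cmod_22i. pose proof (Cmod_ge_0 S).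
  pose proof (fst_ge_Cmod ((2 + 4 * Ci) * S)) as HB. rewrite Cmod_mult in HB.
  assert (Cmod (2 + 4 * Ci) <= 4.5) by (apply normsq_le; [lra|unfold normsq; simpl; lra]).
  change (fst (w * S + (2 + 4 * Ci) * S)%C) with (fst (w * S)%C + fst ((2 + 4 * Ci) * S)%C).
  assert (Cmod (2 + 4 * Ci) * Cmod S <= 4.5 * Cmod S) by (apply Rmult_le_compat_r; assumption).
  assert (2.8 * Cmod S <= Cmod (2 + 2 * Ci) * Cmod S) by (apply Rmult_le_compat_r; assumption).
  nra.
Qed.

Definition depth (K : R) (S w : C) : R := K * Cmod S - fst (w * S)%C.

Lemma depth_stay (w S : C) K d : S <> 0%C -> depth K S (w + RtoC d / S)%C = depth K S w - d.
Proof.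
  intros H. unfold depth. replace ((w + RtoC d / S) * S)%C with (w * S + RtoC d)%C by (field; exact H).
  simpl. ring.
Qed.

Lemma depth_up1 (w S : C) K : 0 <= K -> depth K (S * (Ci / 2))%C (- (2) * Ci * w)%C <= depth K S w.
Proof.
  intros HK. unfold depth. replace (- (2) * Ci * w * (S * (Ci / 2)))%C with (- (Ci * Ci) * (w * S))%C by (field; apply RtoC2_neq0).
  rewrite Ci_sqr, Cmod_mult, Cmod_div, Cmod_R, Rabs_pos_eq by (lra || apply RtoC2_neq0).
  replace (Cmod Ci) with 1 by (symmetry; apply arc_unit_i).
  replace (- - (1) * (w * S))%C with (w * S)%C by ring. pose proof (Cmod_ge_0 S). nra.
Qed.

Lemma depth_up2 (w S : C) K : 10 <= K -> depth K (S / (2 + 2 * Ci))%C (2 + (2 + 2 * Ci) * (w - 2))%C <= depth K S w.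
Proof.
  intros HK. unfold depth. pose proof two_two_i_neq0 as Hn.
  replace ((2 + (2 + 2 * Ci) * (w - 2)) * (S / (2 + 2 * Ci)))%C with (w * S + (2 / (2 + 2 * Ci) - 2) * S)%C by (field; exact Hn).
  rewrite Cmod_div by exact Hn. pose proof Cmod_22i. pose proof (Cmod_ge_0 S).
  pose proof (fst_ge_Cmod ((2 / (2 + 2 * Ci) - 2) * S)) as HB. rewrite Cmod_mult in HB.
  assert (Cmod (2 / (2 + 2 * Ci) - 2) <= 1.6).
  { replace (2 / (2 + 2 * Ci) - 2)%C with (-3/2, -1/2)%R by (apply C_eq; simpl; field).
    apply normsq_le; [lra|unfold normsq; simpl; lra]. }
  change (fst (w * S + (2 / (2 + 2 * Ci) - 2) * S)%C) with (fst (w * S)%C + fst ((2 / (2 + 2 * Ci) - 2) * S)%C).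
  assert (Cmod (2 / (2 + 2 * Ci) - 2) * Cmod S <= 1.6 * Cmod S) by (apply Rmult_le_compat_r; assumption).
  assert (Cmod S / Cmod (2 + 2 * Ci) <= Cmod S / 2.8).
  { apply Rmult_le_compat_l; [assumption|]. apply Rinv_le_contravar; lra. }
  assert (K * (Cmod S / Cmod (2 + 2 * Ci)) <= K * (Cmod S / 2.8)) by (apply Rmult_le_compat_l; lra).
  assert (K * (Cmod S / 2.8) <= K * Cmod S - 1.6 * Cmod S) by nra. lra.
Qed.

(** The position moves in the direction of 1 / S, whose imaginary part has the sign of - Im S. *)
Lemma no_up_when_pos (w S : C) d : 0 < snd S -> 0 <= d -> snd w <= 0 -> 0 < snd (w + RtoC d / S)%C -> False.
Proof.
  intros HS Hd Hw H. assert (Hn : S <> 0%C) by (intros E; rewrite E in HS; simpl in HS; lra).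
  rewrite (proj2 (move_coords w S d Hn)) in H. apply normsq_pos in Hn.
  assert (0 <= d * snd S / normsq S) by (apply Rdiv_le_0_compat; [nra|exact Hn]). lra.
Qed.

(** Leaving to the left forces Re S < 0, and the factor - 2 i turns this into a positive imaginary
    part. *)
Lemma down1_pos (w S : C) d : S <> 0%C -> 0 <= d -> 0 <= fst w -> fst (w + RtoC d / S)%C < 0 -> 0 < snd (- (2) * Ci * S)%C.
Proof.
  intros Hn Hd Hw H. rewrite (proj1 (move_coords w S d Hn)) in H. apply normsq_pos in Hn.
  assert (L : d * fst S / normsq S < 0) by lra. apply div_neg_sign in L; [|assumption..]. simpl. lra.
Qed.

(** Passing the hypotenuse outward forces Re S + Im S > 0, which is half the imaginary part of (2 +
    2 i) S. *)
Lemma down2_pos (w S : C) d : S <> 0%C -> 0 <= d -> fst w - snd w <= 2 ->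
  2 < fst (w + RtoC d / S)%C - snd (w + RtoC d / S)%C -> 0 < snd ((2 + 2 * Ci) * S)%C.
Proof.
  intros Hn Hd Hw H. destruct (move_coords w S d Hn) as [E1 E2]. rewrite E1, E2 in H. apply normsq_pos in Hn.
  assert (L : d * - (fst S + snd S) / normsq S < 0).
  { replace (d * - (fst S + snd S) / normsq S) with (- (d * fst S / normsq S + d * snd S / normsq S)) by (field; lra). lra. }
  apply div_neg_sign in L; [|assumption..]. simpl. lra.
Qed.

Lemma twoPI_pos : 0 < 2 * PI.
Proof. pose proof PI_bounds. lra. Qed.

(* While [Im S > 0] the line cannot cross a side that makes [|S|] smaller. *)
Lemma height_grows (x z : R -> C) t0 t1 S1 w1 K : orbit x z t0 -> t0 < t1 -> 10 <= K ->
  frame x z t1 S1 w1 -> 0 < snd S1 ->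
  forall t, t1 <= t -> exists S w, frame x z t S w /\ 0 < snd S /\ height K S1 w1 + 2 * PI * (t - t1) <= height K S w.
Proof.
  intros HO Ht1 HK HF HS. apply real_induction.
  - exists S1, w1. split; [exact HF|]. split; [exact HS|]. rewrite Rminus_diag, Rmult_0_r. lra.
  - intros T HT. destruct (frame_step x z t0 T HO ltac:(lra)) as (e & He & HB). exists e. split; [exact He|].
    intros t t' Htt Ht Ht' Hor (S & w & HFt & HSt & Hh).
    pose proof (frame_neq0 _ _ _ _ _ HFt) as HSn. pose proof twoPI_pos.
    assert (Hd : 0 <= 2 * PI * (t' - t)) by (apply Rmult_le_pos; lra).
    assert (HK0 : 0 <= K) by lra.
    specialize (HB t t' S w Ht Ht' Hor HFt). cbv zeta in HB.
    pose proof (height_stay w S K (2 * PI * (t' - t)) HSn) as Hst.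
    set (w' := (w + (2 * PI * (t' - t))%R / S)%C) in *.
    destruct HB as [HB|[(A & B & HB)|[(A & B & HB)|(A & B & _)]]].
    + exists S, w'. split; [exact HB|]. split; [exact HSt|]. lra.
    + exists (- (2) * Ci * S)%C, (w' * (Ci / 2))%C. split; [exact HB|]. split.
      * apply (down1_pos w S _ HSn Hd A B).
      * pose proof (height_down1 w' S K HK0). lra.
    + exists ((2 + 2 * Ci) * S)%C, (2 + (w' - 2) / (2 + 2 * Ci))%C. split; [exact HB|]. split.
      * apply (down2_pos w S _ HSn Hd A B).
      * pose proof (height_down2 w' S K HK). lra.
    + exfalso. apply (no_up_when_pos w S _ HSt Hd A B).
Qed.

(** A crossing that enlarges |S| would create a frame with Im S > 0, against the hypothesis; only
    the upward crossings remain, and they do not increase [depth]. *)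
Lemma depth_decreases (x z : R -> C) t0 t1 S1 w1 K : orbit x z t0 -> t0 < t1 -> 10 <= K ->
  frame x z t1 S1 w1 -> (forall t S w, t1 <= t -> frame x z t S w -> snd S <= 0) ->
  forall t, t1 <= t -> exists S w, frame x z t S w /\ depth K S w <= depth K S1 w1 - 2 * PI * (t - t1).
Proof.
  intros HO Ht1 HK HF HN. apply real_induction.
  - exists S1, w1. split; [exact HF|]. rewrite Rminus_diag, Rmult_0_r. lra.
  - intros T HT. destruct (frame_step x z t0 T HO ltac:(lra)) as (e & He & HB). exists e. split; [exact He|].
    intros t t' Htt Ht Ht' Hor (S & w & HFt & Hh).
    pose proof (frame_neq0 _ _ _ _ _ HFt) as HSn. pose proof twoPI_pos.
    assert (Hd : 0 <= 2 * PI * (t' - t)) by (apply Rmult_le_pos; lra).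
    assert (HK0 : 0 <= K) by lra. assert (Ht1' : t1 <= t') by lra.
    specialize (HB t t' S w Ht Ht' Hor HFt). cbv zeta in HB.
    pose proof (depth_stay w S K (2 * PI * (t' - t)) HSn) as Hst.
    set (w' := (w + (2 * PI * (t' - t))%R / S)%C) in *.
    destruct HB as [HB|[(A & B & HB)|[(A & B & HB)|(A & B & [HB|HB])]]].
    + exists S, w'. split; [exact HB|]. lra.
    + exfalso. apply (HN t' _ _ Ht1') in HB. pose proof (down1_pos w S _ HSn Hd A B). lra.
    + exfalso. apply (HN t' _ _ Ht1') in HB. pose proof (down2_pos w S _ HSn Hd A B). lra.
    + exists (S * (Ci / 2))%C, (- (2) * Ci * w')%C. split; [exact HB|]. pose proof (depth_up1 w' S K HK0). lra.
    + exists (S / (2 + 2 * Ci))%C, (2 + (2 + 2 * Ci) * (w' - 2))%C. split; [exact HB|]. pose proof (depth_up2 w' S K HK). lra.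
Qed.

Lemma frame_grows (x z : R -> C) t0 : orbit x z t0 -> exists t1 K b, t0 < t1 /\ 0 < K /\
  forall t, t1 <= t -> exists S w, frame x z t S w /\ b + 2 * PI * (t - t1) <= K * Cmod S.
Proof.
  (* With [K] at least [D], |Re (w S)| <= K |S|: hence the height is at most 2 K |S|, which explains
     the constant [2 * K], and the depth is never negative. *)
  intros HO. destruct pos_bound as [D HD]. set (K := Rmax 10 D).
  assert (HK : 10 <= K) by apply Rmax_l. assert (HDK : D <= K) by apply Rmax_r. pose proof twoPI_pos as HP.
  assert (Hw : forall t S w, frame x z t S w -> Cmod (w * S) <= K * Cmod S).
  { intros t S w (V & HZ & HV). rewrite Cmod_mult. apply Rmult_le_compat_r; [apply Cmod_ge_0|].
    eapply Rle_trans; [apply (HD V _ _ _ HZ HV)|exact HDK]. }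
  destruct (classic (exists t S w, t0 < t /\ frame x z t S w /\ 0 < snd S)) as [(t1 & S1 & w1 & Ht1 & HF & HS)|N].
  - exists t1, (2 * K), (height K S1 w1). split; [exact Ht1|]. split; [lra|]. intros t Ht.
    destruct (height_grows x z t0 t1 S1 w1 K HO Ht1 HK HF HS t Ht) as (S & w & HFt & _ & Hh).
    exists S, w. split; [exact HFt|]. specialize (Hw _ _ _ HFt). pose proof (fst_le_Cmod (w * S)). unfold height at 2 in Hh. lra.
  - exfalso. set (t1 := t0 + 1). assert (Ht1 : t0 < t1) by (unfold t1; lra).
    destruct (frame_exists x z t0 t1 HO Ht1) as (S1 & w1 & HF).
    assert (HN : forall t S w, t1 <= t -> frame x z t S w -> snd S <= 0).
    { intros t S w Ht HFt. apply Rnot_lt_le. intros L. apply N. exists t, S, w. split; [lra|]. auto. }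
    (* The waiting time is chosen so that the depth has dropped by |d| + 1, which would make it
       negative. *)
    set (d := depth K S1 w1). set (t := t1 + (Rabs d + 1) / (2 * PI)).
    assert (Ht : t1 <= t).
    { unfold t. assert (0 <= (Rabs d + 1) / (2 * PI)); [|lra]. apply Rdiv_le_0_compat; [pose proof (Rabs_pos d); lra|exact HP]. }
    destruct (depth_decreases x z t0 t1 S1 w1 K HO Ht1 HK HF HN t Ht) as (S & w & HFt & Hd).
    specialize (Hw _ _ _ HFt). pose proof (fst_le_Cmod (w * S)). unfold depth at 1 in Hd. fold d in Hd.
    assert (E : 2 * PI * (t - t1) = Rabs d + 1) by (unfold t; field; lra).
    pose proof (Rle_abs d). lra.
Qed.

(** * Smallness of (x, z x) at late times *)

Lemma small_at_Good (x z : R -> C) t0 eps : orbit x z t0 -> 0 < eps ->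
  exists T, forall t, T <= t -> Good (z t) -> Cmod (x t) < eps.
Proof.
  intros HO Heps. destruct (frame_grows x z t0 HO) as (t1 & K & b & Ht1 & HK & HG). destruct X_bound as [D HD].
  pose proof twoPI_pos as HP.
  set (M := (Rabs D + 1) * K / eps). set (T := t1 + (Rabs b + M + 1) / (2 * PI)).
  assert (HM : 0 < M).
  { unfold M. apply Rdiv_lt_0_compat; [|exact Heps]. apply Rmult_lt_0_compat; [pose proof (Rabs_pos D); lra|exact HK]. }
  assert (HT : t1 <= T).
  { unfold T. assert (0 <= (Rabs b + M + 1) / (2 * PI)); [|lra]. apply Rdiv_le_0_compat; [pose proof (Rabs_pos b); lra|exact HP]. }
  exists T. intros t Ht HGd. destruct (HG t ltac:(lra)) as (S & w & (V & HZ & HV) & Hb).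
  specialize (HD V _ _ _ HGd HZ HV). rewrite Cmod_mult in HD.
  assert (E : 2 * PI * (T - t1) = Rabs b + M + 1) by (unfold T; field; lra).
  assert (A1 : M < K * Cmod S).
  { pose proof (Rle_abs (- b)) as Hab. rewrite Rabs_Ropp in Hab.
    assert (2 * PI * (T - t1) <= 2 * PI * (t - t1)) by (apply Rmult_le_compat_l; lra). lra. }
  pose proof (Rle_abs D). apply Rnot_le_lt. intros L.
  assert (A2 : M * eps < K * Cmod S * Cmod (x t)).
  { pose proof (Cmod_ge_0 S).
    apply Rlt_le_trans with (K * Cmod S * eps); [apply Rmult_lt_compat_r; assumption|].
    apply Rmult_le_compat_l; [|exact L]. nra. }
  assert (A3 : M * eps = (Rabs D + 1) * K) by (unfold M; field; lra).
  nra.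
Qed.

(** The constant [a] of [local_lift] depends on the instant around which it is taken; h(z) / x - 2
    pi t is locally constant, hence constant on the half-line. *)
Lemma affine_in_zone Z (x z : R -> C) t0 T : orbit x z t0 -> t0 < T -> (forall t, T <= t -> inZ Z (z t)) ->
  exists a : C, forall t, T <= t -> hZ Z (z t) = ((a + (2 * PI * t)%R) * x t)%C.
Proof.
  intros HO HT HZ. set (G := fun t => (hZ Z (z t) / x t - (2 * PI * t)%R)%C).
  assert (HG : forall t, T <= t -> cder G t 0%C).
  { intros t Ht. destruct (local_lift Z x z t0 t HO ltac:(lra) (HZ t Ht)) as (e & L & a & c & He & _ & HB).
    apply (cder_ext_loc (fun _ => a)); [|apply cder_const].
    exists (mkposreal e He). intros s Hs. destruct (HB s Hs) as (Hs0 & _ & _ & _ & _ & EH).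
    destruct (HO s Hs0) as (_ & _ & Hx & _). unfold G. rewrite EH. field. exact Hx. }
  exists (G T). intros t Ht. rewrite (cder_const_eq G T t); [|intros s Hs; apply HG, Hs|exact Ht].
  destruct (HO t ltac:(lra)) as (_ & _ & Hx & _). unfold G. field. exact Hx.
Qed.

(** The second bound serves for y = z x. Near infinity z is unbounded, but h carries the factor q
    and z q = (q - 1) / 2 is bounded. *)
Lemma hZ_bound Z : exists H, 0 < H /\ forall z, inZ Z z -> Cmod (hZ Z z) <= H /\ Cmod (z * hZ Z z) <= H.
Proof.
  pose proof (hreg_neq0 _ _ hreg_al) as Hal. pose proof (hreg_neq0 _ _ hreg_be) as Hbe. pose proof (greg_neq0 _ _ greg_ga) as Hga.
  pose proof (proj1 (Cmod_gt_0 _) Hal) as Pal. pose proof (proj1 (Cmod_gt_0 _) Hbe) as Pbe. pose proof (proj1 (Cmod_gt_0 _) Hga) as Pga.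
  destruct Z.
  - exists (2 / Cmod al). split; [apply Rdiv_lt_0_compat; lra|]. intros z Hz. pose proof (inZA_mod z Hz) as Hm.
    rewrite Cmod_mult, (hZ_uZ ZA), Cmod_div by exact Hal.
    assert (A : Cmod (uZ ZA z) / Cmod al <= 2 / Cmod al).
    { apply Rmult_le_compat_r; [left; apply Rinv_0_lt_compat, Pal|apply uZ_Cmod, Hz]. }
    split; [exact A|]. pose proof (Cmod_ge_0 z).
    assert (0 <= Cmod (uZ ZA z) / Cmod al) by (apply Rdiv_le_0_compat; [apply Cmod_ge_0|exact Pal]). nra.
  - exists (4 / Cmod be). split; [apply Rdiv_lt_0_compat; lra|]. intros z Hz. pose proof (inZB_mod z Hz) as Hm.
    rewrite Cmod_mult, (hZ_uZ ZB), Cmod_div by exact Hbe. rewrite Cmod_opp.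
    assert (A : Cmod (uZ ZB z) / Cmod be <= 2 / Cmod be).
    { apply Rmult_le_compat_r; [left; apply Rinv_0_lt_compat, Pbe|apply uZ_Cmod, Hz]. }
    assert (B : Cmod z <= 2).
    { replace z with (1 - (1 - z))%C by ring. unfold Cminus at 1. eapply Rle_trans; [apply Cmod_triangle|].
      rewrite Cmod_opp, Cmod_1. lra. }
    assert (0 < / Cmod be) by (apply Rinv_0_lt_compat, Pbe). pose proof (Cmod_ge_0 z).
    assert (0 <= Cmod (uZ ZB z) / Cmod be) by (apply Rdiv_le_0_compat; [apply Cmod_ge_0|exact Pbe]).
    unfold Rdiv in *. split; nra.
  - exists (4 / Cmod ga). split; [apply Rdiv_lt_0_compat; lra|]. intros z Hz. pose proof (inZM_mod z Hz) as [Hn Hm].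
    assert (E : (z * hZ ZM z = (1 - qM z) * uZ ZM z / ga)%C).
    { rewrite (hZ_uZ ZM). unfold qM at 1 2. field. split; assumption. }
    rewrite E, (hZ_uZ ZM), !Cmod_div, !Cmod_mult, Cmod_opp, Cmod_R, Rabs_pos_eq by (exact Hga || lra).
    pose proof (uZ_Cmod ZM z Hz) as HU.
    assert (B : Cmod (1 - qM z) <= 2).
    { unfold Cminus at 1. eapply Rle_trans; [apply Cmod_triangle|]. rewrite Cmod_opp, Cmod_1. lra. }
    pose proof (Cmod_ge_0 (uZ ZM z)). pose proof (Cmod_ge_0 (qM z)). pose proof (Cmod_ge_0 (1 - qM z)).
    split; (apply Rmult_le_compat_r; [left; apply Rinv_0_lt_compat, Pga|nra]).
Qed.

Lemma small_in_zone Z (x z : R -> C) t0 T eps : orbit x z t0 -> t0 < T -> (forall t, T <= t -> inZ Z (z t)) -> 0 < eps ->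
  exists T', T <= T' /\ forall t, T' <= t -> Cmod (x t) < eps /\ Cmod (z t * x t) < eps.
Proof.
  intros HO HT HZ Heps. destruct (affine_in_zone Z x z t0 T HO HT HZ) as [a Ha]. destruct (hZ_bound Z) as (H & HH & HB).
  pose proof PI_bounds as HP.
  assert (Q : 0 < H / eps) by (apply Rdiv_lt_0_compat; assumption). pose proof (Cmod_ge_0 a).
  set (T' := Rmax T (Cmod a + H / eps + 1)). exists T'. split; [apply Rmax_l|]. intros t Ht.
  assert (Ht1 : T <= t) by (eapply Rle_trans; [apply Rmax_l|exact Ht]).
  assert (Ht2 : Cmod a + H / eps + 1 <= t) by (eapply Rle_trans; [apply Rmax_r|exact Ht]).
  specialize (Ha t Ht1). destruct (HB _ (HZ t Ht1)) as [B1 B2].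
  assert (HL : H / eps < Cmod (a + (2 * PI * t)%R)).
  { assert (HC : Cmod (2 * PI * t)%R <= Cmod (a + (2 * PI * t)%R) + Cmod a).
    { replace (RtoC (2 * PI * t)%R) with ((a + (2 * PI * t)%R) + - a)%C at 1 by ring.
      eapply Rle_trans; [apply Cmod_triangle|]. rewrite Cmod_opp. lra. }
    rewrite Cmod_R, Rabs_pos_eq in HC by nra. nra. }
  assert (HE : H / eps * eps = H) by (field; lra).
  split; apply Rnot_le_lt; intros L.
  - rewrite Ha, Cmod_mult in B1. assert (H / eps * eps < Cmod (a + (2 * PI * t)%R) * Cmod (x t)); [|lra].
    apply Rlt_le_trans with (Cmod (a + (2 * PI * t)%R) * eps); [apply Rmult_lt_compat_r; assumption|].
    apply Rmult_le_compat_l; [apply Cmod_ge_0|exact L].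
  - replace (z t * hZ Z (z t))%C with ((a + (2 * PI * t)%R) * (z t * x t))%C in B2 by (rewrite Ha; ring).
    rewrite Cmod_mult in B2. assert (H / eps * eps < Cmod (a + (2 * PI * t)%R) * Cmod (z t * x t)); [|lra].
    apply Rlt_le_trans with (Cmod (a + (2 * PI * t)%R) * eps); [apply Rmult_lt_compat_r; assumption|].
    apply Rmult_le_compat_l; [apply Cmod_ge_0|exact L].
Qed.

Lemma Cmod_eq_of_normsq (u : C) r : 0 <= r -> normsq u = r * r -> Cmod u = r.
Proof. intros Hr H. rewrite Cmod_normsq, H. apply sqrt_square, Hr. Qed.

Lemma Cmod_minus_le (u v : C) : Cmod u - Cmod v <= Cmod (u - v).
Proof.
  pose proof (Cmod_triangle (u - v) v) as H. replace (u - v + v)%C with u in H by ring. lra.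
Qed.

(** With the two lemmas that follow: the three circles around the punctures lie in [Good], so an
    orbit that avoids [Good] never crosses them and stays near one puncture. *)
Lemma Good_near0 z : Cmod z = 1/6 -> Good z.
Proof.
  intros H. pose proof (Cmod_minus_le 1 z) as A. rewrite Cmod_1 in A.
  pose proof (Cmod_triangle 1 (- (2 * z))) as B. rewrite Cmod_opp, Cmod_mult, Cmod_1, Cmod_R, Rabs_pos_eq in B by lra.
  change (1 + - (2 * z))%C with (1 - 2 * z)%C in B. unfold Good. repeat split; lra.
Qed.

Lemma Good_near1 z : Cmod (1 - z) = 1/6 -> Good z.
Proof.
  intros H. destruct (Good_near0 (1 - z)%C H) as (A & B & D). unfold Good.
  replace (1 - (1 - z))%C with z in B by ring.
  replace (1 - 2 * (1 - z))%C with (- (1 - 2 * z))%C in D by ring. rewrite Cmod_opp in D. auto.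
Qed.

Lemma Good_far z : Cmod (1 - 2 * z) = 4/3 -> Good z.
Proof.
  intros H. pose proof (Cmod_minus_le (1 - 2 * z) 1) as A. rewrite H, Cmod_1 in A.
  replace (1 - 2 * z - 1)%C with (- (2) * z)%C in A by ring.
  pose proof (Cmod_minus_le (1 - 2 * z) (- (1))) as B. rewrite H, Cmod_opp, Cmod_1 in B.
  replace (1 - 2 * z - - (1))%C with (2 * (1 - z))%C in B by ring.
  rewrite Cmod_mult, Cmod_opp, Cmod_R, Rabs_pos_eq in A by lra. rewrite Cmod_mult, Cmod_R, Rabs_pos_eq in B by lra.
  unfold Good. repeat split; lra.
Qed.

Lemma Cmod_lt_normsq (u : C) r : 0 <= r -> Cmod u < r <-> normsq u < r * r.
Proof.
  intros Hr. split; intros H.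
  - rewrite <- Cmod_sqr. pose proof (Cmod_ge_0 u). nra.
  - apply Rnot_le_lt. intros L. rewrite <- Cmod_sqr in H. nra.
Qed.

Lemma trapped_inside (f : R -> C) T r : 0 <= r -> (forall t, T <= t -> exists l, cder f t l) ->
  (forall t, T <= t -> Cmod (f t) <> r) -> Cmod (f T) < r -> forall t, T <= t -> Cmod (f t) < r.
Proof.
  intros Hr HD HN HT t Ht. apply Cmod_lt_normsq; [exact Hr|]. apply (ivt_avoid (fun s => normsq (f s)) T t); [exact Ht| | |].
  - intros s Hs. destruct (HD s ltac:(lra)) as [l Hl]. exact (is_derive_continuity_pt _ _ _ (cder_normsq _ _ _ Hl)).
  - intros s Hs E. apply (HN s ltac:(lra)). apply Cmod_eq_of_normsq; assumption.
  - apply Cmod_lt_normsq; assumption.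
Qed.

Lemma trapped_outside (f : R -> C) T r : 0 <= r -> (forall t, T <= t -> exists l, cder f t l) ->
  (forall t, T <= t -> Cmod (f t) <> r) -> r < Cmod (f T) -> forall t, T <= t -> r < Cmod (f t).
Proof.
  intros Hr HD HN HT t Ht. destruct (Rle_lt_dec (Cmod (f t)) r) as [L|L]; [exfalso|exact L].
  assert (L' : Cmod (f t) < r) by (destruct L as [L|L]; [exact L|exfalso; exact (HN t Ht L)]).
  assert (A : normsq (f T) < r * r).
  { apply (ivt_avoid' (fun s => normsq (f s)) T t); [exact Ht| | |].
    - intros s Hs. destruct (HD s ltac:(lra)) as [l Hl]. exact (is_derive_continuity_pt _ _ _ (cder_normsq _ _ _ Hl)).
    - intros s Hs E. apply (HN s ltac:(lra)). apply Cmod_eq_of_normsq; assumption.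
    - apply Cmod_lt_normsq; assumption. }
  apply Cmod_lt_normsq in A; lra.
Qed.

Lemma orbit_returns_small (x z : R -> C) t0 eps T0 : orbit x z t0 -> 0 < eps ->
  exists t, T0 <= t /\ t0 < t /\ Cmod (x t) < eps /\ Cmod (z t * x t) < eps.
Proof.
  intros HO Heps.
  (* Half of [eps], because |z| <= 2 on [Good] and z x must be small as well. *)
  destruct (small_at_Good x z t0 (eps / 2) HO ltac:(lra)) as [T1 HT1].
  set (T := Rmax (Rmax T0 T1) (t0 + 1)).
  assert (HTa : T0 <= T) by (eapply Rle_trans; [apply Rmax_l|apply Rmax_l]).
  assert (HTb : T1 <= T) by (eapply Rle_trans; [apply (Rmax_r T0)|apply Rmax_l]).
  assert (HTc : t0 < T) by (pose proof (Rmax_r (Rmax T0 T1) (t0 + 1)); unfold T; lra).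
  destruct (classic (exists t, T <= t /\ Good (z t))) as [(t & Ht & HG)|N].
  - exists t. specialize (HT1 t ltac:(lra) HG). split; [lra|]. split; [lra|]. split; [lra|].
    destruct HG as (_ & _ & G). pose proof (Cmod_minus_le (1 - 2 * z t) 1) as A. rewrite Cmod_mult.
    assert (B : Cmod (z t) <= 2).
    { pose proof (Cmod_triangle 1 (- (1 - 2 * z t))) as C1. rewrite Cmod_opp, Cmod_1 in C1.
      replace (1 + - (1 - 2 * z t))%C with (2 * z t)%C in C1 by ring. rewrite Cmod_mult, Cmod_R, Rabs_pos_eq in C1 by lra. lra. }
    pose proof (Cmod_ge_0 (x t)). pose proof (Cmod_ge_0 (z t)). nra.
  - assert (HN : forall t, T <= t -> ~ Good (z t)) by (intros t Ht HG; apply N; exists t; auto).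
    assert (HD : forall t, T <= t -> exists l, cder z t l) by (intros t Ht; destruct (HO t ltac:(lra)) as [D _]; eexists; exact D).
    assert (HD1 : forall t, T <= t -> exists l, cder (fun s => 1 - z s)%C t l).
    { intros t Ht. destruct (HD t Ht) as [l Hl]. eexists. apply cder_minus; [apply cder_const|exact Hl]. }
    assert (HD2 : forall t, T <= t -> exists l, cder (fun s => 1 - 2 * z s)%C t l).
    { intros t Ht. destruct (HD t Ht) as [l Hl]. eexists. apply cder_minus; [apply cder_const|apply cder_scal; exact Hl]. }
    assert (HZ : exists Z, forall t, T <= t -> inZ Z (z t)).
    { destruct (Rlt_le_dec (Cmod (z T)) (1/6)) as [A|A].
      - exists ZA. intros t Ht. assert (B : Cmod (z t) < 1/6).
        { apply (trapped_inside z T); try assumption; [lra|]. intros s Hs E. apply (HN s Hs), Good_near0, E. }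
        pose proof (fst_le_Cmod (z t)). pose proof (Cmod_triangle 1 (- (2 * z t))) as B'.
        rewrite Cmod_opp, Cmod_mult, Cmod_1, Cmod_R, Rabs_pos_eq in B' by lra.
        change (1 + - (2 * z t))%C with (1 - 2 * z t)%C in B'. cbn [inZ]. lra.
      - destruct (Rlt_le_dec (Cmod (1 - z T)) (1/6)) as [A'|A'].
        + exists ZB. intros t Ht. assert (B : Cmod (1 - z t) < 1/6).
          { apply (trapped_inside (fun s => 1 - z s)%C T); try assumption; [lra|]. intros s Hs E. apply (HN s Hs), Good_near1, E. }
          pose proof (fst_le_Cmod (1 - z t)) as F. rewrite fst_one_minus in F.
          pose proof (Cmod_triangle (2 * (1 - z t)) (- (1))) as B'.
          rewrite Cmod_opp, Cmod_mult, Cmod_1, Cmod_R, Rabs_pos_eq in B' by lra.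
          replace (2 * (1 - z t) + - (1))%C with (1 - 2 * z t)%C in B' by ring. cbn [inZ]. lra.
        + exists ZM. intros t Ht. cbn [inZ]. left. apply (trapped_outside (fun s => 1 - 2 * z s)%C T); try assumption; [lra| |].
          * intros s Hs E. apply (HN s Hs), Good_far, E.
          * apply Rnot_le_lt. intros L. apply (HN T (Rle_refl T)). unfold Good. auto. }
    destruct HZ as [Z HZ]. destruct (small_in_zone Z x z t0 T eps HO HTc HZ Heps) as (T' & HT' & HS).
    exists T'. destruct (HS T' (Rle_refl _)). repeat split; lra.
Qed.

(** * Trajectories of the field *)

Lemma is_derive_within_interior (I : R -> Prop) (gamma : R -> C * C) t l : is_derive_within I gamma t l -> locally t I ->
  @filterdiff R_AbsRing R_NormedModule C2 gamma (locally t) (fun h : R => @scal R_AbsRing C2 h l).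
Proof.
  intros [H1 H2] HI. split; [exact H1|]. intros x Hx.
  assert (Hx' : is_filter_lim (within I (locally t)) x).
  { intros P HP. specialize (Hx P HP). unfold within. revert Hx. apply filter_imp; auto. }
  specialize (H2 x Hx'). intros eps. specialize (H2 eps). unfold within in H2.
  generalize (filter_and _ _ HI H2). apply filter_imp. intros y [Hy1 Hy2]. exact (Hy2 Hy1).
Qed.

Lemma filterdiff_cder (f : R -> C) t (l : C) :
  @filterdiff R_AbsRing R_NormedModule C_R_NormedModule f (locally t) (fun h : R => @scal R_AbsRing C_R_NormedModule h l) -> cder f t l.
Proof.
  intros H. split.
  - exact (filterdiff_comp f (fun p : C_R_NormedModule => fst p : R_NormedModule) _ (fun p : C_R_NormedModule => fst p : R_NormedModule) H
      (filterdiff_linear _ is_linear_fst)).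
  - exact (filterdiff_comp f (fun p : C_R_NormedModule => snd p : R_NormedModule) _ (fun p : C_R_NormedModule => snd p : R_NormedModule) H
      (filterdiff_linear _ is_linear_snd)).
Qed.

Lemma filterdiff_C2_cder (gamma : R -> C * C) t l :
  @filterdiff R_AbsRing R_NormedModule C2 gamma (locally t) (fun h : R => @scal R_AbsRing C2 h l) ->
  cder (fun s => fst (gamma s)) t (fst l) /\ cder (fun s => snd (gamma s)) t (snd l).
Proof.
  intros H. split; apply filterdiff_cder.
  - exact (filterdiff_comp gamma (fun p : C2 => fst p : C_R_NormedModule) _ (fun p : C2 => fst p : C_R_NormedModule) H
      (filterdiff_linear _ is_linear_fst)).
  - exact (filterdiff_comp gamma (fun p : C2 => snd p : C_R_NormedModule) _ (fun p : C2 => snd p : C_R_NormedModule) H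
      (filterdiff_linear _ is_linear_snd)).
Qed.

Lemma al_2pi : (2 * PI * al = PI / 2 + Ci * ln 2)%C.
Proof. pose proof PI_bounds. apply C_eq; simpl; unfold lam; field; lra. Qed.
Lemma sg_2pi : (2 * PI * sg = 3 * PI / 4 - Ci / 2 * ln 2)%C.
Proof. pose proof PI_bounds. apply C_eq; simpl; unfold lam; field; lra. Qed.

Lemma v1_eq x y : v1 x y = (- (2 * PI) * x * (al * x - sg * y))%C.
Proof. unfold v1. rewrite <- al_2pi, <- sg_2pi. simpl. ring. Qed.

Lemma v2_eq x y : v2 x y = (2 * PI * y * ((1 - al) * x - (1 - sg) * y))%C.
Proof.
  assert (A : (3 * PI / 2 - Ci * ln 2 = 2 * PI * (1 - al))%C).
  { transitivity (2 * PI - 2 * PI * al)%C; [|ring]. rewrite al_2pi. field. }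
  assert (B : (5 * PI / 4 + Ci / 2 * ln 2 = 2 * PI * (1 - sg))%C).
  { transitivity (2 * PI - 2 * PI * sg)%C; [|ring]. rewrite sg_2pi. apply C_eq; simpl; field. }
  unfold v2. rewrite A, B. simpl. ring.
Qed.

(* Forward uniqueness for [f' = k f]: [exp (- 2 M t) |f|^2] is nonincreasing. *)
Lemma linear_zero (f k : R -> C) t1 : (forall t, t1 <= t -> cder f t (k t * f t)%C) ->
  (forall t, t1 <= t -> continuity_pt (fun s => fst (k s)) t) -> f t1 = 0%C -> forall t, t1 <= t -> f t = 0%C.
Proof.
  intros HD HK H0 b Hb. destruct Hb as [Hb|<-]; [|exact H0].
  destruct (continuity_ab_maj (fun s => fst (k s)) t1 b) as (m & Hm & _); [lra|intros s Hs; apply HK; lra|].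
  set (M := fst (k m)) in *.
  set (N := fun s => normsq (f s) * exp (- (2 * M) * s)).
  set (dN := fun s => 2 * (fst (k s) - M) * normsq (f s) * exp (- (2 * M) * s)).
  assert (HN : forall s, t1 <= s -> is_derive N s (dN s)).
  { intros s Hs. unfold N, dN. pose proof (cder_normsq _ _ _ (HD s Hs)) as A.
    assert (B : is_derive (fun s => exp (- (2 * M) * s)) s (- (2 * M) * exp (- (2 * M) * s))).
    { auto_derive; [exact I|ring]. }
    pose proof (is_derive_mul _ _ _ _ _ A B) as D. unfold normsq in *; simpl in *.
    match type of D with is_derive _ _ ?l => match goal with |- is_derive _ _ ?l' => replace l' with l; [exact D|] end end. ring. }
  assert (HL : N b <= N t1).
  { destruct (MVT_gen N t1 b dN) as (c & Hc & Ec).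
    - intros s Hs. rewrite Rmin_left, Rmax_right in Hs by lra. apply HN; lra.
    - intros s Hs. rewrite Rmin_left, Rmax_right in Hs by lra. apply (is_derive_continuity_pt _ _ (dN s)), HN; lra.
    - rewrite Rmin_left, Rmax_right in Hc by lra.
      assert (L : dN c <= 0); [|nra]. unfold dN. specialize (Hm c ltac:(lra)). fold M in Hm.
      assert (0 <= normsq (f c)) by (unfold normsq; nra). pose proof (exp_pos (- (2 * M) * c)).
      assert (0 <= normsq (f c) * exp (- (2 * M) * c)) by nra. nra. }
  unfold N in HL. rewrite H0 in HL. replace (normsq 0) with 0 in HL by (unfold normsq; simpl; ring).
  rewrite Rmult_0_l in HL. pose proof (exp_pos (- (2 * M) * b)).
  destruct (classic (f b = 0%C)) as [E|E]; [exact E|]. apply normsq_pos in E. nra.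
Qed.

Lemma cder_continuity_fst (f : R -> C) t l : cder f t l -> continuity_pt (fun s => fst (f s)) t.
Proof. intros [H _]. exact (is_derive_continuity_pt _ _ _ H). Qed.

(** If f vanishes once, it stays zero by [linear_zero]; otherwise 1 / f is affine in time with
    nonzero slope - a, so |1 / f| becomes as large as wanted. *)
Lemma riccati_small (f : R -> C) (a : C) t1 : a <> 0%C -> (forall t, t1 <= t -> cder f t (a * (f t * f t))%C) ->
  forall eps T0, 0 < eps -> exists t, T0 <= t /\ t1 <= t /\ Cmod (f t) < eps.
Proof.
  intros Ha HD eps T0 Heps.
  destruct (classic (exists t2, t1 <= t2 /\ f t2 = 0%C)) as [(t2 & Ht2 & E)|N].
  - exists (Rmax T0 t2). pose proof (Rmax_l T0 t2). pose proof (Rmax_r T0 t2).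
    rewrite (linear_zero f (fun s => a * f s)%C t2) with (t := Rmax T0 t2); [rewrite Cmod_0; lra| | |exact E|assumption].
    + intros t Ht. eapply cder_eq; [apply HD; lra|ring].
    + intros t Ht. apply (cder_continuity_fst (fun s => a * f s)%C t (a * (a * (f t * f t)))%C). apply cder_scal, HD. lra.
  - assert (HN : forall t, t1 <= t -> f t <> 0%C) by (intros t Ht E; apply N; exists t; auto).
    assert (HA : forall t, t1 <= t -> (/ f t = / f t1 + - a * (t - t1)%R)%C).
    { intros t Ht. apply (cder_affine (fun s => / f s)%C); [|exact Ht]. intros s Hs.
      eapply cder_eq; [apply cder_inv; [apply HD; lra|apply HN; lra]|]. field. apply HN; lra. }
    pose proof (proj1 (Cmod_gt_0 _) Ha) as Pa. pose proof (Cmod_ge_0 (/ f t1)).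
    set (s := (Cmod (/ f t1) + / eps + 1) / Cmod a).
    assert (Hs : 0 < s) by (apply Rdiv_lt_0_compat; [pose proof (Rinv_0_lt_compat _ Heps); lra|exact Pa]).
    set (t := Rmax T0 (t1 + s)). assert (Ht1 : t1 + s <= t) by apply Rmax_r. assert (Ht0 : T0 <= t) by apply Rmax_l.
    exists t. split; [exact Ht0|]. split; [lra|]. specialize (HA t ltac:(lra)).
    assert (HL : / eps < Cmod (/ f t)).
    { rewrite HA. pose proof (Cmod_minus_le (- a * (t - t1)%R) (- / f t1)) as B.
      replace (- a * (t - t1)%R - - / f t1)%C with (/ f t1 + - a * (t - t1)%R)%C in B by ring.
      rewrite Cmod_mult, !Cmod_opp, Cmod_R, Rabs_pos_eq in B by lra.
      assert (Cmod a * s <= Cmod a * (t - t1)) by (apply Rmult_le_compat_l; lra).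
      assert (E : Cmod a * s = Cmod (/ f t1) + / eps + 1) by (unfold s; field; lra). lra. }
    assert (Hft : f t <> 0%C) by (apply HN; lra). pose proof (proj1 (Cmod_gt_0 _) Hft) as Pf.
    rewrite Cmod_inv in HL by exact Hft. apply Rnot_le_lt. intros L. apply (Rinv_le_contravar _ _ Heps) in L. lra.
Qed.

Lemma al_neq0 : al <> 0%C.
Proof. exact (hreg_neq0 _ _ hreg_al). Qed.
Lemma be_neq0 : be <> 0%C.
Proof. exact (hreg_neq0 _ _ hreg_be). Qed.
Lemma twoPI_neq0 : (2 * PI <> 0)%C.
Proof. pose proof PI_bounds. neq0. Qed.
Lemma sg_neq1 : (1 - sg <> 0)%C.
Proof. neq0. Qed.
Lemma neg_neq0 (a : C) : a <> 0%C -> (- a)%C <> 0%C.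
Proof. intros H E. apply H. replace a with (- - a)%C by ring. rewrite E. ring. Qed.

Lemma flow_returns_small (X Y : R -> C) t0 :
  (forall t, t0 < t -> cder X t (v1 (X t) (Y t)) /\ cder Y t (v2 (X t) (Y t))) ->
  forall eps T0, 0 < eps -> exists t, T0 <= t /\ t0 < t /\ Cmod (X t) < eps /\ Cmod (Y t) < eps.
Proof.
  intros HD eps T0 Heps.
  assert (DX : forall t, t0 < t -> cder X t (- (2 * PI) * X t * (al * X t - sg * Y t))%C).
  { intros t Ht. rewrite <- v1_eq. apply HD, Ht. }
  assert (DY : forall t, t0 < t -> cder Y t (2 * PI * Y t * ((1 - al) * X t - (1 - sg) * Y t))%C).
  { intros t Ht. rewrite <- v2_eq. apply HD, Ht. }
  pose proof twoPI_neq0 as HP.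
  assert (HC : forall (a b : C) t, t0 < t -> continuity_pt (fun s => fst (2 * PI * (a * X s + b * Y s))%C) t).
  { intros a b t Ht. apply (cder_continuity_fst (fun s => 2 * PI * (a * X s + b * Y s))%C t
      (2 * PI * (a * v1 (X t) (Y t) + b * v2 (X t) (Y t)))%C). apply cder_scal.
    destruct (HD t Ht) as [H1 H2]. apply cder_plus; apply cder_scal; assumption. }
  destruct (classic (exists t1, t0 < t1 /\ X t1 = 0%C)) as [(t1 & Ht1 & E)|NX].
  { assert (HX : forall t, t1 <= t -> X t = 0%C).
    { apply (linear_zero X (fun s => 2 * PI * ((- al) * X s + sg * Y s))%C); [| |exact E].
      - intros t Ht. eapply cder_eq; [apply DX; lra|ring].
      - intros t Ht. apply HC; lra. }
    destruct (riccati_small Y (- (2 * PI * (1 - sg)))%C t1) with (eps := eps) (T0 := T0) as (t & A & B & D); [| |exact Heps|].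
    - apply neg_neq0, Cmult_neq_0; [exact HP|exact sg_neq1].
    - intros t Ht. eapply cder_eq; [apply DY; lra|]. rewrite (HX t Ht). ring.
    - exists t. rewrite (HX t B), Cmod_0. repeat split; lra. }
  destruct (classic (exists t1, t0 < t1 /\ Y t1 = 0%C)) as [(t1 & Ht1 & E)|NY].
  { assert (HY : forall t, t1 <= t -> Y t = 0%C).
    { apply (linear_zero Y (fun s => 2 * PI * ((1 - al) * X s + (- (1 - sg)) * Y s))%C); [| |exact E].
      - intros t Ht. eapply cder_eq; [apply DY; lra|ring].
      - intros t Ht. apply HC; lra. }
    destruct (riccati_small X (- (2 * PI * al))%C t1) with (eps := eps) (T0 := T0) as (t & A & B & D); [| |exact Heps|].
    - apply neg_neq0, Cmult_neq_0; [exact HP|exact al_neq0].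
    - intros t Ht. eapply cder_eq; [apply DX; lra|]. rewrite (HY t Ht). ring.
    - exists t. rewrite (HY t B), Cmod_0. repeat split; lra. }
  (* On the line x = y the equation becomes x' = 2 pi be x^2, since be = sg - al. *)
  destruct (classic (exists t1, t0 < t1 /\ (X t1 - Y t1)%C = 0%C)) as [(t1 & Ht1 & E)|NXY].
  { assert (HXY : forall t, t1 <= t -> (X t - Y t)%C = 0%C).
    { apply (linear_zero (fun s => X s - Y s)%C (fun s => 2 * PI * ((- al) * X s + (- (1 - sg)) * Y s))%C); [| |exact E].
      - intros t Ht. eapply cder_eq; [apply cder_minus; [apply DX|apply DY]; lra|]. ring.
      - intros t Ht. apply HC; lra. }
    assert (HE : forall t, t1 <= t -> Y t = X t).
    { intros t Ht. replace (Y t) with (X t - (X t - Y t))%C by ring. rewrite (HXY t Ht). ring. }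
    destruct (riccati_small X (2 * PI * be)%C t1) with (eps := eps) (T0 := T0) as (t & A & B & D); [| |exact Heps|].
    - apply Cmult_neq_0; [exact HP|exact be_neq0].
    - intros t Ht. eapply cder_eq; [apply DX; lra|]. rewrite (HE t Ht), <- sg_eq. ring.
    - exists t. rewrite (HE t B). repeat split; lra. }
  set (z := fun t => (Y t / X t)%C).
  assert (HX : forall t, t0 < t -> X t <> 0%C) by (intros t Ht E; apply NX; exists t; auto).
  assert (HO : orbit X z t0).
  { intros t Ht. pose proof (HX t Ht) as Hx. unfold z. split; [|split; [|split; [exact Hx|split]]].
    - eapply cder_eq; [apply cder_div; [apply DY, Ht|apply DX, Ht|exact Hx]|]. field. exact Hx.
    - eapply cder_eq; [apply DX, Ht|]. field. exact Hx.
    - intros E. apply NY. exists t. split; [exact Ht|]. replace (Y t) with (Y t / X t * X t)%C by (field; exact Hx). rewrite E. ring.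
    - intros E. apply NXY. exists t. split; [exact Ht|]. replace (X t - Y t)%C with ((1 - Y t / X t) * X t)%C by (field; exact Hx). rewrite E. ring. }
  destruct (orbit_returns_small X z t0 eps T0 HO Heps) as (t & A & B & D & F).
  exists t. replace (z t * X t)%C with (Y t) in F by (unfold z; field; apply HX, B). auto.
Qed.

Lemma C2_ball (p : C2) (eps : posreal) :
  Cmod (fst p) < eps -> Cmod (snd p) < eps -> @ball C2 (RtoC 0, RtoC 0) eps p.
Proof.
  intros H1 H2.
  assert (A : forall r : R, Rabs r < eps -> @ball R_NormedModule 0 eps r).
  { intros r Hr. change (Rabs (r - 0) < eps). rewrite Rminus_0_r. exact Hr. }
  split; split; apply A.
  - exact (Rle_lt_trans _ _ _ (abs_fst_le_Cmod (fst p)) H1).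
  - exact (Rle_lt_trans _ _ _ (abs_snd_le_Cmod (fst p)) H1).
  - exact (Rle_lt_trans _ _ _ (abs_fst_le_Cmod (snd p)) H2).
  - exact (Rle_lt_trans _ _ _ (abs_snd_le_Cmod (snd p)) H2).
Qed.

Theorem mainTheorem3 :
  forall (I : R -> Prop) (gamma : R -> C * C),
    is_trajectory v I gamma ->
    is_regular I ->
    accumulation_set I gamma (RtoC 0, RtoC 0).
Proof.
  intros I gamma [[_ HS] _] [t0 H0].
  assert (HD : forall t, t0 < t -> cder (fun s => fst (gamma s)) t (v1 (fst (gamma t)) (snd (gamma t))) /\
     cder (fun s => snd (gamma s)) t (v2 (fst (gamma t)) (snd (gamma t)))).
  (* Every time after [t0] is interior to the interval, so the derivative relative to [I] is an
     ordinary two-sided one there. *)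
  { intros t Ht. apply (filterdiff_C2_cder gamma t (v (gamma t))). apply (is_derive_within_interior I).
    - apply HS, H0. lra.
    - generalize (open_gt t0 t Ht). apply filter_imp. intros s Hs. apply H0. lra. }
  assert (HE : forall n : nat, exists t, INR n <= t /\ t0 < t /\ Cmod (fst (gamma t)) < / INR (S n) /\ Cmod (snd (gamma t)) < / INR (S n)).
  { intros n. apply (flow_returns_small (fun s => fst (gamma s)) (fun s => snd (gamma s)) t0 HD).
    apply Rinv_0_lt_compat, lt_0_INR. lia. }
  (* The n-th time is at least n, lies after [t0], hence in [I], and has both coordinates below 1 /
     (n + 1). *)
  set (tn := fun n => proj1_sig (constructive_indefinite_description _ (HE n))).
  assert (Htn : forall n, INR n <= tn n /\ t0 < tn n /\ Cmod (fst (gamma (tn n))) < / INR (S n) /\ Cmod (snd (gamma (tn n))) < / INR (S n)).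
  { intros n. exact (proj2_sig (constructive_indefinite_description _ (HE n))). }
  exists tn. split; [|split].
  - intros n. apply H0. destruct (Htn n) as (_ & H & _). lra.
  - apply is_lim_seq_le_p_loc with INR; [|apply is_lim_seq_INR]. exists 0%nat. intros n _. apply (Htn n).
  - intros P [eps HP]. destruct (nfloor_ex (/ eps)) as [N HN]; [left; apply Rinv_0_lt_compat, cond_pos|].
    exists N. intros n Hn. apply HP. destruct (Htn n) as (_ & _ & H1 & H2).
    assert (Hl : / INR (S n) < eps).
    { pose proof (cond_pos eps) as He. rewrite <- (Rinv_inv eps). apply Rinv_lt_contravar.
      - apply Rmult_lt_0_compat; [apply Rinv_0_lt_compat, He|apply lt_0_INR; lia].
      - apply le_INR in Hn. rewrite S_INR. lra. }
    apply C2_ball; [exact (Rlt_trans _ _ _ H1 Hl)|exact (Rlt_trans _ _ _ H2 Hl)].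
Qed.
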